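(* There exists $\epsilon_0>0$ such that the following holds for every $R>0$ (with $\epsilon_0$ independent of $R$). Let $g$ be a smooth Riemannian metric and $k$ a smooth symmetric covariant $2$-tensor on $B(0,R)\subset\mathbb R^3$ which are spherically symmetric and take, in polar coordinates $(\rho,\vartheta,\varphi)$, the form $$g=d\rho^2+(r(\rho))^2(d\vartheta^2+\sin^2\vartheta\,d\varphi^2),\qquad k=k_{\rho\rho}(\rho)\,d\rho^2+k_{\vartheta\vartheta}(\rho)(d\vartheta^2+\sin^2\vartheta\,d\varphi^2),$$ and suppose that for some smooth and spherically symmetric functions $\psi_0,\psi_1:B(0,R)\to\mathbb R$ the constraint equations $$R[g]+(\mathrm{tr}_gk)^2-\|k\|_g^2=\|\nabla\psi_0\|_g^2+\psi_1^2,\qquad \mathrm{div}_gk-\nabla(\mathrm{tr}_gk)=\psi_1\nabla\psi_0$$ hold. Introduce the Cartesian coordinates $x^1=\rho\sin\vartheta\cos\varphi$, $x^2=\rho\sin\vartheta\sin\varphi$, $x^3=\rho\cos\vartheta$, in which $$g_{ij}=\frac{r^2(|x|)}{|x|^2}\delta_{ij}+\Big(1-\frac{r^2(|x|)}{|x|^2}\Big)\frac{x^ix^j}{|x|^2},\qquad k_{ij}=\frac{k_{\vartheta\vartheta}}{|x|^2}\delta_{ij}+\Big(k_{\rho\rho}-\frac{k_{\vartheta\vartheta}}{|x|^2}\Big)\frac{x^ix^j}{|x|^2}.$$ If, in these Cartesian coordinates, $$\|k\|_{H^{1/2}(B(0,R))}+\|\psi_0\|_{H^{3/2}(B(0,R))}+\|\psi_1\|_{H^{1/2}(B(0,R))}\le\epsilon_0,$$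 then there does not exist a spherically symmetric smooth embedded compact trapped $2$-surface $S$ in $(B(0,R),g,k)$.
   Context: $R[g]$ is the scalar curvature of $g$ (not to be confused with the radius $R$), and $\nabla$, $\mathrm{div}_g$, $\mathrm{tr}_g$, $\|\cdot\|_g$ are taken with respect to $g$. Trapped surface: let $S\subset B(0,R)$ be a compact, embedded, smooth $2$-surface. Let $N_g$ be the $g$-unit normal of $S$ pointing towards the unbounded component of the complement of $S$ in $\mathbb R^3$ ($S$ connected), $g_S$ the metric induced by $g$ on $S$, and $h_g(X,Y)=\langle\nabla_X N_g,Y\rangle_g$ (for $X,Y$ tangent to $S$) the second fundamental form. $S$ is trapped in $(B(0,R),g,k)$ if at every point of $S$ both $\mathrm{tr}_{g_S}(k+h_g)<0$ and $\mathrm{tr}_{g_S}(k-h_g)<0$ (with $k$ restricted to $TS$). Norms: $H^s(\mathbb R^3)$ is the usual inhomogeneous $L^2$-based Sobolev space; for an open set $\Omega\subset\mathbb R^3$, $\|\phi\|_{H^s(\Omega)}$ is the infimum of $\|\overline\phi\|_{H^s(\mathbb R^3)}$ over all $\overline\phi\in H^s(\mathbb R^3)$ with $\overline\phi|_\Omega=\phi$. The norm of a covariant $2$-tensor is the sum of the norms of its Cartesian components. *)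

(* Defs.v *)
From HB Require Import structures.
From mathcomp Require Export all_boot all_order all_algebra.
From mathcomp Require Export all_classical all_reals all_analysis.

Set Implicit Arguments.
Unset Strict Implicit.
Unset Printing Implicit Defensive.

Import Order.TTheory GRing.Theory Num.Theory.
Import numFieldNormedType.Exports.

Local Open Scope classical_set_scope.
Local Open Scope ring_scope.

Section Calculus.
Variable R : realType.

Definition partial n (V : normedModType R) (i : 'I_n) (f : 'rV[R]_n -> V)
    (x : 'rV[R]_n) : V := 'D_('e_i) f x.

Fixpoint Cn_on n (V : normedModType R) (m : nat) (U : set 'rV[R]_n)
    (f : 'rV[R]_n -> V) : Prop :=
  (forall x, U x -> {for x, continuous f}) /\
  if m is m'.+1 then
    forall i : 'I_n, (forall x, U x -> derivable f x 'e_i) /\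
                     Cn_on m' U (partial i f)
  else True.

Definition smooth_on n (V : normedModType R) (U : set 'rV[R]_n)
    (f : 'rV[R]_n -> V) : Prop := forall m, Cn_on m U f.

(* The library norm on row vectors is the sup norm. *)
Definition enorm n (x : 'rV[R]_n) : R := Num.sqrt (\sum_i x 0 i ^+ 2).

Definition eball (a : R) : set 'rV[R]_3 := [set x | enorm x < a].

(* Covariant 2-tensors are matrix fields. Row [i] of the Jacobian ['J F x] is
   the derivative of [F] in the direction of the i-th coordinate. *)
Definition pullback n m (F : 'rV[R]_n -> 'rV[R]_m) (T : 'rV[R]_m -> 'M[R]_m)
    (x : 'rV[R]_n) : 'M[R]_n := 'J F x *m T (F x) *m ('J F x)^T.

End Calculus.

Section Geometry.
Variable R : realType.
Local Notation point := 'rV[R]_3.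
Implicit Types (g k : point -> 'M[R]_3) (f : point -> R) (x : point).

Definition inner (G : 'M[R]_3) (X Y : 'rV[R]_3) : R := (X *m G *m Y^T) 0 0.

Definition riemannian_metric (U : set point) g : Prop :=
  [/\ smooth_on U g,
      forall x, U x -> (g x)^T = g x &
      forall x, U x -> forall X : 'rV[R]_3, X != 0 -> 0 < inner (g x) X X].

Definition symmetric_2tensor (U : set point) k : Prop :=
  smooth_on U k /\ forall x, U x -> (k x)^T = k x.

Definition mtrace n (G T : 'M[R]_n) : R := \tr (invmx G *m T).

(* [christoffel g m i j] is the symbol with upper index [m]. *)
Definition christoffel g (m i j : 'I_3) x : R :=
  2^-1 * \sum_l invmx (g x) m l *
    (partial i (fun y => g y j l) x + partial j (fun y => g y i l) x
     - partial l (fun y => g y i j) x).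

(* Sign convention: positive on round spheres. *)
Definition ricci g (i j : 'I_3) x : R :=
  \sum_m (partial m (christoffel g m i j) x - partial j (christoffel g m i m) x
    + \sum_l (christoffel g m m l x * christoffel g l i j x
              - christoffel g m j l x * christoffel g l i m x)).

Definition scalar_curvature g x : R :=
  \sum_i \sum_j invmx (g x) i j * ricci g i j x.

Definition tensor_norm2 g k x : R :=
  \sum_i \sum_j \sum_a \sum_b
    invmx (g x) i a * invmx (g x) j b * k x i j * k x a b.

Definition grad_norm2 g f x : R :=
  \sum_i \sum_j invmx (g x) i j * partial i f x * partial j f x.

Definition cov_deriv g k (a b c : 'I_3) x : R :=
  partial a (fun y => k y b c) x
  - \sum_d (christoffel g d a b x * k x d c)
  - \sum_d (christoffel g d a c x * k x b d).

Definition divergence g k (c : 'I_3) x : R :=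
  \sum_a \sum_b invmx (g x) a b * cov_deriv g k a b c x.

Definition constraint_equations (U : set point) g k (psi0 psi1 : point -> R) :
    Prop :=
  forall x, U x ->
    scalar_curvature g x + mtrace (g x) (k x) ^+ 2 - tensor_norm2 g k x
      = grad_norm2 g psi0 x + psi1 x ^+ 2 /\
    forall j : 'I_3,
      divergence g k j x - partial j (fun y => mtrace (g y) (k y)) x
        = psi1 x * partial j psi0 x.

Definition rotation (Q : 'M[R]_3) : Prop := Q *m Q^T = 1%:M /\ \det Q = 1.

Definition spherical_tensor (U : set point) k : Prop :=
  forall Q, rotation Q -> forall x, U x ->
    pullback (fun y => y *m Q) k x = k x.

Definition spherical_function (U : set point) f : Prop :=
  forall Q, rotation Q -> forall x, U x -> f (x *m Q) = f x.

Definition spherical_set (S : set point) : Prop :=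
  forall Q, rotation Q -> forall x, S x -> S (x *m Q).

Definition row3 (a b c : R) : 'rV[R]_3 := \row_i [:: a; b; c]`_i.

(* The coordinates of [q] are (rho, theta, phi). *)
Definition polar (q : 'rV[R]_3) : point :=
  let rho := q 0 0 in let theta := q 0 1 in let phi := q 0 2 in
  row3 (rho * sin theta * cos phi)
       (rho * sin theta * sin phi)
       (rho * cos theta).

(* On the ball of radius [a] minus the polar axis,
   T = u(rho) drho^2 + v(rho) (dtheta^2 + sin^2 theta dphi^2). *)
Definition polar_form (a : R) (T : point -> 'M[R]_3) (u v : R -> R) : Prop :=
  forall rho theta phi, 0 < rho < a -> 0 < theta < pi ->
    pullback polar T (row3 rho theta phi)
      = diag_mx (row3 (u rho) (v rho) (v rho * sin theta ^+ 2)).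

(* [F] parametrizes the relatively open piece S `&` W of S: it is a
   homeomorphism onto it (with inverse [G]) and an immersion. *)
Definition local_param (S : set point) (U : set 'rV[R]_2) (W : set point)
    (F : 'rV[R]_2 -> point) : Prop :=
  [/\ open U /\ open W,
      smooth_on U F,
      F @` U = S `&` W,
      exists2 G : point -> 'rV[R]_2,
        {within S `&` W, continuous G} & (forall u, U u -> G (F u) = u) &
      forall u, U u -> row_free ('J F u)].

Definition embedded_surface (S : set point) : Prop :=
  forall p, S p -> exists U W F, W p /\ local_param S U W F.

Definition tangent_space (S : set point) (p : point) : set 'rV[R]_3 :=
  [set X | exists U W F u v,
     [/\ local_param S U W F, U u, F u = p & X = v *m 'J F u]].

(* For S compact, the complement of S has exactly one unbounded component. *)
Definition unbounded_side (S : set point) : set point :=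
  [set y | ~ S y /\ ~ bounded_set (connected_component (~` S) y)].

(* [N] is only meaningful on [S]. *)
Definition outer_unit_normal g (S : set point) (N : point -> 'rV[R]_3) : Prop :=
  forall p, S p ->
    [/\ inner (g p) (N p) (N p) = 1,
        forall X, tangent_space S p X -> inner (g p) (N p) X = 0 &
        \forall t \near (0 : R)^'+, unbounded_side S (p + t *: N p)].

(* Covariant derivative of [N] along the a-th coordinate curve of [F]. *)
Definition cov_along g (N : point -> 'rV[R]_3) (F : 'rV[R]_2 -> point)
    (a : 'I_2) (u : 'rV[R]_2) : 'rV[R]_3 :=
  partial a (N \o F) u +
  \row_m \sum_i \sum_j
    christoffel g m i j (F u) * 'J F u a i * N (F u) 0 j.

Definition second_form g (N : point -> 'rV[R]_3) (F : 'rV[R]_2 -> point)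
    (u : 'rV[R]_2) : 'M[R]_2 :=
  \matrix_(a, b) inner (g (F u)) (cov_along g N F a u) (row b ('J F u)).

Definition trapped g k (S : set point) : Prop :=
  exists2 N, outer_unit_normal g S N &
    forall U W F, local_param S U W F -> forall u, U u ->
      mtrace (pullback F g u) (pullback F k u + second_form g N F u) < 0 /\
      mtrace (pullback F g u) (pullback F k u - second_form g N F u) < 0.

End Geometry.

Section Sobolev.
Variable R : realType.
Local Notation point := 'rV[R]_3.
Local Notation mu := (@lebesgue_measure R).
Local Notation mR := (measurableTypeR R).

Let sigma_finite_prod d1 d2 (T1 : measurableType d1) (T2 : measurableType d2)
    (m1 : {sigma_finite_measure set T1 -> \bar R})
    (m2 : {sigma_finite_measure set T2 -> \bar R}) :
  sigma_finite setT (m1 \x m2)%E.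
Proof.
exact: (isSigmaFinite.sigma_finiteT
  (@lebesgue_integral_fubini.measure_function_Measure_isSigmaFinite__to__measure_function_isSigmaFinite
    _ _ _ _ R m1 m2)).
Qed.

(* Matrices carry no measurable structure in the library, so integrals over R^3
   are taken over triples, transported along [vec3]. *)
Definition leb2 : set (mR * mR) -> \bar R := (mu \x mu)%E.
HB.instance Definition _ := Measure.on leb2.
HB.instance Definition _ :=
  @Measure_isSigmaFinite.Build _ _ _ leb2 (sigma_finite_prod mu mu).

Definition leb3 : set (mR * mR * mR) -> \bar R := (leb2 \x mu)%E.
HB.instance Definition _ := Measure.on leb3.
HB.instance Definition _ :=
  @Measure_isSigmaFinite.Build _ _ _ leb3 (sigma_finite_prod leb2 mu).

Definition vec3 (p : mR * mR * mR) : point := row3 p.1.1 p.1.2 p.2.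

Definition L2norm (f : point -> R) : \bar R :=
  'N[leb3]_2%:E[EFin \o (f \o vec3)].

Definition L2fun (f : point -> R) : Prop :=
  measurable_fun setT (f \o vec3) /\ (L2norm f < +oo)%E.

Definition edot (x y : point) : R := \sum_i x 0 i * y 0 i.

(* (2 pi)^(-3/2) times the integral of f(x) tau(x . xi) over |x| <= n *)
Definition truncated_transform (tau : R -> R) (f : point -> R) (n : nat)
    (xi : point) : R :=
  ((2 * pi) `^ (- (3 / 2))) *
  \int[leb3]_(p in [set p | enorm (vec3 p) <= n%:R])
    (f (vec3 p) * tau (edot (vec3 p) xi)).

(* For [f] in L^2: the Fourier transform of [f], with kernel
   (2 pi)^(-3/2) exp(-i x . xi), is A + i B; it is the L^2 limit of the
   transforms of the truncations of [f] to balls. *)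
Definition fourier (f A B : point -> R) : Prop :=
  [/\ L2fun A /\ L2fun B,
      L2norm (A \- truncated_transform cos f n)%R @[n --> \oo] --> 0%E &
      L2norm (B \+ truncated_transform sin f n)%R @[n --> \oo] --> 0%E].

(* For s >= 0; the value is +oo outside of H^s. The transform is unique up to
   null sets, so the infimum is over at most one value. *)
Definition Hs_norm (s : R) (f : point -> R) : \bar R :=
  ereal_inf [set M | exists A B, [/\ L2fun f, fourier f A B &
    M = ((\int[leb3]_p
      ((1 + enorm (vec3 p) ^+ 2) `^ s
         * (A (vec3 p) ^+ 2 + B (vec3 p) ^+ 2))%:E) `^ 2^-1)%E]].

Definition Hs_norm_on (U : set point) (s : R) (f : point -> R) : \bar R :=
  ereal_inf [set Hs_norm s h | h in [set h | forall x, U x -> h x = f x]].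

Definition Hs_norm_tensor_on (U : set point) (s : R) (T : point -> 'M[R]_3) :
    \bar R :=
  (\sum_(i < 3) \sum_(j < 3) Hs_norm_on U s (fun x => T x i j))%E.

End Sobolev.

Arguments leb2 R : clear implicits.
Arguments leb3 R : clear implicits.

(* Main.v *)
(** Write r for the area radius, v = r' and lambda = k_thetatheta / r^2. The
    constraints become
      r v' = (1 - v^2) / 2 + r^2 (k_rr lambda + lambda^2 / 2 - (psi0'^2 + psi1^2) / 4),
      (r lambda)' = v k_rr - r psi1 psi0' / 2,
    so that r (1 - v^2) and (r lambda)^2 have derivatives controlled by r and by
    rho Q, where Q = k_rr^2 + 2 (k_thetatheta / rho^2)^2 + psi0'^2 + psi1^2. If the
    integral of rho Q is small, a continuity argument started at the centre keeps
    v close to 1 and r lambda close to 0. The maximal sphere contained in a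
    trapped surface would satisfy r lambda < - |v|, a contradiction.

    The integral of rho Q is, up to a constant, the integral of the tensor norms
    squared against dx / |x|, and is bounded by the Sobolev norms through Hardy's
    inequality. The latter is obtained by duality: with phi = f / (2 |x|) (smoothly
    truncated) the integral of f phi is paired on the Fourier side, and the dual
    norm of phi is estimated by Schur's test applied to the kernels
    prod_i 2 t_i / (t_i^2 + z_i^2), the Fourier transforms of
    exp (- sum_i t_i |xi_i|), which average to a majorant of (1 + |xi|^2)^(-1/2). *)

From HB Require Import structures.
Require Import Defs.
From mathcomp Require Import ring lra measurable_realfun.

Set Implicit Arguments.
Unset Strict Implicit.
Unset Printing Implicit Defensive.

Import Order.TTheory GRing.Theory Num.Theory.
Import numFieldNormedType.Exports.
Local Open Scope classical_set_scope.
Local Open Scope ring_scope.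

(** The frequency weight is handled one coordinate at a time. The bracket power -1 is a product of
    three powers -1/3, and each is dominated by an average over u of [expR (- u^3 |xi_i|)]; this is
    the origin of the cube roots. With the test weight [|y|^(-2/3)] per coordinate, Schur's test
    followed by the average over u leaves the product of the [|x_i|^(1/3)], which is at most [|x|]:
    just what phi = f / (2 |x|) can absorb. Singular powers carry a shift d > 0 that keeps them
    continuous, and no final constant depends on d. Since the Fourier transform is only an L2 limit,
    pairings are computed for integrable truncations with an exponential damping in frequency, then
    removed as an approximate identity. The geometric obstacle is a circularity. The Sobolev norms
    control the flat component k_thetatheta / rho^2 = (r / rho)^2 lambda, so lambda is controlled
    only where r is comparable to rho, which itself follows from v being close to 1. Hence a
    continuity argument rather than a direct estimate. *)

Section PointwiseDerivatives.
Variables (R : realType) (V : normedModType R).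
Implicit Types (f g : V -> R) (u : R -> R) (x v : V).

(** The rules of this section are phrased for explicit lambda expressions rather than for sums and
    products of functions, so that the derivative of a formula is assembled by unification. *)
Lemma isd_cst (c : R) x v : is_derive x v (fun _ => c) 0.
Proof. exact: is_derive_cst. Qed.

Lemma isdD f g x v df dg : is_derive x v f df -> is_derive x v g dg ->
  is_derive x v (fun y => f y + g y) (df + dg).
Proof. by move=> hf hg; exact: is_deriveD. Qed.

Lemma isdN f x v df : is_derive x v f df -> is_derive x v (fun y => - f y) (- df).
Proof. by move=> hf; exact: is_deriveN. Qed.

Lemma isdM f g x v df dg : is_derive x v f df -> is_derive x v g dg ->
  is_derive x v (fun y => f y * g y) (df * g x + f x * dg).
Proof.
move=> hf hg; have h := @is_deriveM R V f g x v df dg hf hg.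
apply: (@is_derive_eq _ _ _ _ x v _ _ h).
by rewrite addrC /GRing.scale/= [g x * _]mulrC.
Qed.

Lemma isdV f x v df : f x != 0 -> is_derive x v f df ->
  is_derive x v (fun y => (f y)^-1) (- df / f x ^+ 2).
Proof.
move=> f0 hf; have df' : derivable f x v by exact: ex_derive.
apply: DeriveDef; first exact: (derivableV f0 df').
rewrite (deriveV f0 df') derive_val /GRing.scale/=; by field.
Qed.

Lemma isd_sum n (f : 'I_n -> V -> R) x v df :
  (forall i, is_derive x v (f i) (df i)) ->
  is_derive x v (fun y => \sum_i f i y) (\sum_i df i).
Proof.
move=> hf; have -> : (fun y => \sum_i f i y) = \sum_i f i.
  by apply/funext => y; rewrite fct_sumE.
exact: is_derive_sum.
Qed.

Lemma isdX f n x v df : is_derive x v f df ->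
  is_derive x v (fun y => f y ^+ n) (n%:R * f x ^+ n.-1 * df).
Proof.
move=> hf; have -> : (fun y => f y ^+ n) = f ^+ n.
  by apply/funext => y; elim: n => [|n IH]; rewrite ?expr0// !exprS IH.
have h := @is_deriveX R V f n x v df hf.
apply: (@is_derive_eq _ _ _ _ x v _ _ h).
by [].
Qed.

(** A directional derivative is a difference quotient along a line, so one-variable results transfer
    to functions on [V]; the chain rule [isd_comp] is obtained this way. *)
Lemma is_derive_line f x v df : is_derive x v f df <->
  is_derive (0 : R) 1 (fun t : R => f (t *: v + x)) df.
Proof.
have E : (fun t : R => t^-1 *: (f (t *: v + x) - f x)) =
  (fun t : R => t^-1 *: ((fun t : R => f (t *: v + x)) (t *: 1 + 0) - f (0 *: v + x))).
  by apply/funext => t; rewrite /= scale0r add0r addr0 [_ *: 1]mulr1.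
split=> -[ex dv]; split.
+ by rewrite /derivable -E.
+ by rewrite /derive -E.
+ by rewrite /derivable/= E.
+ by rewrite /derive/= E.
Qed.

Lemma isd_comp u f x v du df : is_derive (f x) 1 u du -> is_derive x v f df ->
  is_derive x v (fun y => u (f y)) (du * df).
Proof.
move=> hu hf; apply/is_derive_line; move/is_derive_line : hf => hf.
apply: (@is_derive1_comp _ u (fun t : R => f (t *: v + x))).
by rewrite scale0r add0r.
Qed.

End PointwiseDerivatives.

Section PointwiseDerivatives1.
Variables (R : realType).
Implicit Types (x : R).

Lemma isd_id x : is_derive x 1 (fun y : R => y) 1.
Proof. exact: is_derive_id. Qed.

Lemma isd_sqrt x : 0 < x -> is_derive x 1 (@Num.sqrt R) (2 * Num.sqrt x)^-1.
Proof.
move=> x0; have h := is_derive1_powR 2^-1 x0.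
have -> : (2 * Num.sqrt x)^-1 = 2^-1 * x `^ (2^-1 - 1).
  have -> : 2^-1 - 1 = - 2^-1 :> R by lra.
  by rewrite powRN powR12_sqrt ?ltW// invfM.
apply: near_eq_is_derive h.
near=> y; rewrite powR12_sqrt//; apply: ltW; near: y; exact: lt_nbhsr.
Unshelve. all: by end_near. Qed.

End PointwiseDerivatives1.

(** * Comparison of integrals over different domains *)

Section IntegralHelpers.
Variable R : realType.

Lemma ge0_integral_le_supp (dd : measure_display) (T : measurableType dd) (nu : {measure set T -> \bar R})
    (D E : set T) (f g : T -> \bar R) : measurable D -> measurable E ->
  measurable_fun setT f -> measurable_fun setT g ->
  (forall x, (0 <= f x)%E) -> (forall x, (0 <= g x)%E) ->
  (forall x, D x -> E x -> (f x <= g x)%E) ->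
  (forall x, D x -> ~ E x -> f x = 0%E) ->
  (\int[nu]_(x in D) f x <= \int[nu]_(x in E) g x)%E.
Proof.
move=> mD mE mf mg f0 g0 fg fD.
rewrite integral_mkcond [leRHS]integral_mkcond; apply: ge0_le_integral => //.
- by move=> x _; rewrite patchE; case: ifP.
- by apply/(measurable_restrictT f mD); exact: measurable_funTS.
- by apply/(measurable_restrictT g mE); exact: measurable_funTS.
- move=> x _; rewrite !patchE; case: ifPn => [/set_mem Dx|_].
    by case: ifPn => [/set_mem|/negP nE]; [exact: fg|rewrite fD// => Ex; apply: nE; exact: mem_set].
  by case: ifPn.
Qed.

Lemma measurable_indicb (dd : measure_display) (T : measurableType dd) (b : T -> bool) :
  measurable_fun setT b -> measurable_fun setT (fun x => (b x)%:R : R).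
Proof.
move=> mb.
have -> : (fun x => (b x)%:R) = (fun x => if b x then 1 else 0) :> (T -> R).
  by apply/funext => x; case: (b x).
by apply: measurable_fun_ifT.
Qed.

End IntegralHelpers.

Ltac isd := repeat first
  [ eassumption
  | apply: isd_id | apply: isdD | apply: isdN | apply: isdM | apply: isdX
  | apply: isdV | apply: isd_cst ].

(** * Fourier analysis on the line and on R^3 *)

Section OneDim.
Variable R : realType.
Local Notation mu := (@lebesgue_measure R).
Implicit Types (f F : R -> R) (t z b x y : R).

Lemma derivable1_continuous f x : derivable f x 1 -> {for x, continuous f}.
Proof. by move=> /derivable1_diffP/differentiable_continuous. Qed.

Lemma ge0_FTC_halfline f F (l : R) : (forall x, 0 <= x -> 0 <= f x) ->
  continuous f -> (forall x, is_derive x 1 F (f x)) ->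
  F x @[x --> +oo] --> l ->
  (\int[mu]_(x in `[0%R, +oo[) (f x)%:E = (l - F 0)%:E)%E.
Proof.
move=> f0 cf dF Fl; have cF : continuous F.
  by move=> x; apply: derivable1_continuous; apply: ex_derive.
rewrite (@ge0_continuous_FTC2y _ f F 0 l)//.
- exact: continuous_subspaceT.
- by apply: cvg_at_right_filter; exact: cF.
- by move=> x _; rewrite derive1E; apply: derive_val.
Qed.

Lemma ge0_integralT_halves f : (forall x, 0 <= f x) -> continuous f ->
  (\int[mu]_x (f x)%:E = \int[mu]_(x in `[0%R, +oo[) (f x)%:E
     + \int[mu]_(x in `[0%R, +oo[) (f (- x))%:E)%E.
Proof.
move=> f0 cf.
have mf : measurable_fun [set: R] f by exact: continuous_measurable_fun.
have mp : measurable [set x : R | 0 <= x] by rewrite -set_itvcy.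
rewrite -(setUv [set x : R | 0 <= x]) ge0_integral_setU//= ; last 4 first.
  exact: measurableC.
  by apply/measurable_EFinP; rewrite setUv.
  by move=> x _; rewrite lee_fin.
  exact/disj_setPCl.
rewrite -set_itvcy//; congr (_ + _)%E.
rewrite setCitvr integral_itv_bndo_bndc; last exact/measurable_EFinP/measurable_funTS.
rewrite -{1}oppr0 ge0_integration_by_substitutionNy//.
exact: continuous_subspaceT.
Qed.

Lemma ge0_FTC_line f F (l l' : R) : (forall x, 0 <= f x) ->
  continuous f -> (forall x, is_derive x 1 F (f x)) ->
  F x @[x --> +oo] --> l -> F (- x) @[x --> +oo] --> l' ->
  (\int[mu]_x (f x)%:E = (l - l')%:E)%E.
Proof.
move=> f0 cf dF Fl Fl'; rewrite ge0_integralT_halves//.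
rewrite (ge0_FTC_halfline _ cf dF Fl)//.
have dFN x : is_derive x 1 (fun x => - F (- x)) ((f \o -%R) x).
  have dF' := dF (- x).
  have -> : (f \o -%R) x = - (f (- x) * -1) by rewrite /= mulrN1 opprK.
  by apply: isdN; exact: (@is_derive1_comp _ F -%R).
rewrite (ge0_FTC_halfline _ _ dFN (cvgN Fl'))//.
- by rewrite -EFinD oppr0; congr (_%:E); lra.
- by move=> x _; exact: f0.
- move=> x; apply: (@continuous_comp _ _ _ -%R f); last exact: cf.
  exact: opp_continuous.
Qed.

Lemma expRN_cvg0 t : 0 < t -> expR (- (t * x)) @[x --> +oo] --> (0 : R).
Proof.
move=> t0; apply: (@cvg_comp _ _ _ (fun x => t * x) (fun y => expR (- y)) _ +oo).
  exact: gt0_cvgMry.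
exact: cvgr_expR.
Qed.

Lemma isd_expR x : is_derive x 1 (@expR R) (expR x).
Proof. exact: is_derive_expR. Qed.

Lemma isd_affine c b x : is_derive x 1 (fun y => c * y + b) c.
Proof.
have h : is_derive x 1 (fun y => c * y + b) (0 * x + c * 1 + 0) by isd.
by apply: is_derive_eq h _; lra.
Qed.

Lemma isd_linear c x : is_derive x 1 (fun y => c * y) c.
Proof. by apply: is_derive_eq (isdM (isd_cst c x 1) (isd_id x)) _; lra. Qed.

Lemma isd_expRN t x :
  is_derive x 1 (fun y => expR (- (t * y))) (expR (- (t * x)) * - t).
Proof.
exact: (@isd_comp _ _ (@expR R) (fun y => - (t * y)) x 1 _ _
  (isd_expR _) (isdN (isd_linear t x))).
Qed.

Lemma integral_expRN_halfline t : 0 < t ->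
  (\int[mu]_(x in `[0%R, +oo[) (expR (- (t * x)))%:E = (t^-1)%:E)%E.
Proof.
move=> t0; have tn0 : t != 0 by rewrite gt_eqF.
have dF x : is_derive x 1 (fun x => - t^-1 * expR (- (t * x))) (expR (- (t * x))).
  apply: is_derive_eq (isdM (isd_cst _ _ _) (isd_expRN t x)) _.
  by rewrite mul0r add0r mulrCA mulrNN mulVf// mulr1.
rewrite (ge0_FTC_halfline (l := 0) _ _ dF)//.
- by rewrite mulr0 oppr0 expR0 sub0r mulr1 opprK.
- move=> x; apply: derivable1_continuous; apply: ex_derive; exact: isd_expRN.
- rewrite -[X in _ --> X](mulr0 (- t^-1)).
  by apply: cvgM; [exact: cvg_cst|exact: expRN_cvg0].
Qed.

Lemma continuous_expRN t : continuous (fun x => expR (- (t * x))).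
Proof.
by move=> x; apply: derivable1_continuous; apply: ex_derive; exact: isd_expRN.
Qed.

Lemma continuous_cos_affine z b : continuous (fun x => cos (z * x + b)).
Proof.
by move=> x; apply: derivable1_continuous; apply: ex_derive.
Qed.

(* Adding 1 to the cosine makes the integrand nonnegative. *)
Lemma integral_expRN_cos_halfline t z b : 0 < t ->
  (\int[mu]_(x in `[0%R, +oo[) (expR (- (t * x)) * (1 + cos (z * x + b)))%:E
   = (t^-1 + (t * cos b - z * sin b) / (t ^+ 2 + z ^+ 2))%:E)%E.
Proof.
move=> t0; have D0 : t ^+ 2 + z ^+ 2 != 0 by rewrite gt_eqF// ltr_wpDr ?sqr_ge0 ?exprn_gt0.
set D := t ^+ 2 + z ^+ 2 in D0 *.
(* The oscillating part of [P] is the one in the standard primitive of a damped cosine, and [t^-1]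
   accounts for the added 1. *)
pose P x := t^-1 + (t * cos (z * x + b) - z * sin (z * x + b)) / D.
have dF x : is_derive x 1 (fun x => - (expR (- (t * x)) * P x))
    (expR (- (t * x)) * (1 + cos (z * x + b))).
  have hx := isd_affine z b x.
  have hc := @isd_comp _ _ (@cos R) _ x 1 _ _ (is_derive_cos _) hx.
  have hs := @isd_comp _ _ (@sin R) _ x 1 _ _ (is_derive_sin _) hx.
  have he := isd_expRN t x.
  have hP : is_derive x 1 P (- z * (t * sin (z * x + b) + z * cos (z * x + b)) / D).
    have h : is_derive x 1 P (0 +
      ((0 * cos (z * x + b) + t * (- sin (z * x + b) * z) - (0 * sin (z * x + b) + z * (cos (z * x + b) * z))) * D^-1
        + (t * cos (z * x + b) - z * sin (z * x + b)) * 0)) by rewrite /P; isd.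
    by apply: is_derive_eq h _; ring.
  apply: is_derive_eq (isdN (isdM he hP)) _.
  rewrite /P /D; field.
  by rewrite D0 gt_eqF.
rewrite (ge0_FTC_halfline (l := 0) _ _ dF)//.
- by rewrite /P !mulr0 oppr0 expR0 mul1r sub0r opprK add0r.
- move=> x; apply: cvgM; first exact: continuous_expRN.
  by apply: cvgD; [exact: cvg_cst|exact: continuous_cos_affine].
(* [P] is bounded by [C], so the exponential factor sends the primitive to 0 at infinity. *)
- pose C := t^-1 + (t + `|z|) / D.
  have PC x : `|P x| <= C.
    rewrite /P /C (le_trans (ler_normD _ _))// lerD//.
      by rewrite ger0_norm// invr_ge0 ltW.
    rewrite normrM normfV (ger0_norm (_ : 0 <= D)) ?addr_ge0 ?sqr_ge0//.
    rewrite ler_wpM2r ?invr_ge0 ?addr_ge0 ?sqr_ge0//.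
    rewrite (le_trans (ler_normB _ _))// !normrM (gtr0_norm t0) lerD//.
      by rewrite ler_piMr ?(ltW t0)// ler_norml cos_geN1 cos_le1.
    by rewrite ler_piMr// ler_norml sin_geN1 sin_le1.
  apply/norm_cvg0P.
  apply: (@squeeze_cvgr _ _ _ _ (fun=> 0) (fun x => C * expR (- (t * x)))).
  + near=> x; rewrite normr_ge0/= normrN normrM mulrC.
    by rewrite (ger0_norm (expR_ge0 _)) ler_wpM2r ?expR_ge0.
  + exact: cvg_cst.
  + rewrite -[X in _ --> X](mulr0 C).
    by apply: cvgM; [exact: cvg_cst|exact: expRN_cvg0].
Unshelve. all: by end_near. Qed.

Lemma cos1_ge0 x : 0 <= 1 + cos x.
Proof. by have := cos_geN1 x; lra. Qed.

Lemma continuous_expR_abs t : continuous (fun x => expR (- (t * `|x|))).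
Proof.
move=> x; apply: (@continuous_comp _ _ _ (fun x => `|x|) (fun x => expR (- (t * x)))).
  exact: norm_continuous.
exact: continuous_expRN.
Qed.

(** Reflecting the negative half-line replaces [z] by [- z]; the two sine terms cancel and the
    cosine terms add up to the Poisson kernel. *)
Lemma integral_expR_abs_cos1 t z b : 0 < t ->
  (\int[mu]_x (expR (- (t * `|x|)) * (1 + cos (z * x + b)))%:E
   = (2 / t + 2 * t / (t ^+ 2 + z ^+ 2) * cos b)%:E)%E.
Proof.
move=> t0; rewrite ge0_integralT_halves; last 2 first.
- by move=> x; apply: mulr_ge0; [exact: expR_ge0|exact: cos1_ge0].
- move=> x; apply: cvgM; first exact: continuous_expR_abs.
  by apply: cvgD; [exact: cvg_cst|exact: continuous_cos_affine].
under eq_integral => x.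
  rewrite inE/= in_itv/= andbT => x0.
  rewrite ger0_norm//. over.
under [X in (_ + X)%E]eq_integral => x.
  rewrite inE/= in_itv/= andbT => x0.
  rewrite normrN ger0_norm// mulrN -mulNr. over.
rewrite !integral_expRN_cos_halfline// -EFinD sqrrN; congr (_%:E).
have tn0 : t != 0 by rewrite gt_eqF.
have D0 : t ^+ 2 + z ^+ 2 != 0 by rewrite gt_eqF// ltr_wpDr ?sqr_ge0 ?exprn_gt0.
by field; rewrite ?tn0 ?D0.
Qed.

Lemma integral_expR_abs t : 0 < t ->
  (\int[mu]_x (expR (- (t * `|x|)))%:E = (2 / t)%:E)%E.
Proof.
move=> t0; rewrite ge0_integralT_halves; last 2 first.
- by move=> x; rewrite expR_ge0.
- exact: continuous_expR_abs.
under eq_integral => x.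
  rewrite inE/= in_itv/= andbT => x0.
  rewrite ger0_norm//. over.
under [X in (_ + X)%E]eq_integral => x.
  rewrite inE/= in_itv/= andbT => x0.
  rewrite normrN ger0_norm//. over.
by rewrite !integral_expRN_halfline// -EFinD; congr (_%:E); ring.
Qed.

Lemma integral_poisson t x : 0 < t ->
  (\int[mu]_y (t / (t ^+ 2 + (x - y) ^+ 2))%:E = pi%:E)%E.
Proof.
move=> t0; have D0 y : 0 < t ^+ 2 + (x - y) ^+ 2 by rewrite ltr_wpDr ?sqr_ge0 ?exprn_gt0.
have tn0 : t != 0 by rewrite gt_eqF.
have dF y : is_derive y 1 (fun y => atan (t^-1 * y + (- x / t)))
   (t / (t ^+ 2 + (x - y) ^+ 2)).
  have h := @isd_comp _ _ (@atan R) _ y 1 _ _ (is_derive1_atan _)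
    (isd_affine t^-1 (- x / t) y).
  apply: is_derive_eq h _.
  have := D0 y; have : 0 < t ^+ 2 + (x - y) ^+ 2 by [].
  move=> d _; field.
  by rewrite tn0 (gt_eqF d).
rewrite (ge0_FTC_line (l := pi / 2) (l' := - (pi / 2)) _ _ dF).
- by congr (_%:E); field.
- by move=> y; rewrite divr_ge0 ?ltW.
- move=> y; apply: cvgM; first exact: cvg_cst.
  apply: cvgV; first by rewrite gt_eqF.
  apply: cvgD; first exact: cvg_cst.
  apply: cvgM; apply: cvgB; (exact: cvg_cst || exact: cvg_id).
- apply: (@cvg_comp _ _ _ _ (@atan R) _ +oo); last exact: cvgy_atan.
  apply: (@cvg_comp _ _ _ (fun y => t^-1 * y) (fun y => y + _) _ +oo); last exact: cvg_addrr.
  by apply: gt0_cvgMry; [rewrite invr_gt0|exact: cvg_id].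
- under eq_fun do rewrite -[atan _]opprK -atanN.
  apply: cvgN.
  apply: (@cvg_comp _ _ _ _ (@atan R) _ +oo); last exact: cvgy_atan.
  have -> : (fun y => - (t^-1 * - y + - x / t)) = (fun y => t^-1 * y + x / t).
    by apply/funext => y; ring.
  apply: (@cvg_comp _ _ _ (fun y => t^-1 * y) (fun y => y + _) _ +oo); last exact: cvg_addrr.
  by apply: gt0_cvgMry; [rewrite invr_gt0|exact: cvg_id].
Qed.

(** The Fourier transform of [expR (- t |x|)], that is [2 * pi] times the normalised Poisson kernel
    of height [t]. *)
Definition pker t z : R := 2 * t / (t ^+ 2 + z ^+ 2).

Lemma pker_le t z : 0 < t -> 0 <= pker t z <= 2 / t.
Proof.
move=> t0; have D0 : 0 < t ^+ 2 + z ^+ 2 by rewrite ltr_wpDr ?sqr_ge0 ?exprn_gt0.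
rewrite /pker; apply/andP; split; first by rewrite divr_ge0 ?mulr_ge0 ?ltW.
rewrite ler_pdivrMr// mulrAC ler_pdivlMr// -mulrA ler_pM2l// -expr2.
by rewrite lerDl sqr_ge0.
Qed.

(** The shape [p + q cos] is reproduced by the integration, with [2 / t * p] and [pker t z * q] as
    new coefficients, so that the lemma can be iterated over several variables. The condition
    [q <= p] allows the split into [p - q] and [q (1 + cos)], both nonnegative. *)
Lemma integral_expR_abs_mulcos t z b (c p q : R) : 0 < t -> 0 <= c -> 0 <= q <= p ->
  (\int[mu]_x (c * expR (- (t * `|x|)) * (p + q * cos (z * x + b)))%:E
   = (c * (2 / t * p + pker t z * q * cos b))%:E)%E.
Proof.
move=> t0 c0 /andP[q0 qp].
have me : measurable_fun setT (fun x => (expR (- (t * `|x|)))%:E).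
  by apply/measurable_EFinP; apply: continuous_measurable_fun; exact: continuous_expR_abs.
have mc : measurable_fun setT (fun x => (expR (- (t * `|x|)) * (1 + cos (z * x + b)))%:E).
  apply/measurable_EFinP; apply: continuous_measurable_fun => x.
  apply: cvgM; first exact: continuous_expR_abs.
  by apply: cvgD; [exact: cvg_cst|exact: continuous_cos_affine].
have h0 x : (0 <= (expR (- (t * `|x|)) * (1 + cos (z * x + b)))%:E)%E.
  by rewrite lee_fin mulr_ge0 ?expR_ge0// cos1_ge0.
have k1 : 0 <= c * (p - q) by rewrite mulr_ge0// subr_ge0.
have k2 : 0 <= c * q by rewrite mulr_ge0.
under eq_integral => x _.
  have -> : c * expR (- (t * `|x|)) * (p + q * cos (z * x + b)) =
    c * (p - q) * expR (- (t * `|x|)) +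
    c * q * (expR (- (t * `|x|)) * (1 + cos (z * x + b))) by ring.
  rewrite EFinD (EFinM (c * (p - q))) (EFinM (c * q)).
  over.
rewrite ge0_integralD//=; last 4 first.
- by move=> x _; rewrite -EFinM lee_fin; apply: mulr_ge0 => //; exact: expR_ge0.
- exact: measurable_funeM.
- by move=> x _; rewrite mule_ge0 ?lee_fin.
- exact: measurable_funeM.
rewrite !ge0_integralZl_EFin//=.
rewrite integral_expR_abs// integral_expR_abs_cos1// -!EFinM -EFinD; congr (_%:E).
rewrite /pker; ring.
Qed.

End OneDim.

(** * Power weights on the line and their Poisson averages *)

Section Weights.
Variable R : realType.
Local Notation mu := (@lebesgue_measure R).
Implicit Types (t x y d m : R).

Lemma ge0_integralT_halves_measurable (f : R -> \bar R) : (forall x, (0 <= f x)%E) ->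
  measurable_fun setT f ->
  (\int[mu]_x f x = \int[mu]_(x in `[0%R, +oo[) f x
     + \int[mu]_(x in `[0%R, +oo[) f (- x)%R)%E.
Proof.
move=> f0 mf.
have mp : measurable [set x : R | 0 <= x] by rewrite -set_itvcy.
have mC := measurableC mp.
have mfN : measurable_fun setT (fun x : R => f (- x)).
  by apply: measurableT_comp mf _; exact: oppr_measurable.
rewrite -(setUv [set x : R | 0 <= x]) ge0_integral_setU//= ; last 2 first.
  by rewrite setUv.
  exact/disj_setPCl.
rewrite -set_itvcy//; congr (_ + _)%E.
rewrite setCitvr integral_itv_bndo_bndc; last exact/measurable_funTS.
rewrite [RHS]ge0_integration_by_substitution0//.
by apply: eq_integral => x _; rewrite opprK.
Qed.

Definition cbrt x : R := x `^ 3^-1.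

Lemma cbrt_ge0 x : 0 <= cbrt x. Proof. exact: powR_ge0. Qed.

Lemma cbrt_gt0 x : 0 < x -> 0 < cbrt x. Proof. exact: powR_gt0. Qed.

Lemma cbrtK x : 0 <= x -> cbrt x ^+ 3 = x.
Proof.
move=> x0; rewrite -powR_mulrn ?cbrt_ge0// /cbrt -powRrM mulVf ?powRr1 ?pnatr_eq0//.
Qed.

Lemma ler_cbrt x y : 0 <= x -> x <= y -> cbrt x <= cbrt y.
Proof.
move=> x0 xy; apply: ge0_ler_powR; rewrite ?invr_ge0 ?nnegrE//.
exact: le_trans xy.
Qed.

Lemma cbrt_exp3 x : 0 <= x -> cbrt (x ^+ 3) = x.
Proof.
move=> x0; rewrite /cbrt -(powR_mulrn 3 x0) -powRrM mulfV ?powRr1 ?pnatr_eq0//.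
Qed.

Lemma cbrtM x y : 0 <= x -> 0 <= y -> cbrt (x * y) = cbrt x * cbrt y.
Proof. exact: powRM. Qed.

Lemma isd_cbrt x : 0 < x -> is_derive x 1 (fun y => 3 * cbrt y) ((cbrt x ^+ 2)^-1).
Proof.
move=> x0; have h := is_derive1_powR 3^-1 x0.
apply: is_derive_eq (isdM (isd_cst 3 x 1) h) _.
rewrite mul0r add0r mulrA mulfV ?pnatr_eq0// mul1r.
have -> : 3^-1 - 1 = 3^-1 * (- 2) :> R by field.
rewrite powRrM powRN -/(cbrt x) -(powR_mulrn 2)// cbrt_ge0//.
Qed.

Lemma continuous_cbrt_abs d : 0 < d -> continuous (fun y => cbrt (`|y| + d)).
Proof.
move=> d0 y.
have h := isd_cbrt (_ : 0 < `|y| + d).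
have {}h : {for `|y| + d, continuous (fun y => 3 * cbrt y)}.
  by apply: derivable1_continuous; apply: ex_derive; apply: h; rewrite ltr_wpDl.
have -> : (fun y => cbrt (`|y| + d)) = (fun y => 3^-1 * (3 * cbrt (`|y| + d))).
  by apply/funext => z; rewrite mulrA mulVf ?mul1r ?pnatr_eq0.
apply: cvgM; first exact: cvg_cst.
apply: (@continuous_comp _ _ _ (fun y => `|y| + d) (fun y => 3 * cbrt y)); last exact: h.
apply: cvgD; last exact: cvg_cst; exact: norm_continuous.
Qed.

(** Test weight for Schur's test in one variable, a shifted power -2/3. This exponent is integrable
    at 0, as Poisson averaging demands, and after the substitution [t = u^3] it decays like [u^-2],
    which is integrable at infinity. *)
Definition wgt d y : R := (cbrt (`|y| + d) ^+ 2)^-1.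

Lemma wgt_gt0 d y : 0 < d -> 0 < wgt d y.
Proof. by move=> d0; rewrite invr_gt0 exprn_gt0// cbrt_gt0// ltr_wpDl. Qed.

Lemma continuous_wgt d : 0 < d -> continuous (wgt d).
Proof.
move=> d0 y; apply: cvgV.
  by rewrite gt_eqF// exprn_gt0// cbrt_gt0// ltr_wpDl.
apply: (@continuous_comp _ _ _ (fun y => cbrt (`|y| + d)) (fun z => z ^+ 2)).
  exact: continuous_cbrt_abs.
exact: exprn_continuous.
Qed.

Lemma integral_wgt_half d b : 0 < d -> d <= b ->
  (\int[mu]_(y in `[0%R, (b - d)%R]) (wgt d y)%:E <= (3 * cbrt b)%:E)%E.
Proof.
move=> d0; rewrite le_eqVlt => /predU1P[->|db].
  rewrite subrr set_itv1 integral_set1 lee_fin mulr_ge0 ?cbrt_ge0//.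
rewrite (_ : \int[mu]_(y in `[0%R, (b - d)%R]) (wgt d y)%:E =
  (3 * cbrt b)%:E - (3 * cbrt d)%:E)%E.
  rewrite -EFinB lee_fin gerBl mulr_ge0 ?cbrt_ge0//.
have dF y : 0 <= y -> is_derive y 1 (fun y => 3 * cbrt (y + d)) (wgt d y).
  move=> y0; have yd : 0 < y + d by rewrite ltr_wpDl.
  have h := @isd_comp _ _ (fun y => 3 * cbrt y) _ y 1 _ _ (isd_cbrt yd)
    (isdD (isd_id y) (isd_cst d y 1)).
  by apply: is_derive_eq h _; rewrite /wgt ger0_norm//; ring.
have cF y : 0 <= y -> {for y, continuous (fun y => 3 * cbrt (y + d))}.
  by move=> y0; apply: derivable1_continuous; apply: ex_derive; exact: dF.
rewrite (@continuous_FTC2 _ _ (fun y => 3 * cbrt (y + d))) ?subr_gt0//.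
- by rewrite subrK add0r.
- apply: continuous_subspaceT; exact: continuous_wgt.
- split.
  + move=> x /[!in_itv]/= /andP[/ltW x0 _]; apply: ex_derive; exact: dF.
  + apply: cvg_at_right_filter; exact: cF.
  + by apply: cvg_at_left_filter; apply: cF; rewrite subr_ge0 ltW.
- move=> x /[!in_itv]/= /andP[/ltW x0 _]; rewrite derive1E.
  by have := dF x x0 => h; rewrite derive_val.
Qed.

(* Outside of a small neighbourhood of 0 the weight at [y] is comparable to the
   one at scale [x]; inside it the Poisson kernel is at most 2/m. *)
Lemma poisson_wgt_pointwise t x y d m : 0 < t -> 0 < d -> m = `|x| + t + d ->
  t / (t ^+ 2 + (x - y) ^+ 2) * wgt d y <=
    4 / (cbrt m ^+ 2) * (t / (t ^+ 2 + (x - y) ^+ 2))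
    + 4 / m * (wgt d y * (`|y| + d < m / 8)%R%:R).
Proof.
move=> t0 d0 mE; have m0 : 0 < m by rewrite mE; have := normr_ge0 x; lra.
have P0 : 0 <= t / (t ^+ 2 + (x - y) ^+ 2).
  by rewrite divr_ge0 ?addr_ge0 ?sqr_ge0 ?ltW.
have w0 := wgt_gt0 y d0.
case: ltP => ym; last first.
  rewrite mulr0 mulr0 addr0 mulrC ler_wpM2r//.
  (* Here [|y| + d >= m / 8]. As 8 is a cube, the weight at [y] is at most [2^2 = 4] times the one
     at scale [m]. *)
  have m8 : cbrt (m / 8) = cbrt m / 2.
    have -> : m / 8 = m * 2^-1 ^+ 3 by field.
    by rewrite cbrtM ?cbrt_exp3 ?exprn_ge0 ?ltW// invr_ge0.
  have h := ler_cbrt (ltW (divr_gt0 m0 (ltr0n _ 8))) ym.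
  have c0 := cbrt_gt0 m0.
  rewrite /wgt -[leRHS]invrK lef_pV2 ?posrE ?invr_gt0 ?divr_gt0 ?exprn_gt0 ?cbrt_gt0//.
    by rewrite invfM invrK; move: h; rewrite m8 => h; nra.
  by rewrite (lt_le_trans _ ym) ?divr_gt0.
rewrite mulr1 -[leLHS]add0r; apply: lerD.
  by apply: mulr_ge0 => //; rewrite divr_ge0// exprn_ge0// cbrt_ge0.
apply: ler_wpM2r; first exact: ltW.
rewrite ler_pdivrMr ?ltr_wpDr ?sqr_ge0 ?exprn_gt0//.
rewrite mulrAC ler_pdivlMr//.
(* Now [|y| + d < m / 8], hence [|x - y| + t > 7 m / 8]; the square below controls the mixed product
   of [t] and [|x - y|], and together they give [t m <= 4 (t^2 + (x - y)^2)]. *)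
have xy : `|x - y| >= `|x| - `|y| by exact: lerB_dist.
have := sqr_ge0 (`|x - y| - t); rewrite -(real_normK (num_real (x - y))).
have := normr_ge0 (x - y); have := normr_ge0 y; move: xy ym; rewrite mE.
move: (`|x - y|) (`|x|) (`|y|) => z p q. nra.
Qed.

Lemma integral_wgt_near0 d b : 0 < d ->
  (\int[mu]_y (wgt d y * (`|y| + d < b)%R%:R)%:E <= (6 * cbrt b)%:E)%E.
Proof.
move=> d0; have [bd|db] := ltP b d.
  rewrite (_ : (fun y => _) = cst 0%E) ?integral0 ?lee_fin ?mulr_ge0 ?cbrt_ge0//.
  apply/funext => y; rewrite /= ltNge (le_trans (ltW bd)) ?mulr0//.
  by rewrite lerDr.
have mw : measurable_fun setT (fun y : R => (wgt d y)%:E).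
  by apply/measurable_EFinP; apply: continuous_measurable_fun; exact: continuous_wgt.
have mf : measurable_fun setT (fun y : R => (wgt d y * (`|y| + d < b)%R%:R)%:E).
  apply/measurable_EFinP; apply: measurable_funM; first exact/measurable_EFinP.
  apply: measurable_indicb; apply: measurable_fun_ltr => //.
  by apply: measurable_funD => //; exact: measurable_normr.
have w0 y := ltW (wgt_gt0 y d0).
have f0 y : (0 <= (wgt d y * (`|y| + d < b)%R%:R)%:E)%E.
  by rewrite lee_fin mulr_ge0 ?ler0n.
have half : (\int[mu]_(y in `[0%R, +oo[) (wgt d y * (`|y| + d < b)%R%:R)%:E <=
    (3 * cbrt b)%:E)%E.
  apply: le_trans (integral_wgt_half d0 db).
  apply: ge0_integral_le_supp => //.
  - by move=> y _ _; rewrite lee_fin ler_piMr//; case: (_ < _).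
  - move=> y /=; rewrite in_itv/= andbT => y0 /negP.
    rewrite in_itv/= y0/= -ltNge ltrBlDr => h.
    by rewrite ger0_norm// ltNge ltW ?mulr0.
rewrite ge0_integralT_halves_measurable//.
under [X in (_ + X)%E]eq_integral => y _ do rewrite normrN /wgt normrN -/(wgt d y).
by rewrite (le_trans (leeD half half))// -EFinD lee_fin; lra.
Qed.

(** Poisson averaging at height [t] acts on the weight like replacing [|x|] by [|x| + t]. In the
    constant, [4 * pi] is the far part times the mass of the kernel, and 12 is the integral of the
    weight near 0 times the bound [4 / m] on the kernel there. *)
Lemma integral_poisson_wgt t x d m : 0 < t -> 0 < d -> m = `|x| + t + d ->
  (\int[mu]_y (t / (t ^+ 2 + (x - y) ^+ 2) * wgt d y)%:E
    <= ((4 * pi + 12) / cbrt m ^+ 2)%:E)%E.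
Proof.
move=> t0 d0 mE; have m0 : 0 < m by rewrite mE; have := normr_ge0 x; lra.
have P0 y : 0 <= t / (t ^+ 2 + (x - y) ^+ 2).
  by rewrite divr_ge0 ?addr_ge0 ?sqr_ge0 ?ltW.
have w0 y := ltW (wgt_gt0 y d0).
have mw : measurable_fun setT (fun y : R => wgt d y).
  by apply: continuous_measurable_fun; exact: continuous_wgt.
have mP : measurable_fun setT (fun y : R => t / (t ^+ 2 + (x - y) ^+ 2)).
  apply: continuous_measurable_fun => y.
  apply: cvgM; first exact: cvg_cst.
  apply: cvgV; first by rewrite gt_eqF// ltr_wpDr ?sqr_ge0 ?exprn_gt0.
  apply: cvgD; first exact: cvg_cst.
  by apply: cvgM; apply: cvgB; (exact: cvg_cst || exact: cvg_id).
have mi : measurable_fun setT (fun y : R => (`|y| + d < m / 8)%R%:R : R).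
  apply: measurable_indicb; apply: measurable_fun_ltr => //.
  by apply: measurable_funD => //; exact: measurable_normr.
have c0 := cbrt_gt0 m0.
have A0 : 0 <= 4 / (cbrt m ^+ 2) by rewrite divr_ge0// exprn_ge0// ltW.
have B0 : 0 <= 4 / m by rewrite divr_ge0// ltW.
apply: (@le_trans _ _ (\int[mu]_y ((4 / (cbrt m ^+ 2))%:E * (t / (t ^+ 2 + (x - y) ^+ 2))%:E
    + (4 / m)%:E * (wgt d y * (`|y| + d < m / 8)%R%:R)%:E))%E).
  apply: ge0_le_integral => //.
  - by move=> y _; rewrite lee_fin mulr_ge0.
  - by apply/measurable_EFinP; exact: measurable_funM.
  - apply/measurable_EFinP.
    by apply: measurable_funD; apply: measurable_funM => //; exact: measurable_funM.
  - by move=> y _; rewrite -!EFinM -EFinD lee_fin; exact: poisson_wgt_pointwise.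
rewrite ge0_integralD//=; last 4 first.
- by move=> y _; rewrite -EFinM lee_fin; apply: mulr_ge0.
- by apply/measurable_EFinP; apply: measurable_funM.
- by move=> y _; rewrite -EFinM lee_fin; do 2![apply: mulr_ge0 => //]; exact: ler0n.
- by apply/measurable_EFinP; apply: measurable_funM => //; exact: measurable_funM.
rewrite !ge0_integralZl_EFin//=; last 4 first.
- by move=> y _; rewrite lee_fin; apply: mulr_ge0 => //; exact: ler0n.
- by apply/measurable_EFinP; apply: measurable_funM.
- by move=> y _; rewrite lee_fin.
- exact/measurable_EFinP.
rewrite integral_poisson//.
apply: (@le_trans _ _ ((4 / cbrt m ^+ 2)%:E * pi%:E + (4 / m)%:E * (6 * cbrt (m / 8))%:E)%E).
  by rewrite leeD2l// lee_pmul2l ?lte_fin ?divr_gt0//; exact: integral_wgt_near0.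
rewrite -!EFinM -EFinD lee_fin.
have -> : cbrt (m / 8) = cbrt m / 2.
  have -> : m / 8 = m * 2^-1 ^+ 3 by field.
  by rewrite cbrtM ?cbrt_exp3 ?exprn_ge0 ?ltW// invr_ge0.
rewrite -[X in 4 / X * (6 * _)](cbrtK (ltW m0)).
have cn0 : cbrt m != 0 by rewrite gt_eqF.
by rewrite le_eqVlt; apply/orP; left; apply/eqP; field.
Qed.

Lemma integral_Vsqr a : 0 < a ->
  (\int[mu]_(x in `[a, +oo[) (x ^- 2)%:E = (a^-1)%:E)%E.
Proof.
move=> a0; have dF x : a <= x -> is_derive x 1 (fun x => - x^-1) (x ^- 2).
  move=> ax; have x0 : x != 0 by rewrite gt_eqF// (lt_le_trans a0).
  by apply: is_derive_eq (isdN (isdV x0 (isd_id x))) _; rewrite mulN1r opprK.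
have cV x : a <= x -> {for x, continuous (fun x => x ^- 2)}.
  move=> ax; apply: cvgV; first by rewrite gt_eqF// exprn_gt0// (lt_le_trans a0).
  exact: exprn_continuous.
have cF x : a <= x -> {for x, continuous (fun x => - x^-1)}.
  by move=> ax; apply: derivable1_continuous; apply: ex_derive; exact: dF.
rewrite (@ge0_continuous_FTC2y _ _ (fun x => - x^-1) a 0).
- by rewrite -EFinD sub0r opprK.
- by move=> x ax; rewrite invr_ge0 sqr_ge0.
- apply/continuous_within_itvcyP; split.
    by move=> x; rewrite in_itv/= andbT => /ltW; exact: cV.
  by apply: cvg_at_right_filter; exact: cV.
- rewrite -oppr0; apply: cvgN; apply/(@gtr0_cvgV0 _ _ _ _ id); last exact: cvg_id.
  by near=> x; near: x; exact: nbhs_pinfty_gt.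
- by move=> x /ltW ax; apply: ex_derive; exact: dF.
- by apply: cvg_at_right_filter; exact: cF.
- by move=> x; rewrite in_itv/= andbT => /ltW ax; rewrite derive1E; have h := dF x ax; rewrite derive_val.
Unshelve. all: by end_near. Qed.

Lemma continuous_wgt_exp3 m : 0 < m -> continuous (fun u : R => wgt m (u ^+ 3)).
Proof.
move=> m0 u; apply: (@continuous_comp _ _ _ (fun u : R => u ^+ 3) (wgt m)).
  exact: exprn_continuous.
exact: continuous_wgt.
Qed.

(** The weight is at most [m^(-2/3)] and at most [u^-2]. The two bounds cross at [u = cbrt m], and
    each side of this point contributes at most [1 / cbrt m]. *)
Lemma integral_wgt_exp3 m : 0 < m ->
  (\int[mu]_(u in `]0%R, +oo[) (wgt m (u ^+ 3))%:E <= (2 / cbrt m)%:E)%E.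
Proof.
move=> m0; set a := cbrt m; have a0 : 0 < a by exact: cbrt_gt0.
have mw : measurable_fun setT (fun u : R => (wgt m (u ^+ 3))%:E).
  by apply/measurable_EFinP; apply: continuous_measurable_fun; exact: continuous_wgt_exp3.
have w0 u := ltW (wgt_gt0 (u ^+ 3) m0).
have -> : `]0%R, +oo[%classic = `]0%R, a] `|` `]a, +oo[ :> set R.
  by rewrite -itv_bndbnd_setU ?bnd_simp// ltW.
rewrite ge0_integral_setU//=; last 3 first.
- exact: measurable_funTS.
- by move=> u _; rewrite lee_fin.
- rewrite disj_set2E; apply/eqP; rewrite -subset0 => x []/= /[!in_itv]/=.
  by rewrite andbT => /andP[_ xa] /lt_geF; rewrite xa.
have h1 : (\int[mu]_(u in `]0%R, a]) (wgt m (u ^+ 3))%:E <= (a^-1)%:E)%E.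
  apply: (@le_trans _ _ (\int[mu]_(u in `]0%R, a]) (cst (a ^- 2)%:E) u)%E).
    apply: ge0_le_integral => //.
    - by move=> u _; rewrite lee_fin.
    - exact: measurable_funTS.
    - move=> u /=; rewrite in_itv/= => /andP[u0 ua]; rewrite lee_fin /wgt.
      rewrite lef_pV2 ?posrE ?exprn_gt0 ?cbrt_gt0 ?ltr_wpDl//.
      rewrite lerXn2r ?nnegrE ?cbrt_ge0//.
      by apply: ler_cbrt; [exact: ltW|rewrite lerDr].
  rewrite integral_cst//= lebesgue_measure_itv/= lte_fin a0 -EFinD subr0 -EFinM lee_fin.
  by rewrite expr2 invfM mulfVK ?gt_eqF.
have h2 : (\int[mu]_(u in `]a, +oo[) (wgt m (u ^+ 3))%:E <= (a^-1)%:E)%E.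
  rewrite -(integral_Vsqr a0) integral_itv_obnd_cbnd; last exact: measurable_funTS.
  apply: ge0_le_integral => //.
  - by move=> u _; rewrite lee_fin.
  - exact: measurable_funTS.
  - apply/measurable_EFinP; apply: subspace_continuous_measurable_fun => //.
    apply/subspace_continuousP => x /=; rewrite in_itv/= andbT => ax.
    apply: cvg_within_filter; apply: cvgV; last exact: exprn_continuous.
    by rewrite gt_eqF// exprn_gt0// (lt_le_trans a0).
  - move=> u /=; rewrite in_itv/= andbT => au; have u0 := lt_le_trans a0 au.
    rewrite lee_fin /wgt lef_pV2 ?posrE ?exprn_gt0 ?cbrt_gt0 ?ltr_wpDl//.
    rewrite lerXn2r ?nnegrE ?cbrt_ge0 ?(ltW u0)//.
    rewrite -[leLHS](cbrt_exp3 (ltW u0)); apply: ler_cbrt.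
      by rewrite exprn_ge0// ltW.
    by rewrite ger0_norm ?exprn_ge0 ?(ltW u0)// lerDl ltW.
by rewrite (le_trans (leeD h1 h2))// -EFinD lee_fin; lra.
Qed.

End Weights.

(** * Product measure on R^3, product damping and its Fourier transform *)

Section Space.
Variable R : realType.
Local Notation mu := (@lebesgue_measure R).
Local Notation mR := (measurableTypeR R).
Local Notation T3 := (mR * mR * mR)%type.
Local Notation leb := (leb3 R).

Lemma leb3_tonelli (f : T3 -> \bar R) : measurable_fun setT f ->
  (forall p, (0 <= f p)%E) ->
  (\int[leb]_p f p = \int[mu]_x \int[mu]_y \int[mu]_z f (x, y, z))%E.
Proof.
move=> mf f0.
rewrite (@fubini_tonelli1 _ _ _ _ R (leb2 R) mu f)//.
rewrite (@fubini_tonelli1 _ _ _ _ R mu mu)//.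
- exact: measurable_fun_fubini_tonelli_F.
- by move=> x; apply: integral_ge0.
Qed.

Lemma measurable_c1 : measurable_fun setT (fun p : T3 => p.1.1).
Proof. by apply: measurableT_comp; exact: measurable_fst. Qed.

Lemma measurable_c2 : measurable_fun setT (fun p : T3 => p.1.2).
Proof. by apply: measurableT_comp; [exact: measurable_snd|exact: measurable_fst]. Qed.

Lemma measurable_c3 : measurable_fun setT (fun p : T3 => p.2).
Proof. exact: measurable_snd. Qed.

Lemma integral_leb3_prod (f1 f2 f3 : R -> R) :
  measurable_fun setT f1 -> measurable_fun setT f2 -> measurable_fun setT f3 ->
  (forall x, 0 <= f1 x) -> (forall x, 0 <= f2 x) -> (forall x, 0 <= f3 x) ->
  (\int[leb]_p (f1 p.1.1 * f2 p.1.2 * f3 p.2)%:E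
    = (\int[mu]_x (f1 x)%:E) * (\int[mu]_x (f2 x)%:E) * (\int[mu]_x (f3 x)%:E))%E.
Proof.
move=> m1 m2 m3 p1 p2 p3; rewrite leb3_tonelli; last 2 first.
- apply/measurable_EFinP; apply: measurable_funM; first apply: measurable_funM.
  + by apply: measurableT_comp; [exact: m1|exact: measurable_c1].
  + by apply: measurableT_comp; [exact: m2|exact: measurable_c2].
  + by apply: measurableT_comp; [exact: m3|exact: measurable_c3].
- by move=> p; rewrite lee_fin !mulr_ge0.
have e1 : measurable_fun setT (EFin \o f1) by exact/measurable_EFinP.
have e2 : measurable_fun setT (EFin \o f2) by exact/measurable_EFinP.
have e3 : measurable_fun setT (EFin \o f3) by exact/measurable_EFinP.
have i2 : (0 <= \int[mu]_x (f2 x)%:E)%E by apply: integral_ge0 => x _; rewrite lee_fin.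
have i3 : (0 <= \int[mu]_x (f3 x)%:E)%E by apply: integral_ge0 => x _; rewrite lee_fin.
have pull (f : R -> R) c : measurable_fun setT f -> (forall x, 0 <= f x) -> 0 <= c ->
    (\int[mu]_z (c * f z)%:E = c%:E * \int[mu]_z (f z)%:E)%E.
  move=> mf f0 c0; rewrite -ge0_integralZl_EFin//.
    by move=> z _; rewrite lee_fin.
  exact/measurable_EFinP.
have pulle (f : R -> R) (c : \bar R) : measurable_fun setT f -> (forall x, 0 <= f x) ->
    (0 <= c)%E -> (\int[mu]_z ((f z)%:E * c) = \int[mu]_z (f z)%:E * c)%E.
  move=> mf f0 c0; rewrite -ge0_integralZr//.
    exact/measurable_EFinP.
  by move=> z _; rewrite lee_fin.
rewrite -muleA -pulle//; last exact: mule_ge0.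
apply: eq_integral => x _; rewrite -pulle// -ge0_integralZl//; last 3 first.
- apply: emeasurable_funM; [exact: e2|exact: measurable_cst].
- by move=> y _; apply: mule_ge0; rewrite ?lee_fin.
- by rewrite lee_fin.
by apply: eq_integral => y _; rewrite /= pull ?mulr_ge0// EFinM muleA.
Qed.

Definition dot3 (p q : T3) : R := p.1.1 * q.1.1 + p.1.2 * q.1.2 + p.2 * q.2.

Definition damp (t q : T3) : R :=
  expR (- (t.1.1 * `|q.1.1|)) * expR (- (t.1.2 * `|q.1.2|)) * expR (- (t.2 * `|q.2|)).

(** The Fourier transform of [damp t] at [x - y], as [Rintegral_damp_cos] shows. *)
Definition kern (t x y : T3) : R :=
  pker t.1.1 (x.1.1 - y.1.1) * pker t.1.2 (x.1.2 - y.1.2) * pker t.2 (x.2 - y.2).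

Definition pos3 (t : T3) := [/\ 0 < t.1.1, 0 < t.1.2 & 0 < t.2].

Lemma damp_ge0 t q : 0 <= damp t q.
Proof. by rewrite !mulr_ge0 ?expR_ge0. Qed.

Lemma damp_le1 t q : pos3 t -> damp t q <= 1.
Proof.
have h (s x : R) : 0 < s -> expR (- (s * `|x|)) <= 1.
  by move=> s0; rewrite -expR0 ler_expR oppr_le0 mulr_ge0// ltW.
move=> [t1 t2 t3]; rewrite /damp.
apply: mulr_ile1; [by apply: mulr_ge0; exact: expR_ge0|exact: expR_ge0| |exact: h].
by apply: mulr_ile1; [exact: expR_ge0|exact: expR_ge0|exact: h|exact: h].
Qed.

Lemma measurable_expR_abs (s : R) (dd : measure_display) (T : measurableType dd) (f : T -> R) :
  measurable_fun setT f -> measurable_fun setT (fun x => expR (- (s * `|f x|))).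
Proof.
move=> mf; have h := continuous_measurable_fun (@continuous_expR_abs R s).
exact: (measurableT_comp h mf).
Qed.

Lemma measurable_damp t : measurable_fun setT (damp t).
Proof.
apply: measurable_funM; first apply: measurable_funM; apply: measurable_expR_abs.
- exact: measurable_c1.
- exact: measurable_c2.
- exact: measurable_c3.
Qed.

Lemma measurable_dot3 (dd : measure_display) (T : measurableType dd) (f g : T -> T3) :
  measurable_fun setT f -> measurable_fun setT g ->
  measurable_fun setT (fun x => dot3 (f x) (g x)).
Proof.
move=> mf mg; apply: measurable_funD; first apply: measurable_funD; apply: measurable_funM.
- exact: measurableT_comp measurable_c1 mf.
- exact: measurableT_comp measurable_c1 mg.
- exact: measurableT_comp measurable_c2 mf.
- exact: measurableT_comp measurable_c2 mg.
- exact: measurableT_comp measurable_c3 mf.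
- exact: measurableT_comp measurable_c3 mg.
Qed.

Lemma measurable_cos (dd : measure_display) (T : measurableType dd) (f : T -> R) :
  measurable_fun setT f -> measurable_fun setT (fun x => cos (f x)).
Proof.
move=> mf; have h := continuous_measurable_fun (@continuous_cos R).
exact: (measurableT_comp h mf).
Qed.

Lemma measurable_sin (dd : measure_display) (T : measurableType dd) (f : T -> R) :
  measurable_fun setT f -> measurable_fun setT (fun x => sin (f x)).
Proof.
move=> mf; have h := continuous_measurable_fun (@continuous_sin R).
exact: (measurableT_comp h mf).
Qed.

Lemma integral_damp t : pos3 t ->
  (\int[leb]_q (damp t q)%:E = (8 / (t.1.1 * t.1.2 * t.2))%:E)%E.
Proof.
move=> [t1 t2 t3].
have m (s : R) : measurable_fun setT (fun x : R => expR (- (s * `|x|))).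
  by apply: continuous_measurable_fun; exact: continuous_expR_abs.
rewrite (@integral_leb3_prod (fun x => expR (- (t.1.1 * `|x|)))
  (fun x => expR (- (t.1.2 * `|x|))) (fun x => expR (- (t.2 * `|x|))))//;
  try by move=> x; exact: expR_ge0.
rewrite !integral_expR_abs// -!EFinM; congr (_%:E); field.
by rewrite !gt_eqF.
Qed.

(** The variables are integrated out one after the other. Each integration leaves an integrand in
    the scope of [integral_expR_abs_mulcos], the phase of the outer variables being carried by its
    parameter [b]. *)
Lemma integral_damp_cos1 t x y : pos3 t ->
  (\int[leb]_q (damp t q * (1 + cos (dot3 x q - dot3 y q)))%:E
    = (8 / (t.1.1 * t.1.2 * t.2) + kern t x y)%:E)%E.
Proof.
move=> [t1 t2 t3].
rewrite leb3_tonelli; last 2 first.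
- apply/measurable_EFinP; apply: measurable_funM; first exact: measurable_damp.
  apply: measurable_funD => //; apply: measurable_cos; apply: measurable_funB.
    by apply: measurable_dot3 => //; exact: measurable_cst.
  by apply: measurable_dot3 => //; exact: measurable_cst.
- by move=> q; rewrite lee_fin mulr_ge0 ?damp_ge0 ?cos1_ge0.
have /andP[k20 k21] := pker_le (x.1.2 - y.1.2) t2.
have /andP[k30 k31] := pker_le (x.2 - y.2) t3.
transitivity (\int[mu]_a (1 * expR (- (t.1.1 * `|a|)) * (2 / t.1.2 * (2 / t.2) +
    pker t.1.2 (x.1.2 - y.1.2) * pker t.2 (x.2 - y.2) * cos ((x.1.1 - y.1.1) * a + 0)))%:E)%E.
  apply: eq_integral => a _.
  transitivity (\int[mu]_b (expR (- (t.1.1 * `|a|)) * expR (- (t.1.2 * `|b|)) * (2 / t.2 +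
    pker t.2 (x.2 - y.2) * cos ((x.1.2 - y.1.2) * b + (x.1.1 - y.1.1) * a)))%:E)%E.
    apply: eq_integral => b _.
    under eq_integral => c _.
      rewrite /damp/= (_ : dot3 x (a, b, c) - dot3 y (a, b, c) =
        (x.2 - y.2) * c + ((x.1.2 - y.1.2) * b + (x.1.1 - y.1.1) * a)); last first.
        by rewrite /dot3/=; ring.
      rewrite -[cos _]mul1r. over.
    rewrite integral_expR_abs_mulcos ?mulr_ge0 ?expR_ge0 ?ler01 ?lexx//.
    by congr (_%:E); rewrite !mulr1.
  rewrite integral_expR_abs_mulcos ?expR_ge0 ?k30//.
  by congr (_%:E); rewrite addr0 mul1r.
have hq : 0 <= pker t.1.2 (x.1.2 - y.1.2) * pker t.2 (x.2 - y.2) <= 2 / t.1.2 * (2 / t.2).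
  by rewrite mulr_ge0// ler_pM.
rewrite integral_expR_abs_mulcos//; congr (_%:E); rewrite cos0 /kern; field.
by rewrite !gt_eqF.
Qed.

Lemma integrable_damp t : pos3 t -> leb.-integrable setT (EFin \o damp t).
Proof.
move=> t0; apply/integrableP; split; first by apply/measurable_EFinP; exact: measurable_damp.
rewrite (_ : (fun _ => _) = (fun x => (damp t x)%:E)).
  by rewrite integral_damp// ltry.
by apply/funext => x /=; rewrite ger0_norm ?damp_ge0.
Qed.

(** The 1 added for positivity is subtracted again, which is legitimate because [damp t] is
    integrable. *)
Lemma Rintegral_damp_cos t x y : pos3 t ->
  \int[leb]_q (damp t q * cos (dot3 x q - dot3 y q)) = kern t x y.
Proof.
move=> t0; have i1 := integrable_damp t0.
have mc : measurable_fun setT (fun q : T3 => cos (dot3 x q - dot3 y q)).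
  apply: measurable_cos; apply: measurable_funB.
    by apply: measurable_dot3 => //; exact: measurable_cst.
  by apply: measurable_dot3 => //; exact: measurable_cst.
have i2 : leb.-integrable setT
   (EFin \o (fun q => damp t q * (1 + cos (dot3 x q - dot3 y q)))).
  apply/integrableP; split.
    apply/measurable_EFinP; apply: measurable_funM; first exact: measurable_damp.
    exact: measurable_funD.
  rewrite (_ : (fun _ => _) = (fun q => (damp t q * (1 + cos (dot3 x q - dot3 y q)))%:E)).
    by rewrite integral_damp_cos1// ltry.
  by apply/funext => q /=; rewrite ger0_norm ?mulr_ge0 ?damp_ge0 ?cos1_ge0.
rewrite (_ : (fun q => _) = (fun q => damp t q * (1 + cos (dot3 x q - dot3 y q))
    - damp t q)); last by apply/funext => q; ring.
rewrite RintegralB// /Rintegral integral_damp_cos1// integral_damp//=.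
by ring.
Qed.

End Space.

(** * Fubini's theorem for integrable factors and a bounded kernel *)

Section BoundedFubini.
Context (d1 d2 : measure_display) (T1 : measurableType d1) (T2 : measurableType d2) (R : realType).
Variables (m1 : {sigma_finite_measure set T1 -> \bar R})
  (m2 : {sigma_finite_measure set T2 -> \bar R}).

Lemma integrable_mul_bounded (d : measure_display) (T : measurableType d)
    (m : {measure set T -> \bar R}) (u b : T -> R) M :
  m.-integrable setT (EFin \o u) -> measurable_fun setT b -> (forall x, `|b x| <= M) ->
  m.-integrable setT (EFin \o (fun x => u x * b x)).
Proof.
move=> iu mb bM; have mu : measurable_fun setT u.
  by apply/measurable_EFinP; exact: measurable_int iu.
have M0 : 0 <= M by exact: le_trans (bM point).
have iM : m.-integrable setT (fun x => M%:E * (`|u x|)%:E)%E.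
  by apply: integrableZl => //; exact: integrable_abse iu.
apply: le_integrable iM => //.
- by apply/measurable_EFinP; exact: measurable_funM.
- move=> x _ /=; rewrite lee_fin normrM [leRHS]ger0_norm ?mulr_ge0//.
  by rewrite mulrC ler_wpM2r.
Qed.

Variables (a : T1 -> R) (u : T2 -> R) (b : T1 * T2 -> R) (M : R).
Hypothesis ia : m1.-integrable setT (EFin \o a).
Hypothesis iu : m2.-integrable setT (EFin \o u).
Hypothesis mb : measurable_fun setT b.
Hypothesis bM : forall p, `|b p| <= M.

Let f (p : T1 * T2) : \bar R := (a p.1 * (u p.2 * b p))%:E.

Let ma : measurable_fun setT a.
Proof. by apply/measurable_EFinP; exact: measurable_int ia. Qed.

Let mu_ : measurable_fun setT u.
Proof. by apply/measurable_EFinP; exact: measurable_int iu. Qed.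

Let mf : measurable_fun setT f.
Proof.
apply/measurable_EFinP; apply: measurable_funM.
  by apply: measurableT_comp => //; exact: measurable_fst.
apply: measurable_funM => //.
by apply: measurableT_comp => //; exact: measurable_snd.
Qed.

Let ib1 x : m2.-integrable setT (EFin \o (fun y => u y * b (x, y))).
Proof.
apply: (@integrable_mul_bounded _ _ m2 u (fun y => b (x, y)) M) => //.
exact: measurable_fun_pair2.
Qed.

Let ib2 y : m1.-integrable setT (EFin \o (fun x => a x * b (x, y))).
Proof.
apply: (@integrable_mul_bounded _ _ m1 a (fun x => b (x, y)) M) => //.
exact: measurable_fun_pair1.
Qed.

Lemma bounded_integrable_prod : (m1 \x m2)%E.-integrable setT f.
Proof.
have M0 : 0 <= M by exact: le_trans (bM (point, point)).
apply/integrable12ltyP => //.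
have /integrableP[_ Iu] := integrable_abse iu.
have /integrableP[_ Ia] := integrable_abse ia.
pose K := (\int[m2]_y `|u y|%:E)%E.
have K0 : (0 <= K)%E by apply: integral_ge0 => y _; rewrite lee_fin.
have Kf : K \is a fin_num.
  rewrite ge0_fin_numE// /K; move: Iu; rewrite [X in (X < _)%E](_ : _ = K)//.
  by apply: eq_integral => y _ /=; rewrite normr_id.
have mna : measurable_fun setT (fun x => `|a x|%:E).
  by apply/measurable_EFinP; exact: measurableT_comp.
have mnu : measurable_fun setT (fun y => `|u y|%:E).
  by apply/measurable_EFinP; exact: measurableT_comp.
have mnf : measurable_fun setT (abse \o f) by exact: measurableT_comp.
have le x : (\int[m2]_y `|f (x, y)| <= `|a x|%:E * (M%:E * K))%E.
  rewrite muleA -EFinM -ge0_integralZl_EFin ?mulr_ge0//.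
  apply: ge0_le_integral => //.
  - exact: (measurable_fun_pair2 x mnf).
  - exact: measurable_funeM.
  - move=> y _; rewrite /f/= lee_fin !normrM -mulrA ler_wpM2l//.
    by rewrite mulrC ler_wpM2r.
apply: (@le_lt_trans _ _ (\int[m1]_x (`|a x|%:E * (M%:E * K)))%E).
  apply: ge0_le_integral => //.
  - by move=> x _; apply: integral_ge0.
  - by apply: (measurable_fun_fubini_tonelli_F (abse \o f)) => //= p; exact: abse_ge0.
  - exact: emeasurable_funM.
rewrite ge0_integralZr ?mule_ge0 ?lee_fin//.
rewrite -[K]fineK// -EFinM -[X in (X * _)%E]fineK; last first.
  rewrite ge0_fin_numE; last by apply: integral_ge0 => y _; rewrite lee_fin.
  move: Ia; rewrite [X in (X < _)%E -> _](_ : _ = (\int[m1]_x `|a x|%:E)%E)//.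
  by apply: eq_integral => y _ /=; rewrite normr_id.
by rewrite -EFinM ltry.
Qed.

Lemma bounded_fubini :
  \int[m1]_x (a x * \int[m2]_y (u y * b (x, y))) =
  \int[m2]_y (u y * \int[m1]_x (a x * b (x, y))).
Proof.
have FE x : (\int[m2]_y f (x, y) = (a x * \int[m2]_y (u y * b (x, y)))%:E)%E.
  rewrite EFinM fineK; last exact: integrable_fin_num (ib1 x).
  by rewrite -integralZl//; exact: ib1.
have GE y : (\int[m1]_x f (x, y) = (u y * \int[m1]_x (a x * b (x, y)))%:E)%E.
  rewrite EFinM fineK; last exact: integrable_fin_num (ib2 y).
  rewrite -integralZl//; last exact: ib2.
  by apply: eq_integral => x _; rewrite -EFinM /f/= mulrCA.
rewrite [LHS]/Rintegral [RHS]/Rintegral; congr fine.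
transitivity (\int[m1]_x \int[m2]_y f (x, y))%E.
  by apply: eq_integral => x _; rewrite FE.
rewrite (Fubini bounded_integrable_prod).
by apply: eq_integral => y _; exact: GE.
Qed.

(** Supplies measurability of integral transforms in their parameter, up to an integrable factor [a]
    that [measurable_undamp] strips off afterwards. *)
Lemma measurable_bounded_fubini_F :
  measurable_fun setT (fun x => a x * \int[m2]_y (u y * b (x, y))).
Proof.
apply/measurable_EFinP.
have -> : EFin \o (fun x => a x * \int[m2]_y (u y * b (x, y))) = (fun x => \int[m2]_y f (x, y))%E.
  apply/funext => x /=.
  rewrite EFinM fineK; last exact: integrable_fin_num (ib1 x).
  by rewrite -integralZl//; exact: ib1.
exact: measurable_fubini_F bounded_integrable_prod.
Qed.

End BoundedFubini.

(** * Cosine and sine transforms of integrable functions *)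

Section Transforms.
Variable R : realType.
Local Notation mu := (@lebesgue_measure R).
Local Notation mR := (measurableTypeR R).
Local Notation T3 := (mR * mR * mR)%type.
Local Notation leb := (leb3 R).
Implicit Types (u v : T3 -> R) (t q x y : T3).

(** The complex transform is kept as two real functions: up to normalisation it is
    [Ct u - i St u]. *)
Definition Ct u q : R := \int[leb]_x (u x * cos (dot3 x q)).
Definition St u q : R := \int[leb]_x (u x * sin (dot3 x q)).

Lemma normr_cos_le1 (s : R) : `|cos s| <= 1.
Proof. by rewrite ler_norml cos_geN1 cos_le1. Qed.

Lemma normr_sin_le1 (s : R) : `|sin s| <= 1.
Proof. by rewrite ler_norml sin_geN1 sin_le1. Qed.

Lemma measurable_dotl q : measurable_fun setT (fun x : T3 => dot3 x q).
Proof. by apply: measurable_dot3; [exact: measurable_id|exact: measurable_cst]. Qed.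

Lemma integrable_mul_cos u q : leb.-integrable setT (EFin \o u) ->
  leb.-integrable setT (EFin \o (fun x => u x * cos (dot3 x q))).
Proof.
move=> iu; apply: (integrable_mul_bounded (M := 1)) => //.
  by apply: measurable_cos; exact: measurable_dotl.
by move=> x; exact: normr_cos_le1.
Qed.

Lemma integrable_mul_sin u q : leb.-integrable setT (EFin \o u) ->
  leb.-integrable setT (EFin \o (fun x => u x * sin (dot3 x q))).
Proof.
move=> iu; apply: (integrable_mul_bounded (M := 1)) => //.
  by apply: measurable_sin; exact: measurable_dotl.
by move=> x; exact: normr_sin_le1.
Qed.

Definition one3 : T3 := (1, 1, 1).

Lemma pos3_one3 : pos3 one3.
Proof. by split; exact: ltr01. Qed.

Lemma dampVK q : damp (- one3.1.1, - one3.1.2, - one3.2) q * damp one3 q = 1.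
Proof.
rewrite /damp /=; set a := `|_|; set b := `|q.1.2|; set c := `|q.2|.
rewrite mulrACA [X in X * _]mulrACA -!expRD !mulNr !opprK !mul1r !subrr.
by rewrite !addr0 expR0.
Qed.

(** The reciprocal of a damping factor is again [damp], with negative parameters, hence measurable;
    multiplying by it recovers [f]. *)
Lemma measurable_undamp (f : T3 -> R) :
  measurable_fun setT (fun q => damp one3 q * f q) -> measurable_fun setT f.
Proof.
move=> mf; rewrite [f](_ : _ = fun q =>
  damp (- one3.1.1, - one3.1.2, - one3.2) q * (damp one3 q * f q)); last first.
  by apply/funext => q; rewrite mulrA dampVK mul1r.
by apply: measurable_funM => //; exact: measurable_damp.
Qed.

Lemma measurable_swap_dot : measurable_fun setT (fun p : T3 * T3 => dot3 p.2 p.1).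
Proof. by apply: measurable_dot3; [exact: measurable_snd|exact: measurable_fst]. Qed.

Lemma measurable_Ct u : leb.-integrable setT (EFin \o u) -> measurable_fun setT (Ct u).
Proof.
move=> iu; apply: measurable_undamp.
apply: (@measurable_bounded_fubini_F _ _ _ _ R leb leb (damp one3) u
  (fun p => cos (dot3 p.2 p.1)) 1) => //.
- exact/integrable_damp/pos3_one3.
- by apply: measurable_cos; exact: measurable_swap_dot.
- by move=> p; exact: normr_cos_le1.
Qed.

Lemma measurable_St u : leb.-integrable setT (EFin \o u) -> measurable_fun setT (St u).
Proof.
move=> iu; apply: measurable_undamp.
apply: (@measurable_bounded_fubini_F _ _ _ _ R leb leb (damp one3) u
  (fun p => sin (dot3 p.2 p.1)) 1) => //.
- exact/integrable_damp/pos3_one3.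
- by apply: measurable_sin; exact: measurable_swap_dot.
- by move=> p; exact: normr_sin_le1.
Qed.

Definition nrm1 u : R := \int[leb]_x `|u x|.

Lemma Ct_le u q : leb.-integrable setT (EFin \o u) -> `|Ct u q| <= nrm1 u.
Proof.
move=> iu; have ic := integrable_mul_cos q iu.
apply: le_trans (le_normr_Rintegral measurableT ic) _.
apply: le_Rintegral => //; [exact: (integrable_norm ic)|exact: (integrable_norm iu)|].
by move=> x _; rewrite normrM ler_piMr// normr_cos_le1.
Qed.

Lemma St_le u q : leb.-integrable setT (EFin \o u) -> `|St u q| <= nrm1 u.
Proof.
move=> iu; have ic := integrable_mul_sin q iu.
apply: le_trans (le_normr_Rintegral measurableT ic) _.
apply: le_Rintegral => //; [exact: (integrable_norm ic)|exact: (integrable_norm iu)|].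
by move=> x _; rewrite normrM ler_piMr// normr_sin_le1.
Qed.

(** This takes the place of Plancherel's identity. The damping makes the frequency integral
    absolutely convergent, so Fubini and the addition formula for the cosine move it onto the
    transform of the damping, which is [kern t]. *)
Lemma transform_pairing t u v : pos3 t ->
  leb.-integrable setT (EFin \o u) -> leb.-integrable setT (EFin \o v) ->
  \int[leb]_q (damp t q * (Ct u q * Ct v q + St u q * St v q)) =
  \int[leb]_x (u x * \int[leb]_y (v y * kern t x y)).
Proof.
move=> t0 iu iv.
pose b (p : T3 * T3) := cos (dot3 p.1 p.2) * Ct v p.2 + sin (dot3 p.1 p.2) * St v p.2.
have bE x q : \int[leb]_y (v y * cos (dot3 x q - dot3 y q)) = b (x, q).
  rewrite /b/= /Ct /St.
  rewrite -RintegralZl//; last exact: integrable_mul_cos.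
  rewrite -RintegralZl//; last exact: integrable_mul_sin.
  rewrite -RintegralD//; last 2 first.
  - exact: (integrableZl measurableT _ (integrable_mul_cos q iv)).
  - exact: (integrableZl measurableT _ (integrable_mul_sin q iv)).
  by apply: eq_Rintegral => y _; rewrite cosB; ring.
have inner x : \int[leb]_y (v y * kern t x y) = \int[leb]_q (damp t q * b (x, q)).
  transitivity (\int[leb]_y (v y * \int[leb]_q (damp t q * cos (dot3 x q - dot3 y q)))).
    by apply: eq_Rintegral => y _; rewrite Rintegral_damp_cos.
  rewrite -(@bounded_fubini _ _ _ _ R leb leb (damp t) v
    (fun p => cos (dot3 x p.1 - dot3 p.2 p.1)) 1)//.
  - by apply: eq_Rintegral => q _; rewrite -bE.
  - exact: integrable_damp.
  - apply: measurable_cos; apply: measurable_funB; last exact: measurable_swap_dot.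
    by apply: measurable_dot3; [exact: measurable_cst|exact: measurable_fst].
  - by move=> p; exact: normr_cos_le1.
transitivity (\int[leb]_x (u x * \int[leb]_q (damp t q * b (x, q)))); last first.
  by apply: eq_Rintegral => x _; rewrite inner.
have md : measurable_fun setT (fun p : T3 * T3 => dot3 p.1 p.2).
  by apply: measurable_dot3; [exact: measurable_fst|exact: measurable_snd].
rewrite (@bounded_fubini _ _ _ _ R leb leb u (damp t) b (nrm1 v + nrm1 v))//.
- apply: eq_Rintegral => q _; congr (_ * _).
  rewrite /Ct /St -RintegralZr//; last exact: integrable_mul_cos.
  rewrite -RintegralZr//; last exact: integrable_mul_sin.
  rewrite -RintegralD//; last 2 first.
  - exact: (integrableZr measurableT _ (integrable_mul_cos q iu)).
  - exact: (integrableZr measurableT _ (integrable_mul_sin q iu)).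
  by apply: eq_Rintegral => y _; rewrite /b/= /Ct /St; ring.
- exact: integrable_damp.
- apply: measurable_funD; apply: measurable_funM.
  + exact: measurable_cos.
  + by apply: measurableT_comp; [exact: measurable_Ct|exact: measurable_snd].
  + exact: measurable_sin.
  + by apply: measurableT_comp; [exact: measurable_St|exact: measurable_snd].
- move=> p; rewrite /b (le_trans (ler_normD _ _))// lerD// normrM -[leRHS]mul1r;
    apply: ler_pM => //; rewrite ?normr_cos_le1 ?normr_sin_le1 ?Ct_le ?St_le//.
Qed.

End Transforms.

(** * Products of Poisson kernels as an approximate identity *)

Section Kernel.
Variable R : realType.
Local Notation mu := (@lebesgue_measure R).
Local Notation mR := (measurableTypeR R).
Local Notation T3 := (mR * mR * mR)%type.
Local Notation leb := (leb3 R).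
Implicit Types (u v : T3 -> R) (t q x y : T3).

Lemma continuous_pker (s z : R) : 0 < s -> {for z, continuous (pker s)}.
Proof.
move=> s0; apply: cvgM; first exact: cvg_cst.
apply: cvgV; first by rewrite gt_eqF// ltr_wpDr ?sqr_ge0 ?exprn_gt0.
by apply: cvgD; [exact: cvg_cst|exact: exprn_continuous].
Qed.

Lemma measurable_pker (s : R) (dd : measure_display) (T : measurableType dd) (f : T -> R) :
  0 < s -> measurable_fun setT f -> measurable_fun setT (fun p => pker s (f p)).
Proof.
move=> s0 mf; have h : measurable_fun setT (pker s).
  by apply: continuous_measurable_fun => z; exact: continuous_pker.
exact: (measurableT_comp h mf).
Qed.

Lemma measurable_kern (dd : measure_display) (T : measurableType dd) t (f g : T -> T3) :
  pos3 t -> measurable_fun setT f -> measurable_fun setT g ->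
  measurable_fun setT (fun p => kern t (f p) (g p)).
Proof.
move=> [t1 t2 t3] mf mg; apply: measurable_funM; first apply: measurable_funM;
  apply: measurable_pker => //; apply: measurable_funB.
- exact: measurableT_comp (@measurable_c1 R) mf.
- exact: measurableT_comp (@measurable_c1 R) mg.
- exact: measurableT_comp (@measurable_c2 R) mf.
- exact: measurableT_comp (@measurable_c2 R) mg.
- exact: measurableT_comp (@measurable_c3 R) mf.
- exact: measurableT_comp (@measurable_c3 R) mg.
Qed.

Lemma measurable_kernr t x : pos3 t -> measurable_fun setT (kern t x).
Proof. by move=> t0; apply: measurable_kern. Qed.

Lemma pker_ge0 (s z : R) : 0 < s -> 0 <= pker s z.
Proof. by move=> s0; have /andP[] := pker_le z s0. Qed.

Lemma kern_ge0 t x y : pos3 t -> 0 <= kern t x y.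
Proof. 
move=> [t1 t2 t3]; rewrite /kern; apply: mulr_ge0; last exact: pker_ge0.
by apply: mulr_ge0; exact: pker_ge0. Qed.

Lemma kern_le t x y : pos3 t -> kern t x y <= 2 / t.1.1 * (2 / t.1.2) * (2 / t.2).
Proof.
have le s z : 0 < s -> pker s z <= 2 / s by move=> s0; have /andP[_] := pker_le z s0.
move=> [t1 t2 t3]; rewrite /kern; apply: ler_pM; [|exact: pker_ge0| |exact: le].
  by apply: mulr_ge0; exact: pker_ge0.
by apply: ler_pM; [exact: pker_ge0|exact: pker_ge0|exact: le|exact: le].
Qed.

Lemma pker_subC (s a b : R) : pker s (a - b) = pker s (b - a).
Proof. by rewrite /pker -opprB sqrrN. Qed.

Lemma kern_sym t x y : kern t x y = kern t y x.
Proof. by rewrite /kern (pker_subC _ x.1.1) (pker_subC _ x.1.2) (pker_subC _ x.2). Qed.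

Lemma integral_pker (s x : R) : 0 < s -> (\int[mu]_y (pker s (x - y))%:E = (2 * pi)%:E)%E.
Proof.
move=> s0; rewrite EFinM -(integral_poisson x s0) -ge0_integralZl_EFin//.
- by apply: eq_integral => y _; rewrite -EFinM /pker mulrA.
- by move=> y _; rewrite lee_fin divr_ge0 ?addr_ge0 ?sqr_ge0 ?ltW.
- apply/measurable_EFinP.
  rewrite (_ : (fun y : R => _) = (fun y : R => 2^-1 * pker s (x - y))); last first.
    by apply/funext => y; rewrite /pker !mulrA mulVf ?mul1r ?pnatr_eq0.
  by apply: measurable_funM => //; apply: measurable_pker => //; exact: measurable_funB.
Qed.

Definition cpi : R := 2 * pi.

Lemma integral_prod_pker (a b c : R) x : 0 < a -> 0 < b -> 0 < c ->
  (\int[leb]_y (pker a (x.1.1 - y.1.1) * pker b (x.1.2 - y.1.2) * pker c (x.2 - y.2))%:E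
    = (cpi ^+ 3)%:E)%E.
Proof.
move=> a0 b0 c0.
rewrite (@integral_leb3_prod R (fun y : R => pker a (x.1.1 - y))
  (fun y : R => pker b (x.1.2 - y)) (fun y : R => pker c (x.2 - y))).
- by rewrite !integral_pker// -!EFinM; congr (_%:E); rewrite /cpi; ring.
- by apply: measurable_pker => //; exact: measurable_funB.
- by apply: measurable_pker => //; exact: measurable_funB.
- by apply: measurable_pker => //; exact: measurable_funB.
- by move=> y; exact: pker_ge0.
- by move=> y; exact: pker_ge0.
- by move=> y; exact: pker_ge0.
Qed.

Lemma integral_kern t x : pos3 t -> (\int[leb]_y (kern t x y)%:E = (cpi ^+ 3)%:E)%E.
Proof. by move=> [t1 t2 t3]; exact: integral_prod_pker. Qed.

Lemma integrable_kern t x : pos3 t -> leb.-integrable setT (EFin \o kern t x).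
Proof.
move=> t0; apply/integrableP; split.
  by apply/measurable_EFinP; exact: measurable_kernr.
rewrite (_ : (fun _ => _) = (fun y => (kern t x y)%:E)).
  by rewrite integral_kern// ltry.
by apply/funext => y /=; rewrite ger0_norm ?kern_ge0.
Qed.

Lemma Rintegral_kern t x : pos3 t -> \int[leb]_y kern t x y = cpi ^+ 3.
Proof. by move=> t0; rewrite /Rintegral integral_kern. Qed.

(** Away from 0 the kernel of small height is dominated by the kernel of height 1 with a factor
    proportional to [s]: an integrable majorant whose mass vanishes with [s]. *)
Lemma pker_far (s z d : R) : 0 < s -> 0 < d -> d <= `|z| ->
  pker s z <= s * (1 + d ^- 2) * pker 1 z.
Proof.
move=> s0 d0 dz; have z0 : 0 < `|z| by exact: lt_le_trans dz.
have dz2 : d ^+ 2 <= z ^+ 2.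
  by rewrite -[leRHS]real_normK ?num_real// lerXn2r ?nnegrE ?(ltW d0) ?(ltW z0).
have z2 : 1 <= d ^- 2 * z ^+ 2.
  by rewrite mulrC ler_pdivlMr ?exprn_gt0// mul1r.
have D0 : 0 < 1 ^+ 2 + z ^+ 2 by rewrite ltr_wpDr ?sqr_ge0 ?exprn_gt0.
rewrite /pker ler_pdivrMr ?ltr_wpDr ?sqr_ge0 ?exprn_gt0//.
have -> : s * (1 + d ^- 2) * (2 * 1 / (1 ^+ 2 + z ^+ 2)) * (s ^+ 2 + z ^+ 2) =
  2 * s * ((1 + d ^- 2) * (s ^+ 2 + z ^+ 2) / (1 ^+ 2 + z ^+ 2)) by ring.
rewrite -[leLHS]mulr1 ler_pM2l ?mulr_gt0// ler_pdivlMr// mul1r expr1n.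
have v0 : 0 <= d ^- 2 by rewrite invr_ge0 sqr_ge0.
have := sqr_ge0 s; nra.
Qed.

Definition diag3 (s : R) : T3 := (s, s, s).

Lemma pos3_diag s : 0 < s -> pos3 (diag3 s). Proof. by []. Qed.

(** The kernel has mass [cpi ^+ 3]. If all coordinates of [y] are within [d] of those of [x], the
    oscillation of [v] is at most [eta]; otherwise some coordinate is far and [pker_far] applies to
    its factor. Three coordinates and an oscillation of at most [2 * M] account for [6 * M]. *)
Lemma approx_identity_bound v x (M eta d s : R) :
  0 < s -> 0 < d -> 0 <= eta -> measurable_fun setT v -> (forall y, `|v y| <= M) ->
  (forall y, `|x.1.1 - y.1.1| < d -> `|x.1.2 - y.1.2| < d -> `|x.2 - y.2| < d ->
     `|v y - v x| <= eta) ->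
  `|\int[leb]_y (v y * kern (diag3 s) x y) - cpi ^+ 3 * v x| <=
    cpi ^+ 3 * (eta + 6 * M * (s * (1 + d ^- 2))).
Proof.
move=> s0 d0 eta0 mv vM vc.
have t0 := pos3_diag s0.
have M0 : 0 <= M by exact: le_trans (vM x).
have ik := integrable_kern x t0.
have mk := measurable_kernr x t0.
have k0 y := kern_ge0 x y t0.
have vM2 y : `|v y - v x| <= 2 * M.
  by rewrite (le_trans (ler_normB _ _))// mulrDl mul1r lerD.
have mvx : measurable_fun setT (fun y => v y - v x) by exact: measurable_funB.
have i1 : leb.-integrable setT (EFin \o (fun y => kern (diag3 s) x y * (v y - v x))).
  exact: integrable_mul_bounded ik mvx vM2.
have i2 : leb.-integrable setT (EFin \o (fun y => kern (diag3 s) x y * v y)).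
  exact: integrable_mul_bounded ik mv vM.
have -> : \int[leb]_y (v y * kern (diag3 s) x y) - cpi ^+ 3 * v x =
    \int[leb]_y (kern (diag3 s) x y * (v y - v x)).
  have -> : cpi ^+ 3 = \int[leb]_y (kern (diag3 s) x y).
    by rewrite /Rintegral integral_kern.
  rewrite -RintegralZr// -RintegralB//; last first.
    exact: (integrableZr measurableT _ ik).
    by under eq_fun do rewrite mulrC.
  by apply: eq_Rintegral => y _; ring.
apply: le_trans (le_normr_Rintegral measurableT i1) _.
pose c := s * (1 + d ^- 2).
have c0 : 0 <= c by rewrite mulr_ge0 ?(ltW s0)// addr_ge0// invr_ge0 sqr_ge0.
pose k a b e := kern (a, b, e) x.
have p1 z : 0 <= pker 1 z := pker_ge0 z ltr01.
have ps z : 0 <= pker s z by exact: pker_ge0.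
have ka y : `|kern (diag3 s) x y * (v y - v x)| <=
    eta * k s s s y + 2 * M * c * k 1 s s y + 2 * M * c * k s 1 s y + 2 * M * c * k s s 1 y.
  rewrite normrM (ger0_norm (k0 y)) -/(k s s s y).
  have K0 : 0 <= k s s s y by exact: k0.
  have C0 : 0 <= 2 * M * c by do 2![apply: mulr_ge0 => //].
  have kk a b e : 0 < a -> 0 < b -> 0 < e -> 0 <= 2 * M * c * k a b e y.
    by move=> a0 b0 e0; apply: mulr_ge0 => //; apply: kern_ge0; split.
  have h1 := kk _ _ _ ltr01 s0 s0; have h2 := kk _ _ _ s0 ltr01 s0.
  have h3 := kk _ _ _ s0 s0 ltr01.
  have h0 : 0 <= eta * k s s s y by rewrite mulr_ge0.
  (* [a] and [b] stand for the far factor at heights [s] and 1, while [f] and [e] are the two other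
     factors, left untouched. *)
  have far (a b e f : R) : 0 <= a -> 0 <= b -> a <= c * b -> 0 <= f -> 0 <= e ->
      `|v y - v x| * (a * f * e) <= 2 * M * c * (b * f * e).
    move=> a0 b0 ab f0 e0; rewrite -[leRHS]mulrA; apply: ler_pM => //.
      by do 2![apply: mulr_ge0 => //].
    by rewrite !mulrA ler_wpM2r// ler_wpM2r.
  have [l1|l1] := ltP `|x.1.1 - y.1.1| d; last first.
    have := far _ _ _ _ (ps (x.1.1 - y.1.1)) (p1 (x.1.1 - y.1.1)) (pker_far s0 d0 l1)
      (ps (x.1.2 - y.1.2)) (ps (x.2 - y.2)).
    rewrite -[pker s _ * _ * _]/(k s s s y) -[pker 1 _ * _ * _]/(k 1 s s y); lra.
  have [l2|l2] := ltP `|x.1.2 - y.1.2| d; last first.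
    have := far _ _ _ _ (ps (x.1.2 - y.1.2)) (p1 (x.1.2 - y.1.2)) (pker_far s0 d0 l2)
      (ps (x.1.1 - y.1.1)) (ps (x.2 - y.2)).
    have -> : pker s (x.1.2 - y.1.2) * pker s (x.1.1 - y.1.1) * pker s (x.2 - y.2) = k s s s y.
      by rewrite /k /kern/=; ring.
    have -> : pker 1 (x.1.2 - y.1.2) * pker s (x.1.1 - y.1.1) * pker s (x.2 - y.2) = k s 1 s y.
      by rewrite /k /kern/=; ring.
    lra.
  have [l3|l3] := ltP `|x.2 - y.2| d; last first.
    have := far _ _ _ _ (ps (x.2 - y.2)) (p1 (x.2 - y.2)) (pker_far s0 d0 l3)
      (ps (x.1.2 - y.1.2)) (ps (x.1.1 - y.1.1)).
    have -> : pker s (x.2 - y.2) * pker s (x.1.2 - y.1.2) * pker s (x.1.1 - y.1.1) = k s s s y.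
      by rewrite /k /kern/=; ring.
    have -> : pker 1 (x.2 - y.2) * pker s (x.1.2 - y.1.2) * pker s (x.1.1 - y.1.1) = k s s 1 y.
      by rewrite /k /kern/=; ring.
    lra.
  have hh : k s s s y * `|v y - v x| <= eta * k s s s y.
    by rewrite mulrC ler_wpM2r// vc.
  lra.
have ip a b e K : 0 < a -> 0 < b -> 0 < e ->
    leb.-integrable setT (EFin \o (fun y => K * k a b e y)).
  move=> a0 b0 e0; have ab : pos3 (a, b, e) by split.
  exact: (integrableZl measurableT K (integrable_kern x ab)).
have iD (f g : T3 -> R) : leb.-integrable setT (EFin \o f) ->
    leb.-integrable setT (EFin \o g) -> leb.-integrable setT (EFin \o (fun y => f y + g y)).
  by move=> hf hg; exact: (integrableD measurableT hf hg).
have I1 := ip s s s eta s0 s0 s0; have I2 := ip 1 s s (2 * M * c) ltr01 s0 s0.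
have I3 := ip s 1 s (2 * M * c) s0 ltr01 s0; have I4 := ip s s 1 (2 * M * c) s0 s0 ltr01.
have I12 := iD _ _ I1 I2; have I123 := iD _ _ I12 I3; have I1234 := iD _ _ I123 I4.
apply: le_trans (le_Rintegral measurableT (integrable_norm i1) I1234 (fun y _ => ka y)) _.
have Rk a b e K : 0 < a -> 0 < b -> 0 < e ->
    \int[leb]_y (K * k a b e y) = K * cpi ^+ 3.
  move=> a0 b0 e0; have ab : pos3 (a, b, e) by split.
  by rewrite RintegralZl ?Rintegral_kern//; exact: integrable_kern.
rewrite RintegralD// RintegralD// RintegralD// !Rk//.
by rewrite le_eqVlt; apply/orP; left; apply/eqP; rewrite -/c; ring.
Qed.

End Kernel.

(** * Removal of the damping in the limit of small heights *)

Section Parseval.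
Variable R : realType.
Local Notation mu := (@lebesgue_measure R).
Local Notation mR := (measurableTypeR R).
Local Notation T3 := (mR * mR * mR)%type.
Local Notation leb := (leb3 R).
Implicit Types (u v : T3 -> R) (t q x y : T3).

(** Continuity expressed through coordinate boxes, matching the coordinatewise separation of near
    and far points in [approx_identity_bound]. *)
Definition cont3 v := forall x eta, 0 < eta -> exists2 d, 0 < d &
  forall y, `|x.1.1 - y.1.1| < d -> `|x.1.2 - y.1.2| < d -> `|x.2 - y.2| < d ->
     `|v y - v x| <= eta.

Lemma cpi_gt0 : 0 < cpi R.
Proof. by rewrite mulr_gt0 ?pi_gt0. Qed.

(** Dominated convergence along the heights [1 / (n + 1)]: the inner integrals converge pointwise by
    the approximate identity and stay below [M] times the mass of the kernel, so a multiple of [|u|]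
    is a majorant. *)
Lemma parseval_limit u v (M : R) : leb.-integrable setT (EFin \o u) ->
  leb.-integrable setT (EFin \o v) -> (forall y, `|v y| <= M) -> cont3 v ->
  (fun n => \int[leb]_x (u x * \int[leb]_y (v y * kern (diag3 n.+1%:R^-1) x y))) @ \oo
    --> cpi R ^+ 3 * \int[leb]_x (u x * v x).
Proof.
move=> iu iv vM cv.
have s0 n : 0 < n.+1%:R^-1 :> R by rewrite invr_gt0 ltr0n.
have mv : measurable_fun setT v by apply/measurable_EFinP; exact: measurable_int iv.
have mu_ : measurable_fun setT u by apply/measurable_EFinP; exact: measurable_int iu.
have M0 : 0 <= M by exact: le_trans (vM point).
have c0 := ltW (exprn_gt0 3 cpi_gt0).
pose w n x := \int[leb]_y (v y * kern (diag3 n.+1%:R^-1) x y).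
have wM n x : `|w n x| <= M * cpi R ^+ 3.
  have ik := integrable_kern x (pos3_diag (s0 n)).
  have ivk : leb.-integrable setT (EFin \o (fun y => v y * kern (diag3 n.+1%:R^-1) x y)).
    by have := integrable_mul_bounded ik mv vM; under eq_fun do rewrite mulrC.
  apply: le_trans (le_normr_Rintegral measurableT ivk) _.
  rewrite -(Rintegral_kern x (pos3_diag (s0 n))) -RintegralZl//.
  apply: le_Rintegral => //.
  - exact: integrable_norm.
  - exact: (integrableZl measurableT M ik).
  - move=> y _; rewrite normrM (ger0_norm (kern_ge0 _ _ (pos3_diag (s0 n)))).
    by rewrite ler_wpM2r// kern_ge0//; exact: pos3_diag.
have mw n : measurable_fun setT (fun x => u x * w n x).
  apply: (@measurable_bounded_fubini_F _ _ _ _ R leb leb u v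
    (fun p => kern (diag3 n.+1%:R^-1) p.1 p.2)
    (2 / n.+1%:R^-1 * (2 / n.+1%:R^-1) * (2 / n.+1%:R^-1))) => //.
  - by apply: measurable_kern; [exact: pos3_diag|exact: measurable_fst|exact: measurable_snd].
  - move=> p; rewrite ger0_norm ?kern_ge0//; [|exact: pos3_diag..].
    exact: (kern_le p.1 p.2 (pos3_diag (s0 n))).
have wl x : w n x @[n --> \oo] --> cpi R ^+ 3 * v x.
  apply/cvgrPdist_le => e e0.
  (* The tolerance is split evenly: the modulus of continuity takes [e / 2] after multiplication by
     the mass, and the far term [K / (n + 1)] takes the rest. *)
  have [d d0 vd] := cv x (e / (2 * cpi R ^+ 3)) (divr_gt0 e0 (mulr_gt0 (ltr0n _ 2) (exprn_gt0 3 cpi_gt0))).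
  pose K := 6 * M * (1 + d ^- 2) * cpi R ^+ 3.
  have e2 : 0 < e / 2 by rewrite divr_gt0.
  have /cvgrPdist_le/(_ _ e2) hK : K * @harmonic R n @[n --> \oo] --> K * 0.
    by apply: cvgM; [exact: cvg_cst|exact: cvg_harmonic].
  near=> n; rewrite distrC.
  have h := approx_identity_bound (s0 n) d0 (ltW (divr_gt0 e0 (mulr_gt0 (ltr0n _ 2) (exprn_gt0 3 cpi_gt0)))) mv vM vd.
  apply: le_trans h _.
  have -> : cpi R ^+ 3 * (e / (2 * cpi R ^+ 3) + 6 * M * (n.+1%:R^-1 * (1 + d ^- 2)))
     = e / 2 + K / n.+1%:R.
    have -> : cpi R ^+ 3 * (e / (2 * cpi R ^+ 3) + 6 * M * (n.+1%:R^-1 * (1 + d ^- 2))) =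
      cpi R ^+ 3 / cpi R ^+ 3 * (e / 2) + K / n.+1%:R by rewrite /K invfM; ring.
    by rewrite divff ?mul1r// gt_eqF// exprn_gt0// cpi_gt0.
  have : `|K * 0 - K * @harmonic R n| <= e / 2 by near: n.
  rewrite mulr0 sub0r normrN => hn.
  have := le_trans (ler_norm _) hn; rewrite /harmonic/=. move: (K / _) => z; lra.
pose f_ n := EFin \o (fun x => u x * w n x).
have mK : leb.-integrable setT (fun x => ((M * cpi R ^+ 3)%:E * `|(u x)%:E|)%E).
  by apply: integrableZl => //; exact: integrable_abse iu.
have [|||hi _ h] := @dominated_convergence _ _ R leb setT measurableT f_
   (EFin \o (fun x => cpi R ^+ 3 * (u x * v x)))
   (fun x => ((M * cpi R ^+ 3)%:E * `|(u x)%:E|)%E)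
   (fun n => (measurable_EFinP _ _).2 (mw n)) _ _ mK _.
- apply/measurable_EFinP; apply: measurable_funM => //; exact: measurable_funM.
- apply: aeW => x _; apply: cvg_EFin.
    by apply: nearW.
  rewrite /= mulrCA; apply: cvgM; [exact: cvg_cst|exact: wl].
- apply: aeW => x n _; rewrite /f_ /= lee_fin normrM mulrC ler_wpM2r//.
rewrite -RintegralZl//; last exact: integrable_mul_bounded iu mv vM.
by apply: fine_cvg; rewrite fineK; [exact: h|exact: integrable_fin_num hi].
Unshelve. all: by end_near. Qed.

End Parseval.

(** * Schur's test for the damped quadratic form *)

Section Schur.
Variable R : realType.
Local Notation mu := (@lebesgue_measure R).
Local Notation mR := (measurableTypeR R).
Local Notation T3 := (mR * mR * mR)%type.
Local Notation leb := (leb3 R).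
Implicit Types (u v w phi : T3 -> R) (t q x y : T3).

Lemma tonelli (dx dy : measure_display) (X : measurableType dx) (Y : measurableType dy)
    (mx : {sigma_finite_measure set X -> \bar R}) (my : {sigma_finite_measure set Y -> \bar R})
    (f : X -> Y -> R) : measurable_fun setT (fun p => f p.1 p.2) ->
  (forall a b, 0 <= f a b) ->
  (\int[mx]_a \int[my]_b (f a b)%:E = \int[my]_b \int[mx]_a (f a b)%:E)%E.
Proof.
move=> mf f0.
have := @fubini_tonelli _ _ _ _ R mx my (fun p => (f p.1 p.2)%:E).
by apply=> //; [exact/measurable_EFinP|move=> p; rewrite lee_fin].
Qed.

Lemma measurable_tonelli (dx dy : measure_display) (X : measurableType dx) (Y : measurableType dy)
    (my : {sigma_finite_measure set Y -> \bar R})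
    (f : X -> Y -> R) : measurable_fun setT (fun p => f p.1 p.2) ->
  (forall a b, 0 <= f a b) -> measurable_fun setT (fun a => \int[my]_b (f a b)%:E)%E.
Proof.
move=> mf f0.
apply: (measurable_fun_fubini_tonelli_F (fun p : X * Y => (f p.1 p.2)%:E)).
  exact/measurable_EFinP.
by move=> p; rewrite lee_fin.
Qed.

(** By the arithmetic-geometric inequality the product is at most half the sum of
    [phi x ^+ 2 * w y / w x] and its mirror image. As the kernel is symmetric, both halves integrate
    to the same value. *)
Lemma schur_test t phi w : pos3 t -> measurable_fun setT phi -> measurable_fun setT w ->
  (forall x, 0 < w x) ->
  (\int[leb]_x \int[leb]_y (`|phi x| * `|phi y| * kern t x y)%:E <=
   \int[leb]_x \int[leb]_y (phi x ^+ 2 / w x * (kern t x y * w y))%:E)%E.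
Proof.
move=> t0 mphi mw w0.
pose F x y := phi x ^+ 2 / w x * (kern t x y * w y).
have F0 x y : 0 <= F x y.
  apply: mulr_ge0; first by rewrite divr_ge0 ?sqr_ge0 ?ltW.
  by rewrite mulr_ge0 ?kern_ge0 ?ltW.
have mk : measurable_fun setT (fun p : T3 * T3 => kern t p.1 p.2).
  by apply: measurable_kern; [|exact: measurable_fst|exact: measurable_snd].
have mwV : measurable_fun setT (fun x => (w x)^-1).
  have -> : (fun x => (w x)^-1) = (fun x => powR (w x) (-1)).
    by apply/funext => x; rewrite powR_inv1 ?ltW.
  exact: (measurableT_comp (@measurable_powR R (-1)) mw).
have m1 (f : T3 -> R) : measurable_fun setT f -> measurable_fun setT (fun p : T3 * T3 => f p.1).
  by move=> mf; exact: measurableT_comp mf measurable_fst.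
have m2 (f : T3 -> R) : measurable_fun setT f -> measurable_fun setT (fun p : T3 * T3 => f p.2).
  by move=> mf; exact: measurableT_comp mf measurable_snd.
have mF : measurable_fun setT (fun p : T3 * T3 => F p.1 p.2).
  apply: measurable_funM; apply: measurable_funM => //.
  - by apply: measurable_funX; exact: (m1 phi).
  - exact: (m1 (fun x => (w x)^-1)).
  - exact: (m2 w).
have mF' : measurable_fun setT (fun p : T3 * T3 => F p.2 p.1).
  exact: (measurableT_comp mF (@measurable_swap _ _ T3 T3)).
have half x y : `|phi x| * `|phi y| * kern t x y <= 2^-1 * F x y + 2^-1 * F y x.
  rewrite /F (kern_sym t y x); have wx := w0 x; have wy := w0 y.
  have -> : 2^-1 * (phi x ^+ 2 / w x * (kern t x y * w y)) + 2^-1 * (phi y ^+ 2 / w y * (kern t x y * w x))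
    = (2^-1 * (phi x ^+ 2 * (w y / w x) + phi y ^+ 2 * (w x / w y))) * kern t x y by ring.
  apply: ler_wpM2r; first exact: kern_ge0.
  rewrite -[phi x ^+ 2]real_normK ?num_real// -[phi y ^+ 2]real_normK ?num_real//.
  have r0 : 0 < w y / w x by rewrite divr_gt0.
  have -> : w x / w y = (w y / w x)^-1 by rewrite invf_div.
  move: (w y / w x) r0 => r r0.
  have := sqr_ge0 (`|phi x| * r - `|phi y|).
  move: `|phi x| `|phi y| => a b h.
  rewrite -subr_ge0.
  have -> : 2^-1 * (a ^+ 2 * r + b ^+ 2 / r) - a * b = (a * r - b) ^+ 2 / (2 * r).
    by field; rewrite gt_eqF.
  by rewrite divr_ge0// mulr_ge0// ltW.
have E1 : (\int[(leb \x leb)%E]_p (F p.1 p.2)%:E = \int[leb]_x \int[leb]_y (F x y)%:E)%E.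
  rewrite (@fubini_tonelli1 _ _ _ _ R leb leb (fun p => (F p.1 p.2)%:E))//.
    exact/measurable_EFinP.
  by move=> p; rewrite lee_fin.
have E2 : (\int[(leb \x leb)%E]_p (F p.2 p.1)%:E = \int[leb]_x \int[leb]_y (F x y)%:E)%E.
  rewrite (@fubini_tonelli2 _ _ _ _ R leb leb (fun p => (F p.2 p.1)%:E))//.
    exact/measurable_EFinP.
  by move=> p; rewrite lee_fin.
have mG : measurable_fun setT (fun p : T3 * T3 => `|phi p.1| * `|phi p.2| * kern t p.1 p.2).
  apply: measurable_funM => //; apply: measurable_funM; apply: measurableT_comp => //; [exact: m1|exact: m2].
have G0 x y : 0 <= `|phi x| * `|phi y| * kern t x y.
  by apply: mulr_ge0; [exact: mulr_ge0|exact: kern_ge0].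
have E3 : (\int[leb]_x \int[leb]_y (`|phi x| * `|phi y| * kern t x y)%:E =
  \int[(leb \x leb)%E]_p (`|phi p.1| * `|phi p.2| * kern t p.1 p.2)%:E)%E.
  rewrite (@fubini_tonelli1 _ _ _ _ R leb leb (fun p => (`|phi p.1| * `|phi p.2| * kern t p.1 p.2)%:E))//.
    exact/measurable_EFinP.
  by move=> p; rewrite lee_fin; exact: G0.
have h2 : 0 <= 2^-1 :> R by rewrite invr_ge0.
have mE (G : T3 * T3 -> R) : measurable_fun setT G -> measurable_fun setT (EFin \o G).
  by move=> ?; exact/measurable_EFinP.
apply: (@le_trans _ _ (\int[(leb \x leb)%E]_p (`|phi p.1| * `|phi p.2| * kern t p.1 p.2)%:E)%E).
  by rewrite le_eqVlt; apply/orP; left; apply/eqP; exact: E3.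
apply: (@le_trans _ _ (\int[(leb \x leb)%E]_p
   ((2^-1)%:E * (F p.1 p.2)%:E + (2^-1)%:E * (F p.2 p.1)%:E))%E).
  apply: ge0_le_integral => //.
  - by move=> p _; rewrite lee_fin; exact: G0.
  - exact: mE.
  - by apply: emeasurable_funD; apply: measurable_funeM; exact: mE.
  - by move=> p _; rewrite -!EFinM -EFinD lee_fin; exact: half.
rewrite ge0_integralD//=; last 4 first.
- by move=> p _; rewrite -EFinM lee_fin; apply: mulr_ge0.
- by apply: measurable_funeM; exact: mE.
- by move=> p _; rewrite -EFinM lee_fin; apply: mulr_ge0.
- by apply: measurable_funeM; exact: mE.
rewrite !ge0_integralZl_EFin//=; try exact: mE.
rewrite E1 E2 -ge0_muleDl ?lee_fin// -EFinD.
have -> : 2^-1 + 2^-1 = 1 :> R by lra.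
- by rewrite mul1e.
- by move=> p _; rewrite lee_fin.
- by move=> p _; rewrite lee_fin.
Qed.

(** With [u = v = phi], the pairing identity turns the damped energy into a quadratic form with
    nonnegative kernel; absolute values are then taken inside and Schur's test applies. *)
Lemma damp_transform_le t phi w : pos3 t -> leb.-integrable setT (EFin \o phi) ->
  measurable_fun setT w -> (forall x, 0 < w x) ->
  (\int[leb]_q (damp t q * (Ct phi q ^+ 2 + St phi q ^+ 2))%:E <=
   \int[leb]_x \int[leb]_y (phi x ^+ 2 / w x * (kern t x y * w y))%:E)%E.
Proof.
move=> t0 iphi mw w0.
have mphi : measurable_fun setT phi by apply/measurable_EFinP; exact: measurable_int iphi.
apply: le_trans (schur_test t0 mphi mw w0).
have mCS : measurable_fun setT (fun q => Ct phi q ^+ 2 + St phi q ^+ 2).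
  by apply: measurable_funD; apply: measurable_funX; [exact: measurable_Ct|exact: measurable_St].
have bCS q : `|Ct phi q ^+ 2 + St phi q ^+ 2| <= nrm1 phi ^+ 2 + nrm1 phi ^+ 2.
  rewrite (le_trans (ler_normD _ _))// !normrX lerD// lerXn2r ?nnegrE//.
  - exact: le_trans (Ct_le q iphi).
  - exact: Ct_le.
  - exact: le_trans (Ct_le q iphi).
  - exact: St_le.
have iL := integrable_mul_bounded (integrable_damp t0) mCS bCS.
have mk : measurable_fun setT (fun p : T3 * T3 => kern t p.1 p.2).
  by apply: measurable_kern; [|exact: measurable_fst|exact: measurable_snd].
pose K := 2 / t.1.1 * (2 / t.1.2) * (2 / t.2).
have kK (p : T3 * T3) : `|kern t p.1 p.2| <= K.
  by rewrite ger0_norm ?kern_ge0//; exact: kern_le.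
have mr x : measurable_fun setT (kern t x) by exact: measurable_kernr.
have ik x : leb.-integrable setT (EFin \o (fun y => phi y * kern t x y)).
  by apply: (integrable_mul_bounded (M := K)) => // y; exact: (kK (x, y)).
pose g x := \int[leb]_y (phi y * kern t x y).
have mg : measurable_fun setT g.
  apply: measurable_undamp.
  apply: (@measurable_bounded_fubini_F _ _ _ _ R leb leb (damp (one3 R)) phi
    (fun p => kern t p.1 p.2) K) => //.
  exact/integrable_damp/pos3_one3.
have gK x : `|g x| <= nrm1 phi * K.
  apply: le_trans (le_normr_Rintegral measurableT (ik x)) _.
  rewrite /nrm1 -RintegralZr//; last exact: integrable_norm.
  apply: le_Rintegral => //; first exact: (integrable_norm (ik x)).
    exact: (integrableZr measurableT K (integrable_norm iphi)).
  by move=> y _; rewrite normrM ler_wpM2l// (kK (x, y)).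
have ig : leb.-integrable setT (EFin \o (fun x => phi x * g x)).
  exact: integrable_mul_bounded iphi mg gK.
have E : (\int[leb]_q (damp t q * (Ct phi q ^+ 2 + St phi q ^+ 2))%:E =
    \int[leb]_x (phi x * g x)%:E)%E.
  rewrite -[LHS]fineK; last exact: integrable_fin_num iL.
  rewrite -[RHS]fineK; last exact: integrable_fin_num ig.
  congr EFin; apply: etrans (transform_pairing t0 iphi iphi).
  by apply: eq_Rintegral => q _; rewrite !expr2.
have gE x : (`|g x|%:E <= \int[leb]_y (`|phi y| * kern t x y)%:E)%E.
  rewrite EFin_normr_Rintegral//.
  apply: le_trans (le_abse_integral _ _ _) _ => //; first exact: (measurable_int _ (ik x)).
  apply: ge0_le_integral => //.
  - by apply: measurableT_comp => //; exact: (measurable_int _ (ik x)).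
  - by apply/measurable_EFinP; apply: measurable_funM => //; exact: measurableT_comp.
  - by move=> y _; rewrite /= lee_fin normrM (ger0_norm (kern_ge0 _ _ t0)).
have k0 x y : 0 <= kern t x y by exact: kern_ge0.
rewrite E; apply: le_trans (lee_abs _) _.
apply: le_trans (le_abse_integral _ _ _) _ => //; first exact: (measurable_int _ ig).
apply: ge0_le_integral => //.
- by apply: measurableT_comp => //; exact: (measurable_int _ ig).
- apply: (@measurable_tonelli _ _ T3 T3 leb (fun x y => `|phi x| * `|phi y| * kern t x y)).
    apply: measurable_funM => //; apply: measurable_funM; apply: measurableT_comp => //.
      exact: measurableT_comp mphi measurable_fst.
    exact: measurableT_comp mphi measurable_snd.
  by move=> x y; apply: mulr_ge0 => //; exact: mulr_ge0.
- move=> x _; rewrite /= normrM EFinM.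
  apply: (@le_trans _ _ (`|phi x|%:E * \int[leb]_y (`|phi y| * kern t x y)%:E)%E).
    by rewrite lee_wpmul2l ?lee_fin.
  rewrite -ge0_integralZl_EFin//.
  + apply: ge0_le_integral => //.
    * by move=> y _; rewrite -EFinM lee_fin; do 2![apply: mulr_ge0 => //].
    * apply: measurable_funeM; apply/measurable_EFinP; apply: measurable_funM => //.
      exact: measurableT_comp.
    * apply/measurable_EFinP; apply: measurable_funM => //.
      by apply: measurable_funM => //; exact: measurableT_comp.
    * by move=> y _; rewrite -EFinM mulrA.
  + by move=> y _; rewrite lee_fin; apply: mulr_ge0.
  + apply/measurable_EFinP; apply: measurable_funM => //; exact: measurableT_comp.
Qed.

End Schur.

(** * The dual form of Hardy's inequality, by averaging Schur's test over heights *)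

Section Weighted.
Variable R : realType.
Local Notation mu := (@lebesgue_measure R).
Local Notation mR := (measurableTypeR R).
Local Notation T3 := (mR * mR * mR)%type.
Local Notation leb := (leb3 R).
Implicit Types (u v w phi : T3 -> R) (t q x y : T3).

(** A constant weight in Schur's test gives the upper half of Plancherel's identity, uniformly in
    [t]; it serves to keep the truncation error of the duality argument bounded. *)
Lemma damp_transform_plain t phi : pos3 t -> leb.-integrable setT (EFin \o phi) ->
  (\int[leb]_q (damp t q * (Ct phi q ^+ 2 + St phi q ^+ 2))%:E <=
   (cpi R ^+ 3)%:E * \int[leb]_x (phi x ^+ 2)%:E)%E.
Proof.
move=> t0 iphi.
have mphi : measurable_fun setT phi by apply/measurable_EFinP; exact: measurable_int iphi.
apply: le_trans (@damp_transform_le R t phi (fun=> 1) t0 iphi (measurable_cst _) (fun=> ltr01)) _.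
rewrite -ge0_integralZl_EFin//; last 3 first.
- by move=> x _; rewrite lee_fin sqr_ge0.
- by apply/measurable_EFinP; exact: measurable_funX.
- by rewrite exprn_ge0 ?(ltW (cpi_gt0 R)).
rewrite le_eqVlt; apply/orP; left; apply/eqP; apply: eq_integral => x _.
rewrite divr1; under eq_integral do rewrite mulr1 EFinM.
rewrite ge0_integralZl_EFin ?sqr_ge0//.
- by rewrite integral_kern// muleC.
- by move=> y _; rewrite lee_fin kern_ge0.
- by apply/measurable_EFinP; exact: measurable_kernr.
Qed.

Definition wgt3 (d : R) x : R := wgt d x.1.1 * wgt d x.1.2 * wgt d x.2.

Definition Kw : R := 2 * (4 * pi + 12).

Lemma Kw_ge0 : 0 <= Kw.
Proof. by rewrite /Kw; have := pi_ge0 R; lra. Qed.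

(** The bound depends on [|x| + t + d] alone. It is written as a weight in [t] with shift [|x| + d]
    because the next integration runs over the height. *)
Lemma integral_pker_wgt (t x d : R) : 0 < t -> 0 < d ->
  (\int[mu]_y (pker t (x - y) * wgt d y)%:E <= (Kw * wgt (`|x| + d) t)%:E)%E.
Proof.
move=> t0 d0; have := @integral_poisson_wgt R t x d (`|x| + t + d) t0 d0 erefl.
have E : (\int[mu]_y (pker t (x - y) * wgt d y)%:E =
   2%:E * \int[mu]_y (t / (t ^+ 2 + (x - y) ^+ 2) * wgt d y)%:E)%E.
  rewrite -ge0_integralZl_EFin//.
  - by apply: eq_integral => y _; rewrite -EFinM /pker; congr (_%:E); ring.
  - move=> y _; rewrite lee_fin; apply: mulr_ge0; last exact/ltW/wgt_gt0.
    by rewrite divr_ge0 ?addr_ge0 ?sqr_ge0 ?ltW.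
  - apply/measurable_EFinP.
    rewrite (_ : (fun y : R => _) = (fun y : R => 2^-1 * (pker t (x - y) * wgt d y))); last first.
      by apply/funext => y; rewrite /pker !mulrA mulVf ?mul1r ?pnatr_eq0.
    apply: measurable_funM => //; apply: measurable_funM.
      by apply: measurable_pker => //; exact: measurable_funB.
    by apply: continuous_measurable_fun; exact: continuous_wgt.
move=> h; rewrite E; apply: (@le_trans _ _ (2%:E * ((4 * pi + 12) / cbrt (`|x| + t + d) ^+ 2)%:E)%E).
  by rewrite lee_wpmul2l// lee_fin.
rewrite -EFinM lee_fin /wgt /Kw (ger0_norm (ltW t0)).
have -> : `|x| + t + d = t + (`|x| + d) by ring.
by rewrite mulrA.
Qed.

Lemma integral_kern_wgt3 t x d : pos3 t -> 0 < d ->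
  (\int[leb]_y (kern t x y * wgt3 d y)%:E <=
    (Kw ^+ 3 * (wgt (`|x.1.1| + d) t.1.1 * wgt (`|x.1.2| + d) t.1.2 * wgt (`|x.2| + d) t.2))%:E)%E.
Proof.
move=> [t1 t2 t3] d0.
pose f (s z : R) := fun y : R => pker s (z - y) * wgt d y.
have mf (s z : R) : 0 < s -> measurable_fun setT (f s z).
  move=> s0; apply: measurable_funM.
    by apply: measurable_pker => //; exact: measurable_funB.
  by apply: continuous_measurable_fun; exact: continuous_wgt.
have f0 (s z y : R) : 0 < s -> 0 <= f s z y.
  by move=> s0; apply: mulr_ge0; [exact: pker_ge0|exact/ltW/wgt_gt0].
under eq_integral => y _.
  rewrite (_ : kern t x y * wgt3 d y = f t.1.1 x.1.1 y.1.1 * f t.1.2 x.1.2 y.1.2 * f t.2 x.2 y.2);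
    last by rewrite /kern /wgt3 /f; ring.
  over.
rewrite (@integral_leb3_prod R (f t.1.1 x.1.1) (f t.1.2 x.1.2) (f t.2 x.2));
  try (by exact: mf); try (by move=> y; exact: f0).
have i0 (s z : R) : 0 < s -> (0 <= \int[mu]_y (f s z y)%:E)%E.
  by move=> s0; apply: integral_ge0 => y _; rewrite lee_fin f0.
apply: (@le_trans _ _ ((Kw * wgt (`|x.1.1| + d) t.1.1)%:E * (Kw * wgt (`|x.1.2| + d) t.1.2)%:E
  * (Kw * wgt (`|x.2| + d) t.2)%:E)%E).
  apply: lee_pmul; [by rewrite mule_ge0 ?i0|exact: i0| |exact: integral_pker_wgt].
  by apply: lee_pmul; [exact: i0|exact: i0|exact: integral_pker_wgt|exact: integral_pker_wgt].
by rewrite -!EFinM lee_fin le_eqVlt; apply/orP; left; apply/eqP; ring.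
Qed.

(* The substitution [t = u ^+ 3] turns the density [t ^ (-2/3)] into a constant. *)
Definition cdamp1 (u s : R) : R := (0 < u)%R%:R * expR (- (u ^+ 3 * `|s|)).

Lemma measurable_pos : measurable_fun setT (fun u : R => (0 < u)%R%:R : R).
Proof. by apply: measurable_indicb; exact: measurable_fun_ltr. Qed.

Lemma measurable_cube_expR (dd : measure_display) (T : measurableType dd) (f g : T -> R) :
  measurable_fun setT f -> measurable_fun setT g ->
  measurable_fun setT (fun p => cdamp1 (f p) (g p)).
Proof.
move=> mf mg; apply: measurable_funM; first exact: (measurableT_comp measurable_pos mf).
apply: measurableT_comp => //; apply: measurableT_comp => //; apply: measurable_funM.
  exact: measurable_funX.
exact: measurableT_comp.
Qed.

Lemma cdamp1_ge0 (u s : R) : 0 <= cdamp1 u s.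
Proof. by rewrite mulr_ge0 ?ler0n ?expR_ge0. Qed.

(** For [0 < u <= 1 / cbrt m] the exponent [u^3 |s|] is at most 1, so the integrand is at least
    [expR (-1)] on an interval of length [1 / cbrt m]. *)
Lemma integral_cdamp1 (s m : R) : 0 < m -> `|s| <= m ->
  ((expR (-1) / cbrt m)%:E <= \int[mu]_u (cdamp1 u s)%:E)%E.
Proof.
move=> m0 sm; set a := cbrt m; have a0 : 0 < a by exact: cbrt_gt0.
have -> : (expR (-1) / a)%:E = (\int[mu]_(u in `]0%R, (a^-1)%R]) (expR (-1))%:E)%E.
  rewrite (integral_cst mu) //= lebesgue_measure_itv/= lte_fin invr_gt0 a0.
  by rewrite -EFinD subr0 -EFinM.
apply: ge0_integral_le_supp => //.
- apply/measurable_EFinP; apply: measurable_cube_expR => //; exact: measurable_cst.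
- by move=> u; rewrite lee_fin cdamp1_ge0.
- move=> u /=; rewrite in_itv/= => /andP[u0 ua] _; rewrite lee_fin /cdamp1 u0 mul1r.
  rewrite ler_expR lerN2.
  have h : u ^+ 3 <= m^-1.
    rewrite -[m](cbrtK (ltW m0)) -exprVn lerXn2r ?nnegrE ?(ltW u0)// invr_ge0.
    exact: cbrt_ge0.
  apply: (@le_trans _ _ (m^-1 * m)); last by rewrite mulVf ?gt_eqF.
  by apply: ler_pM; rewrite ?exprn_ge0 ?(ltW u0).
- by move=> u _ /(_ I).
Qed.

Definition nsq3 q : R := q.1.1 ^+ 2 + q.1.2 ^+ 2 + q.2 ^+ 2.

Definition japanese q : R := Num.sqrt (1 + nsq3 q).

Lemma nsq3_ge0 q : 0 <= nsq3 q.
Proof. by rewrite /nsq3 !addr_ge0 ?sqr_ge0. Qed.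

Lemma japanese_gt0 q : 0 < japanese q.
Proof. by rewrite sqrtr_gt0; have := nsq3_ge0 q; lra. Qed.

Lemma le_japanese q :
  [/\ `|q.1.1| <= japanese q, `|q.1.2| <= japanese q & `|q.2| <= japanese q].
Proof.
have h1 := sqr_ge0 q.1.1; have h2 := sqr_ge0 q.1.2; have h3 := sqr_ge0 q.2.
by split; rewrite -sqrtr_sqr ler_sqrt /nsq3; lra.
Qed.

Definition cdamp t q : R := cdamp1 t.1.1 q.1.1 * cdamp1 t.1.2 q.1.2 * cdamp1 t.2 q.2.

Lemma cdamp_ge0 t q : 0 <= cdamp t q.
Proof. by rewrite /cdamp mulr_ge0 ?cdamp1_ge0// mulr_ge0 ?cdamp1_ge0. Qed.

Lemma measurable_cdamp (dd : measure_display) (T : measurableType dd) (f g : T -> T3) :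
  measurable_fun setT f -> measurable_fun setT g ->
  measurable_fun setT (fun p => cdamp (f p) (g p)).
Proof.
move=> mf mg; apply: measurable_funM; first apply: measurable_funM;
  apply: measurable_cube_expR.
- exact: measurableT_comp (@measurable_c1 R) mf.
- exact: measurableT_comp (@measurable_c1 R) mg.
- exact: measurableT_comp (@measurable_c2 R) mf.
- exact: measurableT_comp (@measurable_c2 R) mg.
- exact: measurableT_comp (@measurable_c3 R) mf.
- exact: measurableT_comp (@measurable_c3 R) mg.
Qed.

(** Every coordinate is at most the bracket, so each one-dimensional average is at least [expR (-1)]
    times the bracket to the power -1/3. The product of three such bounds restores the power -1, at
    the cost of [expR 1 ^+ 3]. *)
Lemma japaneseV_le q :
  (((japanese q)^-1)%:E <= (expR 1 ^+ 3)%:E * \int[leb]_t (cdamp t q)%:E)%E.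
Proof.
have m1 (s : R) : measurable_fun setT (cdamp1 ^~ s).
  by apply: measurable_cube_expR => //; exact: measurable_cst.
rewrite (@integral_leb3_prod R (cdamp1 ^~ q.1.1) (cdamp1 ^~ q.1.2) (cdamp1 ^~ q.2))//;
  try (by move=> x; exact: cdamp1_ge0).
have [h1 h2 h3] := le_japanese q; have j0 := japanese_gt0 q.
have c0 := cbrt_gt0 j0.
pose e := (expR (-1) / cbrt (japanese q)).
have e0 : 0 <= e by rewrite divr_ge0 ?expR_ge0 ?ltW.
apply: (@le_trans _ _ ((expR 1 ^+ 3)%:E * (e%:E * e%:E * e%:E))%E).
  rewrite -!EFinM lee_fin /e expRN.
  rewrite -[X in X^-1](cbrtK (ltW j0)) le_eqVlt; apply/orP; left; apply/eqP.
  by field; rewrite !gt_eqF ?expR_gt0.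
apply: lee_wpmul2l; first by rewrite lee_fin exprn_ge0 ?expR_ge0.
apply: lee_pmul; [by rewrite mule_ge0 ?lee_fin|by rewrite lee_fin| |exact: integral_cdamp1].
by apply: lee_pmul; rewrite ?lee_fin//; exact: integral_cdamp1.
Qed.

Lemma cdamp_pos t q : pos3 t -> cdamp t q = damp (t.1.1 ^+ 3, t.1.2 ^+ 3, t.2 ^+ 3) q.
Proof. by move=> [t1 t2 t3]; rewrite /cdamp /cdamp1 t1 t2 t3 !mul1r. Qed.

Lemma cdamp_npos t q : ~ pos3 t -> cdamp t q = 0.
Proof.
move=> h; rewrite /cdamp /cdamp1.
have [t1|t1] := ltP 0 t.1.1; last by rewrite !mul0r.
have [t2|t2] := ltP 0 t.1.2; last by rewrite mul0r mulr0 mul0r.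
have [t3|t3] := ltP 0 t.2; last by rewrite mul0r mulr0.
by exfalso; apply: h.
Qed.

(** The weight after Poisson averaging at height [u ^+ 3]. The indicator is the one in [cdamp1], so
    that both vanish off the positive heights. *)
Definition cwgt1 (d u x : R) : R := (0 < u)%R%:R * wgt (`|x| + d) (u ^+ 3).

Lemma cwgt1_ge0 (d u x : R) : 0 < d -> 0 <= cwgt1 d u x.
Proof.
move=> d0; apply: mulr_ge0; first by rewrite ler0n.
by apply/ltW/wgt_gt0; rewrite ltr_wpDl.
Qed.

Lemma measurable_wgt2 (d : R) (dd : measure_display) (T : measurableType dd) (f g : T -> R) :
  measurable_fun setT f -> measurable_fun setT g ->
  measurable_fun setT (fun p => cwgt1 d (f p) (g p)).
Proof.
move=> mf mg; apply: measurable_funM; first exact: (measurableT_comp measurable_pos mf).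
rewrite (_ : (fun p => _) = (fun p => powR (cbrt (`|f p ^+ 3| + (`|g p| + d)) ^+ 2) (-1))); last first.
  by apply/funext => p; rewrite powR_inv1 ?exprn_ge0 ?cbrt_ge0.
apply: (measurableT_comp (@measurable_powR R (-1))).
apply: measurable_funX; apply: (measurableT_comp (@measurable_powR R 3^-1)).
apply: measurable_funD; first by apply: measurableT_comp => //; exact: measurable_funX.
by apply: measurable_funD => //; exact: measurableT_comp.
Qed.

Lemma integral_cwgt1 (d x : R) : 0 < d ->
  (\int[mu]_u (cwgt1 d u x)%:E <= (2 / cbrt (`|x| + d))%:E)%E.
Proof.
move=> d0; have m0 : 0 < `|x| + d by rewrite ltr_wpDl.
apply: le_trans (integral_wgt_exp3 m0).
apply: ge0_integral_le_supp => //.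
- by apply/measurable_EFinP; apply: measurable_wgt2 => //; exact: measurable_cst.
- by apply/measurable_EFinP; apply: continuous_measurable_fun; exact: continuous_wgt_exp3.
- by move=> u; rewrite lee_fin cwgt1_ge0.
- by move=> u; rewrite lee_fin ltW// wgt_gt0.
- move=> u _ /=; rewrite in_itv/= andbT => u0.
  by rewrite lee_fin /cwgt1 u0 mul1r.
- move=> u _ /=; rewrite in_itv/= andbT => /negP.
  by rewrite /cwgt1 => /negbTE ->; rewrite mul0r.
Qed.

Definition cwgt (d : R) t x : R :=
  cwgt1 d t.1.1 x.1.1 * cwgt1 d t.1.2 x.1.2 * cwgt1 d t.2 x.2.

(** What Schur's test leaves: per coordinate, the inverse test weight has power 2/3 and the integral
    over heights has power -1/3, which makes 1/3. *)
Definition cbrt3 (d : R) x : R := cbrt (`|x.1.1| + d) * cbrt (`|x.1.2| + d) * cbrt (`|x.2| + d).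

Lemma integral_cwgt (d : R) x : 0 < d ->
  (\int[leb]_t (cwgt d t x)%:E <= (8 / cbrt3 d x)%:E)%E.
Proof.
move=> d0.
have m1 (s : R) : measurable_fun setT ((cwgt1 d) ^~ s).
  by apply: measurable_wgt2 => //; exact: measurable_cst.
rewrite (@integral_leb3_prod R ((cwgt1 d) ^~ x.1.1) ((cwgt1 d) ^~ x.1.2) ((cwgt1 d) ^~ x.2))//;
  try (by move=> u; exact: cwgt1_ge0).
have i0 (s : R) : (0 <= \int[mu]_u (cwgt1 d u s)%:E)%E.
  by apply: integral_ge0 => u _; rewrite lee_fin cwgt1_ge0.
apply: (@le_trans _ _ ((2 / cbrt (`|x.1.1| + d))%:E * (2 / cbrt (`|x.1.2| + d))%:E
   * (2 / cbrt (`|x.2| + d))%:E)%E).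
  apply: lee_pmul; [by rewrite mule_ge0|by []| |exact: integral_cwgt1].
  by apply: lee_pmul => //; exact: integral_cwgt1.
rewrite -!EFinM lee_fin /cbrt3 !invfM le_eqVlt; apply/orP; left; apply/eqP; ring.
Qed.

Lemma wgt3_gt0 (d : R) x : 0 < d -> 0 < wgt3 d x.
Proof. by move=> d0; rewrite /wgt3 !mulr_gt0 ?wgt_gt0. Qed.

Lemma measurable_wgt3 (d : R) : 0 < d -> measurable_fun setT (wgt3 d).
Proof.
move=> d0; have mw : measurable_fun setT (wgt d).
  by apply: continuous_measurable_fun; exact: continuous_wgt.
apply: measurable_funM; first apply: measurable_funM.
- exact: measurableT_comp mw (@measurable_c1 R).
- exact: measurableT_comp mw (@measurable_c2 R).
- exact: measurableT_comp mw (@measurable_c3 R).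
Qed.

Lemma cdamp_transform_le t phi d : 0 < d -> leb.-integrable setT (EFin \o phi) ->
  (\int[leb]_q (cdamp t q * (Ct phi q ^+ 2 + St phi q ^+ 2))%:E <=
   \int[leb]_x (phi x ^+ 2 / wgt3 d x * Kw ^+ 3 * cwgt d t x)%:E)%E.
Proof.
move=> d0 iphi.
have mphi : measurable_fun setT phi by apply/measurable_EFinP; exact: measurable_int iphi.
have c0 x : 0 <= phi x ^+ 2 / wgt3 d x by rewrite divr_ge0 ?sqr_ge0 ?ltW ?wgt3_gt0.
have [tp|tp] := pselect (pos3 t); last first.
  under eq_integral do rewrite (cdamp_npos _ tp) mul0r.
  rewrite integral0; apply: integral_ge0 => x _; rewrite lee_fin.
  apply: mulr_ge0; first by apply: mulr_ge0 => //; rewrite exprn_ge0 ?Kw_ge0.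
  rewrite /cwgt; apply: mulr_ge0; last exact: cwgt1_ge0.
  by apply: mulr_ge0; exact: cwgt1_ge0.
set T := (t.1.1 ^+ 3, t.1.2 ^+ 3, t.2 ^+ 3).
have Tp : pos3 T by case: tp => ? ? ?; split; exact: exprn_gt0.
under eq_integral do rewrite (cdamp_pos _ tp).
apply: le_trans (damp_transform_le Tp iphi (measurable_wgt3 d0) (fun x => wgt3_gt0 x d0)) _.
have mw := measurable_wgt3 d0.
have mwV : measurable_fun setT (fun x => (wgt3 d x)^-1).
  have -> : (fun x => (wgt3 d x)^-1) = (fun x => powR (wgt3 d x) (-1)).
    by apply/funext => x; rewrite powR_inv1 ?ltW ?wgt3_gt0.
  exact: (measurableT_comp (@measurable_powR R (-1)) mw).
have mc : measurable_fun setT (fun x => phi x ^+ 2 / wgt3 d x).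
  by apply: measurable_funM => //; exact: measurable_funX.
have k0 x y : 0 <= kern T x y * wgt3 d y.
  by apply: mulr_ge0; [exact: kern_ge0|exact/ltW/wgt3_gt0].
apply: ge0_le_integral => //.
- by move=> x _; apply: integral_ge0 => y _; rewrite lee_fin; exact: mulr_ge0.
- apply: (@measurable_tonelli R _ _ T3 T3 leb (fun x y => phi x ^+ 2 / wgt3 d x * (kern T x y * wgt3 d y))).
    apply: measurable_funM; first exact: (measurableT_comp mc measurable_fst).
    apply: measurable_funM; last exact: (measurableT_comp mw measurable_snd).
    by apply: measurable_kern; [|exact: measurable_fst|exact: measurable_snd].
  by move=> x y; exact: mulr_ge0.
- apply/measurable_EFinP; apply: measurable_funM; first exact: measurable_funM.
  apply: measurable_funM; first apply: measurable_funM; apply: measurable_wgt2; try exact: measurable_cst.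
  + exact: measurable_c1.
  + exact: measurable_c2.
  + exact: measurable_c3.
- move=> x _; under eq_integral do rewrite EFinM.
  rewrite ge0_integralZl_EFin//; last 2 first.
  + by move=> y _; rewrite lee_fin.
  + by apply/measurable_EFinP; apply: measurable_funM => //; exact: measurable_kernr.
  apply: le_trans (lee_wpmul2l _ (integral_kern_wgt3 x Tp d0)) _; first by rewrite lee_fin.
  case: tp => t1 t2 t3.
  rewrite -EFinM lee_fin /T/= mulrA /cwgt /cwgt1 t1 t2 t3 !mul1r. by rewrite -!mulrA.
Qed.

(** The factors come from [japaneseV_le], from the three integrals over heights (2 each), and from
    the three Poisson averages. *)
Definition Kd : R := expR 1 ^+ 3 * (8 * Kw ^+ 3).

(** The inverse bracket is replaced by an average of dampings; Tonelli moves the average outside,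
    Schur's test acts at each fixed height, and a second exchange integrates the averaged weights
    over the heights, where they collapse to [cbrt3]. *)
Lemma weighted_transform phi d : 0 < d -> leb.-integrable setT (EFin \o phi) ->
  (\int[leb]_q ((japanese q)^-1 * (Ct phi q ^+ 2 + St phi q ^+ 2))%:E <=
   Kd%:E * \int[leb]_x (phi x ^+ 2 * cbrt3 d x)%:E)%E.
Proof.
move=> d0 iphi.
have mphi : measurable_fun setT phi by apply/measurable_EFinP; exact: measurable_int iphi.
pose G q := Ct phi q ^+ 2 + St phi q ^+ 2.
have G0 q : 0 <= G q by rewrite addr_ge0 ?sqr_ge0.
have mG : measurable_fun setT G.
  by apply: measurable_funD; apply: measurable_funX; [exact: measurable_Ct|exact: measurable_St].
have mcd : measurable_fun setT (fun p : T3 * T3 => cdamp p.2 p.1 * G p.1).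
  apply: measurable_funM; last exact: (measurableT_comp mG measurable_fst).
  by apply: measurable_cdamp; [exact: measurable_snd|exact: measurable_fst].
have cd0 q t : 0 <= cdamp t q * G q by rewrite mulr_ge0 ?cdamp_ge0.
have e0 : 0 <= expR 1 ^+ 3 :> R by rewrite exprn_ge0 ?expR_ge0.
have mj : measurable_fun setT (fun q => (japanese q)^-1).
  rewrite (_ : (fun q => _) = (fun q => powR (1 + nsq3 q) (- 2^-1))); last first.
    by apply/funext => q; rewrite powRN powR12_sqrt// addr_ge0 ?nsq3_ge0.
  apply: (measurableT_comp (@measurable_powR R (- 2^-1))).
  apply: measurable_funD => //; apply: measurable_funD; first apply: measurable_funD; apply: measurable_funX.
  + exact: measurable_c1.
  + exact: measurable_c2.
  + exact: measurable_c3.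
apply: (@le_trans _ _ (\int[leb]_q ((expR 1 ^+ 3)%:E * \int[leb]_t (cdamp t q * G q)%:E))%E).
  apply: ge0_le_integral => //.
  - move=> q _; rewrite lee_fin; apply: mulr_ge0; last exact: G0.
    by rewrite invr_ge0; exact/ltW/japanese_gt0.
  - by apply/measurable_EFinP; exact: measurable_funM.
  - by apply: measurable_funeM; exact: (@measurable_tonelli R _ _ T3 T3 leb (fun q t => cdamp t q * G q)).
  - move=> q _; rewrite -/(G q) EFinM.
    apply: le_trans (lee_wpmul2r _ (japaneseV_le q)) _; first by rewrite lee_fin; exact: G0.
    rewrite -muleA lee_wpmul2l ?lee_fin// -ge0_integralZr ?lee_fin//.
    + apply/measurable_EFinP; apply: measurable_cdamp => //; exact: measurable_cst.
    + by move=> t _; rewrite lee_fin cdamp_ge0.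
rewrite ge0_integralZl_EFin//; last 2 first.
- by move=> q _; apply: integral_ge0 => t _; rewrite lee_fin.
- exact: (@measurable_tonelli R _ _ T3 T3 leb (fun q t => cdamp t q * G q)).
rewrite /Kd (EFinM (expR 1 ^+ 3)) -muleA; apply: lee_wpmul2l; first by rewrite lee_fin.
rewrite (@tonelli R _ _ T3 T3 leb leb (fun q t => cdamp t q * G q))//.
pose H x t := phi x ^+ 2 / wgt3 d x * Kw ^+ 3 * cwgt d t x.
have K0 : 0 <= Kw ^+ 3 by rewrite exprn_ge0 ?Kw_ge0.
have c0 x : 0 <= phi x ^+ 2 / wgt3 d x by rewrite divr_ge0 ?sqr_ge0 ?ltW ?wgt3_gt0.
have cw0 t x : 0 <= cwgt d t x.
  rewrite /cwgt; apply: mulr_ge0; last exact: cwgt1_ge0.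
  by apply: mulr_ge0; exact: cwgt1_ge0.
have H0 x t : 0 <= H x t by rewrite /H mulr_ge0// mulr_ge0.
have mw := measurable_wgt3 d0.
have mwV : measurable_fun setT (fun x => (wgt3 d x)^-1).
  have -> : (fun x => (wgt3 d x)^-1) = (fun x => powR (wgt3 d x) (-1)).
    by apply/funext => x; rewrite powR_inv1 ?ltW ?wgt3_gt0.
  exact: (measurableT_comp (@measurable_powR R (-1)) mw).
have mc : measurable_fun setT (fun x => phi x ^+ 2 / wgt3 d x * Kw ^+ 3).
  by apply: measurable_funM => //; apply: measurable_funM => //; exact: measurable_funX.
have mcw (dd : measure_display) (T : measurableType dd) (f g : T -> T3) :
    measurable_fun setT f -> measurable_fun setT g ->
    measurable_fun setT (fun p => cwgt d (f p) (g p)).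
  move=> mf mg; apply: measurable_funM; first apply: measurable_funM; apply: measurable_wgt2.
  - exact: measurableT_comp (@measurable_c1 R) mf.
  - exact: measurableT_comp (@measurable_c1 R) mg.
  - exact: measurableT_comp (@measurable_c2 R) mf.
  - exact: measurableT_comp (@measurable_c2 R) mg.
  - exact: measurableT_comp (@measurable_c3 R) mf.
  - exact: measurableT_comp (@measurable_c3 R) mg.
have mH : measurable_fun setT (fun p : T3 * T3 => H p.1 p.2).
  apply: measurable_funM; first exact: (measurableT_comp mc measurable_fst).
  by apply: mcw; [exact: measurable_snd|exact: measurable_fst].
have mH' : measurable_fun setT (fun p : T3 * T3 => H p.2 p.1).
  exact: (measurableT_comp mH (@measurable_swap _ _ T3 T3)).
have mcb : measurable_fun setT (cbrt3 d).
  have mcb1 (f : T3 -> R) : measurable_fun setT f -> measurable_fun setT (fun x => cbrt (`|f x| + d)).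
    move=> mf; apply: (measurableT_comp (@measurable_powR R 3^-1)).
    by apply: measurable_funD => //; exact: measurableT_comp.
  apply: measurable_funM; first apply: measurable_funM; apply: mcb1.
  - exact: measurable_c1.
  - exact: measurable_c2.
  - exact: measurable_c3.
have cb0 x : 0 < cbrt3 d x.
  by rewrite /cbrt3 !mulr_gt0 ?cbrt_gt0 ?ltr_wpDl.
apply: (@le_trans _ _ (\int[leb]_t \int[leb]_x (H x t)%:E)%E).
  apply: ge0_le_integral => //.
  - by move=> t _; apply: integral_ge0 => q _; rewrite lee_fin.
  - apply: (@measurable_tonelli R _ _ T3 T3 leb (fun t q => cdamp t q * G q)) => //.
    exact: (measurableT_comp mcd (@measurable_swap _ _ T3 T3)).
  - exact: (@measurable_tonelli R _ _ T3 T3 leb (fun t x => H x t)).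
  - by move=> t _; exact: cdamp_transform_le.
rewrite (@tonelli R _ _ T3 T3 leb leb (fun t x => H x t))//.
have K8 : 0 <= 8 * Kw ^+ 3 by apply: mulr_ge0.
rewrite -ge0_integralZl_EFin//; last 2 first.
- by move=> x _; rewrite lee_fin; apply: mulr_ge0; [exact: sqr_ge0|exact: ltW].
- by apply/measurable_EFinP; apply: measurable_funM => //; exact: measurable_funX.
apply: ge0_le_integral => //.
- by move=> x _; apply: integral_ge0 => t _; rewrite lee_fin.
- exact: (@measurable_tonelli R _ _ T3 T3 leb H).
- apply: measurable_funeM; apply/measurable_EFinP; apply: measurable_funM => //.
  exact: measurable_funX.
move=> x _; rewrite /H; under eq_integral do rewrite EFinM.
have pK x' : 0 <= phi x' ^+ 2 / wgt3 d x' * Kw ^+ 3 by apply: mulr_ge0.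
rewrite ge0_integralZl_EFin//; last 2 first.
- by move=> t _; rewrite lee_fin.
- by apply/measurable_EFinP; apply: mcw => //; exact: measurable_cst.
apply: le_trans (lee_wpmul2l _ (integral_cwgt x d0)) _; first by rewrite lee_fin.
rewrite -!EFinM lee_fin /wgt3 /wgt /cbrt3.
have p1 : 0 < cbrt (`|x.1.1| + d) by rewrite cbrt_gt0// ltr_wpDl.
have p2 : 0 < cbrt (`|x.1.2| + d) by rewrite cbrt_gt0// ltr_wpDl.
have p3 : 0 < cbrt (`|x.2| + d) by rewrite cbrt_gt0// ltr_wpDl.
rewrite le_eqVlt; apply/orP; left; apply/eqP; field.
by rewrite !gt_eqF.
Qed.

End Weighted.

(** * Square integrable functions and their truncated transforms *)

Section Duality.
Variable R : realType.
Local Notation mu := (@lebesgue_measure R).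
Local Notation mR := (measurableTypeR R).
Local Notation T3 := (mR * mR * mR)%type.
Local Notation leb := (leb3 R).
Implicit Types (u v w phi : T3 -> R) (t q x y : T3) (h A B : 'rV[R]_3 -> R).

Lemma vec3E x : [/\ vec3 x 0 0 = x.1.1, vec3 x 0 1 = x.1.2 & vec3 x 0 2%:R = x.2].
Proof. by split; rewrite mxE. Qed.

Lemma sum3 (F : 'I_3 -> R) : \sum_i F i = F 0 + F 1 + F 2%:R.
Proof.
rewrite !big_ord_recl big_ord0 addr0 addrA; congr (_ + F _ + F _); exact: val_inj.
Qed.

Lemma enorm_vec3 x : enorm (vec3 x) ^+ 2 = nsq3 x.
Proof.
have [e0 e1 e2] := vec3E x.
by rewrite /enorm sum3 e0 e1 e2 sqr_sqrtr// nsq3_ge0.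
Qed.

Lemma edot_vec3 x y : edot (vec3 x) (vec3 y) = dot3 x y.
Proof.
have [e0 e1 e2] := vec3E x; have [f0 f1 f2] := vec3E y.
by rewrite /edot sum3 e0 e1 e2 f0 f1 f2.
Qed.

Lemma L2norm_sqr (f : 'rV[R]_3 -> R) :
  (L2norm f `^ 2 = \int[leb]_x ((f (vec3 x)) ^+ 2)%:E)%E.
Proof.
rewrite /L2norm poweR_Lnorm ?pnatr_eq0//; apply: eq_integral => x _.
by rewrite /= (powR_mulrn 2)// real_normK ?num_real.
Qed.

Lemma L2norm_lt_sqr (f : 'rV[R]_3 -> R) (e : R) : (L2norm f < e%:E)%E ->
  (\int[leb]_x ((f (vec3 x)) ^+ 2)%:E <= (e ^+ 2)%:E)%E.
Proof.
rewrite -L2norm_sqr => h; have := Lnorm_ge0 leb 2%:E (EFin \o (f \o vec3 (R:=R))).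
rewrite -/(L2norm f); move: h; case: (L2norm f) => [r| |]//.
rewrite lte_fin lee_fin => re r0; rewrite poweR_EFin lee_fin (powR_mulrn 2)//.
by rewrite lerXn2r ?nnegrE// ?ltW// (le_lt_trans r0).
Qed.

Lemma L2fun_sqr_lty (f : 'rV[R]_3 -> R) : L2fun f ->
  (\int[leb]_x ((f (vec3 x)) ^+ 2)%:E < +oo)%E.
Proof.
move=> [mf]; rewrite -L2norm_sqr; have := Lnorm_ge0 leb 2%:E (EFin \o (f \o vec3 (R:=R))).
rewrite -/(L2norm f); case: (L2norm f) => [r| |]//= _ _.
by rewrite ?poweR_EFin ltry.
Qed.

(** With the ball written as an indicator, a truncated transform becomes the [Ct] or [St] of an
    integrable function on the whole space. *)
Definition trunc h (n : nat) x : R :=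
  (enorm (vec3 x) <= n%:R)%R%:R * h (vec3 x).

Lemma measurable_enorm : measurable_fun setT (fun x : T3 => enorm (vec3 x)).
Proof.
have -> : (fun x : T3 => enorm (vec3 x)) = (fun x => powR (nsq3 x) 2^-1).
  apply/funext => x; rewrite powR12_sqrt ?nsq3_ge0// -enorm_vec3.
  by rewrite sqrtr_sqr ger0_norm// sqrtr_ge0.
apply: (measurableT_comp (@measurable_powR R 2^-1)).
apply: measurable_funD; first apply: measurable_funD; apply: measurable_funX.
- exact: measurable_c1.
- exact: measurable_c2.
- exact: measurable_c3.
Qed.

(** The majorant rests on [|h| <= h^2 + 1]: the square is integrable, and on the ball the 1 is
    dominated by a multiple of the integrable [damp one3]. *)
Lemma trunc_integrable h n : L2fun h -> leb.-integrable setT (EFin \o trunc h n).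
Proof.
move=> hL; have [mh _] := hL; have h2 := L2fun_sqr_lty hL.
have mh2 : measurable_fun setT (fun x => (h (vec3 x) ^+ 2)%:E).
  by apply/measurable_EFinP; apply: measurable_funX; exact: mh.
have i1 : leb.-integrable setT (fun x => (h (vec3 x) ^+ 2)%:E).
  apply/integrableP; split => //.
  rewrite [X in (X < _)%E](_ : _ = (\int[leb]_x (h (vec3 x) ^+ 2)%:E)%E)//.
  by apply: eq_integral => x _; rewrite gee0_abs ?lee_fin ?sqr_ge0.
have i2 := integrableZl measurableT (expR (3 * n%:R)) (integrable_damp (@pos3_one3 R)).
have i12 := integrableD measurableT i1 i2.
apply: le_integrable i12 => //.
  apply/measurable_EFinP; apply: measurable_funM => //.
  apply: measurable_indicb; apply: measurable_fun_ler => //; exact: measurable_enorm.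
move=> x _ /=; rewrite lee_fin [leRHS]ger0_norm; last first.
  by rewrite addr_ge0 ?sqr_ge0// mulr_ge0 ?expR_ge0 ?damp_ge0.
rewrite /trunc; have [xn|xn] := boolP (enorm (vec3 x) <= n%:R); last first.
  by rewrite mul0r normr0 addr_ge0 ?sqr_ge0// mulr_ge0 ?expR_ge0 ?damp_ge0.
rewrite mul1r.
have : 1 <= expR (3 * n%:R) * damp (one3 R) x.
  have hn : nsq3 x <= n%:R ^+ 2.
    by rewrite -enorm_vec3 lerXn2r ?nnegrE ?sqrtr_ge0.
  have b (z : R) : z ^+ 2 <= nsq3 x -> `|z| <= n%:R.
    move=> zx; rewrite -(ger0_norm (ler0n R n)) -ler_sqr ?nnegrE// !real_normK ?num_real//.
    exact: le_trans hn.
  rewrite /damp -!expRD -[leLHS]expR0 ler_expR /one3/= !mul1r.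
  have q1 := sqr_ge0 x.1.1; have q2 := sqr_ge0 x.1.2; have q3 := sqr_ge0 x.2.
  have b1 : `|x.1.1| <= n%:R by apply: b; rewrite /nsq3; lra.
  have b2 : `|x.1.2| <= n%:R by apply: b; rewrite /nsq3; lra.
  have b3 : `|x.2| <= n%:R by apply: b; rewrite /nsq3; lra.
  lra.
rewrite -[h _ ^+ 2]real_normK ?num_real//.
have := sqr_ge0 (`|h (vec3 x)| - 2^-1); nra.
Qed.

Definition cF : R := (2 * pi) `^ (- (3 / 2)).

Lemma cF_gt0 : 0 < cF.
Proof. by rewrite powR_gt0// mulr_gt0// pi_gt0. Qed.

(** Two normalising constants of the transform cancel the mass of the kernel, so the limit of the
    damped pairings is exactly the inner product. *)
Lemma cF_sqr : cF ^+ 2 * cpi R ^+ 3 = 1.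
Proof.
have c0 := cpi_gt0 R.
rewrite -(powR_mulrn 3 (ltW c0)) -(powR_mulrn 2 (ltW cF_gt0)) /cF -/(cpi R) -powRrM.
rewrite -powRD; last by rewrite (gt_eqF c0) implybT.
have -> : - (3 / 2) * 2 + 3%:R = 0 :> R by field.
by rewrite powRr0.
Qed.

Lemma cF_le1 : cF <= 1.
Proof.
have : cF ^+ 2 <= 1.
  have := cF_sqr; have : 1 <= cpi R ^+ 3.
    rewrite exprn_ege1// /cpi; have := pi_ge2 R; lra.
  have := sqr_ge0 cF; nra.
have := cF_gt0; nra.
Qed.

Lemma truncated_transform_cos h n x : truncated_transform cos h n (vec3 x) = cF * Ct (trunc h n) x.
Proof.
rewrite /truncated_transform -/cF; congr (_ * _); rewrite Rintegral_mkcond.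
apply: eq_Rintegral => y _; rewrite patchE edot_vec3 /trunc.
case: ifPn => [/set_mem /= ->|/negP hn]; first by rewrite mul1r.
case: (boolP (_ <= _)) => [k|_]; last by rewrite !mul0r.
by exfalso; apply: hn; exact: mem_set.
Qed.

Lemma truncated_transform_sin h n x : truncated_transform sin h n (vec3 x) = cF * St (trunc h n) x.
Proof.
rewrite /truncated_transform -/cF; congr (_ * _); rewrite Rintegral_mkcond.
apply: eq_Rintegral => y _; rewrite patchE edot_vec3 /trunc.
case: ifPn => [/set_mem /= ->|/negP hn]; first by rewrite mul1r.
case: (boolP (_ <= _)) => [k|_]; last by rewrite !mul0r.
by exfalso; apply: hn; exact: mem_set.
Qed.

End Duality.

(** * Duality between a Sobolev function and a test function *)

Section Duality.
Variable R : realType.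
Local Notation mu := (@lebesgue_measure R).
Local Notation mR := (measurableTypeR R).
Local Notation T3 := (mR * mR * mR)%type.
Local Notation leb := (leb3 R).
Implicit Types (u v w phi : T3 -> R) (t q x y : T3) (h A B : 'rV[R]_3 -> R).

Lemma young (a c W th : R) : 0 < W -> 0 < th ->
  a * c <= th / 2 * (W * a ^+ 2) + (2 * th)^-1 * (W^-1 * c ^+ 2).
Proof.
move=> W0 th0; rewrite -subr_ge0.
have -> : th / 2 * (W * a ^+ 2) + (2 * th)^-1 * (W^-1 * c ^+ 2) - a * c =
  (th * W * a - c) ^+ 2 / (2 * th * W).
  by field; rewrite !gt_eqF.
by rewrite divr_ge0 ?sqr_ge0// mulr_ge0 ?mulr_ge0 ?ltW.
Qed.

(** In the application [a] and [b] are the true transform, [cc * Ch] and [- cc * Sh] the truncated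
    one, and [e] is the damping. Young's inequality is applied with weight [W] to the true transform
    and with parameter [k] to the error; one factor [cc] is spent on normalisation, the other is
    bounded by 1. *)
Lemma pairing_pointwise (e W th k cc Ch Sh C S a b : R) : 0 <= e -> e <= 1 ->
  0 < W -> 0 < th -> 0 < k -> 0 < cc -> cc <= 1 ->
  cc ^+ 2 * `|e * (Ch * C + Sh * S)| <=
    th / 2 * (W * (a ^+ 2 + b ^+ 2)) + (2 * th)^-1 * (W^-1 * (C ^+ 2 + S ^+ 2))
    + (2 * k)^-1 * ((a - cc * Ch) ^+ 2 + (b + cc * Sh) ^+ 2)
    + k / 2 * (e * (C ^+ 2 + S ^+ 2)).
Proof.
move=> e0 e1 W0 th0 k0 c0 c1.
set da := a - cc * Ch; set db := b + cc * Sh.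
have ha : `|cc * Ch| <= `|a| + `|da|.
  have -> : cc * Ch = a - da by rewrite /da; ring.
  exact: ler_normB.
have hb : `|cc * Sh| <= `|b| + `|db|.
  have -> : cc * Sh = db - b by rewrite /db; ring.
  by rewrite [leRHS]addrC; exact: ler_normB.
have h1 : cc ^+ 2 * `|e * (Ch * C + Sh * S)| <= e * ((`|a| + `|da|) * `|C| + (`|b| + `|db|) * `|S|).
  rewrite normrM (ger0_norm e0) mulrCA ler_wpM2l//.
  apply: (@le_trans _ _ (cc * `|Ch * C + Sh * S|)).
    by rewrite ler_wpM2r// expr2 ler_piMr// ltW.
  rewrite -[X in X * _](gtr0_norm c0) -normrM mulrDr !mulrA.
  by rewrite (le_trans (ler_normD _ _))// !normrM lerD// ler_wpM2r// -normrM.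
apply: le_trans h1 _.
have y1 := young `|a| `|C| W0 th0; have y2 := young `|b| `|S| W0 th0.
have y3 := young `|C| `|da| ltr01 k0; have y4 := young `|S| `|db| ltr01 k0.
move: y1 y2 y3 y4; rewrite invr1 !mul1r !real_normK ?num_real//.
have eC : e * `|a| * `|C| <= `|a| * `|C| by rewrite -mulrA ler_piMl// mulr_ge0.
have eS : e * `|b| * `|S| <= `|b| * `|S| by rewrite -mulrA ler_piMl// mulr_ge0.
have k2 : 0 <= (2 * k)^-1 by rewrite invr_ge0 mulr_ge0 ?ltW.
have ea : e * ((2 * k)^-1 * da ^+ 2) <= (2 * k)^-1 * da ^+ 2 by rewrite ler_piMl// mulr_ge0 ?sqr_ge0.
have eb : e * ((2 * k)^-1 * db ^+ 2) <= (2 * k)^-1 * db ^+ 2 by rewrite ler_piMl// mulr_ge0 ?sqr_ge0.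
move=> y1 y2 y3 y4.
have z3 := ler_wpM2l e0 y3; have z4 := ler_wpM2l e0 y4.
move: z3 z4 y1 y2 eC eS ea eb; rewrite !(mulrDr, mulrDl, mulrA).
lra.
Qed.

Lemma integrable_sqr phi (M : R) : leb.-integrable setT (EFin \o phi) ->
  (forall x, `|phi x| <= M) -> leb.-integrable setT (EFin \o (fun x => phi x ^+ 2)).
Proof.
move=> iphi pM.
have mphi : measurable_fun setT phi by apply/measurable_EFinP; exact: measurable_int iphi.
by have := integrable_mul_bounded iphi mphi pM; under eq_fun do rewrite -expr2.
Qed.

(** A truncation radius beyond the support of [phi] that also makes the transform error small is
    fixed first. The damped pairing is then bounded independently of the height, and
    [parseval_limit] removes the damping. The parameter [th] of Young's inequality is left to the
    caller. *)
Lemma duality_bound h A B (s : R) phi (M : R) (n0 : nat) (th N Q : R) :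
  L2fun h -> fourier h A B -> leb.-integrable setT (EFin \o phi) ->
  (forall x, `|phi x| <= M) -> cont3 phi ->
  (forall x, phi x != 0 -> enorm (vec3 x) <= n0%:R) -> 0 < th ->
  (\int[leb]_q ((1 + nsq3 q) `^ s * (A (vec3 q) ^+ 2 + B (vec3 q) ^+ 2))%:E <= N%:E)%E ->
  (\int[leb]_q ((1 + nsq3 q) `^ (- s) * (Ct phi q ^+ 2 + St phi q ^+ 2))%:E <= Q%:E)%E ->
  `|\int[leb]_x (h (vec3 x) * phi x)| <= th / 2 * N + (2 * th)^-1 * Q.
Proof.
move=> hL [[AL BL] cA cB] iphi phiM cphi suppphi th0 AN CQ.
have mphi : measurable_fun setT phi by apply/measurable_EFinP; exact: measurable_int iphi.
have i2 := integrable_sqr iphi phiM.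
pose P := \int[leb]_x (phi x ^+ 2).
have P0 : 0 <= P by apply: Rintegral_ge0 => x _; exact: sqr_ge0.
have PE : (\int[leb]_x (phi x ^+ 2)%:E = P%:E)%E.
  by rewrite /P /Rintegral fineK//; exact: integrable_fin_num i2.
have c3 : 0 < cpi R ^+ 3 by rewrite exprn_gt0 ?cpi_gt0.
(* [K] exceeds the factor [1 + cpi^3 P / 2] that multiplies [k] in the total error, so [k = e / K]
   keeps this error below [e]. *)
pose K := 2 + cpi R ^+ 3 * P.
have cP0 : 0 <= cpi R ^+ 3 * P by apply: mulr_ge0 => //; exact: ltW.
have K0 : 0 < K by rewrite /K; lra.
apply/ler_addgt0Pr => e e0.
pose k := e / K; have k0 : 0 < k by rewrite divr_gt0.
have [n [n0n nA nB]] : exists n, [/\ (n0 <= n)%N,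
   (L2norm (A \- truncated_transform cos h n)%R < k%:E)%E &
   (L2norm (B \+ truncated_transform sin h n)%R < k%:E)%E].
  have k0E : (0 < k%:E)%E by rewrite lte_fin.
  have a1 : \forall n \near \oo, (L2norm (A \- truncated_transform cos h n)%R < k%:E)%E.
    exact: (cA _ (open_ereal_lt' k0E)).
  have a2 : \forall n \near \oo, (L2norm (B \+ truncated_transform sin h n)%R < k%:E)%E.
    exact: (cB _ (open_ereal_lt' k0E)).
  have a3 : \forall n \near \oo, (n0 <= n)%N by exact: nbhs_infty_ge.
  have [n /= [[? ?] ?]] := filter_ex (filterI (filterI a1 a2) a3).
  by exists n.
have iu := @trunc_integrable R h n hL.
(* [phi] vanishes beyond radius [n0 <= n], so the truncation of [h] is invisible to the pairing. *)
have hphi : \int[leb]_x (h (vec3 x) * phi x) = \int[leb]_x (trunc h n x * phi x).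
  apply: eq_Rintegral => x _; rewrite /trunc.
  have [->|px] := eqVneq (phi x) 0; first by rewrite !mulr0.
  by rewrite (le_trans (suppphi x px)) ?mul1r// ler_nat.
have lim := parseval_limit iu iphi phiM cphi.
have cFc := cF_sqr R.
pose I := \int[leb]_x (trunc h n x * phi x).
have step t : pos3 t ->
   cF R ^+ 2 * `|\int[leb]_x (trunc h n x * \int[leb]_y (phi y * kern t x y))| <=
   th / 2 * N + (2 * th)^-1 * Q + k + k / 2 * (cpi R ^+ 3 * P).
  move=> t0; rewrite -(transform_pairing t0 iu iphi).
  have idt := integrable_damp t0.
  pose F q := damp t q * (Ct (trunc h n) q * Ct phi q + St (trunc h n) q * St phi q).
  have mC := measurable_Ct iphi; have mS := measurable_St iphi.
  have mCh := measurable_Ct iu; have mSh := measurable_St iu.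
  have mF : measurable_fun setT F.
    apply: measurable_funM; first exact: measurable_damp.
    by apply: measurable_funD; exact: measurable_funM.
  have iF : leb.-integrable setT (EFin \o F).
    apply: (integrable_mul_bounded (M := nrm1 (trunc h n) * nrm1 phi + nrm1 (trunc h n) * nrm1 phi)) => //.
      by apply: measurable_funD; exact: measurable_funM.
    move=> q; rewrite (le_trans (ler_normD _ _))// !normrM lerD//; apply: ler_pM => //.
    - exact: Ct_le.
    - exact: Ct_le.
    - exact: St_le.
    - exact: St_le.
  pose W q := (1 + nsq3 q) `^ s.
  have j0 q : 0 < 1 + nsq3 q by rewrite ltr_wpDr// nsq3_ge0.
  have W0 q : 0 < W q by rewrite powR_gt0.
  have WV q : (W q)^-1 = (1 + nsq3 q) `^ (- s) by rewrite powRN.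
  have mj : measurable_fun setT (fun q : T3 => 1 + nsq3 q).
    apply: measurable_funD => //; apply: measurable_funD; first apply: measurable_funD; apply: measurable_funX.
    - exact: measurable_c1.
    - exact: measurable_c2.
    - exact: measurable_c3.
  have mW : measurable_fun setT W by exact: (measurableT_comp (@measurable_powR R s) mj).
  have mWV : measurable_fun setT (fun q => (W q)^-1).
    under eq_fun do rewrite WV.
    exact: (measurableT_comp (@measurable_powR R (- s)) mj).
  have [mA _] := AL; have [mB _] := BL.
  pose F1 q := W q * (A (vec3 q) ^+ 2 + B (vec3 q) ^+ 2).
  pose F2 q := (W q)^-1 * (Ct phi q ^+ 2 + St phi q ^+ 2).
  pose F3 q := (A (vec3 q) - cF R * Ct (trunc h n) q) ^+ 2.
  pose F4 q := (B (vec3 q) + cF R * St (trunc h n) q) ^+ 2.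
  pose F5 q := damp t q * (Ct phi q ^+ 2 + St phi q ^+ 2).
  have mF1 : measurable_fun setT F1.
    by apply: measurable_funM => //; apply: measurable_funD; apply: measurable_funX; [exact: mA|exact: mB].
  have mF2 : measurable_fun setT F2.
    by apply: measurable_funM => //; apply: measurable_funD; exact: measurable_funX.
  have mF3 : measurable_fun setT F3.
    apply: measurable_funX; apply: measurable_funB; first exact: mA.
    exact: measurable_funM.
  have mF4 : measurable_fun setT F4.
    apply: measurable_funX; apply: measurable_funD; first exact: mB.
    exact: measurable_funM.
  have mF5 : measurable_fun setT F5.
    apply: measurable_funM; first exact: measurable_damp.
    by apply: measurable_funD; exact: measurable_funX.
  have sq0 (a b : R) : 0 <= a ^+ 2 + b ^+ 2 by rewrite addr_ge0 ?sqr_ge0.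
  have F10 q : 0 <= F1 q by apply: mulr_ge0; [exact: ltW|exact: sq0].
  have F20 q : 0 <= F2 q by apply: mulr_ge0; [rewrite invr_ge0; exact: ltW|exact: sq0].
  have F30 q : 0 <= F3 q by exact: sqr_ge0.
  have F40 q : 0 <= F4 q by exact: sqr_ge0.
  have F50 q : 0 <= F5 q by apply: mulr_ge0; [exact: damp_ge0|exact: sq0].
  have I1 : (\int[leb]_q (F1 q)%:E <= N%:E)%E by [].
  have I2 : (\int[leb]_q (F2 q)%:E <= Q%:E)%E.
    by under eq_integral do rewrite /F2 WV.
  have I3 : (\int[leb]_q (F3 q)%:E <= (k ^+ 2)%:E)%E.
    apply: le_trans (L2norm_lt_sqr nA); rewrite le_eqVlt; apply/orP; left; apply/eqP.
    by apply: eq_integral => q _; rewrite /F3 /= truncated_transform_cos.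
  have I4 : (\int[leb]_q (F4 q)%:E <= (k ^+ 2)%:E)%E.
    apply: le_trans (L2norm_lt_sqr nB); rewrite le_eqVlt; apply/orP; left; apply/eqP.
    by apply: eq_integral => q _; rewrite /F4 /= truncated_transform_sin.
  have I5 : (\int[leb]_q (F5 q)%:E <= (cpi R ^+ 3 * P)%:E)%E.
    by rewrite EFinM -PE; exact: damp_transform_plain.
  have th2 : 0 <= th / 2 by rewrite divr_ge0 ?ltW.
  have th3 : 0 <= (2 * th)^-1 by rewrite invr_ge0 mulr_ge0 ?ltW.
  have k2 : 0 <= (2 * k)^-1 by rewrite invr_ge0 mulr_ge0 ?ltW.
  have k3 : 0 <= k / 2 by rewrite divr_ge0 ?ltW.
  have cF2 : 0 <= cF R ^+ 2 by exact: sqr_ge0.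
  have term (c a : R) (G : T3 -> R) : 0 <= c -> measurable_fun setT G -> (forall q, 0 <= G q) ->
      (\int[leb]_q (G q)%:E <= a%:E)%E -> (\int[leb]_q (c * G q)%:E <= (c * a)%:E)%E.
    move=> c0 mG G0 Ga; under eq_integral do rewrite EFinM.
    rewrite ge0_integralZl_EFin//; last 2 first.
    - by move=> q _; rewrite lee_fin.
    - exact/measurable_EFinP.
    by rewrite EFinM lee_wpmul2l ?lee_fin.
  have add (a b : R) (G H : T3 -> R) : measurable_fun setT G -> measurable_fun setT H ->
      (forall q, 0 <= G q) -> (forall q, 0 <= H q) ->
      (\int[leb]_q (G q)%:E <= a%:E)%E -> (\int[leb]_q (H q)%:E <= b%:E)%E ->
      (\int[leb]_q (G q + H q)%:E <= (a + b)%:E)%E.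
    move=> mG mH G0 H0 Ga Hb; under eq_integral do rewrite EFinD.
    rewrite ge0_integralD//; last 4 first.
    - by move=> q _; rewrite lee_fin.
    - exact/measurable_EFinP.
    - by move=> q _; rewrite lee_fin.
    - exact/measurable_EFinP.
    by rewrite EFinD leeD.
  have mcM (c : R) (G : T3 -> R) : measurable_fun setT G -> measurable_fun setT (fun q => c * G q).
    by move=> mG; exact: measurable_funM.
  have J1 := term _ _ _ th2 mF1 F10 I1; have J2 := term _ _ _ th3 mF2 F20 I2.
  have J34 := term _ _ _ k2 (measurable_funD mF3 mF4) (fun q => addr_ge0 (F30 q) (F40 q))
    (add _ _ _ _ mF3 mF4 F30 F40 I3 I4).
  have J5 := term _ _ _ k3 mF5 F50 I5.
  have p1 q : 0 <= th / 2 * F1 q by apply: mulr_ge0.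
  have p2 q : 0 <= (2 * th)^-1 * F2 q by apply: mulr_ge0.
  have p3 q : 0 <= (2 * k)^-1 * (F3 q + F4 q) by apply: mulr_ge0 => //; exact: addr_ge0.
  have p5 q : 0 <= k / 2 * F5 q by apply: mulr_ge0.
  have m1 := mcM (th / 2) _ mF1; have m2 := mcM (2 * th)^-1 _ mF2.
  have m3 := mcM (2 * k)^-1 _ (measurable_funD mF3 mF4); have m5 := mcM (k / 2) _ mF5.
  have p12 q := addr_ge0 (p1 q) (p2 q); have p123 q := addr_ge0 (p12 q) (p3 q).
  have J12 := add _ _ _ _ m1 m2 p1 p2 J1 J2.
  have J123 := add _ _ _ _ (measurable_funD m1 m2) m3 p12 p3 J12 J34.
  have J := add _ _ _ _ (measurable_funD (measurable_funD m1 m2) m3) m5 p123 p5 J123 J5.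
  have -> : th / 2 * N + (2 * th)^-1 * Q + k + k / 2 * (cpi R ^+ 3 * P) =
     th / 2 * N + (2 * th)^-1 * Q + (2 * k)^-1 * (k ^+ 2 + k ^+ 2) + k / 2 * (cpi R ^+ 3 * P).
    by field; rewrite !gt_eqF.
  rewrite -lee_fin; apply: le_trans J.
  rewrite EFinM EFin_normr_Rintegral//.
  apply: (@le_trans _ _ ((cF R ^+ 2)%:E * \int[leb]_q `|F q|%:E)%E).
    apply: lee_wpmul2l; first by rewrite lee_fin.
    by apply: le_abse_integral => //; exact/measurable_EFinP.
  rewrite -ge0_integralZl_EFin//; last by apply/measurable_EFinP; exact: measurableT_comp.
  apply: ge0_le_integral => //.
  - by move=> q _; rewrite -EFinM lee_fin; apply: mulr_ge0.
  - by apply: measurable_funeM; apply/measurable_EFinP; exact: measurableT_comp.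
  - apply/measurable_EFinP; exact: (measurable_funD (measurable_funD (measurable_funD m1 m2) m3) m5).
  - move=> q _; rewrite -EFinM lee_fin /F /F1 /F2 /F3 /F4 /F5.
    apply: pairing_pointwise => //.
    + exact: damp_ge0.
    + exact: damp_le1.
    + exact: cF_gt0.
    + exact: cF_le1.
rewrite hphi -/I.
suff : `|I| <= th / 2 * N + (2 * th)^-1 * Q + k + k / 2 * (cpi R ^+ 3 * P).
  move=> h1; apply: le_trans h1 _; rewrite -addrA lerD2l.
  have -> : k + k / 2 * (cpi R ^+ 3 * P) = k * (1 + cpi R ^+ 3 * P / 2) by ring.
  rewrite /k mulrAC ler_pdivrMr// ler_wpM2l ?(ltW e0)// /K.
  lra.
have -> : I = cF R ^+ 2 * (cpi R ^+ 3 * I) by rewrite mulrA cFc mul1r.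
rewrite normrM (ger0_norm (sqr_ge0 _)).
have nl : cF R ^+ 2 * `|\int[leb]_x (trunc h n x * \int[leb]_y (phi y * kern (diag3 m.+1%:R^-1) x y))|
    @[m --> \oo] --> cF R ^+ 2 * `|cpi R ^+ 3 * I|.
  by apply: cvgM; [exact: cvg_cst|exact: cvg_norm].
apply: (cvgr_to_le nl); apply: nearW => m; apply: step.
by apply: pos3_diag; rewrite invr_gt0 ltr0n.
Qed.

End Duality.

(** * Hardy's inequality *)

Section TestFunctions.
Variable R : realType.
Local Notation mu := (@lebesgue_measure R).
Local Notation mR := (measurableTypeR R).
Local Notation T3 := (mR * mR * mR)%type.
Local Notation leb := (leb3 R).
Local Notation point := 'rV[R]_3.
Implicit Types (v : T3 -> R) (g : point -> R) (x y : T3).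

Lemma nbhs_box (n : nat) (x : 'rV[R]_n) (P : set 'rV[R]_n) : nbhs x P ->
  exists2 d, 0 < d & forall y : 'rV[R]_n, (forall i, `|x 0 i - y 0 i| < d) -> P y.
Proof.
move=> /nbhs_ballP[d /= d0 h]; exists d => // y yd; apply: h; split=> // i j.
by rewrite ord1; exact: yd.
Qed.

Lemma forall3 (P : 'I_3 -> Prop) : P 0 -> P 1 -> P 2%:R -> forall i, P i.
Proof.
move=> h0 h1 h2 [[|[|[|//]]] hi].
- by rewrite (_ : Ordinal hi = 0)//; exact: val_inj.
- by rewrite (_ : Ordinal hi = 1)//; exact: val_inj.
- by rewrite (_ : Ordinal hi = 2%:R)//; exact: val_inj.
Qed.

Lemma continuous_cont3 g : continuous g -> cont3 (g \o vec3 (R:=R)).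
Proof.
move=> cg x eta eta0.
have /cvgrPdist_le/(_ _ eta0)/nbhs_box[d d0 h] := cg (vec3 x).
exists d => // y y1 y2 y3; rewrite distrC; apply: h.
have [e0 e1 e2] := vec3E x; have [f0 f1 f2] := vec3E y.
by apply: forall3; rewrite ?e0 ?e1 ?e2 ?f0 ?f1 ?f2.
Qed.

(** The preimage of an open half-line is the union of the boxes with rational data that it contains,
    and there are countably many of them. *)
Lemma cont3_measurable v : cont3 v -> measurable_fun setT v.
Proof.
move=> cv.
apply: (measurability _ (RGenOInfty.measurableE R)) => //.
move=> _ [_ [c ->] <-]; rewrite setTI.
pose box (q : rat * rat * rat * rat) : set T3 :=
  [set p | [/\ `|p.1.1 - ratr q.1.1.1| < ratr q.2, `|p.1.2 - ratr q.1.1.2| < ratr q.2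
     & `|p.2 - ratr q.1.2| < ratr q.2]].
pose good q := box q `<=` v @^-1` `]c, +oo[.
have -> : v @^-1` `]c, +oo[ = \bigcup_q (if `[< good q >] then box q else set0).
  apply/seteqP; split => [x /=|x [q _]]; last by case: asboolP => // + xq; apply.
  rewrite in_itv/= andbT => cx.
  have eta0 : 0 < (v x - c) / 2 by rewrite divr_gt0// subr_gt0.
  have [d d0 h] := cv x _ eta0.
  have [r] := rat_in_itvoo (divr_gt0 d0 (ltr0n _ 2)).
  rewrite in_itv/= => /andP[r0 rd].
  have pick (z : R) : exists q : rat, `|z - ratr q| < ratr r.
    have [|q] := @rat_in_itvoo R (z - ratr r) z; first by rewrite ltrBlDr ltrDl.
    rewrite in_itv/= => /andP[q1 q2]; exists q; rewrite gtr0_norm ?subr_gt0//; lra.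
  have [q1 h1] := pick x.1.1; have [q2 h2] := pick x.1.2; have [q3 h3] := pick x.2.
  exists (q1, q2, q3, r) => //.
  case: asboolP => [_|]; first by split.
  case=> y [/= y1 y2 y3]; rewrite in_itv/= andbT.
  have tri (a b e : R) : `|a - e| < ratr r -> `|b - e| < ratr r -> `|a - b| < d.
    move=> ha hb; have -> : a - b = (a - e) - (b - e) by ring.
    by rewrite (le_lt_trans (ler_normB _ _))//; lra.
  have := h y (tri _ _ _ h1 y1) (tri _ _ _ h2 y2) (tri _ _ _ h3 y3).
  rewrite ler_norml => /andP[+ _]; lra.
apply: countable_bigcupT_measurable; first exact: countableP.
move=> q; case: asboolP => // _.
have mlt (f : T3 -> R) (a b : R) : measurable_fun setT f -> measurable [set p | `|f p - a| < b].
  move=> mf; rewrite -[X in measurable X]setTI.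
  have -> : [set p | `|f p - a| < b] = (fun p => `|f p - a|) @^-1` `]-oo, b[.
    by apply/seteqP; split => p /=; rewrite in_itv.
  have mfa : measurable_fun setT (fun p => `|f p - a|).
    by apply: measurableT_comp => //; exact: measurable_funB.
  exact: mfa.
have -> : box q = [set p | `|p.1.1 - ratr q.1.1.1| < ratr q.2] `&`
   [set p | `|p.1.2 - ratr q.1.1.2| < ratr q.2] `&` [set p | `|p.2 - ratr q.1.2| < ratr q.2].
  by apply/seteqP; split => p; [case=> *; split|case=> [[]]].
apply: measurableI; first apply: measurableI.
- by apply: mlt; exact: measurable_c1.
- by apply: mlt; exact: measurable_c2.
- by apply: mlt; exact: measurable_c3.
Qed.

Lemma damp_lower (n : nat) x : enorm (vec3 x) <= n%:R ->
  1 <= expR (3 * n%:R) * damp (one3 R) x.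
Proof.
move=> xn; have hn : nsq3 x <= n%:R ^+ 2.
  by rewrite -enorm_vec3 lerXn2r ?nnegrE ?sqrtr_ge0.
have b (z : R) : z ^+ 2 <= nsq3 x -> `|z| <= n%:R.
  move=> zx; rewrite -(ger0_norm (ler0n R n)) -ler_sqr ?nnegrE// !real_normK ?num_real//.
  exact: le_trans hn.
rewrite /damp -!expRD -[leLHS]expR0 ler_expR /one3/= !mul1r.
have q1 := sqr_ge0 x.1.1; have q2 := sqr_ge0 x.1.2; have q3 := sqr_ge0 x.2.
have b1 : `|x.1.1| <= n%:R by apply: b; rewrite /nsq3; lra.
have b2 : `|x.1.2| <= n%:R by apply: b; rewrite /nsq3; lra.
have b3 : `|x.2| <= n%:R by apply: b; rewrite /nsq3; lra.
lra.
Qed.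

Definition ccs g := continuous g /\ exists n : nat, forall p, n%:R < enorm p -> g p = 0.

Lemma enorm_coord (n : nat) (p : 'rV[R]_n) i : `|p 0 i| <= enorm p.
Proof.
rewrite -sqrtr_sqr ler_sqrt.
  by rewrite (bigD1 i)//= lerDl sumr_ge0// => j _; exact: sqr_ge0.
by apply: sumr_ge0 => j _; exact: sqr_ge0.
Qed.

Lemma continuous_coord (n : nat) (i : 'I_n) : continuous (fun p : 'rV[R]_n => p 0 i).
Proof. by move=> p; exact: coord_continuous. Qed.

Definition nsq (p : point) : R := p 0 0 ^+ 2 + p 0 1 ^+ 2 + p 0 2%:R ^+ 2.

Lemma nsq_ge0 p : 0 <= nsq p.
Proof. by rewrite /nsq !addr_ge0 ?sqr_ge0. Qed.

Lemma enormE p : enorm p = Num.sqrt (nsq p).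
Proof. by rewrite /enorm sum3. Qed.

Lemma enorm_sqr p : enorm p ^+ 2 = nsq p.
Proof. by rewrite enormE sqr_sqrtr// nsq_ge0. Qed.

Lemma continuous_nsq : continuous nsq.
Proof.
have h (i : 'I_3) : continuous (fun p : point => p 0 i ^+ 2).
  move=> p; apply: (@continuous_comp _ _ _ (fun p : point => p 0 i) (fun z => z ^+ 2)).
    exact: continuous_coord.
  exact: exprn_continuous.
by move=> p; exact: (cvgD (cvgD (h 0 p) (h 1 p)) (h 2%:R p)).
Qed.

Lemma continuous_enorm : continuous (@enorm R 3).
Proof.
move=> p; have -> : @enorm R 3 = Num.sqrt \o nsq by apply/funext => q; exact: enormE.
apply: continuous_comp; [exact: continuous_nsq|exact: sqrt_continuous].
Qed.

Lemma ccs_bounded g : ccs g -> exists2 M, 0 <= M & forall p, `|g p| <= M.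
Proof.
move=> [cg [n gn]].
have cA : compact [set p : point | forall i, p ord0 i \in `[- (n%:R : R), n%:R]].
  apply: (@rV_compact _  _ (fun=> `[- (n%:R : R), n%:R]%classic)).
  by move=> _; apply: segment_compact.
have [||c _ hc] := @EVT_max_rV R 3 (fun p => `|g p|) _ _ cA.
- by exists 0 => i /=; rewrite mxE in_itv/= oppr_le0 ler0n.
- apply: continuous_subspaceT => p.
  apply: (@continuous_comp _ _ _ g (fun z : R => `|z|)); first exact: cg.
  exact: norm_continuous.
exists `|g c| => // p.
have [pn|pn] := leP (enorm p) n%:R; last by rewrite gn// normr0.
apply: hc; rewrite inE/= => i; rewrite in_itv/= -ler_norml.
exact: le_trans (enorm_coord p i) pn.
Qed.

Lemma ccs_integrable g : ccs g -> leb.-integrable setT (EFin \o (g \o vec3 (R:=R))).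
Proof.
move=> cg; have [M M0 gM] := ccs_bounded cg; case: cg => cg [n gn].
have mg := cont3_measurable (continuous_cont3 cg).
have i2 := integrableZl measurableT (M * expR (3 * n%:R)) (integrable_damp (@pos3_one3 R)).
apply: le_integrable i2 => //; first exact/measurable_EFinP.
move=> x _ /=; rewrite lee_fin [leRHS]ger0_norm; last first.
  by rewrite mulr_ge0 ?damp_ge0// mulr_ge0 ?expR_ge0.
have [pn|pn] := leP (enorm (vec3 x)) n%:R; last first.
  by rewrite gn// normr0 mulr_ge0 ?damp_ge0// mulr_ge0 ?expR_ge0.
rewrite -mulrA -[leLHS]mulr1; apply: ler_pM => //; exact: damp_lower.
Qed.

End TestFunctions.

(** * Vanishing of the integral of a partial derivative *)

Section IntegrationByParts.
Variable R : realType.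
Local Notation mu := (@lebesgue_measure R).
Local Notation mR := (measurableTypeR R).
Local Notation T3 := (mR * mR * mR)%type.
Local Notation leb := (leb3 R).
Local Notation point := 'rV[R]_3.
Implicit Types (v : T3 -> R) (g : point -> R).

(** The fundamental theorem makes the signed integral vanish. It is recorded as an equality between
    positive and negative parts so that it can be integrated over the remaining variables by
    Tonelli. *)
Lemma integral_derivative_line (f f' : R -> R) (n : nat) :
  (forall s : R, is_derive s 1 f (f' s)) -> continuous f' ->
  (forall s, n%:R < `|s| -> f s = 0) -> (forall s, n%:R < `|s| -> f' s = 0) ->
  (\int[mu]_s (Num.max (f' s) 0)%:E = \int[mu]_s (Num.max (- f' s) 0)%:E)%E.
Proof.
move=> df cf' fn fn'.
(* One more than [n], since the vanishing hypotheses are strict and the end points must lie outside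
   the support. *)
pose L : R := n.+1%:R; have L0 : 0 < L by rewrite ltr0n.
have nL : n%:R < L by rewrite ltr_nat.
have cf : continuous f by move=> s; apply: derivable1_continuous; apply: ex_derive.
have z : (\int[mu]_(s in `[(- L)%R, L]) (f' s)%:E = 0)%E.
  rewrite (@continuous_FTC2 _ f' f); first 1 last.
  - by lra.
  - exact: continuous_subspaceT.
  - split.
    + by move=> s _; apply: ex_derive.
    + by apply: cvg_at_right_filter; exact: cf.
    + by apply: cvg_at_left_filter; exact: cf.
  - by move=> s _; rewrite derive1E; apply: derive_val.
  have e1 : f L = 0 by apply: fn; rewrite gtr0_norm.
  have e2 : f (- L) = 0 by apply: fn; rewrite normrN gtr0_norm.
  by rewrite e1 e2 -EFinD subrr.
have cmax (h : R -> R) : continuous h -> continuous (fun s => Num.max (h s) 0).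
  move=> ch s; apply: (@continuous_max _ _ h (fun=> 0)); first exact: ch.
  exact: cst_continuous.
have cN : continuous (fun s => - f' s) by move=> s; apply: cvgN; exact: cf'.
have restr (h : R -> R) : continuous h -> (forall s, 0 <= h s) -> (forall s, n%:R < `|s| -> h s = 0) ->
    (\int[mu]_s (h s)%:E = \int[mu]_(s in `[(- L)%R, L]) (h s)%:E)%E.
  move=> ch h0 hn; rewrite [RHS]integral_mkcond; apply: eq_integral => s _.
  rewrite patchE; case: ifPn => // /negP hs; rewrite hn//.
  rewrite ltNge; apply/negP => sn; apply: hs; rewrite inE/= in_itv/= -ler_norml.
  exact: le_trans (ltW nL).
rewrite !restr; first 1 last.
- exact: cmax.
- by move=> s; rewrite le_max lexx orbT.
- by move=> s sn; rewrite fn'// oppr0 maxxx.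
- exact: cmax.
- by move=> s; rewrite le_max lexx orbT.
- by move=> s sn; rewrite fn'// maxxx.
have int (h : R -> R) : continuous h -> mu.-integrable `[(- L)%R, L] (EFin \o h).
  move=> ch; apply: continuous_compact_integrable; first exact: segment_compact.
  exact: continuous_subspaceT.
transitivity (\int[mu]_(s in `[(- L)%R, L]) ((Num.max (- f' s) 0)%:E + (f' s)%:E))%E.
  apply: eq_integral => s _; rewrite -EFinD; congr (_%:E).
  by case: (leP (f' s) 0) => fs; case: (leP (- f' s) 0) => fs'; lra.
rewrite integralD//; last 2 first.
- exact: (int _ (cmax _ cN)).
- exact: int.
by rewrite z adde0.
Qed.

(** Together with [tonelli_perm1] and [leb3_tonelli], this offers an order of integration with any
    chosen coordinate innermost, where the one-dimensional result is applied. *)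
Lemma tonelli_perm2 v : measurable_fun setT v -> (forall x, 0 <= v x) ->
  (\int[leb]_x (v x)%:E = \int[mu]_a \int[mu]_c \int[mu]_b (v (a, b, c))%:E)%E.
Proof.
move=> mv v0; rewrite leb3_tonelli; last 2 first.
- exact/measurable_EFinP.
- by move=> x; rewrite lee_fin.
apply: eq_integral => a _; rewrite (@tonelli R _ _ mR mR mu mu (fun b c => v (a, b, c)))//.
apply: (measurableT_comp mv); apply: measurable_fun_pair; last exact: measurable_snd.
by apply: measurable_fun_pair; [exact: measurable_cst|exact: measurable_fst].
Qed.

Lemma tonelli_perm1 v : measurable_fun setT v -> (forall x, 0 <= v x) ->
  (\int[leb]_x (v x)%:E = \int[mu]_c \int[mu]_b \int[mu]_a (v (a, b, c))%:E)%E.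
Proof.
move=> mv v0.
have mE : measurable_fun setT (EFin \o v) by exact/measurable_EFinP.
rewrite (@fubini_tonelli2 _ _ _ _ R (leb2 R) mu (EFin \o v))//.
apply: eq_integral => c _.
rewrite /fubini_G (@fubini_tonelli2 _ _ _ _ R mu mu (fun p => (v (p, c))%:E))//.
- by apply/measurable_EFinP; exact: measurable_fun_pair1.
- by move=> x; rewrite lee_fin.
Qed.

Lemma integral_partial0 (j : 'I_3) g g' : ccs g -> ccs g' ->
  (forall p, is_derive p 'e_j g (g' p)) -> \int[leb]_x (g' (vec3 x)) = 0.
Proof.
move=> [cg [n gn]] cg' dg; have ig' := ccs_integrable cg'.
case: (cg') => cont' [n' gn'].
pose N := maxn n n'.
have Gn p : N%:R < enorm p -> g p = 0.
  by move=> h; apply: gn; apply: le_lt_trans h; rewrite ler_nat leq_maxl.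
have Gn' p : N%:R < enorm p -> g' p = 0.
  by move=> h; apply: gn'; apply: le_lt_trans h; rewrite ler_nat leq_maxr.
have line (w : R -> point) : (forall s s', w s' = (s' - s) *: 'e_j + w s) ->
    (forall s, `|s| <= enorm (w s)) ->
    (\int[mu]_s (Num.max (g' (w s)) 0)%:E = \int[mu]_s (Num.max (- g' (w s)) 0)%:E)%E.
  move=> wE wn; apply: (@integral_derivative_line (fun s => g (w s)) (fun s => g' (w s)) N).
  - move=> s; have /is_derive_line h := dg (w s).
    have ha : is_derive s 1 (fun y => y - s) 1.
      by apply: is_derive_eq (isdD (isd_id s) (isd_cst (- s) s 1)) _; rewrite addr0.
    rewrite -[g' (w s)]mulr1.
    rewrite (_ : (fun s0 => g (w s0)) = (fun y => (fun t => g (t *: 'e_j + w s)) (y - s))); last first.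
      by apply/funext => y; rewrite (wE s y).
    have h' : is_derive (s - s) 1 (fun t : R => g (t *: 'e_j + w s)) (g' (w s)) by rewrite subrr.
    exact: (@isd_comp R R (fun t => g (t *: 'e_j + w s)) (fun y => y - s) s 1 _ _ h' ha).
  - move=> s; apply: (@continuous_comp _ _ _ w g'); last exact: cont'.
    have -> : w = (fun y => (y - s) *: 'e_j + w s) by apply/funext => y; exact: wE.
    apply: cvgD; last exact: cvg_cst.
    apply: cvgZr_tmp; apply: cvgB; [exact: cvg_id|exact: cvg_cst].
  - by move=> s sN; apply: Gn; exact: lt_le_trans (wn s).
  - by move=> s sN; apply: Gn'; exact: lt_le_trans (wn s).
pose vp x := Num.max (g' (vec3 (R:=R) x)) 0; pose vm x := Num.max (- g' (vec3 (R:=R) x)) 0.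
have mg' : measurable_fun setT (g' \o vec3 (R:=R)) by exact: cont3_measurable (continuous_cont3 cont').
have mvp : measurable_fun setT vp by apply: measurable_maxr.
have mvm : measurable_fun setT vm by apply: measurable_maxr => //; exact: measurableT_comp.
have vp0 x : 0 <= vp x by rewrite le_max lexx orbT.
have vm0 x : 0 <= vm x by rewrite le_max lexx orbT.
suff E : (\int[leb]_x (vp x)%:E = \int[leb]_x (vm x)%:E)%E.
  rewrite /Rintegral integralE.
  have fp : (\int[leb]_x (fun x => (g' (vec3 x))%:E)^\+ x = \int[leb]_x (vp x)%:E)%E.
    by apply: eq_integral => x _; rewrite funeposE -EFin_max.
  have fm : (\int[leb]_x (fun x => (g' (vec3 x))%:E)^\- x = \int[leb]_x (vm x)%:E)%E.
    by apply: eq_integral => x _; rewrite funenegE -EFin_max.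
  rewrite fp fm E subee//.
  have := integrable_neg_fin_num measurableT ig'.
  by rewrite /= fm.
have enc x : [/\ `|x.1.1| <= enorm (vec3 (R:=R) x), `|x.1.2| <= enorm (vec3 (R:=R) x) & `|x.2| <= enorm (vec3 (R:=R) x)].
  have [e0 e1 e2] := vec3E x.
  by split; rewrite -?e0 -?e1 -?e2; exact: enorm_coord.
have ej k (c : R) i : (c *: 'e_k : point) 0 i = c * (i == k)%:R.
  by rewrite !mxE eqxx/= eq_sym.
move: j dg line; apply: (@forall3 (fun j => (forall p, is_derive p 'e_j g (g' p)) -> _ -> _)) => dg line.
- rewrite (tonelli_perm1 mvp vp0) (tonelli_perm1 mvm vm0); apply: eq_integral => c _; apply: eq_integral => b _.
  apply: (line (fun s => vec3 (s, b, c))).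
    move=> s s'; apply/rowP => i; rewrite [RHS]mxE ej.
    have [a0 a1 a2] := vec3E (s, b, c); have [b0 b1 b2] := vec3E (s', b, c).
    by move: i; apply: forall3; rewrite ?a0 ?a1 ?a2 ?b0 ?b1 ?b2/=; ring.
  by move=> s; have [] := enc (s, b, c).
- rewrite (tonelli_perm2 mvp vp0) (tonelli_perm2 mvm vm0); apply: eq_integral => a _; apply: eq_integral => c _.
  apply: (line (fun s => vec3 (a, s, c))).
    move=> s s'; apply/rowP => i; rewrite [RHS]mxE ej.
    have [a0 a1 a2] := vec3E (a, s, c); have [b0 b1 b2] := vec3E (a, s', c).
    by move: i; apply: forall3; rewrite ?a0 ?a1 ?a2 ?b0 ?b1 ?b2/=; ring.
  by move=> s; have [] := enc (a, s, c).
- have T (v : T3 -> R) : measurable_fun setT v -> (forall x, 0 <= v x) ->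
      (\int[leb]_p (v p)%:E = \int[mu]_x \int[mu]_y \int[mu]_z (v (x, y, z))%:E)%E.
    move=> mv v0; apply: (@leb3_tonelli R (fun p => (v p)%:E)); first exact/measurable_EFinP.
    by move=> x; rewrite lee_fin.
  rewrite (T _ mvp vp0) (T _ mvm vm0).
  apply: eq_integral => a _; apply: eq_integral => b _.
  apply: (line (fun s => vec3 (a, b, s))).
    move=> s s'; apply/rowP => i; rewrite [RHS]mxE ej.
    have [a0 a1 a2] := vec3E (a, b, s); have [b0 b1 b2] := vec3E (a, b, s').
    by move: i; apply: forall3; rewrite ?a0 ?a1 ?a2 ?b0 ?b1 ?b2/=; ring.
  by move=> s; have [] := enc (a, b, s).
Qed.

End IntegrationByParts.

(** * Regularised and truncated multiples of 1 / |x| *)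

Section Cutoff.
Variable R : realType.
Local Notation point := 'rV[R]_3.
Implicit Types (u w : point -> R) (p : point).

Lemma isd_coord (n : nat) (p v : 'rV[R]_n) i :
  is_derive p v (fun q : 'rV[R]_n => q 0 i) (v 0 i).
Proof.
apply/is_derive_line.
have -> : (fun t : R => (t *: v + p) 0 i) = (fun t => t * v 0 i + p 0 i).
  by apply/funext => t; rewrite !mxE.
by apply: is_derive_eq (isdD (isdM (isd_id (0 : R)) (isd_cst (v 0 i) (0 : R) (1 : R))) (isd_cst (p 0 i) (0 : R) (1 : R))) _; ring.
Qed.

Lemma isd_nsq p (j : 'I_3) : is_derive p 'e_j (@nsq R) (2 * p 0 j).
Proof.
have h i := isdX 2 (isd_coord p ('e_j) i).
apply: is_derive_eq (isdD (isdD (h 0) (h 1)) (h 2%:R)) _.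
by move: j {h}; apply: forall3; rewrite !mxE/=; ring.
Qed.

(** Squaring removes the corner: at 0 the difference quotient is 0 or [h]. This is what makes the
    cutoff continuously differentiable. *)
Lemma isd_maxsqr (x : R) : is_derive x 1 (fun t => Num.max 0 t ^+ 2) (2 * Num.max 0 x).
Proof.
move Em : (Num.max 0 x) => m; have [x0|x0|x0] := ltgtP x 0.
- rewrite -Em (max_l (ltW x0)) mulr0; apply: near_eq_is_derive (isd_cst 0 x 1).
  near=> y; rewrite max_l ?expr0n//; apply: ltW; near: y; exact: lt_nbhsl.
- rewrite -Em (max_r (ltW x0)); apply: near_eq_is_derive; last first.
    by apply: is_derive_eq (isdX 2 (isd_id x)) _; rewrite expr1 mulr1.
  near=> y; rewrite max_r//; apply: ltW; near: y; exact: lt_nbhsr.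
- rewrite -Em x0 maxxx mulr0.
  have l : h^-1 *: (Num.max 0 (h *: (1 : R) + 0) ^+ 2 - Num.max 0 0 ^+ 2) @[h --> (0 : R)^'] --> (0 : R).
    apply/cvgrPdist_le => e e0; near=> h.
    have h0 : h != 0 by near: h; exact: nbhs_dnbhs_neq.
    have he : `|h| <= e by near: h; apply: dnbhs0_le.
    rewrite sub0r normrN maxxx expr0n/= subr0 addr0 normrM [`|_ ^+ 2|]ger0_norm ?sqr_ge0//.
    rewrite [h *: 1]mulr1; apply: le_trans he.
    have [hn|hp] : h <= 0 \/ 0 < h by case: (leP h 0) => _; [left|right].
      by rewrite max_l// expr0n/= mulr0.
    by rewrite max_r ?(ltW hp)// normfV gtr0_norm// expr2 mulKf.
  by split; [apply/cvg_ex; exists 0|exact: cvg_lim].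
Unshelve. all: by end_near. Qed.

Variables (a b d : R) (n : nat).

(** Positive exactly inside radius [b]. The quotient [n cutM / (1 + n cutM)] is then an elementary
    cutoff that increases to 1 there as [n] grows, and [cutW] regularises [1 / (2 |x|)]. *)
Definition cutM p : R := Num.max 0 (b ^+ 2 - nsq p) ^+ 2.
Definition cutW p : R := (2 * Num.sqrt (nsq p + d ^+ 2))^-1.
Definition cutoff p : R := n%:R * cutM p / (1 + n%:R * cutM p) * cutW p.
Definition dcutoff (j : 'I_3) p : R :=
  (n%:R * (- 4 * Num.max 0 (b ^+ 2 - nsq p) * p 0 j)) / (1 + n%:R * cutM p) ^+ 2 * cutW p
  - n%:R * cutM p / (1 + n%:R * cutM p) * (2 * p 0 j * (4 * Num.sqrt (nsq p + d ^+ 2) ^+ 3)^-1).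

Hypotheses (b0 : 0 < b) (ba : b < a) (d0 : 0 < d).

Let cM_ge0 p : 0 <= cutM p. Proof. exact: sqr_ge0. Qed.
Let cM1 p : 0 < 1 + n%:R * cutM p.
Proof. by have := mulr_ge0 (ler0n R n) (cM_ge0 p); lra. Qed.
Let sd0 p : 0 < nsq p + d ^+ 2.
Proof. by rewrite ltr_wpDl ?nsq_ge0// exprn_gt0. Qed.
Let sd1 p : 0 < Num.sqrt (nsq p + d ^+ 2). Proof. by rewrite sqrtr_gt0. Qed.

Lemma cutW_gt0 p : 0 < cutW p.
Proof. by rewrite invr_gt0 mulr_gt0. Qed.

Lemma cutoff_ge0 p : 0 <= cutoff p.
Proof.
apply: mulr_ge0; last exact: ltW (cutW_gt0 p).
by apply: divr_ge0; [exact: mulr_ge0|exact: ltW].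
Qed.

Lemma cutoff_le p : cutoff p <= cutW p.
Proof.
rewrite /cutoff ler_piMl// ?(ltW (cutW_gt0 p))//.
by rewrite ler_pdivrMr// mul1r lerDr ler01.
Qed.

Lemma cutM_out p : b <= enorm p -> cutM p = 0 /\ Num.max 0 (b ^+ 2 - nsq p) = 0.
Proof.
move=> bp; have h : b ^+ 2 - nsq p <= 0.
  by rewrite -enorm_sqr subr_le0 ler_pXn2r// nnegrE ?sqrtr_ge0// ltW.
by rewrite /cutM max_l// expr0n.
Qed.

Lemma cutoff_out p : b <= enorm p -> cutoff p = 0.
Proof. by move=> /cutM_out[h _]; rewrite /cutoff h mulr0 !mul0r. Qed.

Lemma dcutoff_out j p : b <= enorm p -> dcutoff j p = 0.
Proof. by move=> /cutM_out[h h']; rewrite /dcutoff h h' !(mulr0, mul0r) subr0. Qed.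

Lemma isd_cutoff p (j : 'I_3) : is_derive p 'e_j cutoff (dcutoff j p).
Proof.
have hM : is_derive p 'e_j cutM (- 4 * Num.max 0 (b ^+ 2 - nsq p) * p 0 j).
  have h := isdD (isd_cst (b ^+ 2) p 'e_j) (isdN (isd_nsq p j)).
  by apply: is_derive_eq (isd_comp (isd_maxsqr _) h) _; ring.
have hW : is_derive p 'e_j cutW (- (2 * p 0 j * (4 * Num.sqrt (nsq p + d ^+ 2) ^+ 3)^-1)).
  have h := @isd_comp R _ Num.sqrt (fun q => nsq q + d ^+ 2) p ('e_j) _ _ (isd_sqrt (sd0 p)) (isdD (isd_nsq p j) (isd_cst (d ^+ 2) p 'e_j)).
  have n0 : 2 * Num.sqrt (nsq p + d ^+ 2) != 0 by rewrite lt0r_neq0// mulr_gt0.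
  have h2 := @isdV R _ (fun q => 2 * Num.sqrt (nsq q + d ^+ 2)) p ('e_j) _ n0 (isdM (isd_cst 2 p 'e_j) h).
  apply: is_derive_eq h2 _.
  by have := lt0r_neq0 (sd1 p) => s0; field.
have hnM := isdM (isd_cst n%:R p 'e_j) hM.
have := lt0r_neq0 (cM1 p) => c0.
have hI := @isdV R _ (fun q => 1 + n%:R * cutM q) p ('e_j) _ c0 (isdD (isd_cst 1 p 'e_j) hnM).
apply: is_derive_eq (isdM (isdM hnM hI) hW) _.
move: c0; rewrite /dcutoff; move: (cutW p) ((4 * _ ^+ 3)^-1) (cutM p) (Num.max _ _) (p 0 j) (n%:R : R) => W S M X q N c0.
by field.
Qed.

Let cc u w : continuous u -> continuous w -> continuous (fun p => u p * w p).
Proof. by move=> cu cw p; exact: (cvgM (cu p) (cw p)). Qed.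
Let ca u w : continuous u -> continuous w -> continuous (fun p => u p + w p).
Proof. by move=> cu cw p; exact: (cvgD (cu p) (cw p)). Qed.
Let cn u : continuous u -> continuous (fun p => - u p).
Proof. by move=> cu p; exact: (cvgN (cu p)). Qed.
Let ci u : continuous u -> (forall p, u p != 0) -> continuous (fun p => (u p)^-1).
Proof. by move=> cu u0 p; exact: (cvgV (u0 p) (cu p)). Qed.
Let ck (c : R) : continuous (fun _ : point => c). Proof. exact: cst_continuous. Qed.
Let cmax : continuous (fun p => Num.max 0 (b ^+ 2 - nsq p)).
Proof.
move=> p; apply: (@continuous_max _ _ (fun=> 0) (fun p => b ^+ 2 - nsq p)); first exact: ck.
by apply: (ca (@ck _) (cn _)); exact: continuous_nsq.
Qed.
Let cM : continuous cutM.
Proof.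
have -> : cutM = (fun p => Num.max 0 (b ^+ 2 - nsq p) * Num.max 0 (b ^+ 2 - nsq p)).
  by apply/funext => p; rewrite /cutM expr2.
exact: cc.
Qed.
Let cS : continuous (fun p => Num.sqrt (nsq p + d ^+ 2)).
Proof.
move=> p; apply: (@continuous_comp _ _ _ (fun p => nsq p + d ^+ 2) Num.sqrt).
  by apply: (ca _ (@ck _)); exact: continuous_nsq.
exact: sqrt_continuous.
Qed.
Let cW : continuous cutW.
Proof. by apply: ci; [exact: cc|move=> p; rewrite lt0r_neq0// mulr_gt0]. Qed.
Let cI : continuous (fun p => (1 + n%:R * cutM p)^-1).
Proof. by apply: ci => [|p]; [exact: (ca (@ck _) (cc (@ck _) cM))|rewrite lt0r_neq0]. Qed.

Lemma continuous_cutoff : continuous cutoff.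
Proof. exact: (cc (cc (cc (@ck _) cM) cI) cW). Qed.

Lemma continuous_dcutoff j : continuous (dcutoff j).
Proof.
have cj : continuous (fun p : point => p 0 j) by exact: continuous_coord.
have e u : (fun p => u p ^+ 2) = (fun p => u p * u p) by apply/funext => p; rewrite expr2.
have e3 u : (fun p => u p ^+ 3) = (fun p => u p * u p * u p).
  by apply/funext => p; rewrite !exprS expr0 mulr1 mulrA.
apply: ca; last apply: cn.
  apply: cc => //; apply: cc; first exact: (cc (@ck _) (cc (cc (@ck _) cmax) cj)).
  apply: ci => [|p]; last by rewrite lt0r_neq0// exprn_gt0.
  by rewrite e; apply: cc; exact: (ca (@ck _) (cc (@ck _) cM)).
apply: cc; first exact: (cc (cc (@ck _) cM) cI).
apply: cc; first exact: (cc (@ck _) cj).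
apply: ci => [|p]; last by rewrite lt0r_neq0// mulr_gt0// exprn_gt0.
by apply: (cc (@ck _)); rewrite e3; exact: (cc (cc cS cS) cS).
Qed.

Lemma out_cases p : enorm p < a \/ b < enorm p.
Proof. by have [h|h] := ltP (enorm p) a; [left|right; exact: lt_le_trans h]. Qed.

Lemma near_out p : b < enorm p -> \forall q \near p, b < enorm q.
Proof. by move=> bp; exact: (@continuous_enorm R p _ (lt_nbhsr bp)). Qed.

(** The fields are controlled only inside radius [a]. Because [b < a], the two open conditions of
    [out_cases] cover the space, and near a point of the outer one the product is identically 0. *)
Lemma ccs_mul u w : (forall p, enorm p < a -> {for p, continuous u}) -> continuous w ->
  (forall p, b <= enorm p -> w p = 0) -> ccs (fun p => u p * w p).
Proof.
move=> cu cw w0; split; last first.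
  exists (Num.bound b) => p mp; rewrite w0 ?mulr0//.
  by apply: le_trans (ltW mp); apply: ltW; apply: archi_boundP; exact: ltW.
move=> p; have [pa|bp] := out_cases p; first exact: (cvgM (cu p pa) (cw p)).
rewrite /continuous_at w0 ?mulr0 ?ltW//.
have H : \forall q \near p, u q * w q = 0.
  by apply: filterS (near_out bp) => q bq /=; rewrite w0 ?mulr0// ltW.
exact: (@cvg_near_cst point R 0 (fun q => u q * w q) (nbhs p) (nbhs_filter p) H).

Qed.

Lemma isd_mul_out u w p (v : point) du dw :
  (enorm p < a -> is_derive p v u du) -> is_derive p v w dw ->
  (forall p, b <= enorm p -> w p = 0) ->
  is_derive p v (fun p => u p * w p) (du * w p + u p * dw).
Proof.
move=> hu hw w0; have [pa|bp] := out_cases p; first exact: isdM (hu pa) hw.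
have dw0 : dw = 0.
  rewrite -(@derive_val _ _ _ p v w dw hw).
  have h : is_derive p v w 0.
    apply: (@near_eq_is_derive _ _ _ (fun=> 0) w p v 0).
    by apply: filterS (near_out bp) => q bq /=; rewrite w0// ltW.
  exact: derive_val.
rewrite dw0 w0 ?(ltW bp)// !mulr0 addr0.
apply: (@near_eq_is_derive _ _ _ (fun=> 0) (fun p => u p * w p) p v 0).
by apply: filterS (near_out bp) => q bq /=; rewrite w0 ?mulr0// ltW.
Qed.

(** Each [|x_i| + d] is at most twice [sqrt (|x|^2 + d^2)], hence so is the product of the three
    cube roots; that double is the inverse of [cutW], which explains the 2 in its definition. *)
Lemma cutoff_cbrt3 (x : R * R * R) : cutoff (vec3 x) * cbrt3 d x <= 1.
Proof.
have e0 := cbrt_ge0; have [c0 c1 c2] := vec3E x.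
pose s := Num.sqrt (nsq (vec3 x) + d ^+ 2).
have hn : nsq (vec3 x) = x.1.1 ^+ 2 + x.1.2 ^+ 2 + x.2 ^+ 2 by rewrite /nsq c0 c1 c2.
have s2 : s ^+ 2 = nsq (vec3 x) + d ^+ 2 by rewrite sqr_sqrtr// ltW.
have s0 : 0 < s by exact: sd1.
have bnd (z : R) : z ^+ 2 <= nsq (vec3 x) -> cbrt (`|z| + d) <= cbrt (2 * s).
  move=> zx; apply: ler_cbrt; first by rewrite addr_ge0// ltW.
  have zs : `|z| <= s.
    rewrite -ler_sqr ?nnegrE// ?(ltW s0)// real_normK ?num_real// s2.
    by have := sqr_ge0 d; lra.
  have ds : d <= s by rewrite -ler_sqr ?nnegrE ?(ltW s0) ?(ltW d0)// s2 lerDr nsq_ge0.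
  lra.
have q1 := sqr_ge0 x.1.1; have q2 := sqr_ge0 x.1.2; have q3 := sqr_ge0 x.2.
have h : cbrt3 d x <= 2 * s.
  have -> : 2 * s = cbrt (2 * s) * cbrt (2 * s) * cbrt (2 * s).
    by rewrite -expr2 -exprSr cbrtK// mulr_ge0// ltW.
  have b1 := bnd x.1.1; have b2 := bnd x.1.2; have b3 := bnd x.2.
  rewrite hn in b1 b2 b3; rewrite /cbrt3.
  by apply: (ler_pM (mulr_ge0 (e0 _ _) (e0 _ _)) (e0 _ _) (ler_pM (e0 _ _) (e0 _ _) _ _) _);
    [apply: b1|apply: b2|apply: b3]; lra.
have cb0 : 0 <= cbrt3 d x by rewrite /cbrt3; exact: (mulr_ge0 (mulr_ge0 (e0 _ _) (e0 _ _)) (e0 _ _)).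
apply: (@le_trans _ _ (cutW (vec3 x) * (2 * s))).
  apply: ler_pM => //; [exact: cutoff_ge0|exact: cutoff_le].
by rewrite /cutW -/s mulVf// lt0r_neq0// mulr_gt0.
Qed.

End Cutoff.

(** * Lower bounds for integrals of radial functions *)

Section Radial.
Variable R : realType.
Local Notation mu := (@lebesgue_measure R).
Local Notation mR := (measurableTypeR R).
Local Notation T3 := (mR * mR * mR)%type.
Local Notation leb := (leb3 R).
Local Notation point := 'rV[R]_3.
Implicit Types (F : R -> R).

(* The substitution [rho = sqrt (s^2 + z^2)] has derivative at most 1. *)
Lemma integral_tail_le F (s : R) (m : nat) : 0 < s -> continuous F -> (forall x, 0 <= F x) ->
  (forall x, m%:R < x -> F x = 0) ->
  (\int[mu]_(c in `[s, +oo[) (F c)%:E <= \int[mu]_c (F (Num.sqrt (s ^+ 2 + c ^+ 2)))%:E)%E.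
Proof.
move=> s0 cF F0 Fm.
pose u (z : R) : R := Num.sqrt (s ^+ 2 + z ^+ 2).
have p0 z : 0 < s ^+ 2 + z ^+ 2 by rewrite ltr_wpDr ?sqr_ge0// exprn_gt0.
have u0 z : 0 < u z by rewrite sqrtr_gt0.
have du (z : R) : is_derive z 1 u (z / u z).
  have h := @isd_comp R R Num.sqrt (fun z : R => s ^+ 2 + z ^+ 2) z (1 : R) _ _ (isd_sqrt (p0 z))
    (isdD (isd_cst (s ^+ 2) z (1:R)) (isdX 2 (isd_id z))).
  by apply: is_derive_eq h _; have := lt0r_neq0 (u0 z); rewrite /u => ?; field.
have cu : continuous u by move=> z; apply: derivable1_continuous; apply: ex_derive.
have u'E : derive1 u = (fun z => z / u z) by apply/funext => z; rewrite derive1E; exact: derive_val.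
have cu' : continuous (fun z : R => z / u z).
  by move=> z; apply: cvgM; [exact: cvg_id|exact: (cvgV (lt0r_neq0 (u0 z)) (cu z))].
(* Since [u L >= L > m], the integrand vanishes beyond [u L] and the half-line can be cut there. *)
pose L : R := m.+1%:R; have L0 : 0 < L by rewrite ltr0n.
have E := @integration_by_substitution_increasing R u F 0 L (ltW L0).
have uz : u 0 = s by rewrite /u expr0n addr0 sqrtr_sqr gtr0_norm.
have uL : m%:R < u L.
  apply: (@lt_le_trans _ _ L); first by rewrite ltr_nat.
  rewrite -{1}(gtr0_norm L0) -sqrtr_sqr ler_sqrt ?(ltW (p0 _))//.
  by rewrite lerDr sqr_ge0.
have cFu : continuous (fun c : R => F (u c)).
  by move=> c; apply: (@continuous_comp _ _ _ u F); [exact: cu|exact: cF].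
have mF : measurable_fun setT (EFin \o F) by apply/measurable_EFinP; exact: continuous_measurable_fun.
have mFu : measurable_fun setT (fun c : R => (F (u c))%:E).
  by apply/measurable_EFinP; exact: continuous_measurable_fun.
apply: (@le_trans _ _ (\int[mu]_(c in `[u 0%R, u L]) (F c)%:E)%E).
  apply: ge0_integral_le_supp => //; try by move=> x; rewrite lee_fin.
  move=> x /=; rewrite !in_itv/= andbT uz => sx; rewrite sx/= => xL; rewrite Fm//.
  by rewrite (lt_trans uL)// ltNge; apply/negP.
rewrite E; first last.
- exact: continuous_subspaceT.
- split.
  + by move=> x _; apply: ex_derive.
  + by apply: cvg_at_right_filter; exact: cu.
  + by apply: cvg_at_left_filter; exact: cu.
- by rewrite u'E; apply/cvg_ex; exists (L / u L); apply: cvg_at_left_filter; exact: cu'.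
- by rewrite u'E; apply/cvg_ex; exists (0 / u 0); apply: cvg_at_right_filter; exact: cu'.
- by move=> z _; rewrite u'E; exact: cu'.
- move=> x y; rewrite !in_itv/= => /andP[x0 _] /andP[y0 _] xy.
  rewrite /u ltr_sqrt// ltrD2l ltr_pXn2r// nnegrE//.
apply: (@le_trans _ _ (\int[mu]_(c in `[0%R, L]) (F (u c))%:E)%E).
  apply: ge0_le_integral => //.
  - move=> c /=; rewrite in_itv/= => /andP[c0 _].
    by rewrite lee_fin u'E; apply: mulr_ge0; [exact: F0|apply: divr_ge0 => //; exact: ltW].
  - apply: measurable_funTS; apply/measurable_EFinP; apply: continuous_measurable_fun; rewrite u'E => c.
    by apply: cvgM; [exact: cFu|exact: cu'].
  - exact: measurable_funTS.
  - move=> c /=; rewrite in_itv/= => /andP[c0 _]; rewrite lee_fin u'E.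
    apply: ler_piMr; first exact: F0.
    rewrite ler_pdivrMr// mul1r -{1}(ger0_norm c0) -sqrtr_sqr ler_sqrt ?(ltW (p0 _))//.
    by rewrite lerDr sqr_ge0.
by apply: ge0_subset_integral => // c _; rewrite lee_fin.
Qed.

Lemma enorm_triple (x : T3) :
  enorm (vec3 x) = Num.sqrt (Num.sqrt (x.1.1 ^+ 2 + x.1.2 ^+ 2) ^+ 2 + x.2 ^+ 2).
Proof.
have [c0 c1 c2] := vec3E x; rewrite enormE /nsq c0 c1 c2 sqr_sqrtr//.
by rewrite addr_ge0 ?sqr_ge0.
Qed.

(** A substitute for polar coordinates, with a smaller constant. For fixed positive [(p1, p2)],
    [integral_tail_le] trades the third coordinate for a radius [c] beyond [s = sqrt (p1^2 + p2^2)].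
    The condition [p1, p2 <= c / 2] ensures [c >= s], and its cross-section at fixed [c] is a square
    of area [(c / 2) ^+ 2]. *)
Lemma radial_lower F (m : nat) : continuous F -> (forall x, 0 <= F x) ->
  (forall x, m%:R < x -> F x = 0) ->
  (\int[mu]_(c in `[0%R, +oo[) (F c * (c / 2) ^+ 2)%:E <=
   \int[leb]_x (F (enorm (vec3 x)))%:E)%E.
Proof.
move=> cF F0 Fm.
pose v (x : T3) : R := F x.2 * (0 < x.1.1 <= x.2 / 2)%R%:R * (0 < x.1.2 <= x.2 / 2)%R%:R.
have v0 x : 0 <= v x by apply: mulr_ge0 => //; apply: mulr_ge0.
have mb (f : T3 -> R) : measurable_fun setT f ->
    measurable_fun setT (fun x : T3 => (0 < f x <= x.2 / 2)%R%:R : R).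
  move=> mf; apply: measurable_indicb.
  have m2 : measurable_fun setT (fun x : T3 => x.2 / 2 : R).
    by apply: measurable_funM; [exact: measurable_c3|exact: measurable_cst].
  by apply: measurable_and; [exact: measurable_fun_ltr|exact: measurable_fun_ler].
have mF : measurable_fun setT F by exact: continuous_measurable_fun.
have mv : measurable_fun setT v.
  have m1 := mb _ (@measurable_c1 R); have m2 := mb _ (@measurable_c2 R).
  have m3 := measurableT_comp mF (@measurable_c3 R).
  exact: (measurable_funM (measurable_funM m3 m1) m2).
have mW : measurable_fun setT (fun x : T3 => F (enorm (vec3 x))).
  apply: cont3_measurable; apply: (@continuous_cont3 R (fun p => F (enorm p))) => p.
  by apply: (@continuous_comp _ _ _ (@enorm R 3) F); [exact: continuous_enorm|exact: cF].
apply: (@le_trans _ _ (\int[leb]_x (v x)%:E)%E).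
  rewrite (tonelli_perm1 mv v0) integral_mkcond.
  rewrite le_eqVlt; apply/orP; left; apply/eqP; apply: eq_integral => c _.
  rewrite patchE; case: ifPn => [/set_mem/=|/negP cn]; last first.
    rewrite integral0_eq// => b _; apply: integral0_eq => a _; rewrite /v/=.
    case: (boolP (0 < b <= c / 2)%R) => [/andP[b0 bc]|_]; last by rewrite mulr0.
    by case: cn; apply/mem_set; rewrite /= in_itv/= andbT; lra.
  rewrite in_itv/= andbT => c0.
  have Ib : (\int[mu]_b ((0 < b <= c / 2)%R%:R : R)%:E = (c / 2)%:E)%E.
    transitivity (\int[mu]_(b in `]0%R, (c / 2)%R]) (cst 1%:E b))%E.
      rewrite [RHS]integral_mkcond; apply: eq_integral => b _; rewrite patchE.
      case: ifPn => [/set_mem/=|/negP h]; first by rewrite in_itv/= => ->.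
      by case: (boolP (0 < b <= c / 2)%R) => // bc; case: h; apply/mem_set; rewrite /= in_itv.
    rewrite (integral_cst mu)//= lebesgue_measure_itv/= lte_fin mul1e.
    case: ltP => [_|h]; first by rewrite oppr0 adde0.
    by congr (_%:E); apply/eqP; rewrite eq_le h divr_ge0.
  have mi : measurable_fun setT (fun b : mR => ((0 < b <= c / 2)%R%:R : R)%:E).
    apply/measurable_EFinP; apply: measurable_indicb; apply: measurable_and.
      exact: measurable_fun_ltr.
    exact: measurable_fun_ler.
  transitivity (\int[mu]_b ((F c * (c / 2))%:E * ((0 < b <= c / 2)%R%:R : R)%:E))%E.
    rewrite ge0_integralZl//; last first.
      by rewrite lee_fin; apply: mulr_ge0 => //; apply: divr_ge0.
    by rewrite Ib -EFinM expr2 mulrA.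
  apply: eq_integral => b _.
  transitivity (\int[mu]_a ((F c * (0 < b <= c / 2)%R%:R)%:E * ((0 < a <= c / 2)%R%:R : R)%:E))%E.
    rewrite ge0_integralZl//; last by rewrite lee_fin; exact: mulr_ge0.
    by rewrite Ib -!EFinM mulrAC.
  by apply: eq_integral => a _; rewrite -EFinM /v/= mulrAC.
have T (f : T3 -> R) : measurable_fun setT f -> (forall x, 0 <= f x) ->
    (\int[leb]_x (f x)%:E = \int[leb2 R]_p \int[mu]_c (f (p, c))%:E)%E.
  move=> mf f0; apply: (@fubini_tonelli1 _ _ _ _ R (leb2 R) mu (EFin \o f)); first exact/measurable_EFinP.
  by move=> x; rewrite lee_fin.
rewrite (T _ mv v0) (T _ mW (fun x => F0 _)).
have mt (f : T3 -> R) : measurable_fun setT f -> (forall x, 0 <= f x) ->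
    measurable_fun setT (fun p => \int[mu]_c (f (p, c))%:E)%E.
  move=> mf f0; apply: (@measurable_tonelli R _ _ _ _ mu (fun p c => f (p, c))) => //.
  by have -> : (fun p : T3 => f (p.1, p.2)) = f by apply/funext => -[].
apply: ge0_le_integral => //.
- by move=> p _; apply: integral_ge0 => c _; rewrite lee_fin.
- exact: (mt _ mv v0).
- exact: (mt _ mW (fun x => F0 _)).
move=> [p1 p2] _.
have [p10|p10] := boolP (0 < p1)%R; last first.
  rewrite integral0_eq; first by apply: integral_ge0 => c _; rewrite lee_fin.
  by move=> c _; rewrite /v/= (negbTE p10)/= mulr0 mul0r.
have [p20|p20] := boolP (0 < p2)%R; last first.
  rewrite integral0_eq; first by apply: integral_ge0 => c _; rewrite lee_fin.
  by move=> c _; rewrite /v/= (negbTE p20)/= mulr0.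
pose s : R := Num.sqrt (p1 ^+ 2 + p2 ^+ 2).
have s0 : 0 < s by rewrite sqrtr_gt0 addr_gt0// exprn_gt0.
have := integral_tail_le s0 cF F0 Fm.
under [X in (_ <= X)%E -> _]eq_integral => c _ do rewrite -(enorm_triple (p1, p2, c)).
have pp : measurable_fun setT (fun c : mR => ((p1, p2), c)) by exact: measurable_fun_pair.
apply: le_trans; apply: ge0_integral_le_supp => //.
- by apply/measurable_EFinP; exact: (measurableT_comp mv pp).
- exact/measurable_EFinP.
- by move=> c; rewrite lee_fin.
- move=> c _ _; rewrite lee_fin /v/=.
  by case: (0 < p1 <= c / 2); case: (0 < p2 <= c / 2); rewrite /= ?mulr1 ?mulr0 ?mul0r.
- move=> c _ /= sc; congr (_%:E); rewrite /v/=.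
  case: (boolP (0 < p1 <= c / 2)%R) => [/andP[_ h1]|_]; last by rewrite mulr0 mul0r.
  case: (boolP (0 < p2 <= c / 2)%R) => [/andP[_ h2]|_]; last by rewrite mulr0.
  exfalso; apply: sc; rewrite in_itv/= andbT.
  have c0 : 0 < c by lra.
  rewrite -(gtr0_norm c0) -sqrtr_sqr ler_sqrt ?sqr_ge0//.
  have e1 : p1 ^+ 2 <= (c / 2) ^+ 2 by rewrite ler_pXn2r// nnegrE; lra.
  have e2 : p2 ^+ 2 <= (c / 2) ^+ 2 by rewrite ler_pXn2r// nnegrE; lra.
  have := sqr_ge0 c; rewrite !expr_div_n in e1 e2 *; lra.
Qed.

End Radial.

(** * Hardy's inequality for the orders 1/2 and 3/2 *)

Section Hardy.
Variable R : realType.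
Local Notation mu := (@lebesgue_measure R).
Local Notation mR := (measurableTypeR R).
Local Notation T3 := (mR * mR * mR)%type.
Local Notation leb := (leb3 R).
Local Notation point := 'rV[R]_3.
Local Notation v3 := (vec3 (R:=R)).
Implicit Types (g f h A B phi eta : point -> R) (q : T3).

Lemma Kd_gt0 : 0 < Kd R.
Proof.
have p0 := pi_gt0 R.
rewrite /Kd /Kw; apply: mulr_gt0; first by rewrite exprn_gt0// expR_gt0.
by apply: mulr_gt0 => //; apply: exprn_gt0; lra.
Qed.

(** Common core of the two orders: [phi] is paired with [h], the transform of [eta] dominates the
    dual norm of [phi], and [w] is the energy density. Young's parameter [Kd R] turns duality into
    [I <= Kd N / 2 + I / 2], where the last term is absorbed because [I] is finite. *)
Lemma hardy_abs h A B (s d N : R) phi eta w :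
  L2fun h -> fourier h A B -> ccs phi -> ccs eta -> ccs w -> 0 < d ->
  (forall x, 0 <= w (v3 x)) ->
  (\int[leb]_q ((1 + nsq3 q) `^ s * (A (vec3 q) ^+ 2 + B (vec3 q) ^+ 2))%:E <= N%:E)%E ->
  (forall q, (1 + nsq3 q) `^ (- s) * (Ct (phi \o v3) q ^+ 2 + St (phi \o v3) q ^+ 2) <=
     (japanese q)^-1 * (Ct (eta \o v3) q ^+ 2 + St (eta \o v3) q ^+ 2)) ->
  (forall x, eta (v3 x) ^+ 2 * cbrt3 d x <= w (v3 x)) ->
  `|\int[leb]_x (h (vec3 x) * phi (vec3 x))| = \int[leb]_x w (vec3 x) ->
  (\int[leb]_x w (vec3 x)) <= Kd R * N.
Proof.
move=> hh hF cphi ceta cw d0 w0 hN hT hw hI.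
have [M M0 phiM] := ccs_bounded cphi; have [cphi' [n0 phin]] := cphi.
have iphi := ccs_integrable cphi; have ieta := ccs_integrable ceta.
have iw := ccs_integrable cw.
set I := \int[leb]_x w (vec3 x).
have I0 : 0 <= I by apply: Rintegral_ge0 => x _.
have k0 := Kd_gt0.
have mCS : forall v : T3 -> R, leb.-integrable setT (EFin \o v) ->
    measurable_fun setT (fun q => Ct v q ^+ 2 + St v q ^+ 2).
  move=> v iv; apply: measurable_funD; apply: measurable_funX;
    [exact: measurable_Ct|exact: measurable_St].
have mj : measurable_fun setT (fun q : T3 => nsq3 q).
  by rewrite /nsq3; apply: measurable_funD; [apply: measurable_funD|]; apply: measurable_funX;
    [exact: measurable_c1|exact: measurable_c2|exact: measurable_c3].
have mj1 : measurable_fun setT (fun q : T3 => 1 + nsq3 q).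
  by apply: measurable_funD => //; exact: measurable_cst.
have mjap : measurable_fun setT (fun q : T3 => (japanese q)^-1).
  have -> : (fun q : T3 => (japanese q)^-1) = (fun q => (1 + nsq3 q) `^ (- 2^-1)).
    apply/funext => q; rewrite powRN powR12_sqrt//.
    by rewrite addr_ge0// nsq3_ge0.
  exact: (measurableT_comp (measurable_powR _) mj1).
have hQ : (\int[leb]_q ((1 + nsq3 q) `^ (- s) * (Ct (phi \o v3) q ^+ 2 + St (phi \o v3) q ^+ 2))%:E
   <= (Kd R * I)%:E)%E.
  apply: (@le_trans _ _ (\int[leb]_q ((japanese q)^-1 * (Ct (eta \o v3) q ^+ 2 + St (eta \o v3) q ^+ 2))%:E)%E).
    apply: ge0_le_integral => //.
    - by move=> q _; rewrite lee_fin mulr_ge0 ?powR_ge0// addr_ge0 ?sqr_ge0.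
    - apply/measurable_EFinP; apply: measurable_funM; last exact: mCS.
      exact: (measurableT_comp (measurable_powR _) mj1).
    - by apply/measurable_EFinP; apply: measurable_funM => //; exact: mCS.
    - by move=> q _; rewrite lee_fin.
  apply: le_trans (weighted_transform d0 ieta) _.
  rewrite (EFinM (Kd R) I); apply: lee_wpmul2l; first by rewrite lee_fin ltW.
  rewrite /I /Rintegral fineK; last exact: integrable_fin_num.
  apply: ge0_le_integral => //.
  - move=> x _; rewrite lee_fin; apply: mulr_ge0; first exact: sqr_ge0.
    by apply: mulr_ge0; [apply: mulr_ge0|]; exact: cbrt_ge0.
  - apply/measurable_EFinP; apply: measurable_funM.
      by apply: measurable_funX; exact: cont3_measurable (continuous_cont3 ceta.1).
    have mc (f : T3 -> R) : measurable_fun setT f -> measurable_fun setT (fun x => cbrt (`|f x| + d)).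
      move=> mf; apply: (measurableT_comp (measurable_powR _)); apply: measurable_funD.
        exact: measurableT_comp.
      exact: measurable_cst.
    by rewrite /cbrt3; apply: measurable_funM; [apply: measurable_funM|]; apply: mc;
      [exact: measurable_c1|exact: measurable_c2|exact: measurable_c3].
  - by apply/measurable_EFinP; exact: cont3_measurable (continuous_cont3 cw.1).
  - by move=> x _; rewrite lee_fin; exact: hw.
have := @duality_bound R h A B s (phi \o v3) M n0 (Kd R) N _ hh hF iphi (fun x => phiM _)
  (continuous_cont3 cphi') _ k0 hN hQ.
rewrite /= hI -/I => /(_ _).
have phin' (x : T3) : phi (v3 x) != 0 -> enorm (v3 x) <= n0%:R.
  by move=> px; rewrite leNgt; apply/negP => /phin e; rewrite e eqxx in px.
move=> /(_ phin').
have -> : (2 * Kd R)^-1 * (Kd R * I) = I / 2 by have := lt0r_neq0 k0 => ?; field.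
by lra.
Qed.

Lemma edot_continuous (y : point) : continuous (fun p : point => edot p y).
Proof.
have -> : (fun p : point => edot p y) = (fun p : point => p 0 0 * y 0 0 + p 0 1 * y 0 1 + p 0 2%:R * y 0 2%:R).
  by apply/funext => p; rewrite /edot sum3.
have h (i : 'I_3) : continuous (fun p : point => p 0 i * y 0 i).
  by move=> p; apply: (cvgM (@continuous_coord R 3 i p) (cvg_cst _)).
by move=> p; exact: (cvgD (cvgD (h 0 p) (h 1 p)) (h 2%:R p)).
Qed.

Lemma isd_edot (p y : point) j : is_derive p 'e_j (fun p : point => edot p y) (y 0 j).
Proof.
have -> : (fun p : point => edot p y) = (fun p : point => \sum_i (p 0 i * y 0 i)) by [].
have h i := isdM (isd_coord p ('e_j) i) (isd_cst (y 0 i) p ('e_j)).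
apply: is_derive_eq (isd_sum h) _.
rewrite (bigD1 j)//= big1 ?addr0; first by rewrite !mxE !eqxx/= mulr0 addr0 mul1r.
by move=> i ij; rewrite !mxE eqxx/= (negbTE ij) mul0r mulr0 addr0.
Qed.

(** The product of [eta] with the cosine, respectively the sine, of [edot p y] has compact support,
    so its partial derivative integrates to 0. *)
Lemma transform_derivative eta phi (j : 'I_3) q : ccs eta -> ccs phi ->
  (forall p, is_derive p 'e_j eta (phi p)) ->
  Ct (phi \o v3) q = v3 q 0 j * St (eta \o v3) q /\
  St (phi \o v3) q = - (v3 q 0 j * Ct (eta \o v3) q).
Proof.
move=> ceta cphi deta; set y := v3 q.
have hE x : dot3 x q = edot (v3 x) y.
  by rewrite edot_vec3.
have iphi := ccs_integrable cphi; have ieta := ccs_integrable ceta.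
have cE := @edot_continuous y.
have ccsM (u v : point -> R) : ccs u -> continuous v -> ccs (fun p => u p * v p).
  move=> [cu [n un]] cv; split; first by move=> p; exact: (cvgM (cu p) (cv p)).
  by exists n => p /un ->; rewrite mul0r.
have cC : continuous (fun p => cos (edot p y)).
  by move=> p; apply: (@continuous_comp _ _ _ (fun p => edot p y) cos); [exact: cE|exact: continuous_cos].
have cS : continuous (fun p => sin (edot p y)).
  by move=> p; apply: (@continuous_comp _ _ _ (fun p => edot p y) sin); [exact: cE|exact: continuous_sin].
have ccsD (u v : point -> R) : ccs u -> ccs v -> ccs (fun p => u p + v p).
  move=> [cu [n un]] [cv [m vm]]; split; first by move=> p; exact: (cvgD (cu p) (cv p)).
  exists (maxn n m) => p hp.
  have h1 : n%:R < enorm p by apply: le_lt_trans hp; rewrite ler_nat leq_maxl.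
  have h2 : m%:R < enorm p by apply: le_lt_trans hp; rewrite ler_nat leq_maxr.
  by rewrite un// vm// addr0.
have ccsN (c : R) (u : point -> R) : ccs u -> ccs (fun p => u p * c).
  have ck : continuous (fun _ : point => c) by exact: cst_continuous.
  move=> cu; have h := ccsM u (fun=> c) cu ck.
  exact: h.
have dC p : is_derive p 'e_j (fun p => cos (edot p y)) (- sin (edot p y) * y 0 j).
  exact: (@isd_comp R _ cos (fun p => edot p y) p ('e_j) _ _ (is_derive_cos _) (isd_edot p y j)).
have dS p : is_derive p 'e_j (fun p => sin (edot p y)) (cos (edot p y) * y 0 j).
  exact: (@isd_comp R _ sin (fun p => edot p y) p ('e_j) _ _ (is_derive_sin _) (isd_edot p y j)).
have ic (u : point -> R) : ccs u -> leb.-integrable setT (EFin \o (fun x => u (v3 x) * cos (dot3 x q))).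
  by move=> cu; apply: (@integrable_mul_cos R (u \o v3)); exact: ccs_integrable.
have ins (u : point -> R) : ccs u -> leb.-integrable setT (EFin \o (fun x => u (v3 x) * sin (dot3 x q))).
  by move=> cu; apply: (@integrable_mul_sin R (u \o v3)); exact: ccs_integrable.
split.
- have h0 := @integral_partial0 R j _ (fun p => phi p * cos (edot p y) + eta p * sin (edot p y) * (- y 0 j))
    (ccsM _ _ ceta cC) (ccsD _ _ (ccsM _ _ cphi cC) (ccsN _ _ (ccsM _ _ ceta cS))).
  have {}h0 := h0 (fun p => is_derive_eq (isdM (deta p) (dC p)) _).
  have e (p : point) : phi p * cos (edot p y) + eta p * (- sin (edot p y) * y 0 j) =
     phi p * cos (edot p y) + eta p * sin (edot p y) * (- y 0 j) by ring.
  have := h0 e; under eq_Rintegral => x _ do rewrite -hE.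
  rewrite RintegralD//; [|exact: ic|]; last first.
    by have := integrableZr measurableT (- y 0 j) (ins _ ceta).
  rewrite RintegralZr//; last exact: ins.
  by rewrite /Ct /St/= => h; apply/eqP; rewrite -subr_eq0 -h; apply/eqP; ring.
- have h0 := @integral_partial0 R j _ (fun p => phi p * sin (edot p y) + eta p * cos (edot p y) * y 0 j)
    (ccsM _ _ ceta cS) (ccsD _ _ (ccsM _ _ cphi cS) (ccsN _ _ (ccsM _ _ ceta cC))).
  have {}h0 := h0 (fun p => is_derive_eq (isdM (deta p) (dS p)) _).
  have e (p : point) : phi p * sin (edot p y) + eta p * (cos (edot p y) * y 0 j) =
     phi p * sin (edot p y) + eta p * cos (edot p y) * y 0 j by ring.
  have := h0 e; under eq_Rintegral => x _ do rewrite -hE.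
  rewrite RintegralD//; [|exact: ins|]; last first.
    by have := integrableZr measurableT (y 0 j) (ic _ ceta).
  rewrite RintegralZr//; last exact: ic.
  by rewrite /Ct /St/= => h; apply/eqP; rewrite -subr_eq0 opprK -h; apply/eqP; ring.
Qed.

Variables (a b d : R) (n : nat).
Hypotheses (b0 : 0 < b) (ba : b < a) (d0 : 0 < d).
Local Notation zeta := (cutoff b d n).

Lemma weight_le f x : (f (v3 x) * zeta (v3 x)) ^+ 2 * cbrt3 d x <= f (v3 x) * f (v3 x) * zeta (v3 x).
Proof.
have -> : (f (v3 x) * zeta (v3 x)) ^+ 2 * cbrt3 d x =
  (f (v3 x) * f (v3 x) * zeta (v3 x)) * (zeta (v3 x) * cbrt3 d x) by ring.
apply: ler_piMr; last exact: cutoff_cbrt3.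
by apply: mulr_ge0; [rewrite -expr2 sqr_ge0|exact: cutoff_ge0].
Qed.

(** With [phi = eta = f * zeta] the two frequency weights coincide, and the pairing with [h] is the
    energy itself because [h] equals [f] on the support of [zeta]. *)
Lemma hardy_half f h A B (N : R) : (forall p, enorm p < a -> {for p, continuous f}) ->
  (forall p, enorm p < a -> h p = f p) -> L2fun h -> fourier h A B ->
  (\int[leb]_q ((1 + nsq3 q) `^ (1 / 2) * (A (vec3 q) ^+ 2 + B (vec3 q) ^+ 2))%:E <= N%:E)%E ->
  \int[leb]_x (f (vec3 x) * f (vec3 x) * zeta (vec3 x)) <= Kd R * N.
Proof.
move=> cf hf hh hF hN.
have cz := @continuous_cutoff R b d n d0; have z0 p := @cutoff_out R b d n b0 p.
have cfz := ccs_mul b0 ba cf cz z0.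
have cff p : enorm p < a -> {for p, continuous (fun p => f p * f p)}.
  by move=> pa; exact: (cvgM (cf p pa) (cf p pa)).
have cw := ccs_mul b0 ba cff cz z0.
apply: (@hardy_abs h A B (1 / 2) d N _ _ (fun p => f p * f p * zeta p) hh hF cfz cfz cw d0 _ hN).
- by move=> x; apply: mulr_ge0; [rewrite -expr2 sqr_ge0|exact: cutoff_ge0].
- move=> q; have q0 : 0 <= 1 + nsq3 q by rewrite addr_ge0// nsq3_ge0.
  by rewrite powRN mul1r powR12_sqrt.
- by move=> x; exact: weight_le.
- have e : \int[leb]_x (h (vec3 x) * (f (vec3 x) * zeta (vec3 x))) =
     \int[leb]_x (f (vec3 x) * f (vec3 x) * zeta (vec3 x)).
    apply: eq_Rintegral => x _; have [xa|bx] := out_cases ba (v3 x); first by rewrite hf// mulrA.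
    by rewrite z0 ?(ltW bx)// !mulr0.
  rewrite e ger0_norm//; apply: Rintegral_ge0 => x _.
  by apply: mulr_ge0; [rewrite -expr2 sqr_ge0|exact: cutoff_ge0].
Qed.

(** Here [eta = f' * zeta] and [phi] is its derivative. Integration by parts turns the pairing of
    [f] with [phi] into minus the energy, and the frequency factor of a derivative raises the weight
    from order -3/2 to -1/2. Derivatives fall on [f] inside the ball, never on the extension [h]. *)
Lemma hardy_three_half f f' f'' h A B (N : R) (j : 'I_3) :
  (forall p, enorm p < a -> {for p, continuous f}) ->
  (forall p, enorm p < a -> {for p, continuous f'}) ->
  (forall p, enorm p < a -> {for p, continuous f''}) ->
  (forall p, enorm p < a -> is_derive p 'e_j f (f' p)) ->
  (forall p, enorm p < a -> is_derive p 'e_j f' (f'' p)) ->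
  (forall p, enorm p < a -> h p = f p) -> L2fun h -> fourier h A B ->
  (\int[leb]_q ((1 + nsq3 q) `^ (3 / 2) * (A (vec3 q) ^+ 2 + B (vec3 q) ^+ 2))%:E <= N%:E)%E ->
  \int[leb]_x (f' (vec3 x) * f' (vec3 x) * zeta (vec3 x)) <= Kd R * N.
Proof.
move=> cf cf' cf'' df df' hf hh hF hN.
have cz := @continuous_cutoff R b d n d0; have z0 p := @cutoff_out R b d n b0 p.
have cz' := @continuous_dcutoff R b d n d0 j; have z0' p := @dcutoff_out R b d n b0 j p.
have dz p := @isd_cutoff R b d n d0 p j.
pose eta p := f' p * zeta p; pose phi p := f'' p * zeta p + f' p * dcutoff b d n j p.
have ceta : ccs eta := ccs_mul b0 ba cf' cz z0.
have ccsD (u v : point -> R) : ccs u -> ccs v -> ccs (fun p : point => u p + v p : R).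
  move=> [cu [k uk]] [cv [m vm]]; split; first by move=> p; exact: (cvgD (cu p) (cv p)).
  exists (maxn k m) => p hp.
  have h1 : k%:R < enorm p by apply: le_lt_trans hp; rewrite ler_nat leq_maxl.
  have h2 : m%:R < enorm p by apply: le_lt_trans hp; rewrite ler_nat leq_maxr.
  by rewrite uk// vm// addr0.
have cphi : ccs phi := ccsD _ _ (ccs_mul b0 ba cf'' cz z0) (ccs_mul b0 ba cf' cz' z0').
have deta p : is_derive p 'e_j eta (phi p).
  exact: (isd_mul_out ba (df' p) (dz p) z0).
have cff p : enorm p < a -> {for p, continuous (fun p => f' p * f' p)}.
  by move=> pa; exact: (cvgM (cf' p pa) (cf' p pa)).
have cw := ccs_mul b0 ba cff cz z0.
have eta0 p : b <= enorm p -> eta p = 0 by move=> bp; rewrite /eta z0// mulr0.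
have phi0 p : b <= enorm p -> phi p = 0 by move=> bp; rewrite /phi z0// z0'// !mulr0 addr0.
apply: (@hardy_abs h A B (3 / 2) d N phi eta (fun p => f' p * f' p * zeta p) hh hF cphi ceta cw d0 _ hN).
- by move=> x; apply: mulr_ge0; [rewrite -expr2 sqr_ge0|exact: cutoff_ge0].
- move=> q; have [-> ->] := transform_derivative q ceta cphi deta.
  have q0 : 0 < 1 + nsq3 q by rewrite ltr_pwDl// nsq3_ge0.
  have -> : (1 + nsq3 q) `^ (- (3 / 2)) = (1 + nsq3 q)^-1 * (japanese q)^-1.
    rewrite powRN (_ : 3 / 2 = 1 + 2^-1); last by field.
    by rewrite powRD ?gt_eqF ?implybT// powRr1 ?(ltW q0)// powR12_sqrt ?(ltW q0)// invfM.
  set C := Ct _ _; set S := St _ _; set J := (japanese q)^-1.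
  have J0 : 0 <= J by rewrite invr_ge0 ltW// japanese_gt0.
  have -> : (1 + nsq3 q)^-1 * J * ((v3 q 0 j * S) ^+ 2 + (- (v3 q 0 j * C)) ^+ 2) =
    (J * (C ^+ 2 + S ^+ 2)) * ((v3 q 0 j) ^+ 2 / (1 + nsq3 q)).
    by have := lt0r_neq0 q0 => ?; field.
  apply: ler_piMr; first by apply: mulr_ge0 => //; rewrite addr_ge0 ?sqr_ge0.
  rewrite ler_pdivrMr// mul1r -enorm_vec3.
  have := enorm_coord (v3 q) j; rewrite -ler_sqr ?nnegrE ?sqrtr_ge0// real_normK ?num_real//.
  lra.
- by move=> x; exact: weight_le.
- have cfe := ccs_mul b0 ba cf ceta.1 eta0.
  have h0 : \int[leb]_x (f' (vec3 x) * eta (vec3 x) + f (vec3 x) * phi (vec3 x)) = 0.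
    apply: (@integral_partial0 R j (fun p => f p * eta p) (fun p => f' p * eta p + f p * phi p)) => //.
      exact: (ccsD _ _ (ccs_mul b0 ba cf' ceta.1 eta0) (ccs_mul b0 ba cf cphi.1 phi0)).
    by move=> p; exact: (isd_mul_out ba (df p) (deta p) eta0).
  have i1 := ccs_integrable (ccs_mul b0 ba cf' ceta.1 eta0).
  have i2 := ccs_integrable (ccs_mul b0 ba cf cphi.1 phi0).
  rewrite RintegralD// in h0.
  have e : \int[leb]_x (h (vec3 x) * phi (vec3 x)) = \int[leb]_x (f (vec3 x) * phi (vec3 x)).
    apply: eq_Rintegral => x _; have [xa|bx] := out_cases ba (v3 x); first by rewrite hf.
    by rewrite phi0 ?(ltW bx)// !mulr0.
  have e2 : \int[leb]_x (f' (vec3 x) * eta (vec3 x)) = \int[leb]_x (f' (vec3 x) * f' (vec3 x) * zeta (vec3 x)).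
    by apply: eq_Rintegral => x _; rewrite mulrA.
  rewrite e -e2; have -> : \int[leb]_x (f (vec3 x) * phi (vec3 x)) = - \int[leb]_x (f' (vec3 x) * eta (vec3 x)).
    by apply/eqP; rewrite -addr_eq0 addrC h0.
  rewrite normrN e2 ger0_norm//; apply: Rintegral_ge0 => x _.
  by apply: mulr_ge0; [rewrite -expr2 sqr_ge0|exact: cutoff_ge0].
Qed.

End Hardy.

(** * Extracting extensions from the restricted Sobolev norms *)

Section SobolevExtraction.
Variable R : realType.
Local Notation leb := (leb3 R).
Local Notation point := 'rV[R]_3.

Lemma Hs_norm_ge0 (s : R) (h : point -> R) : (0 <= Hs_norm s h)%E.
Proof. by apply: le_ereal_inf_tmp => M [A [B [_ _ ->]]]; exact: poweR_ge0. Qed.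

Lemma Hs_norm_on_ge0 (U : set point) (s : R) (f : point -> R) : (0 <= Hs_norm_on U s f)%E.
Proof. by apply: le_ereal_inf_tmp => _ [h _ <-]; exact: Hs_norm_ge0. Qed.

(** The infimum over extensions need not be attained, hence the strictly larger [e']. *)
Lemma Hs_norm_on_extension (U : set point) (s e e' : R) (f : point -> R) :
  (Hs_norm_on U s f <= e%:E)%E -> 0 < e' -> e < e' ->
  exists h A B, [/\ forall x, U x -> h x = f x, L2fun h, fourier h A B &
   (\int[leb]_q ((1 + nsq3 q) `^ s * (A (vec3 q) ^+ 2 + B (vec3 q) ^+ 2))%:E <= (e' ^+ 2)%:E)%E].
Proof.
move=> fe e0 ee; have : (Hs_norm_on U s f < e'%:E)%E by apply: le_lt_trans fe _; rewrite lte_fin.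
move=> /ereal_inf_lt[_ [h hf <-]] /ereal_inf_lt[_ [A [B [hh hF ->]]]] he.
exists h, A, B; split => //.
move: he; under eq_integral => q _ do rewrite enorm_vec3.
have : (0 <= \int[leb]_q ((1 + nsq3 q) `^ s * (A (vec3 q) ^+ 2 + B (vec3 q) ^+ 2))%:E)%E.
  by apply: integral_ge0 => q _; rewrite lee_fin mulr_ge0 ?powR_ge0// addr_ge0 ?sqr_ge0.
case: (\int[leb]_q _)%E => [X| |] //; last first.
  by rewrite poweRyr ?invr_neq0 ?pnatr_eq0// ltNge leey.
rewrite lee_fin => X0; rewrite poweR_EFin lte_fin powR12_sqrt// lee_fin => h1.
by rewrite -(sqr_sqrtr X0) ler_pXn2r ?nnegrE ?sqrtr_ge0 ?ltW.
Qed.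

Lemma Hs_norm_tensor_on_ge (U : set point) (s : R) (T : point -> 'M[R]_3) i j :
  (Hs_norm_on U s (fun x => T x i j) <= Hs_norm_tensor_on U s T)%E.
Proof.
rewrite /Hs_norm_tensor_on (bigD1 i)//= (bigD1 j)//= -addeA; apply: leeDl.
by apply: adde_ge0; [|apply: sume_ge0 => k _]; apply: sume_ge0 => l _; exact: Hs_norm_on_ge0.
Qed.

End SobolevExtraction.

(** * From Hardy's inequality to an energy along a ray *)

Section RadialEnergy.
Variable R : realType.

Lemma continuous_sqr_div (d : R) : 0 < d ->
  continuous (fun c : R => c ^+ 2 / Num.sqrt (c ^+ 2 + d ^+ 2)).
Proof.
move=> d0.
have n0 (c : R) : Num.sqrt (c ^+ 2 + d ^+ 2) != 0.
  by rewrite lt0r_neq0// sqrtr_gt0 ltr_wpDl ?sqr_ge0// exprn_gt0.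
have cs : continuous (fun c : R => Num.sqrt (c ^+ 2 + d ^+ 2)).
  move=> c; apply: (@continuous_comp _ _ _ (fun c : R => c ^+ 2 + d ^+ 2) Num.sqrt).
    exact: (cvgD (@exprn_continuous R 2 c) (cvg_cst _)).
  exact: sqrt_continuous.
by move=> c; exact: (cvgM (@exprn_continuous R 2 c) (cvgV (n0 c) (cs c))).
Qed.

Local Notation mu := (@lebesgue_measure R).
Local Notation leb := (leb3 R).
Local Notation point := 'rV[R]_3.
Variables (I : finType) (f : I -> point -> R) (a C : R) (Q : R -> R).
Hypotheses (a0 : 0 < a) (cf : forall i p, enorm p < a -> {for p, continuous (f i)})
  (fQ : forall p, enorm p < a -> \sum_i f i p * f i p = Q (enorm p))
  (fC : forall b d (n : nat), 0 < b -> b < a -> 0 < d ->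
     \sum_i \int[leb]_x (f i (vec3 x) * f i (vec3 x) * cutoff b d n (vec3 x)) <= C).

Let S p := \sum_i f i p * f i p.
Let ray (s : R) : point := s *: 'e_0.

Let enorm_ray s : enorm (ray s) = `|s|.
Proof.
by rewrite enormE /nsq !mxE/= !mulr0 mulr1 expr0n/= !addr0 sqrtr_sqr.
Qed.

Let cray : continuous ray.
Proof. by move=> s; apply: cvgZr_tmp; exact: cvg_id. Qed.

Let cS p : enorm p < a -> {for p, continuous S}.
Proof.
move=> pa; rewrite /S.
have -> : (fun p => \sum_i f i p * f i p) = \sum_i (fun p => f i p * f i p).
  by apply/funext => q; rewrite fct_sumE.
elim/big_ind: _ => [|u v cu cv|i _]; first exact: cst_continuous.
- exact: (cvgD cu cv).
- exact: (cvgM (@cf i p pa) (@cf i p pa)).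
Qed.

Let S0 p : 0 <= S p.
Proof. by apply: sumr_ge0 => i _; rewrite -expr2 sqr_ge0. Qed.

(** The factor 16 collects a 2 from the cutoff quotient, which is at least 1/2 on the ball of radius
    [r1], a 2 from [cutW], and a 4 from the area [(c / 2) ^+ 2] in [radial_lower]. *)
Let energy_bound (r1 d : R) : 0 < r1 < a -> 0 < d ->
  (\int[mu]_(c in `[0%R, r1]) (16^-1 * ((c ^+ 2 / Num.sqrt (c ^+ 2 + d ^+ 2)) * S (ray c)))%:E <= C%:E)%E.
Proof.
move=> /andP[r10 r1a] d0; pose b := (r1 + a) / 2.
have b0 : 0 < b by rewrite /b; lra.
have ba : b < a by rewrite /b; lra.
have r1b : r1 < b by rewrite /b; lra.
have g0 : 0 < b ^+ 2 - r1 ^+ 2 by rewrite subr_gt0 ltr_pXn2r// nnegrE ltW.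
(* Chosen so that [n cutM >= 1] up to radius [r1], which makes the cutoff quotient at least 1/2
   there. *)
pose n := Num.bound (((b ^+ 2 - r1 ^+ 2) ^+ 2)^-1).
have hn : 1 <= n%:R * (b ^+ 2 - r1 ^+ 2) ^+ 2.
  rewrite -ler_pdivrMr ?exprn_gt0// mul1r; apply: ltW; apply: archi_boundP.
  by rewrite invr_ge0 sqr_ge0.
pose W p := S p * cutoff b d n p.
have cz := @continuous_cutoff R b d n d0; have z0 p := @cutoff_out R b d n b0 p.
have cW : ccs W by exact: (ccs_mul b0 ba (@cS) cz z0).
have W0 p : 0 <= W p by apply: mulr_ge0 => //; exact: cutoff_ge0.
have [cW' [m Wm]] := cW.
have IW : (\int[leb]_x (W (vec3 x))%:E <= C%:E)%E.
  have iW := ccs_integrable cW.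
  rewrite -[leLHS]fineK; last exact: integrable_fin_num.
  rewrite lee_fin; apply: le_trans (fC n b0 ba d0).
  pose g i p := f i p * f i p * cutoff b d n p.
  have cg i : ccs (g i).
    by apply: (ccs_mul b0 ba _ cz z0) => p pa; exact: (cvgM (@cf i p pa) (@cf i p pa)).
  rewrite le_eqVlt; apply/orP; left; apply/eqP.
  transitivity (\int[leb]_x (\sum_i g i (vec3 x))).
    by apply: eq_Rintegral => x _; rewrite /W /S big_distrl.
  suff H : forall r : seq I, leb.-integrable setT (EFin \o (fun x => \sum_(i <- r) g i (vec3 x)))
     /\ \int[leb]_x (\sum_(i <- r) g i (vec3 x)) = \sum_(i <- r) \int[leb]_x (g i (vec3 x)).
    by have [] := H (index_enum I).
  elim=> [|i r [ih1 ih2]].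
    split; last by rewrite big_nil; under eq_Rintegral do rewrite big_nil; rewrite /Rintegral integral0.
    by under eq_fun do rewrite big_nil; exact: integrable0.
  have ii := ccs_integrable (cg i).
  split; last by under eq_Rintegral do rewrite big_cons; rewrite RintegralD// ih2 big_cons.
  have -> : (fun x => \sum_(j <- i :: r) g j (vec3 x)) =
      (fun x => g i (vec3 x) + \sum_(j <- r) g j (vec3 x)).
    by apply/funext => x; rewrite big_cons.
  exact: (integrableD measurableT ii ih1).
pose F s := W (ray s).
have cF : continuous F.
  by move=> s; apply: (@continuous_comp _ _ _ ray W); [exact: cray|exact: cW'].
have F0 s : 0 <= F s by exact: W0.
have Fm s : m%:R < s -> F s = 0.
  move=> ms; apply: Wm; rewrite enorm_ray gtr0_norm//; exact: le_lt_trans ms.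
have FW p : F (enorm p) = W p.
  have e : enorm (ray (enorm p)) = enorm p by rewrite enorm_ray ger0_norm// sqrtr_ge0.
  have en : nsq (ray (enorm p)) = nsq p by rewrite -!enorm_sqr e.
  rewrite /F /W; have -> : cutoff b d n (ray (enorm p)) = cutoff b d n p.
    by rewrite /cutoff /cutM /cutW en.
  have [pa|bp] := out_cases ba p; last by rewrite z0 ?(ltW bp)// !mulr0.
  by rewrite /S !fQ ?e.
have := radial_lower cF F0 Fm.
under [X in (_ <= X)%E -> _]eq_integral => x _ do rewrite FW.
move=> h; apply: le_trans IW; apply: le_trans h.
have mS : measurable_fun `[0, r1]%classic (fun c => S (ray c)).
  apply: subspace_continuous_measurable_fun => //.
  apply: continuous_in_subspaceT => c /set_mem/=; rewrite in_itv/= => /andP[c0 cr].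
  apply: (@continuous_comp _ _ _ ray S); [exact: cray|apply: cS].
  by rewrite enorm_ray ger0_norm// (le_lt_trans cr).
have cs2 := continuous_sqr_div d0.
have hc2 : continuous (fun c : R => (c / 2) ^+ 2).
  have -> : (fun c : R => (c / 2) ^+ 2) = (fun c => c ^+ 2 * 4^-1) by apply/funext => c; field.
  by move=> c; exact: (cvgM (@exprn_continuous R 2 c) (cvg_cst _)).
apply: (@le_trans _ _ (\int[mu]_(c in `[0%R, r1]) (F c * (c / 2) ^+ 2)%:E)%E).
  apply: ge0_le_integral => //.
  - move=> c _; rewrite lee_fin; apply: mulr_ge0 => //; apply: mulr_ge0 => //.
    by apply: divr_ge0; [exact: sqr_ge0|exact: sqrtr_ge0].
  - apply/measurable_EFinP; apply: measurable_funM => //; apply: measurable_funM => //.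
    by apply: measurable_funTS; exact: continuous_measurable_fun.
  - apply: measurable_funTS; apply/measurable_EFinP; apply: continuous_measurable_fun => c.
    exact: (cvgM (cF c) (hc2 c)).
  - move=> c /=; rewrite in_itv/= => /andP[c0 cr]; rewrite lee_fin /F /W.
    have ns : nsq (ray c) = c ^+ 2 by rewrite -enorm_sqr enorm_ray real_normK ?num_real.
    have p0 : 0 < Num.sqrt (c ^+ 2 + d ^+ 2) by rewrite sqrtr_gt0 ltr_wpDl ?sqr_ge0// exprn_gt0.
    have -> : 16^-1 * (c ^+ 2 / Num.sqrt (c ^+ 2 + d ^+ 2) * S (ray c)) =
      S (ray c) * (2^-1 * cutW d (ray c)) * (c / 2) ^+ 2.
      by rewrite /cutW ns; have := lt0r_neq0 p0 => ?; field.
    apply: ler_wpM2r; first exact: sqr_ge0.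
    apply: ler_wpM2l => //; rewrite /cutoff; apply: ler_wpM2r; first exact: ltW (cutW_gt0 d0 _).
    have hM : 1 <= n%:R * cutM b (ray c).
      apply: le_trans hn _; apply: ler_wpM2l => //.
      have hc : c ^+ 2 <= r1 ^+ 2 by rewrite ler_pXn2r// nnegrE// ltW.
      rewrite /cutM ns max_r ?ler_pXn2r ?nnegrE//; lra.
    rewrite ler_pdivlMr; lra.
apply: ge0_subset_integral => //.
- apply: measurable_funTS; apply/measurable_EFinP; apply: continuous_measurable_fun => c.
  exact: (cvgM (cF c) (hc2 c)).
- by move=> c _; rewrite lee_fin mulr_ge0 ?sqr_ge0.
- by move=> c /=; rewrite !in_itv/= andbT => /andP[].
Qed.

(** [E] is the integral along the first axis. The regularisation is removed by
    [c^2 / sqrt (c^2 + d^2) >= c - d], whose loss is [d] times a finite integral. *)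
Lemma radial_energy : exists E : R -> R, forall r1, 0 < r1 < a ->
  is_derive r1 1 E (r1 * \sum_i f i (r1 *: 'e_0) ^+ 2) /\ 0 <= E r1 <= 16 * C.
Proof.
have cg c : `|c| < a -> {for c, continuous (fun c => S (ray c))}.
  move=> ca; apply: (@continuous_comp _ _ _ ray S); [exact: cray|apply: cS].
  by rewrite enorm_ray.
pose g c := c * S (ray c).
have cg' c : `|c| < a -> {for c, continuous g}.
  by move=> ca; exact: (cvgM cvg_id (cg c ca)).
have int (h : R -> R) (u : R) : (forall c, `|c| < a -> {for c, continuous h}) -> 0 < u < a ->
    mu.-integrable `[0, u] (EFin \o h).
  move=> ch /andP[u0 ua]; apply: continuous_compact_integrable; first exact: segment_compact.
  apply: continuous_in_subspaceT => c /set_mem/=; rewrite in_itv/= => /andP[c0 cu].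
  by apply: ch; rewrite ger0_norm// (le_lt_trans cu).
exists (fun r => \int[mu]_(t in `[0, r]) g t) => r1 /andP[r10 r1a].
have u01 : 0 < (r1 + a) / 2 < a by apply/andP; split; lra.
have r1u : r1 < (r1 + a) / 2 by lra.
split.
  have [] := @continuous_FTC1_closed R g 0 r1 ((r1 + a) / 2) r1u (int g _ cg' u01) r10 (cg' r1 _).
    by rewrite gtr0_norm.
  move=> dF dE; apply: (DeriveDef dF).
  by rewrite -derive1E dE /g /S; under eq_bigr do rewrite -expr2.
have r1b : 0 < r1 < a by rewrite r10.
have mD : (@measurable _ (measurableTypeR R)) `[0, r1]%classic by exact: measurable_itv.
have i1 := int g r1 cg' r1b; have i2 := int (fun c => S (ray c)) r1 cg r1b.
apply/andP; split.
  apply: Rintegral_ge0 => c /=; rewrite in_itv/= => /andP[c0 _]; exact: mulr_ge0.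
apply/ler_addgt0Pr => e e0.
set J := \int[mu]_(t in `[0, r1]) S (ray t).
have J0 : 0 <= J by apply: Rintegral_ge0 => c _.
pose d := e / (J + 1); have d0 : 0 < d by rewrite divr_gt0// ltr_wpDl.
have h : (\int[mu]_(t in `[0%R, r1]) (g t - d * S (ray t))%:E <= (16 * C)%:E)%E.
  have := energy_bound r1b d0.
  have cs2 := continuous_sqr_div d0.
  have i3 := int (fun c => 16^-1 * (c ^+ 2 / Num.sqrt (c ^+ 2 + d ^+ 2) * S (ray c))) r1 _ r1b.
  have ci3 (c : R) : `|c| < a -> {for c, continuous (fun c : R => 16^-1 * (c ^+ 2 / Num.sqrt (c ^+ 2 + d ^+ 2) * S (ray c)))}.
    move=> ca; exact: (cvgM (cvg_cst _) (cvgM (cs2 c) (cg c ca))).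
  have {}i3 := i3 ci3.
  have i4 := integrableB mD i1 (integrableZl mD d i2).
  rewrite -[X in (X <= _)%E -> _]fineK; last exact: integrable_fin_num.
  rewrite lee_fin => hC.
  rewrite -[leLHS]fineK; last exact: integrable_fin_num.
  rewrite lee_fin; apply: (@le_trans _ _ (16 * \int[mu]_(c in `[0, r1]) (16^-1 * (c ^+ 2 / Num.sqrt (c ^+ 2 + d ^+ 2) * S (ray c))))); last by rewrite ler_pM2l.
  rewrite -RintegralZl//; apply: le_Rintegral => //.
    exact: (integrableZl mD 16 i3).
  move=> c; rewrite /= in_itv/= => /andP[c0 _].
  have -> : 16 * (16^-1 * (c ^+ 2 / Num.sqrt (c ^+ 2 + d ^+ 2) * S (ray c))) =
    c ^+ 2 / Num.sqrt (c ^+ 2 + d ^+ 2) * S (ray c) by rewrite mulrA divff ?mul1r// pnatr_eq0.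
  rewrite /g -mulrBl; apply: ler_wpM2r => //.
  have pp : 0 < c ^+ 2 + d ^+ 2 by rewrite ltr_wpDl ?sqr_ge0// exprn_gt0.
  have p0 : 0 < Num.sqrt (c ^+ 2 + d ^+ 2) by rewrite sqrtr_gt0.
  have sq : Num.sqrt (c ^+ 2 + d ^+ 2) ^+ 2 = c ^+ 2 + d ^+ 2 by rewrite sqr_sqrtr// ltW.
  rewrite ler_pdivlMr//.
  have [cd|cd] := leP c d.
    apply: (@le_trans _ _ 0); last exact: sqr_ge0.
    by rewrite pmulr_lle0// subr_le0.
  rewrite -ler_sqr ?nnegrE ?sqr_ge0//; last by apply: mulr_ge0; [rewrite subr_ge0 ltW|exact: ltW].
  rewrite exprMn sq.
  nra.
have : \int[mu]_(t in `[0, r1]) g t - d * J <= 16 * C.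
  rewrite /J -RintegralZl// -RintegralB//; last exact: (integrableZl mD d i2).
  rewrite -lee_fin; apply: le_trans h; rewrite /Rintegral fineK//.
  have i4 := integrableB mD i1 (integrableZl mD d i2).
  exact: integrable_fin_num.
have : d * J <= e by rewrite /d mulrAC ler_pdivrMr ?ltr_wpDl// ler_wpM2l ?(ltW e0)// lerDl.
move=> h1 h2; apply: (@le_trans _ _ (16 * C + d * J)); last by rewrite lerD2l.
by rewrite -lerBlDr.
Qed.

End RadialEnergy.

(** * The geometry of spherically symmetric tensors *)

Section Differentiability.
Variable R : realType.

Lemma det3 (M : 'M[R]_3) : \det M =
  M 0 0 * (M 1 1 * M 2%:R 2%:R - M 1 2%:R * M 2%:R 1)
  - M 0 1 * (M 1 0 * M 2%:R 2%:R - M 1 2%:R * M 2%:R 0)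
  + M 0 2%:R * (M 1 0 * M 2%:R 1 - M 1 1 * M 2%:R 0).
Proof.
pose m (i j : nat) := M (inord i) (inord j).
have mE i j : M i j = m i j by rewrite /m !inord_val.
rewrite (expand_det_row M 0) !big_ord_recl big_ord0 /cofactor.
rewrite !(expand_det_row _ 0) !big_ord_recl !big_ord0 /cofactor !det_mx11 !mxE /= !mE /=.
rewrite /bump /= !(addn0, add0n) !(@modn_small 1 3)// !(@modn_small (1 + 1) 3)//.
rewrite expr0 expr1 (_ : (1 + 1 = 2)%N)// sqrrN expr1n.
by ring.
Qed.

Lemma mean_value_estimate (f f' : R -> R) (L e h : R) :
  (forall t : R, `|t| <= `|h| -> is_derive t 1 f (f' t)) ->
  (forall t, `|t| <= `|h| -> `|f' t - L| <= e) -> `|f h - f 0 - L * h| <= e * `|h|.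
Proof.
move=> df fe.
have H (u v : R) : u <= v -> (forall t, u <= t <= v -> `|t| <= `|h|) ->
    exists2 c, `|c| <= `|h| & f v - f u = f' c * (v - u).
  move=> uv uvh; have [||c cuv E] := @MVT_segment R f f' u v uv.
  - move=> t; rewrite in_itv/= => /andP[tu tv]; apply: df; apply: uvh.
    by rewrite !ltW.
  - apply: continuous_in_subspaceT => t /set_mem/=; rewrite in_itv/= => tuv.
    by apply: derivable1_continuous; have := df t (uvh t tuv) => ?; apply: ex_derive.
  by exists c => //; apply: uvh; move: cuv; rewrite in_itv.
suff [c ch E] : exists2 c, `|c| <= `|h| & f h - f 0 = f' c * h.
  by rewrite E -mulrBl normrM ler_wpM2r// fe.
have [h0|h0] := leP 0 h.
  have [|c ch E] := H 0 h h0; last by exists c; rewrite // E subr0.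
  by move=> t /andP[t0 th]; rewrite !ger0_norm.
have [|c ch E] := H h 0 (ltW h0); last by exists c; rewrite // -opprB E; ring.
by move=> t /andP[ht t0]; rewrite (ler0_norm t0) (ltr0_norm h0) lerN2.
Qed.

Lemma line_derivative n (f : 'rV[R]_n -> R) (v q : 'rV[R]_n) (t : R) (df : R) :
  is_derive (t *: v + q) v f df -> is_derive t 1 (fun s => f (s *: v + q)) df.
Proof.
move=> /is_derive_line h; apply/is_derive_line.
have -> // : (fun s : R => f ((s *: 1 + t) *: v + q)) = (fun s => f (s *: v + (t *: v + q))).
by apply/funext => s; rewrite [s *: 1]mulr1 scalerDl addrA.
Qed.

(** One coordinate is moved at a time, with the mean value theorem on each segment. Smoothness is
    defined through directional derivatives, whereas Jacobians of charts are meaningful only for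
    differentiable maps; this closes the gap. *)
Lemma C1_differentiable2 (f : 'rV[R]_2 -> R) (p : 'rV[R]_2) (U : set 'rV[R]_2) :
  open U -> U p -> (forall i x, U x -> derivable f x 'e_i) ->
  (forall i, {for p, continuous (partial i f)}) -> differentiable f p.
Proof.
move=> oU Up df cf.
pose D (h : 'rV[R]_2) : R := partial 0 f p * h 0 0 + partial 1 f p * h 0 1.
have Dlin : linear D by move=> c u v; rewrite /D !mxE /GRing.scale/=; ring.
pose DL : {linear 'rV[R]_2 -> R} := HB.pack D (GRing.isLinear.Build _ _ _ _ D Dlin).
have cD : continuous DL.
  move=> h; have c i := @continuous_coord R 2 i h.
  exact: (cvgD (cvgM (cvg_cst _) (c 0)) (cvgM (cvg_cst _) (c 1))).
suff E : f \o shift p = cst (f p) + DL +o_ (0 : 'rV[R]_2) id.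
  by apply/diff_locallyP; rewrite (diff_unique cD E).
apply/eqaddoP => e e0.
have two (i : 'I_2) : i = 0 \/ i = 1.
  by case: i => [[|[|//]] hi']; [left|right]; exact: val_inj.
have n1 : \forall x \near p, U x /\ forall i, `|partial i f x - partial i f p| <= e / 2.
  have c i : \forall x \near p, `|partial i f x - partial i f p| <= e / 2.
    have /cvgrPdist_le/(_ (e / 2)) := cf i; rewrite divr_gt0// => /(_ isT).
    by apply: filterS => x; rewrite distrC.
  apply: filterS3 (open_nbhs_nbhs (conj oU Up)) (c 0) (c 1) => x Ux x0 x1.
  split; first exact: Ux.
  by move=> i; case: (two i) => ->; [exact: x0|exact: x1].
have [d d0 hd] := nbhs_box n1.
apply/nbhs_ballP; exists d => //= h hh.
have hi i : `|h 0 i| < d.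
  by move: hh => [_] /(_ 0 i); rewrite /ball/= mxE sub0r normrN.
have nh i : `|h 0 i| <= `|h|.
  by rewrite [leRHS]mx_normrE; exact: (le_bigmax _ (fun ij : 'I_1 * 'I_2 => `|h ij.1 ij.2|) (0, i)).
rewrite /= !fctE/=.
pose q := h 0 0 *: 'e_0 + p.
have hE : h + p = h 0 1 *: 'e_1 + q.
  by apply/rowP => i; rewrite !mxE; case: (two i) => ->/=; rewrite ?mulr0 ?mulr1 ?add0r.
have b0 : `|f (h 0 0 *: 'e_0 + p) - f (0 *: 'e_0 + p) - partial 0 f p * h 0 0| <= e / 2 * `|h 0 0|.
  have inb t : `|t| <= `|h 0 0| -> U (t *: 'e_0 + p) /\ forall i, `|partial i f (t *: 'e_0 + p) - partial i f p| <= e / 2.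
    move=> th; apply: hd => i; rewrite !mxE eqxx/=.
    have -> : p 0 i - (t * (i == 0)%:R + p 0 i) = - (t * (i == 0)%:R) by ring.
    rewrite normrN normrM; apply: le_lt_trans (hi 0); apply: le_trans th.
    by rewrite ler_piMr//; case: (i == 0); rewrite ?normr1 ?normr0.
  apply: (@mean_value_estimate (fun t => f (t *: 'e_0 + p)) (fun t => partial 0 f (t *: 'e_0 + p))).
    move=> t /inb[Ut _]; apply: line_derivative; exact/derivableP/df.
  by move=> t /inb[_]; apply.
have b1 : `|f (h 0 1 *: 'e_1 + q) - f (0 *: 'e_1 + q) - partial 1 f p * h 0 1| <= e / 2 * `|h 0 1|.
  have inb t : `|t| <= `|h 0 1| -> U (t *: 'e_1 + q) /\ forall i, `|partial i f (t *: 'e_1 + q) - partial i f p| <= e / 2.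
    move=> th; apply: hd => i; rewrite !mxE !eqxx/=.
    have -> : p 0 i - (t * (i == 1)%:R + (h 0 0 * (i == 0)%:R + p 0 i)) = - (t * (i == 1)%:R + h 0 0 * (i == 0)%:R) by ring.
    rewrite normrN; case: i => [[|[|//]] hi'].
      by rewrite (_ : Ordinal hi' = 0)/=; [rewrite mulr0 add0r mulr1|exact: val_inj].
    by rewrite (_ : Ordinal hi' = 1)/=; [rewrite mulr0 addr0 mulr1; exact: le_lt_trans (hi 1)|exact: val_inj].
  apply: (@mean_value_estimate (fun t => f (t *: 'e_1 + q)) (fun t => partial 1 f (t *: 'e_1 + q))).
    move=> t /inb[Ut _]; apply: line_derivative; exact/derivableP/df.
  by move=> t /inb[_]; apply.
rewrite hE; rewrite !scale0r !add0r in b0 b1.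
have -> : f (h 0 1 *: 'e_1 + q) - (f p + D h) =
  (f (h 0 1 *: 'e_1 + q) - f q - partial 1 f p * h 0 1) + (f q - f p - partial 0 f p * h 0 0).
  by rewrite /D; ring.
apply: le_trans (ler_normD _ _) _.
have e2 : 0 <= e / 2 by rewrite divr_ge0// ltW.
have := ler_wpM2l e2 (nh 0); have := ler_wpM2l e2 (nh 1); rewrite -/q in b0 *; lra.
Qed.

Lemma differentiable_rV n m (f : 'rV[R]_n -> 'rV[R]_m) p :
  (forall j, differentiable (fun x => f x 0 j) p) -> differentiable f p.
Proof.
move=> df; have -> : f = \sum_j (fun x => f x 0 j *: 'e_j).
  apply/funext => x; rewrite fct_sumE [LHS]row_sum_delta.
  by apply: eq_bigr.
by apply: differentiable_sum => j; apply: differentiableZl.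
Qed.

Lemma jacobian_row n m (F : 'rV[R]_n -> 'rV[R]_m) p i :
  differentiable F p -> row i ('J F p) = 'D_('e_i) F p.
Proof. by move=> dF; rewrite deriveEjacobian// -rowE. Qed.

Lemma jacobian_entry n m (F : 'rV[R]_n -> 'rV[R]_m) p i j :
  differentiable F p -> 'J F p i j = 'D_('e_i) (fun x => F x 0 j) p.
Proof.
move=> dF; have := congr1 (fun M : 'rV[R]_m => M 0 j) (jacobian_row i dF); rewrite mxE => ->.
by rewrite derive_mx ?mxE//; exact: diff_derivable.
Qed.

Lemma differentiable_mulmxr n m (Q : 'M[R]_(n, m)) p : differentiable (fun y : 'rV[R]_n => y *m Q) p.
Proof.
apply: differentiable_rV => j.
have -> : (fun x : 'rV[R]_n => (x *m Q) 0 j) = \sum_i (fun x : 'rV[R]_n => x 0 i * Q i j).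
  by apply/funext => x; rewrite fct_sumE mxE.
apply: (@differentiable_sum _ _ _ n (fun i (x : 'rV[R]_n) => x 0 i * Q i j)) => i.
exact: (differentiableM (differentiable_coord p 0 i) (differentiable_cst (Q i j) p)).
Qed.

Lemma jacobian_mulmxr n m (Q : 'M[R]_(n, m)) p : 'J (fun y : 'rV[R]_n => y *m Q) p = Q.
Proof.
apply/matrixP => i j; rewrite jacobian_entry; last exact: differentiable_mulmxr.
have h k := isdM (isd_coord p ('e_i) k) (isd_cst (Q k j) p ('e_i)).
have -> : (fun x : 'rV[R]_n => (x *m Q) 0 j) = (fun x => \sum_k x 0 k * Q k j).
  by apply/funext => x; rewrite mxE.
have hs := isd_sum h; rewrite (@derive_val _ _ _ _ _ _ _ hs).
rewrite (bigD1 i)//= big1 ?addr0; first by rewrite !mxE !eqxx/= mulr0 addr0 mul1r.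
by move=> k ki; rewrite !mxE eqxx/= (negbTE ki) mul0r mulr0 addr0.
Qed.

End Differentiability.

(** * Normal form of rotation invariant symmetric tensors *)

Section SphericalTensors.
Variable R : realType.
Local Notation point := 'rV[R]_3.
Implicit Types (x : point) (T : point -> 'M[R]_3).

Lemma enorm_scale_e0 (s : R) : enorm (s *: 'e_0 : point) = `|s|.
Proof. by rewrite enormE /nsq !mxE/= !mulr0 mulr1 expr0n/= !addr0 sqrtr_sqr. Qed.

Lemma rotation_inv (Q : 'M[R]_3) : rotation Q -> rotation Q^T /\ Q^T *m Q = 1%:M.
Proof. by move=> [QQ dQ]; have h := mulmx1C QQ; split => //; split; rewrite ?trmxK ?det_tr. Qed.

(* Half turn about the bisector of [x] and the first axis. *)
Lemma rotation_to_axis x : exists2 Q, rotation Q & x *m Q = enorm x *: 'e_0.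
Proof.
pose n := enorm x; have n0 : 0 <= n by exact: sqrtr_ge0.
have n2 : n ^+ 2 = x 0 0 ^+ 2 + x 0 1 ^+ 2 + x 0 2%:R ^+ 2 by rewrite enorm_sqr.
have [q1 q2] : 0 <= x 0 1 ^+ 2 /\ 0 <= x 0 2%:R ^+ 2 by split; exact: sqr_ge0.
(* When [x] lies on the nonpositive first half-axis the bisector degenerates, and the half turn
   about the third axis is used instead. *)
have [N0|N0] := eqVneq (n * (n + x 0 0)) 0.
  have xn : x 0 0 = - n.
    have /orP[/eqP z|/eqP z] : (n == 0) || (n + x 0 0 == 0) by rewrite -mulf_eq0 N0.
      move: n2; rewrite z expr0n/= oppr0 => e; apply/eqP; rewrite -sqrf_eq0.
      by have := sqr_ge0 (x 0 0); rewrite eq_le; lra.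
    by lra.
  have [z1 z2] : x 0 1 = 0 /\ x 0 2%:R = 0.
    by move: n2; rewrite xn sqrrN => e; split; apply/eqP; rewrite -sqrf_eq0 eq_le; lra.
  exists (\matrix_(i, j) ((i == j)%:R * (if i == 2%:R then 1 else -1))).
    split; last by rewrite det3 !mxE/=; ring.
    by apply/matrixP => i j; rewrite mxE sum3 !mxE; move: i; apply: forall3; move: j; apply: forall3;
      rewrite ?mxE/=; ring.
  by apply/rowP; apply: forall3; rewrite mxE sum3 !mxE/= xn z1 z2 -/n; ring.
(* [w = x + |x| e_0] spans the bisector and [M] is 2 over its squared length, so [M w w^T - 1] is
   the half turn about it. *)
pose w (i : 'I_3) := n * (i == 0)%:R + x 0 i.
pose M := (n * (n + x 0 0))^-1.
have MS : M * (w 0 ^+ 2 + w 1 ^+ 2 + w 2%:R ^+ 2) = 2.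
  have -> : w 0 ^+ 2 + w 1 ^+ 2 + w 2%:R ^+ 2 = 2 * (n * (n + x 0 0)).
    rewrite /w/= !mulr0 !mulr1 !add0r.
    have -> : (n + x 0 0) ^+ 2 + x 0 1 ^+ 2 + x 0 2%:R ^+ 2 =
      n ^+ 2 + 2 * n * x 0 0 + (x 0 0 ^+ 2 + x 0 1 ^+ 2 + x 0 2%:R ^+ 2) by ring.
    by rewrite -n2; ring.
  by rewrite /M mulrCA mulVf// mulr1.
have xw : x 0 0 * w 0 + x 0 1 * w 1 + x 0 2%:R * w 2%:R = n * (n + x 0 0).
  rewrite /w/= !mulr0 !mulr1 !add0r.
  have -> : x 0 0 * (n + x 0 0) + x 0 1 * x 0 1 + x 0 2%:R * x 0 2%:R =
    n * x 0 0 + (x 0 0 ^+ 2 + x 0 1 ^+ 2 + x 0 2%:R ^+ 2) by ring.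
  by rewrite -n2; ring.
exists (\matrix_(i, j) (M * w i * w j - (i == j)%:R)).
  split.
    apply/matrixP => i j; rewrite mxE sum3 !mxE.
    have key (d : R) : M * w i * w j * (M * (w 0 ^+ 2 + w 1 ^+ 2 + w 2%:R ^+ 2)) - 2 * M * w i * w j + d = d.
      by rewrite MS; ring.
    rewrite -[RHS](key (i == j)%:R).
    by move: i key; apply: forall3 => _; move: j; apply: forall3; rewrite /=; ring.
  rewrite det3 !mxE/=.
  transitivity (M * (w 0 ^+ 2 + w 1 ^+ 2 + w 2%:R ^+ 2) - 1); first by ring.
  by rewrite MS; ring.
apply/rowP => j; rewrite mxE sum3 !mxE.
transitivity (M * (x 0 0 * w 0 + x 0 1 * w 1 + x 0 2%:R * w 2%:R) * w j - x 0 j).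
  by move: j; apply: forall3; rewrite /=; ring.
by rewrite xw /M mulVf// mul1r /w eqxx/= -/n; ring.
Qed.

Lemma spherical_conj (a : R) T Q x : spherical_tensor (eball a) T -> rotation Q ->
  enorm x < a -> T x = Q *m T (x *m Q) *m Q^T.
Proof. by move=> sT rQ xa; rewrite -(sT Q rQ x xa) /pullback jacobian_mulmxr. Qed.

(** Two rotations fixing the first axis suffice: the half turn kills the entries mixing index 0 with
    the others, and the quarter turn equates the two other diagonal entries and, with symmetry,
    kills the entry between them. *)
Lemma spherical_axis (a s : R) T : spherical_tensor (eball a) T ->
  (forall x, eball a x -> (T x)^T = T x) -> `|s| < a ->
  forall i j, T (s *: 'e_0) i j =
    T (s *: 'e_0) 1 1 * (i == j)%:R + (T (s *: 'e_0) 0 0 - T (s *: 'e_0) 1 1) * ((i == 0) && (j == 0))%:R.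
Proof.
move=> sT tT sa; set t := T _.
have sa' : enorm (s *: 'e_0 : point) < a by rewrite enorm_scale_e0.
have tt i j : t i j = t j i.
  by have := congr1 (fun M : 'M[R]_3 => M j i) (tT _ sa'); rewrite mxE.
have S1 : rotation (\matrix_(i, j) ((i == j)%:R * (if i == 0 then 1 else -1)) : 'M[R]_3).
  split; last by rewrite det3 !mxE/=; ring.
  by apply/matrixP => i j; rewrite mxE sum3 !mxE; move: i; apply: forall3; move: j; apply: forall3;
      rewrite ?mxE/=; ring.
have S2 : rotation (\matrix_(i, j) (if i == 0 then (j == 0)%:R else if i == 1 then (j == 2%:R)%:R else - (j == 1)%:R) : 'M[R]_3).
  split; last by rewrite det3 !mxE/=; ring.
  by apply/matrixP => i j; rewrite mxE sum3 !mxE; move: i; apply: forall3; move: j; apply: forall3;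
      rewrite ?mxE/=; ring.
have h1 := spherical_conj sT S1 sa'; have h2 := spherical_conj sT S2 sa'.
have f1 : (s *: 'e_0 : point) *m (\matrix_(i, j) ((i == j)%:R * (if i == 0 then 1 else -1)) : 'M[R]_3) = s *: 'e_0.
  by apply/rowP; apply: forall3; rewrite mxE sum3 !mxE/=; ring.
have f2 : (s *: 'e_0 : point) *m (\matrix_(i, j) (if i == 0 then (j == 0)%:R else if i == 1 then (j == 2%:R)%:R else - (j == 1)%:R) : 'M[R]_3) = s *: 'e_0.
  by apply/rowP; apply: forall3; rewrite mxE sum3 !mxE/=; ring.
rewrite f1 -/t in h1; rewrite f2 -/t in h2.
have e1 i j := congr1 (fun M : 'M[R]_3 => M i j) h1.
have e2 i j := congr1 (fun M : 'M[R]_3 => M i j) h2.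
have a01 := e1 0 1; have a02 := e1 0 2%:R; have b11 := e2 1 1; have b12 := e2 1 2%:R.
rewrite /= !mxE !sum3 !mxE !sum3 !mxE/= in a01 a02 b11 b12.
have c01 : t 0 1 = 0 by lra.
have c02 : t 0 2%:R = 0 by lra.
have c12 : t 1 2%:R = 0 by have := tt 2%:R 1; lra.
have c22 : t 2%:R 2%:R = t 1 1 by lra.
apply: forall3; apply: forall3; rewrite /= ?c01 ?c02 ?c12 ?c22 ?[t _ 0]tt ?[t 2%:R 1]tt ?c01 ?c02 ?c12; ring.
Qed.

(** Conjugation by the rotation that takes [x] to the axis reduces to [spherical_axis]; the first
    column of that rotation is [x / |x|], which produces the rank one term. *)
Lemma spherical_form (a : R) T x : spherical_tensor (eball a) T ->
  (forall x, eball a x -> (T x)^T = T x) -> 0 < enorm x < a ->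
  forall i j, T x i j = T (enorm x *: 'e_0) 1 1 * (i == j)%:R
    + (T (enorm x *: 'e_0) 0 0 - T (enorm x *: 'e_0) 1 1) / nsq x * x 0 i * x 0 j.
Proof.
move=> sT tT /andP[x0 xa] i j; have [Q rQ xQ] := rotation_to_axis x.
rewrite (spherical_conj sT rQ xa) xQ.
have na : `|enorm x| < a by rewrite ger0_norm// sqrtr_ge0.
have H := spherical_axis sT tT na; set t := T (enorm x *: 'e_0) in H *.
have QQ : Q i 0 * Q j 0 + Q i 1 * Q j 1 + Q i 2%:R * Q j 2%:R = (i == j)%:R.
  by have [/(congr1 (fun M : 'M[R]_3 => M i j)) + _] := rQ; rewrite /= mxE sum3 !mxE.
have xE k : x 0 k = enorm x * Q k 0.
  have [QQ' _] := rQ.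
  have : x = (enorm x *: 'e_0) *m Q^T by rewrite -xQ -mulmxA QQ' mulmx1.
  by move=> {1}->; rewrite mxE sum3 !mxE/=; ring.
move: H; move: (t 1 1) (t 0 0) => A B H.
rewrite !mxE sum3 !mxE !sum3 !H/=.
rewrite !xE -enorm_sqr -QQ; have := lt0r_neq0 x0 => xn.
by field.
Qed.

(** Evaluated on the equator at longitude 0: there the radial row of the Jacobian of [polar] is the
    first unit vector, so the radial coefficient of the form is the Cartesian entry [0 0]. *)
Lemma polar_axis (a s : R) g v : polar_form a g (fun=> 1) v -> 0 < s < a -> g (s *: 'e_0) 0 0 = 1.
Proof.
move=> pg sa; pose q : point := row3 s (pi / 2) 0.
have p0 := pi_gt0 R.
have pi2 : 0 < (pi / 2 : R) < pi by apply/andP; split; lra.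
have [q0 q1 q2] : [/\ q 0 0 = s, q 0 1 = pi / 2 & q 0 2%:R = 0] by split; rewrite mxE.
have polE : polar q = s *: 'e_0.
  apply/rowP; apply: forall3; rewrite !mxE/= ?sin_pihalf ?cos_pihalf ?sin0 ?cos0; ring.
have dc (i : 'I_3) : differentiable (fun x : point => x 0 i) q by exact: differentiable_coord.
have dcos (i : 'I_3) : differentiable (fun x : point => cos (x 0 i)) q.
  apply: (@differentiable_comp _ _ _ _ (fun x : point => x 0 i) cos) => //.
  exact/derivable1_diffP/derivable_cos.
have dsin (i : 'I_3) : differentiable (fun x : point => sin (x 0 i)) q.
  apply: (@differentiable_comp _ _ _ _ (fun x : point => x 0 i) sin) => //.
  exact/derivable1_diffP/derivable_sin.
have pE : [/\ (fun x : point => polar x 0 0) = (fun x => x 0 0 * sin (x 0 1) * cos (x 0 2%:R)),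
   (fun x : point => polar x 0 1) = (fun x => x 0 0 * sin (x 0 1) * sin (x 0 2%:R)) &
   (fun x : point => polar x 0 2%:R) = (fun x => x 0 0 * cos (x 0 1))].
  have e : (2 : 'I_3) = 2%:R by [].
  by split; apply/funext => x; rewrite mxE/=.
have [P0 P1 P2] := pE.
have dP : differentiable (@polar R) q.
  apply: differentiable_rV; apply: forall3.
  - by rewrite P0; exact: (differentiableM (differentiableM (dc 0) (dsin 1)) (dcos 2%:R)).
  - by rewrite P1; exact: (differentiableM (differentiableM (dc 0) (dsin 1)) (dsin 2%:R)).
  - by rewrite P2; exact: (differentiableM (dc 0) (dcos 1)).
have ic (i : 'I_3) := @isd_comp R _ cos (fun x : point => x 0 i) q ('e_0) _ _ (is_derive_cos _) (isd_coord q ('e_0) i).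
have is_ (i : 'I_3) := @isd_comp R _ sin (fun x : point => x 0 i) q ('e_0) _ _ (is_derive_sin _) (isd_coord q ('e_0) i).
have J0 : 'J (@polar R) q 0 0 = 1.
  rewrite jacobian_entry// P0; have h := isdM (isdM (isd_coord q ('e_0) 0) (is_ 1)) (ic 2%:R).
  by rewrite (@derive_val _ _ _ _ _ _ _ h) !mxE/= ?sin_pihalf ?cos_pihalf ?sin0 ?cos0; ring.
have J1 : 'J (@polar R) q 0 1 = 0.
  rewrite jacobian_entry// P1; have h := isdM (isdM (isd_coord q ('e_0) 0) (is_ 1)) (is_ 2%:R).
  by rewrite (@derive_val _ _ _ _ _ _ _ h) !mxE/= ?sin_pihalf ?cos_pihalf ?sin0 ?cos0; ring.
have J2 : 'J (@polar R) q 0 2%:R = 0.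
  rewrite jacobian_entry// P2; have h := isdM (isd_coord q ('e_0) 0) (ic 1).
  by rewrite (@derive_val _ _ _ _ _ _ _ h) !mxE/= ?sin_pihalf ?cos_pihalf; ring.
have := congr1 (fun M : 'M[R]_3 => M 0 0) (pg s (pi / 2) 0 sa pi2).
rewrite /pullback -/q polE; move: J0 J1 J2; move: ('J _ q) => J J0 J1 J2.
rewrite /= !mxE sum3 !mxE !sum3 J0 J1 J2/= => e.
by apply: (etrans _ e); ring.
Qed.

End SphericalTensors.

Ltac fieldn := field; repeat (apply/andP; split); try assumption.

(** * Curvature, divergence and traces for radial metrics and tensors *)

Section RadialGeometry.
Variable R : realType.
Local Notation point := 'rV[R]_3.
Implicit Types (x : point) (i j l m : 'I_3).

Lemma isd_radial (phi : R -> R) (dphi : R) x l : 0 < enorm x ->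
  is_derive (enorm x) 1 phi dphi ->
  is_derive x 'e_l (fun y => phi (enorm y)) (dphi * (x 0 l / enorm x)).
Proof.
move=> x0 hphi.
have n0 : 0 < nsq x by rewrite -enorm_sqr exprn_gt0.
have h := @isd_comp R _ Num.sqrt (@nsq R) x ('e_l) _ _ (isd_sqrt n0) (isd_nsq x l).
have E : (fun y : point => Num.sqrt (nsq y)) = @enorm R 3 by apply/funext => y; rewrite enormE.
rewrite E -enormE in h.
apply: is_derive_eq (@isd_comp R _ phi (@enorm R 3) x ('e_l) _ _ hphi h) _.
by have := lt0r_neq0 x0 => ?; fieldn.
Qed.

Lemma near_annulus (a : R) x : 0 < enorm x < a -> \forall y \near x, 0 < enorm y < a.
Proof.
move=> /andP[x0 xa].
have h1 : \forall y \near x, 0 < enorm y by exact: (@continuous_enorm R x _ (lt_nbhsr x0)).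
have h2 : \forall y \near x, enorm y < a by exact: (@continuous_enorm R x _ (lt_nbhsl xa)).
by apply: filterS2 h1 h2 => y -> ->.
Qed.

Lemma partial_near (f h : point -> R) i x df : (\near x, h x = f x) -> is_derive x 'e_i h df ->
  partial i f x = df.
Proof. by move=> fh hd; exact: (@derive_val _ _ _ _ _ _ _ (near_eq_is_derive fh hd)). Qed.

Variables (a : R) (g k : point -> 'M[R]_3) (al al1 al2 K K1 L L1 : R -> R).
Hypothesis al0 : forall s, 0 < s < a -> 0 < al s.
Hypothesis dal : forall s, 0 < s < a -> is_derive s 1 al (al1 s).
Hypothesis dal1 : forall s, 0 < s < a -> is_derive s 1 al1 (al2 s).
Hypothesis dK : forall s, 0 < s < a -> is_derive s 1 K (K1 s).
Hypothesis dL : forall s, 0 < s < a -> is_derive s 1 L (L1 s).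
Hypothesis gE : forall x, 0 < enorm x < a -> forall i j, g x i j =
  al (enorm x) * (i == j)%:R + (1 - al (enorm x)) / nsq x * x 0 i * x 0 j.
Hypothesis kE : forall x, 0 < enorm x < a -> forall i j, k x i j =
  L (enorm x) * (i == j)%:R + (K (enorm x) - L (enorm x)) / nsq x * x 0 i * x 0 j.

(** In this section [al] plays the role of [r^2 / rho^2], [K] of k_rr and [L] of k_thetatheta /
    rho^2. The inverse is a Sherman-Morrison formula, simplified by the fact that the eigenvalue
    along [x] is 1. *)
Lemma invmx_radial x : 0 < enorm x < a -> forall i j, invmx (g x) i j =
  ((i == j)%:R - (1 - al (enorm x)) / nsq x * x 0 i * x 0 j) / al (enorm x).
Proof.
move=> xa; case/andP : (xa) => x0 _; have A0 := lt0r_neq0 (al0 xa).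
have s0 : nsq x != 0 by rewrite -enorm_sqr lt0r_neq0// exprn_gt0.
set A := al (enorm x) in A0 *; set B := (1 - A) / nsq x.
pose N : 'M[R]_3 := \matrix_(i, j) (((i == j)%:R - B * x 0 i * x 0 j) / A).
suff NE : invmx (g x) = N by move=> i j; rewrite NE mxE.
have gN : g x *m N = 1%:M.
  apply/matrixP => i j; rewrite mxE sum3 !mxE !(gE xa) -/A -/B.
  have key (d : R) : d + x 0 i * x 0 j * B * (1 - A - B * (x 0 0 ^+ 2 + x 0 1 ^+ 2 + x 0 2%:R ^+ 2)) / A = d.
    by rewrite -/(nsq x) {2}/B divfK// subrr mulr0 mul0r addr0.
  rewrite -[RHS]key.
  by move: i {key}; apply: forall3; move: j; apply: forall3; rewrite /=; fieldn.
have [gu _] := mulmx1_unit gN.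
by rewrite -[invmx _]mulmx1 -gN mulmxA mulVmx// mul1mx.
Qed.

Let ca s := al1 s / (2 * s * al s).
Let cb s := (1 - al s) / s ^+ 2 - al1 s / (2 * s).
Let cc s := - al1 s / (2 * s ^+ 3) - (1 - al s) / s ^+ 4 - al1 s * (1 - al s) / (s ^+ 3 * al s).

Lemma partial_radial_tensor (T : point -> 'M[R]_3) (u w u1 w1 : R -> R) :
  (forall x, 0 < enorm x < a -> forall i j, T x i j =
     u (enorm x) * (i == j)%:R + (w (enorm x) - u (enorm x)) / nsq x * x 0 i * x 0 j) ->
  (forall s, 0 < s < a -> is_derive s 1 u (u1 s)) -> (forall s, 0 < s < a -> is_derive s 1 w (w1 s)) ->
  forall x, 0 < enorm x < a -> forall l i j, partial l (fun y => T y i j) x =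
    u1 (enorm x) * (x 0 l / enorm x) * (i == j)%:R
    + ((w1 (enorm x) - u1 (enorm x)) / enorm x ^+ 3 - 2 * (w (enorm x) - u (enorm x)) / enorm x ^+ 4) * x 0 l * x 0 i * x 0 j
    + (w (enorm x) - u (enorm x)) / enorm x ^+ 2 * ((i == l)%:R * x 0 j + x 0 i * (j == l)%:R).
Proof.
move=> TE du dw x xa l i j; case/andP : (xa) => x0 _; have xn := lt0r_neq0 x0.
have s0 : nsq x != 0 by rewrite -enorm_sqr lt0r_neq0// exprn_gt0.
have hu := isd_radial l x0 (du _ xa); have hw := isd_radial l x0 (dw _ xa).
have hc i' := isd_coord x ('e_l) i'.
have hV := @isdV R _ (@nsq R) x ('e_l) _ s0 (isd_nsq x l).
have H := isdD (isdM hu (isd_cst (i == j)%:R x ('e_l)))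
  (isdM (isdM (isdM (isdD hw (isdN hu)) hV) (hc i)) (hc j)).
apply: (partial_near _ (is_derive_eq H _)).
  by apply: filterS (near_annulus xa) => y ya; rewrite TE.
rewrite !mxE !eqxx/= -enorm_sqr.
by move: (i == j)%:R (i == l)%:R (j == l)%:R => d1 d2 d3; fieldn.
Qed.

Lemma christoffel_radial x : 0 < enorm x < a -> forall m i j, christoffel g m i j x =
  ca (enorm x) * (x 0 i * (j == m)%:R + x 0 j * (i == m)%:R)
  + cb (enorm x) * x 0 m * (i == j)%:R + cc (enorm x) * x 0 i * x 0 j * x 0 m.
Proof.
move=> xa m i j; case/andP : (xa) => x0 _; have A0 := lt0r_neq0 (al0 xa).
have xn := lt0r_neq0 x0.
have s0 : nsq x != 0 by rewrite -enorm_sqr lt0r_neq0// exprn_gt0.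
have P := @partial_radial_tensor g al (fun=> 1) al1 (fun=> 0) gE dal (fun s _ => isd_cst 1 s 1) x xa.
(* The position vector is an eigenvector of the metric with eigenvalue 1, so contracting the inverse
   metric with it changes nothing. *)
have Ix : \sum_l invmx (g x) m l * x 0 l = x 0 m.
  under eq_bigr do rewrite (invmx_radial xa).
  have h : nsq x = x 0 0 ^+ 2 + x 0 1 ^+ 2 + x 0 2%:R ^+ 2 by [].
  rewrite sum3; set B := (1 - al (enorm x)) / nsq x.
  have key : (1 - B * (x 0 0 ^+ 2 + x 0 1 ^+ 2 + x 0 2%:R ^+ 2)) / al (enorm x) = 1.
    by rewrite -h /B divfK// opprB addrC subrK divff.
  rewrite -[RHS]mulr1 -[in RHS]key.
  by move: m; apply: forall3; rewrite /=; fieldn.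
have Id i' : \sum_l invmx (g x) m l * (i' == l)%:R = invmx (g x) m i'.
  rewrite (bigD1 i')//= eqxx mulr1 big1 ?addr0// => l /negbTE li.
  by rewrite eq_sym li mulr0.
rewrite /christoffel.
rewrite /ca /cb /cc; set n := enorm x in xn P A0 *; set A := al n in A0 P *; set A1 := al1 n in P *.
pose c3 := ((1 - A) / n ^+ 2 - A1 / (2 * n)) * (i == j)%:R
   + (- A1 / (2 * n ^+ 3) - (1 - A) / n ^+ 4) * x 0 i * x 0 j.
transitivity (\sum_l (A1 / (2 * n) * x 0 i * (invmx (g x) m l * (j == l)%:R)
   + A1 / (2 * n) * x 0 j * (invmx (g x) m l * (i == l)%:R) + c3 * (invmx (g x) m l * x 0 l))).
  rewrite big_distrr/=; apply: eq_bigr => l _; rewrite !P /c3.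
  rewrite [l == i]eq_sym [l == j]eq_sym [j == i]eq_sym.
  move: (i == j)%:R (i == l)%:R (j == l)%:R (invmx _ _ _) => d1 d2 d3 v; by fieldn.
rewrite !big_split/= -!big_distrr/= !Id Ix !(invmx_radial xa) -/n -/A -enorm_sqr -/n.
rewrite [m == j]eq_sym [m == i]eq_sym /c3.
clear P; move: (x 0 i) (x 0 j) (x 0 m) => xi xj xm.
move: (i == j)%:R (i == m)%:R (j == m)%:R => d1 d2 d3.
clearbody A A1 n; by fieldn.
Qed.

Variable s : R.
Hypothesis sa : 0 < s < a.
Let z : point := s *: 'e_0.

Let enz : enorm z = s.
Proof. by rewrite enorm_scale_e0 gtr0_norm//; case/andP : sa. Qed.
Let za : 0 < enorm z < a. Proof. by rewrite enz. Qed.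
Let s0 : 0 < s. Proof. by case/andP : sa. Qed.
Let sn : s != 0. Proof. exact: lt0r_neq0. Qed.
Let z0 i : z 0 i = s * (i == 0)%:R. Proof. by rewrite !mxE eqxx. Qed.
Let nz : nsq z = s ^+ 2. Proof. by rewrite -enorm_sqr enz. Qed.

Let da := al2 s / (2 * s * al s) - al1 s / (2 * s ^+ 2 * al s) - al1 s ^+ 2 / (2 * s * al s ^+ 2).
Let db := - al1 s / s ^+ 2 - 2 * (1 - al s) / s ^+ 3 - al2 s / (2 * s) + al1 s / (2 * s ^+ 2).

(** The derivative [dc] of the coefficient [cc] is left unspecified: it enters only when all four
    indices are radial and cancels from the Ricci tensor. *)
Lemma partial_christoffel : exists dc, forall l m i j, partial l (christoffel g m i j) z =
  (l == 0)%:R * (s * da * ((i == 0)%:R * (j == m)%:R + (j == 0)%:R * (i == m)%:R)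
     + s * db * (m == 0)%:R * (i == j)%:R + s ^+ 3 * dc * (i == 0)%:R * (j == 0)%:R * (m == 0)%:R)
  + ca s * ((i == l)%:R * (j == m)%:R + (j == l)%:R * (i == m)%:R) + cb s * (m == l)%:R * (i == j)%:R
  + cc s * s ^+ 2 * ((i == l)%:R * (j == 0)%:R * (m == 0)%:R + (i == 0)%:R * (j == l)%:R * (m == 0)%:R
     + (i == 0)%:R * (j == 0)%:R * (m == l)%:R).
Proof.
have A0 := lt0r_neq0 (al0 sa).
have two0 : (2 : R) != 0 by rewrite pnatr_eq0.
have da' : is_derive s 1 ca da.
  have n0 : 2 * s * al s != 0 by rewrite !mulf_neq0.
  have h := isdM (dal1 sa) (@isdV R R (fun t => 2 * t * al t) s 1 _ n0
    (isdM (isdM (isd_cst 2 s (1 : R)) (isd_id s)) (dal sa))).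
  by apply: is_derive_eq h _; rewrite /da; fieldn.
have i2 := @isdV R R (fun t => t ^+ 2) s 1 _ (expf_neq0 2 sn) (isdX 2 (isd_id s)).
have i3 := @isdV R R (fun t => 2 * t ^+ 3) s 1 _ (mulf_neq0 two0 (expf_neq0 3 sn))
   (isdM (isd_cst 2 s (1 : R)) (isdX 3 (isd_id s))).
have i4 := @isdV R R (fun t => t ^+ 4) s 1 _ (expf_neq0 4 sn) (isdX 4 (isd_id s)).
have i1 := @isdV R R (fun t => 2 * t) s 1 _ (mulf_neq0 two0 sn) (isdM (isd_cst 2 s (1 : R)) (isd_id s)).
have iA := @isdV R R (fun t => t ^+ 3 * al t) s 1 _ (mulf_neq0 (expf_neq0 3 sn) A0) (isdM (isdX 3 (isd_id s)) (dal sa)).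
have o := isdD (isd_cst 1 s (1 : R)) (isdN (dal sa)).
have db' : is_derive s 1 cb db.
  apply: is_derive_eq (isdD (isdM o i2) (isdN (isdM (dal1 sa) i1))) _.
  by rewrite /db; fieldn.
have dc' := isdD (isdD (isdM (isdN (dal1 sa)) i3) (isdN (isdM o i4))) (isdN (isdM (isdM (dal1 sa) o) iA)).
move: dc'; set dc := (X in is_derive _ _ _ X) => dc'.
have {}dc' : is_derive s 1 cc dc := dc'.
exists dc => l m i j.
have r1 := isd_radial l (_ : 0 < enorm z); rewrite enz in r1.
have ha := r1 _ _ s0 da'; have hb := r1 _ _ s0 db'; have hcc := r1 _ _ s0 dc'.
have hc i' := isd_coord z ('e_l) i'.
have H := isdD (isdD (isdM ha (isdD (isdM (hc i) (isd_cst (j == m)%:R z ('e_l))) (isdM (hc j) (isd_cst (i == m)%:R z ('e_l)))))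
   (isdM (isdM hb (hc m)) (isd_cst (i == j)%:R z ('e_l)))) (isdM (isdM (isdM hcc (hc i)) (hc j)) (hc m)).
apply: (partial_near _ (is_derive_eq H _)).
  by apply: filterS (near_annulus za) => y ya; rewrite christoffel_radial.
rewrite !z0 !mxE !eqxx/= enz.
have -> : s * (l == 0)%:R / s = (l == 0)%:R by rewrite mulrC mulKf.
clearbody dc; ring.
Qed.

Let invz i j : invmx (g z) i j = (i == j)%:R / (if i == 0 then 1 else al s).
Proof.
have A0 := lt0r_neq0 (al0 sa).
rewrite (invmx_radial za) enz nz !z0.
by move: i; apply: forall3; move: j; apply: forall3; rewrite /=; fieldn.
Qed.

Let trace_invz (T : 'I_3 -> 'I_3 -> R) :
  \sum_i \sum_j invmx (g z) i j * T i j = T 0 0 + (T 1 1 + T 2%:R 2%:R) / al s.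
Proof.
transitivity (\sum_i \sum_j (i == j)%:R / (if i == 0 then 1 else al s) * T i j).
  by apply: eq_bigr => i _; apply: eq_bigr => j _; rewrite invz.
by rewrite !sum3 /= !mul0r invr1; ring.
Qed.

Let q := s ^+ 2 * al s.
Let q1 := 2 * s * al s + s ^+ 2 * al1 s.
Let q2 := 2 * al s + 4 * s * al1 s + s ^+ 2 * al2 s.

(** With [q = r^2] this is the warped product formula [- 4 r'' / r + 2 (1 - r'^2) / r^2]; writing it
    in [q] avoids square roots. *)
Lemma scalar_curvature_radial : scalar_curvature g z = (2 - 2 * q2 + q1 ^+ 2 / (2 * q)) / q.
Proof.
have A0 := lt0r_neq0 (al0 sa).
have [dc dG] := partial_christoffel.
have GE m i j : christoffel g m i j z = ca s * s * ((i == 0)%:R * (j == m)%:R + (j == 0)%:R * (i == m)%:R)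
  + cb s * s * (m == 0)%:R * (i == j)%:R + cc s * s ^+ 3 * (i == 0)%:R * (j == 0)%:R * (m == 0)%:R.
  by rewrite christoffel_radial// enz !z0; ring.
pose P := 2 * (ca s * s) + cb s * s + cc s * s ^+ 3.
have R0 : ricci g 0 0 z = 2 * (cb s + cc s * s ^+ 2) - 2 * (s * da + ca s)
    + 2 * (ca s * s) * P - 2 * (ca s * s) ^+ 2.
  rewrite /ricci !sum3 !dG !GE /P /= ?(mulr0, mul0r, addr0, add0r, mulr1, mul1r); clear.
  move: (ca s) (cb s) (cc s); generalize da db => d1 d2 c1 c2 c3; by ring.
have R1 (i : 'I_3) : i != 0 -> ricci g i i z =
    s * db + 2 * cb s - 2 * ca s - cc s * s ^+ 2 + P * (cb s * s).
  move: i; apply: forall3 => // _;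
    rewrite /ricci !sum3 !dG !GE /P /= ?(mulr0, mul0r, addr0, add0r, mulr1, mul1r); clear;
    by ring.
rewrite /scalar_curvature (trace_invz (fun i j => ricci g i j z)) R0 !R1//.
rewrite /P /ca /cb /cc /da /db /q /q1 /q2; move: (al s) (al1 s) (al2 s) s A0 sn => A A1 A2 t A0 tn.
by field; rewrite A0 tn.
Qed.

Let trE y : 0 < enorm y < a -> mtrace (g y) (k y) = K (enorm y) + 2 * L (enorm y) / al (enorm y).
Proof.
move=> ya; case/andP : (ya) => y0 _; have A0 := lt0r_neq0 (al0 ya).
have yn : nsq y != 0 by rewrite -enorm_sqr lt0r_neq0// exprn_gt0.
have h : nsq y = y 0 0 ^+ 2 + y 0 1 ^+ 2 + y 0 2%:R ^+ 2 by [].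
rewrite /mtrace /mxtrace sum3 !mxE !sum3 !(invmx_radial ya) !(kE ya)/=.
move: (al _) (K _) (L _) A0 => A k1 l1 A0.
have key : (1 - A) / nsq y * (y 0 0 ^+ 2 + y 0 1 ^+ 2 + y 0 2%:R ^+ 2) = 1 - A by rewrite -h divfK.
have key2 : (k1 - l1) / nsq y * (y 0 0 ^+ 2 + y 0 1 ^+ 2 + y 0 2%:R ^+ 2) = k1 - l1 by rewrite -h divfK.
move: key key2; move: ((1 - A) / nsq y) ((k1 - l1) / nsq y) => B D.
set S := (X in B * X = _) => e1 e2.
transitivity ((3 * l1 + D * S - B * S * l1 - (B * S) * (D * S)) / A); first by rewrite /S; fieldn.
by rewrite e1 e2; fieldn.
Qed.

Lemma trace_radial : mtrace (g z) (k z) = K s + 2 * L s / al s.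
Proof. by rewrite trE// enz. Qed.

Lemma tensor_norm2_radial : tensor_norm2 g k z = K s ^+ 2 + 2 * (L s / al s) ^+ 2.
Proof.
have A0 := lt0r_neq0 (al0 sa).
rewrite /tensor_norm2 !sum3 !invz /= !(mul0r, addr0, add0r) !(kE za) enz nz !z0/=.
by fieldn.
Qed.

Lemma partial_trace_radial : partial 0 (fun y => mtrace (g y) (k y)) z =
  K1 s + 2 * (L1 s * al s - L s * al1 s) / al s ^+ 2.
Proof.
have A0 := lt0r_neq0 (al0 sa).
have h : is_derive (enorm z) 1 (fun t => K t + 2 * L t / al t) (K1 s + 2 * (L1 s * al s - L s * al1 s) / al s ^+ 2).
  rewrite enz; apply: is_derive_eq (isdD (dK sa) (isdM (isdM (isd_cst 2 s (1 : R)) (dL sa)) (isdV A0 (dal sa)))) _.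
  by fieldn.
have H := isd_radial 0 (_ : 0 < enorm z) h.
apply: (partial_near _ (is_derive_eq (H _) _)).
- by apply: filterS (near_annulus za) => y ya; rewrite trE.
- by rewrite enz.
by rewrite enz z0/= mulr1 divff// mulr1.
Qed.

Lemma divergence_radial : divergence g k 0 z = K1 s + q1 / q * (K s - L s / al s).
Proof.
have A0 := lt0r_neq0 (al0 sa).
have P := @partial_radial_tensor k L K L1 K1 kE dL dK z za.
have GE m i j : christoffel g m i j z = ca s * s * ((i == 0)%:R * (j == m)%:R + (j == 0)%:R * (i == m)%:R)
  + cb s * s * (m == 0)%:R * (i == j)%:R + cc s * s ^+ 3 * (i == 0)%:R * (j == 0)%:R * (m == 0)%:R.
  by rewrite christoffel_radial// enz !z0; ring.
have kz i j : k z i j = L s * (i == j)%:R + (K s - L s) * (i == 0)%:R * (j == 0)%:R.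
  by rewrite (kE za) enz nz !z0; fieldn.
rewrite /divergence (trace_invz (fun i j => cov_deriv g k i j 0 z)) /cov_deriv !sum3 !P !GE !kz !z0 enz/=.
rewrite /ca /cb /cc /q1 /q; by fieldn.
Qed.

Lemma grad_norm2_radial (psi : point -> R) (phi phi1 : R -> R) :
  (forall x, 0 < enorm x < a -> psi x = phi (enorm x)) -> is_derive s 1 phi (phi1 s) ->
  grad_norm2 g psi z = phi1 s ^+ 2 /\ partial 0 psi z = phi1 s.
Proof.
move=> pE dp.
have P l : partial l psi z = phi1 s * (l == 0)%:R.
  have dp' : is_derive (enorm z) 1 phi (phi1 s) by rewrite enz.
  have H := isd_radial l (_ : 0 < enorm z) dp'.
  apply: (partial_near _ (is_derive_eq (H _) _)).
  - by apply: filterS (near_annulus za) => y ya; rewrite pE.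
  - by rewrite enz.
  by rewrite enz z0/= mulrAC divff// mul1r.
split; last by rewrite P mulr1.
rewrite /grad_norm2; under eq_bigr do under eq_bigr do rewrite -mulrA.
by rewrite (trace_invz (fun i j => partial i psi z * partial j psi z)) !P/=; ring.
Qed.

End RadialGeometry.

(** * The continuity argument *)

Section Bootstrap.
Variable R : realType.

Lemma abs_le_of_sqr (z c : R) : 0 <= c -> z ^+ 2 <= c ^+ 2 -> `|z| <= c.
Proof. by move=> c0 zc; rewrite -ler_sqr ?nnegrE// real_normK ?num_real. Qed.

Lemma derivative_nondecreasing (f f' : R -> R) (s t : R) : s <= t ->
  (forall u, s <= u <= t -> is_derive u 1 f (f' u)) ->
  (forall u, s <= u <= t -> 0 <= f' u) -> f s <= f t.
Proof.
move=> st df f0; have [||c cst E] := @MVT_segment R f f' s t st.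
- by move=> u; rewrite in_itv/= => /andP[su ut]; apply: df; rewrite !ltW.
- apply: continuous_in_subspaceT => u /set_mem/=; rewrite in_itv/= => stu.
  by apply: derivable1_continuous; have := df u stu => ?; apply: ex_derive.
rewrite -subr_ge0 E mulr_ge0 ?subr_ge0//; apply: f0.
by move: cst; rewrite in_itv.
Qed.

Lemma derivative_dominated (f f' g g' : R -> R) (s t : R) : s <= t ->
  (forall u, s <= u <= t -> is_derive u 1 f (f' u)) ->
  (forall u, s <= u <= t -> is_derive u 1 g (g' u)) ->
  (forall u, s <= u <= t -> `|f' u| <= g' u) -> `|f t - f s| <= g t - g s.
Proof.
move=> st df dg fg; rewrite ler_norml.
have h1 := @derivative_nondecreasing (fun u => g u + f u) (fun u => g' u + f' u) s t st
  (fun u su => isdD (dg u su) (df u su)).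
have h2 := @derivative_nondecreasing (fun u => g u + - f u) (fun u => g' u + - f' u) s t st
  (fun u su => isdD (dg u su) (isdN (df u su))).
have {}h1 : g s + f s <= g t + f t.
  by apply: h1 => u su; have := fg u su; rewrite ler_norml => /andP[? ?]; lra.
have {}h2 : g s + - f s <= g t + - f t.
  by apply: h2 => u su; have := fg u su; rewrite ler_norml => /andP[? ?]; lra.
by apply/andP; split; lra.
Qed.

Variables (a delta : R) (r v v1 lam lam1 kap p q E : R -> R).
Hypotheses (delta0 : 0 <= delta) (delta1 : delta <= 1000^-1).
Hypothesis r0 : forall t, 0 < t < a -> 0 < r t.
Hypothesis dr : forall t, 0 < t < a -> is_derive t 1 r (v t).
Hypothesis dv : forall t, 0 < t < a -> is_derive t 1 v (v1 t).
Hypothesis dlam : forall t, 0 < t < a -> is_derive t 1 lam (lam1 t).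
(** The flat energy density: [r^2 / t^2 * lam] is the Cartesian coefficient k_thetatheta / rho^2,
    the quantity that the Sobolev norm controls. *)
Let src t := kap t ^+ 2 + 2 * (r t ^+ 2 / t ^+ 2 * lam t) ^+ 2 + p t ^+ 2 + q t ^+ 2.
Hypothesis dE : forall t, 0 < t < a -> is_derive t 1 E (t * src t).
Hypothesis Eb : forall t, 0 < t < a -> 0 <= E t <= delta.
Hypothesis ham : forall t, 0 < t < a -> r t * v1 t =
  (1 - v t ^+ 2) / 2 + r t ^+ 2 * (kap t * lam t + lam t ^+ 2 / 2 - (p t ^+ 2 + q t ^+ 2) / 4).
Hypothesis mom : forall t, 0 < t < a ->
  - 2 * lam1 t + 2 * (v t / r t) * (kap t - lam t) = q t * p t.
Hypothesis lim0 : forall e, 0 < e -> exists2 d, 0 < d & forall t, 0 < t < a -> t < d ->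
  [/\ `|v t - 1| <= e, `|r t * lam t| <= e & r t <= e].

Let G t := (v t - 1) ^+ 2 + (r t * lam t) ^+ 2.
Let good x := forall t, 0 < t <= x -> G t <= 4^-1.

Let src_ge0 t : 0 <= src t.
Proof.
have := sqr_ge0 (kap t); have := sqr_ge0 (p t); have := sqr_ge0 (q t).
have := sqr_ge0 (r t ^+ 2 / t ^+ 2 * lam t); rewrite /src; lra.
Qed.

(** [G <= 1/4] keeps [v] between 1/2 and 3/2, hence [r] between [t / 2] and [3 t / 2], and the flat
    density controls [lam^2]. Integrating the constraints then yields [|v - 1| <= 72 delta] and
    [(r lam)^2 <= 36 delta], which for [delta <= 1/1000] is well below the threshold. *)
Let improve x : 0 < x < a -> good x -> G x <= 16^-1.
Proof.
move=> /andP[x0 xa] gx.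
have xin t : 0 < t <= x -> 0 < t < a by move=> /andP[-> tx]; exact: le_lt_trans xa.
have xx : 0 < x <= x by rewrite x0 lexx.
have gv t : 0 < t <= x -> [/\ 2^-1 <= v t, v t <= 3 / 2 & `|r t * lam t| <= 2^-1].
  move=> tx; have := gx t tx; rewrite /G => Gt.
  have q1 := sqr_ge0 (v t - 1); have q2 := sqr_ge0 (r t * lam t).
  have h1 : `|v t - 1| <= 2^-1.
    by apply: abs_le_of_sqr => //; have -> : 2^-1 ^+ 2 = 4^-1 :> R; [field|lra].
  have h2 : `|r t * lam t| <= 2^-1.
    by apply: abs_le_of_sqr => //; have -> : 2^-1 ^+ 2 = 4^-1 :> R; [field|lra].
  by move: h1; rewrite ler_norml => /andP[? ?]; split => //; lra.
(* The functions are controlled only on the open interval, so integrations start at a small radius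
   [s] supplied by [lim0], at the price of an arbitrary [e]. *)
have small (P : R -> Prop) e : 0 < e -> (forall s, 0 < s -> s <= x -> s <= e ->
   `|v s - 1| <= e -> `|r s * lam s| <= e -> r s <= e -> P s) -> exists s, [/\ 0 < s, s <= x & P s].
  move=> e0 HP; have [d d0 hd] := lim0 e0.
  pose s := Num.min (d / 2) (Num.min x e).
  have s0 : 0 < s by rewrite /s !lt_min x0 e0 divr_gt0.
  have sx : s <= x by rewrite /s !ge_min lexx orbT.
  have se : s <= e by rewrite /s !ge_min lexx !orbT.
  have sd : s < d by apply: (@le_lt_trans _ _ (d / 2)); [rewrite /s ge_min lexx|lra].
  have sa : 0 < s < a by apply: xin; rewrite s0.
  by have [h1 h2 h3] := hd s sa sd; exists s; split => //; exact: HP.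
have sub s t u : 0 < s -> t <= x -> s <= u <= t -> 0 < u <= x.
  by move=> s0 tx /andP[su ut]; rewrite (lt_le_trans s0)//= (le_trans ut).
have rlow t : 0 < t <= x -> t / 2 <= r t.
  move=> tx; case/andP : (tx) => t0 tx'; apply/ler_addgt0Pr => e e0.
  have [||s [s0 _ [st se]]] := @small (fun s => s <= t /\ s <= e) (Num.min t e).
    by rewrite lt_min t0.
    by move=> s _ _; rewrite le_min => /andP[? ?] _ _ _; split.
  unshelve epose proof (@derivative_nondecreasing (fun u => r u + - (u * 2^-1)) (fun u => v u + - (1 * 2^-1 + u * 0)) s t st _ _) as h.
  - by move=> u su; exact: (isdD (dr (xin _ (sub _ _ _ s0 tx' su))) (isdN (isdM (isd_id u) (isd_cst 2^-1 u (1 : R))))).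
  - by move=> u su; have [? _ _] := gv u (sub _ _ _ s0 tx' su); lra.
  have ss : 0 < s <= x by rewrite s0 (le_trans st tx').
  by have := r0 (xin s ss); move: h => /=; lra.
have rup t : 0 < t <= x -> r t <= 3 / 2 * t.
  move=> tx; case/andP : (tx) => t0 tx'; apply/ler_addgt0Pr => e e0.
  have [||s [s0 _ [st se]]] := @small (fun s => s <= t /\ r s <= e) (Num.min t e).
    by rewrite lt_min t0.
    by move=> s _ _; rewrite le_min => /andP[? _] _ _; rewrite le_min => /andP[_ ?]; split.
  unshelve epose proof (@derivative_nondecreasing (fun u => u * (3 / 2) + - r u) (fun u => 1 * (3 / 2) + u * 0 + - v u) s t st _ _) as h.
  - by move=> u su; exact: (isdD (isdM (isd_id u) (isd_cst (3 / 2) u (1 : R))) (isdN (dr (xin _ (sub _ _ _ s0 tx' su))))).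
  - by move=> u su; have [_ ? _] := gv u (sub _ _ _ s0 tx' su); lra.
  move: h => /=; lra.
have rmono s t : 0 < s -> s <= t -> t <= x -> r s <= r t.
  move=> s0 st tx; apply: (@derivative_nondecreasing r v s t st).
  - by move=> u su; exact: dr (xin _ (sub _ _ _ s0 tx su)).
  - by move=> u su; have [? _ _] := gv u (sub _ _ _ s0 tx su); lra.
(* Here the circularity is resolved: [rlow] gives [r^2 / t^2 >= 1/4], so [lam^2] is at most 16 times
   the squared Cartesian coefficient. *)
have lamb t : 0 < t <= x -> lam t ^+ 2 <= 8 * (2 * (r t ^+ 2 / t ^+ 2 * lam t) ^+ 2).
  move=> tx; case/andP : (tx) => t0 _; have t2 : 0 < t ^+ 2 by rewrite exprn_gt0.
  have al : 4^-1 <= r t ^+ 2 / t ^+ 2.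
    rewrite ler_pdivlMr//; have := rlow t tx => h.
    have : (t / 2) ^+ 2 <= r t ^+ 2 by rewrite ler_pXn2r// nnegrE ?divr_ge0 ?(ltW t0) ?(ltW (r0 (xin t tx))).
    rewrite expr_div_n; lra.
  rewrite exprMn; have := sqr_ge0 (lam t).
  move: al; set A := r t ^+ 2 / t ^+ 2 => al.
  have : 4^-1 ^+ 2 <= A ^+ 2 by rewrite ler_pXn2r// nnegrE; lra.
  by rewrite exprVn; nra.
have kl (k l : R) : `|k * l| <= (k ^+ 2 + l ^+ 2) / 2.
  by rewrite ler_norml; have := sqr_ge0 (k + l); have := sqr_ge0 (k - l); nra.
have rsrc t : 0 < t <= x -> r t * src t <= 3 / 2 * (t * src t).
  by move=> tx; rewrite mulrA; apply: ler_wpM2r => //; exact: rup.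
have sE s : 0 < s -> s <= x -> E x - E s <= delta.
  move=> s0 sx; have /andP[_ h1] := Eb (xin x xx).
  have ss : 0 < s <= x by rewrite s0.
  have /andP[h2 _] := Eb (xin s ss).
  by lra.
(* In the derivative of [r (1 - v^2)] the first constraint cancels the term without sources. The
   constant is 3 * 16 * 3/2, from [2 v <= 3], the bound on the sources and [r <= 3 t / 2]; the
   remaining factor [r <= r x] is divided out at the end. *)
have M : `|r x * (1 - v x ^+ 2)| <= 72 * r x * delta.
  apply/ler_addgt0Pr => e e0.
  have [||s [s0 sx hs]] := @small (fun s => `|r s * (1 - v s ^+ 2)| <= e) (Num.min (e / 2) 2^-1).
    by rewrite lt_min divr_gt0//=; lra.
    move=> s s0 sx _ _ _; rewrite le_min => /andP[re _].
    have ss : 0 < s <= x by rewrite s0.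
    have [h1 h2 _] := gv s ss; have rs := r0 (xin s ss).
    rewrite normrM (gtr0_norm rs).
    have : `|1 - v s ^+ 2| <= 2 by rewrite ler_norml; nra.
    by nra.
  have su u : s <= u <= x -> 0 < u <= x by exact: sub.
  unshelve epose proof (@derivative_dominated (fun t => r t * (1 + - (v t ^+ 2))) (fun t => v t * (1 + - (v t ^+ 2)) + r t * (0 + - (2%:R * v t ^+ 1 * v1 t))) (fun t => 72 * r x * E t) (fun t => 0 * E t + 72 * r x * (t * src t)) s x sx _ _ _) as h.
  - move=> u /su/xin ux; exact: (isdM (dr ux) (isdD (isd_cst 1 u (1 : R)) (isdN (isdX 2 (dv ux))))).
  - move=> u /su/xin ux; exact: (isdM (isd_cst (72 * r x) u (1 : R)) (dE ux)).
  - move=> u su'; have ux := su _ su'; have rp := r0 (xin _ ux).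
    have -> : v u * (1 + - (v u ^+ 2)) + r u * (0 + - (2%:R * v u ^+ 1 * v1 u)) =
       v u * (1 - v u ^+ 2) - 2 * v u * (r u * v1 u) by ring.
    rewrite (ham (xin _ ux)).
    have -> : v u * (1 - v u ^+ 2) - 2 * v u * ((1 - v u ^+ 2) / 2 + r u ^+ 2 *
       (kap u * lam u + lam u ^+ 2 / 2 - (p u ^+ 2 + q u ^+ 2) / 4)) =
       - (2 * v u) * (r u * (r u * (kap u * lam u + lam u ^+ 2 / 2 - (p u ^+ 2 + q u ^+ 2) / 4))) by field.
    have [v1' v2' _] := gv u ux.
    have lb := lamb u ux; have := kl (kap u) (lam u); rewrite ler_norml => /andP[k1 k2].
    have S : `|kap u * lam u + lam u ^+ 2 / 2 - (p u ^+ 2 + q u ^+ 2) / 4| <= 16 * src u.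
      have Q1 := sqr_ge0 (kap u); have Q2 := sqr_ge0 (r u ^+ 2 / u ^+ 2 * lam u).
      have Q3 := sqr_ge0 (p u); have Q4 := sqr_ge0 (q u).
      by rewrite ler_norml /src; lra.
    rewrite !normrM (gtr0_norm rp) normrN (_ : `|2 * v u| = 2 * v u); last by rewrite ger0_norm; lra.
    have h1 : r u * `|kap u * lam u + lam u ^+ 2 / 2 - (p u ^+ 2 + q u ^+ 2) / 4| <= 16 * (3 / 2 * (u * src u)).
      apply: (@le_trans _ _ (r u * (16 * src u))); first by apply: ler_wpM2l => //; exact: ltW.
      by have := rsrc u ux; lra.
    have h2 : r u <= r x by case/andP : su' => _ ?; apply: rmono => //; case/andP : ux.
    have W0 : 0 <= u * src u by apply: mulr_ge0 => //; case/andP : ux => /ltW.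
    apply: (@le_trans _ _ (3 * (r u * (16 * (3 / 2 * (u * src u)))))).
      apply: ler_pM => //; [by lra|by rewrite !mulr_ge0// ltW|by lra|].
      by apply: ler_wpM2l => //; exact: ltW.
    by nra.
  have := sE s s0 sx => es; have rx := r0 (xin x xx).
  have h3 : 72 * r x * E x - 72 * r x * E s <= 72 * r x * delta.
    by rewrite -mulrBr ler_pM2l//; lra.
  have := ler_normD (r x * (1 - v x ^+ 2) - r s * (1 - v s ^+ 2)) (r s * (1 - v s ^+ 2)).
  by rewrite subrK; move: h => /=; lra.
(* The second constraint replaces the derivative of [r lam] by [v kap - r q p / 2], which has no
   linear term in [lam]; the constant is 24 * 3/2. *)
have Z : (r x * lam x) ^+ 2 <= 36 * delta.
  apply/ler_addgt0Pr => e e0.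
  have [||s [s0 sx hs]] := @small (fun s => (r s * lam s) ^+ 2 <= e) (Num.min e 1).
    by rewrite lt_min e0//=; lra.
    move=> s s0 sx _ _; rewrite le_min => /andP[y1 y2] _.
    have : `|r s * lam s| * `|r s * lam s| <= e * 1 by apply: ler_pM.
    by rewrite -expr2 real_normK ?num_real// mulr1.
  have su u : s <= u <= x -> 0 < u <= x by exact: sub.
  unshelve epose proof (@derivative_dominated (fun t => (r t * lam t) ^+ 2) (fun t => 2%:R * (r t * lam t) ^+ 1 * (v t * lam t + r t * lam1 t)) (fun t => 36 * E t) (fun t => 0 * E t + 36 * (t * src t)) s x sx _ _ _) as h.
  - by move=> u /su/xin ux; exact: (isdX 2 (isdM (dr ux) (dlam ux))).
  - by move=> u /su/xin ux; exact: (isdM (isd_cst 36 u (1 : R)) (dE ux)).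
  - move=> u su'; have ux := su _ su'; have rp := r0 (xin _ ux).
    have rn := lt0r_neq0 rp.
    have -> : v u * lam u + r u * lam1 u = v u * kap u - r u * (q u * p u) / 2.
      by rewrite -(mom (xin _ ux)); field.
    have [v1' v2' y] := gv u ux.
    have lb := lamb u ux; have := kl (kap u) (lam u) => k1; have k2 := kl (q u) (p u).
    have -> : 2%:R * (r u * lam u) ^+ 1 * (v u * kap u - r u * (q u * p u) / 2) =
      r u * (2 * v u * (kap u * lam u) - (r u * lam u) * (q u * p u)) by field.
    rewrite normrM (gtr0_norm rp) mul0r add0r.
    have n1 : `|2 * v u * (kap u * lam u)| <= 3 * ((kap u ^+ 2 + lam u ^+ 2) / 2).
      by rewrite normrM; apply: ler_pM => //; rewrite ger0_norm; lra.
    have n2 : `|(r u * lam u) * (q u * p u)| <= 2^-1 * ((q u ^+ 2 + p u ^+ 2) / 2).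
      by rewrite normrM; apply: ler_pM.
    have S : `|2 * v u * (kap u * lam u) - (r u * lam u) * (q u * p u)| <= 24 * src u.
      apply: le_trans (ler_normB _ _) _.
      have Q1 := sqr_ge0 (kap u); have Q2 := sqr_ge0 (r u ^+ 2 / u ^+ 2 * lam u).
      have Q3 := sqr_ge0 (p u); have Q4 := sqr_ge0 (q u).
      by rewrite /src; lra.
    apply: (@le_trans _ _ (r u * (24 * src u))); first by apply: ler_wpM2l => //; exact: ltW.
    by have := rsrc u ux; lra.
  have es := sE s s0 sx.
  by move: h => /=; rewrite ler_norml => /andP[_]; lra.
have rx := r0 (xin x xx); have [v1' v2' _] := gv x xx.
have V : `|1 - v x ^+ 2| <= 72 * delta.
  move: M; rewrite normrM (gtr0_norm rx) (_ : 72 * r x * delta = r x * (72 * delta)); last by ring.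
  by rewrite ler_pM2l.
have V1 : `|v x - 1| <= 72 * delta.
  apply: le_trans V; rewrite (_ : 1 - v x ^+ 2 = - ((v x - 1) * (v x + 1))); last by ring.
  by rewrite normrN normrM ler_peMr// ger0_norm; lra.
have V2 : (v x - 1) ^+ 2 <= (72 * delta) * (72 * delta).
  by rewrite -(real_normK (num_real _)) expr2; apply: ler_pM.
have d72 : 72 * delta <= 72 / 1000 by rewrite ler_wpM2l.
have D0 : 0 <= 72 * delta by rewrite mulr_ge0.
have D2 : (72 * delta) * (72 * delta) <= 72 / 1000 * (72 / 1000) by apply: ler_pM.
by rewrite /G; lra.
Qed.

Let cG t : 0 < t < a -> {for t, continuous G}.
Proof.
move=> ta; apply: derivable1_continuous.
have h := isdD (isdX 2 (isdD (dv ta) (isd_cst (- 1) t (1 : R)))) (isdX 2 (isdM (dr ta) (dlam ta))).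
by apply: (@ex_derive _ _ _ _ _ _ _ h).
Qed.

(** The supremum of the good radii is good by continuity of [G], and [improve] leaves room to pass
    beyond it. The improved bound puts [|v - 1|] and [|r lam|] below 1/4, so that
    [|r lam| < 3/4 <= v]. *)
Lemma bootstrap x : 0 < x < a -> `|r x * lam x| < v x.
Proof.
move=> xa; suff gx : good x.
  have := improve xa gx; rewrite /G => Gt.
  have q1 := sqr_ge0 (v x - 1); have q2 := sqr_ge0 (r x * lam x).
  have h1 : `|v x - 1| <= 4^-1.
    by apply: abs_le_of_sqr => //; have -> : 4^-1 ^+ 2 = 16^-1 :> R; [field|lra].
  have h2 : `|r x * lam x| <= 4^-1.
    by apply: abs_le_of_sqr => //; have -> : 4^-1 ^+ 2 = 16^-1 :> R; [field|lra].
  by move: h1; rewrite ler_norml => /andP[? ?]; lra.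
move=> t0 /andP[t00 t0x]; rewrite leNgt; apply/negP => Gt0.
have t0a : 0 < t0 < a by rewrite t00 (le_lt_trans t0x)//; case/andP : xa.
pose S := [set t : R | 0 < t <= t0 /\ good t].
have [d d0 hd] := @lim0 4^-1 ltac:(lra).
have S0 : S !=set0.
  exists (Num.min (d / 2) t0); split; first by rewrite lt_min t00 divr_gt0//= ge_min lexx orbT.
  move=> t /andP[tp]; rewrite le_min => /andP[td tt0].
  have ta : 0 < t < a by rewrite tp (le_lt_trans tt0)//; case/andP : t0a.
  have [|h1 h2 _] := hd t ta; first by lra.
  have : `|v t - 1| * `|v t - 1| <= 4^-1 * 4^-1 by apply: ler_pM.
  have : `|r t * lam t| * `|r t * lam t| <= 4^-1 * 4^-1 by apply: ler_pM.
  by rewrite -!expr2 !real_normK ?num_real// /G exprVn; lra.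
have Sub : has_ubound S by exists t0 => t [/andP[_ ?] _].
have hS : has_sup S by split.
pose s := sup S.
have s_le t : S t -> t <= s by move=> St; exact: ub_le_sup.
have st0 : s <= t0 by apply: ge_sup => // t [/andP[_ ?] _].
have sp : 0 < s by have [t St] := S0; have := s_le t St; case: St => /andP[? _] _; exact: lt_le_trans.
have sa : 0 < s < a by rewrite sp (le_lt_trans st0)//; case/andP : t0a.
have gs' t : 0 < t < s -> G t <= 4^-1.
  move=> /andP[tp ts]; have [u [_ gu] tu] := sup_gt S0 ts.
  by apply: gu; rewrite tp ltW.
have gs : good s.
  move=> t /andP[tp]; rewrite le_eqVlt => /predU1P[->|ts]; last by apply: gs'; rewrite tp.
  rewrite leNgt; apply/negP => Gs.
  have : \forall u \near s, 4^-1 < G u by exact: (cG sa (lt_nbhsr Gs)).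
  move=> /nbhs_ballP[e /= e0 he].
  pose u := Num.max (s / 2) (s - e / 2).
  have us : u < s by rewrite gt_max; apply/andP; split; lra.
  have up : 0 < u by rewrite lt_max; apply/orP; left; lra.
  have : 4^-1 < G u.
    apply: he; rewrite /ball/= ger0_norm ?subr_ge0 ?ltW//.
    have : s - e / 2 <= u by rewrite le_max lexx orbT.
    lra.
  by rewrite ltNge gs'// up.
have Gs := improve sa gs.
have st : s < t0.
  by rewrite lt_neqAle st0 andbT; apply/eqP => e; move: Gt0; rewrite -e; lra.
have Gs4 : G s < 4^-1 by lra.
have : \forall u \near s, G u < 4^-1 by exact: (cG sa (lt_nbhsl Gs4)).
move=> /nbhs_ballP[e /= e0 he].
pose u := Num.min t0 (s + e / 2).
have su : s < u by rewrite lt_min st; lra.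
have : S u.
  split; first by rewrite (lt_trans sp su) ge_min lexx.
  move=> t /andP[tp tu]; have [ts|ts] := leP t s; first by apply: gs; rewrite tp.
  apply: ltW; apply: he; rewrite /ball/= distrC ger0_norm ?subr_ge0 ?(ltW ts)//.
  have : u <= s + e / 2 by rewrite ge_min lexx orbT.
  lra.
by move=> /s_le; rewrite leNgt su.
Qed.

End Bootstrap.

(** * Spherically symmetric surfaces *)

Section LocalInjectivity.
Variable R : realType.

Lemma smooth_coord n m (U : set 'rV[R]_n) (F : 'rV[R]_n -> 'rV[R]_m) : smooth_on U F ->
  forall j, (forall i x, U x -> derivable (fun y => F y 0 j) x 'e_i) /\
   (forall i x, U x -> {for x, continuous (partial i (fun y => F y 0 j))} \/ True) /\
   (forall i x, U x -> partial i (fun y => F y 0 j) x = partial i F x 0 j).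
Proof.
move=> sF j; have [_ h] := sF 1%N; split; last split => [|i x Ux]; first 1 last.
- by right.
- have [d _] := h i; have := d x Ux => dx.
  by rewrite /partial (derive_mx dx) mxE.
by move=> i x Ux; have [d _] := h i; have /derivable_mxP := d x Ux; apply.
Qed.

Lemma smooth_partial_continuous n m (U : set 'rV[R]_n) (F : 'rV[R]_n -> 'rV[R]_m) i j x : open U ->
  smooth_on U F -> U x -> {for x, continuous (partial i (fun y => F y 0 j))}.
Proof.
move=> oU sF Ux; have [_ h] := sF 1%N; have [_ [cp _]] := h i.
have [_ [_ pE]] := smooth_coord sF j.
have c : {for x, continuous (fun y => partial i F y 0 j)}.
  by apply: (@continuous_comp _ _ _ (partial i F) (fun z : 'rV[R]_m => z 0 j)); [exact: cp|exact: coord_continuous].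
have E : \forall y \near x, partial i F y 0 j = partial i (fun y => F y 0 j) y.
  by apply: filterS (open_nbhs_nbhs (conj oU Ux)) => y Uy; rewrite pE.
move=> P /=; rewrite (pE _ _ Ux) => /c /= HP.
by apply: filterS2 E HP => y /= <-.
Qed.

Lemma smooth_differentiable m (U : set 'rV[R]_2) (F : 'rV[R]_2 -> 'rV[R]_m) x : open U ->
  smooth_on U F -> U x -> differentiable F x.
Proof.
move=> oU sF Ux; apply: differentiable_rV => j.
have [d _] := smooth_coord sF j.
apply: (C1_differentiable2 oU Ux d) => i; exact: smooth_partial_continuous sF Ux.
Qed.

(** Strict differentiability at [p]: both end points are free, whereas differentiability compares
    with the value at [p] only. Injectivity on a neighbourhood requires the stronger form. *)
Lemma increment_estimate (U : set 'rV[R]_2) (f : 'rV[R]_2 -> R) p : open U -> U p ->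
  (forall i x, U x -> derivable f x 'e_i) -> (forall i, {for p, continuous (partial i f)}) ->
  forall e, 0 < e -> exists2 d, 0 < d & forall u w : 'rV[R]_2,
    (forall i, `|p 0 i - u 0 i| < d) -> (forall i, `|p 0 i - w 0 i| < d) ->
    `|f u - f w - (partial 0 f p * (u 0 0 - w 0 0) + partial 1 f p * (u 0 1 - w 0 1))|
      <= e * (`|u 0 0 - w 0 0| + `|u 0 1 - w 0 1|).
Proof.
move=> oU Up df cf e e0.
have two (i : 'I_2) : i = 0 \/ i = 1.
  by case: i => [[|[|//]] hi]; [left|right]; exact: val_inj.
have n1 : \forall x \near p, U x /\ forall i, `|partial i f x - partial i f p| <= e.
  have c i : \forall x \near p, `|partial i f x - partial i f p| <= e.
    have /cvgrPdist_le/(_ e e0) := cf i.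
    by apply: filterS => x; rewrite distrC.
  apply: filterS3 (open_nbhs_nbhs (conj oU Up)) (c 0) (c 1) => x Ux x0 x1.
  split; first exact: Ux.
  by move=> i; case: (two i) => ->; [exact: x0|exact: x1].
have [d d0 hd] := nbhs_box n1.
(* With radius [d / 3] the corner [q] and both coordinate segments joining [w] to [u] stay within
   [d] of [p]. *)
exists (d / 3); first by rewrite divr_gt0.
move=> u w hu hw.
pose q := (u 0 0 - w 0 0) *: 'e_0 + w.
have uE : u = (u 0 1 - w 0 1) *: 'e_1 + q.
  by apply/rowP => i; rewrite !mxE; case: (two i) => ->/=; ring.
have uw i : `|u 0 i - w 0 i| < 2 * (d / 3).
  have -> : u 0 i - w 0 i = (p 0 i - w 0 i) - (p 0 i - u 0 i) by ring.
  by apply: le_lt_trans (ler_normB _ _) _; have := hu i; have := hw i; lra.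
have seg (c : R) (v : 'rV[R]_2) (j : 'I_2) :
    (forall t, `|t| <= `|c| -> forall i, `|p 0 i - (t *: 'e_j + v) 0 i| < d) ->
    `|f (c *: 'e_j + v) - f v - partial j f p * c| <= e * `|c|.
  move=> H; have := @mean_value_estimate R (fun t => f (t *: 'e_j + v))
    (fun t => partial j f (t *: 'e_j + v)) (partial j f p) e c.
  rewrite scale0r add0r; apply.
    by move=> t /H/hd[Ut _]; apply: line_derivative; exact/derivableP/df.
  by move=> t /H/hd[_]; apply.
have S0 : `|f q - f w - partial 0 f p * (u 0 0 - w 0 0)| <= e * `|u 0 0 - w 0 0|.
  apply: seg => t ht i; rewrite !mxE eqxx/=.
  have -> : p 0 i - (t * (i == 0)%:R + w 0 i) = (p 0 i - w 0 i) - t * (i == 0)%:R by ring.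
  apply: le_lt_trans (ler_normB _ _) _; have := hw i; have := uw 0; have := normr_ge0 t.
  by case: (two i) => ->/=; rewrite ?mulr1 ?mulr0 ?normr0; lra.
have S1 : `|f u - f q - partial 1 f p * (u 0 1 - w 0 1)| <= e * `|u 0 1 - w 0 1|.
  rewrite {1}uE; apply: seg => t ht i; rewrite !mxE eqxx/=.
  have -> : p 0 i - (t * (i == 1)%:R + ((u 0 0 - w 0 0) * (i == 0)%:R + w 0 i)) =
    (p 0 i - ((u 0 0 - w 0 0) * (i == 0)%:R + w 0 i)) - t * (i == 1)%:R by ring.
  apply: le_lt_trans (ler_normB _ _) _; have := hw i; have := hu i; have := uw 1; have := normr_ge0 t.
  case: (two i) => ->/=; rewrite ?mulr1 ?mulr0 ?normr0 ?subrK ?add0r; lra.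
have -> : f u - f w - (partial 0 f p * (u 0 0 - w 0 0) + partial 1 f p * (u 0 1 - w 0 1)) =
  (f u - f q - partial 1 f p * (u 0 1 - w 0 1)) + (f q - f w - partial 0 f p * (u 0 0 - w 0 0)) by ring.
apply: le_trans (ler_normD _ _) _; apply: (le_trans (lerD S1 S0)).
by rewrite -mulrDr addrC.
Qed.

(** By Cramer's rule, the choice [e = d / (8 * M)] bounds each unknown by a quarter of [|x| + |y|],
    which forces this sum to vanish. *)
Lemma quantitative_injectivity2 (A B C D : R) : A * D - B * C != 0 ->
  exists2 e, 0 < e & forall x y : R, `|A * x + B * y| <= e * (`|x| + `|y|) ->
    `|C * x + D * y| <= e * (`|x| + `|y|) -> x = 0 /\ y = 0.
Proof.
move=> D0; set d := `|A * D - B * C|.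
have d0 : 0 < d by rewrite normr_gt0.
pose M := `|A| + `|B| + `|C| + `|D| + 1.
have nA := normr_ge0 A; have nB := normr_ge0 B; have nC := normr_ge0 C; have nD := normr_ge0 D.
have [MA MB MC MD] : [/\ `|A| <= M, `|B| <= M, `|C| <= M & `|D| <= M].
  by rewrite /M; clear -nA nB nC nD; split; lra.
have M0 : 0 < M by rewrite /M; clear -nA nB nC nD; lra.
clearbody M; pose e := d / (8 * M).
have e0 : 0 < e by rewrite divr_gt0// mulr_gt0.
have eM : M * e = d / 8 by rewrite /e; have := lt0r_neq0 M0 => ?; field.
exists e => // x y; set S := `|x| + `|y| => h1 h2.
have bnd (c1 c2 X Y : R) : `|c1| <= M -> `|c2| <= M -> `|X| <= e * S -> `|Y| <= e * S ->
    `|c1 * X - c2 * Y| <= d / 8 * S + d / 8 * S.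
  move=> a1 a2 a3 a4; apply: le_trans (ler_normB _ _) _; rewrite !normrM.
  have b1 : `|c1| * `|X| <= M * (e * S) by apply: ler_pM.
  have b2 : `|c2| * `|Y| <= M * (e * S) by apply: ler_pM.
  by rewrite mulrA eM in b1 b2; exact: lerD.
have half (w : R) : d * `|w| <= d / 8 * S + d / 8 * S -> `|w| <= S / 4.
  move=> h; rewrite -(ler_pM2l d0); apply: le_trans h _.
  by rewrite le_eqVlt; apply/orP; left; apply/eqP; field.
have hx : `|x| <= S / 4.
  apply: half; rewrite -normrM (_ : (A * D - B * C) * x = D * (A * x + B * y) - B * (C * x + D * y)); last by ring.
  exact: bnd.
have hy : `|y| <= S / 4.
  apply: half; rewrite -normrM (_ : (A * D - B * C) * y = A * (C * x + D * y) - C * (A * x + B * y)); last by ring.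
  exact: bnd.
have S00 : S <= 0 by move: hx hy; rewrite /S; clear; move: `|x| `|y| => u v; lra.
by split; apply/eqP; rewrite -normr_le0; apply: le_trans S00; [rewrite lerDl|rewrite lerDr].
Qed.

(** The injective half of the inverse function theorem; the onto half will come from the
    parametrization of the surface. *)
Lemma local_injectivity (U : set 'rV[R]_2) (f1 f2 : 'rV[R]_2 -> R) p : open U -> U p ->
  (forall i x, U x -> derivable f1 x 'e_i) -> (forall i, {for p, continuous (partial i f1)}) ->
  (forall i x, U x -> derivable f2 x 'e_i) -> (forall i, {for p, continuous (partial i f2)}) ->
  partial 0 f1 p * partial 1 f2 p - partial 1 f1 p * partial 0 f2 p != 0 ->
  exists2 d, 0 < d & forall u w : 'rV[R]_2,
    (forall i, `|p 0 i - u 0 i| < d) -> (forall i, `|p 0 i - w 0 i| < d) ->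
    f1 u = f1 w -> f2 u = f2 w -> u = w.
Proof.
move=> oU Up d1 c1 d2 c2 /quantitative_injectivity2[e e0 inj].
have [r1 r10 h1] := increment_estimate oU Up d1 c1 e0.
have [r2 r20 h2] := increment_estimate oU Up d2 c2 e0.
exists (Num.min r1 r2); first by rewrite lt_min r10.
move=> u w hu hw E1 E2.
have lt1 (x : R) : x < Num.min r1 r2 -> x < r1 by rewrite lt_min => /andP[].
have lt2 (x : R) : x < Num.min r1 r2 -> x < r2 by rewrite lt_min => /andP[].
have {}h1 := h1 u w (fun i => lt1 _ (hu i)) (fun i => lt1 _ (hw i)).
have {}h2 := h2 u w (fun i => lt2 _ (hu i)) (fun i => lt2 _ (hw i)).
rewrite E1 subrr sub0r normrN in h1; rewrite E2 subrr sub0r normrN in h2.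
have [x0 y0] := inj _ _ h1 h2.
apply/rowP => i; apply/eqP; rewrite -subr_eq0; apply/eqP.
case: i => [[|[|//]] hi].
  by rewrite (_ : Ordinal hi = 0)//; exact: val_inj.
by rewrite (_ : Ordinal hi = 1)//; exact: val_inj.
Qed.

End LocalInjectivity.

(** * The outermost sphere of a trapped surface *)

Section SphericalSurface.
Variable R : realType.
Local Notation point := 'rV[R]_3.

Lemma norm_le_enorm (x : point) : `|x| <= enorm x.
Proof.
rewrite [leLHS]mx_normrE; apply: bigmax_le; first exact: sqrtr_ge0.
by move=> [i j] _ /=; rewrite ord1; exact: enorm_coord.
Qed.

(** The norm maps the component of [z] onto an interval that contains [enorm z] and misses [s], so
    the component stays in the ball of radius [s]. *)
Lemma inside_not_unbounded (S : set point) (s : R) (z : point) :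
  (forall y, enorm y = s -> S y) -> enorm z < s -> ~ unbounded_side S z.
Proof.
move=> sS zs [nSz]; apply.
set C := connected_component _ _.
have Cz : C z by exact: connected_component_refl.
have CS : C `<=` ~` S by exact: connected_component_sub.
have Cin w : C w -> enorm w < s.
  move=> Cw; rewrite ltNge; apply/negP => sw.
  have cC : connected (@enorm R 3 @` C).
    apply: connected_continuous_connected; first exact: component_connected.
    by apply: continuous_subspaceT; exact: continuous_enorm.
  have /connected_intervalP/(_ (enorm z) (enorm w)) := cC.
  move=> /(_ _ _ s)[]; first by exists z.
  - by exists w.
  - by rewrite (ltW zs).
  by move=> y Cy ys; apply: (CS _ Cy); exact: sS.
exists s; split; first exact: num_real.
move=> M sM w Cw; apply: le_trans (norm_le_enorm w) _.
by apply: ltW; exact: lt_trans (Cin w Cw) sM.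
Qed.

Variables (a : R) (g k : point -> 'M[R]_3) (al L : R -> R).
Hypothesis al0 : forall s, 0 < s < a -> 0 < al s.
Hypothesis gE : forall x, 0 < enorm x < a -> forall i j, g x i j =
  al (enorm x) * (i == j)%:R + (1 - al (enorm x)) / nsq x * x 0 i * x 0 j.
Hypothesis kE : forall x, 0 < enorm x < a -> exists D, forall i j, k x i j =
  L (enorm x) * (i == j)%:R + D * x 0 i * x 0 j.

Let innerE x X Y : 0 < enorm x < a -> inner (g x) X Y =
  al (enorm x) * edot X Y + (1 - al (enorm x)) / nsq x * edot x X * edot x Y.
Proof.
move=> xa; rewrite /inner !mxE sum3 !mxE !sum3 !(gE xa) /edot !sum3 /=.
by ring.
Qed.

Let kinnerE x X Y : 0 < enorm x < a -> edot x X = 0 -> edot x Y = 0 ->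
  inner (k x) X Y = L (enorm x) * edot X Y.
Proof.
move=> xa X0 Y0; have [D kD] := kE xa.
have -> : inner (k x) X Y = L (enorm x) * edot X Y + D * edot x X * edot x Y.
  by rewrite /inner !mxE sum3 !mxE !sum3 !kD /edot !sum3 /=; ring.
by rewrite X0 mulr0 mul0r addr0.
Qed.

Let pullbackE (F : 'rV[R]_2 -> point) (T : point -> 'M[R]_3) u i j :
  pullback F T u i j = inner (T (F u)) (row i ('J F u)) (row j ('J F u)).
Proof.
rewrite /pullback /inner; move: ('J F u) (T (F u)) => J M.
by rewrite !mxE !sum3 !mxE !sum3 !mxE.
Qed.

Variables (S : set point) (s : R).
Hypotheses (sa : 0 < s < a) (Smax : forall y, S y -> enorm y <= s)
  (sS : forall y, enorm y = s -> S y).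

(* The distance to the origin is maximal on the sphere of radius [s]. *)
Lemma jacobian_orthogonal U W F u : local_param S U W F -> U u -> enorm (F u) = s ->
  forall i, edot (F u) (row i ('J F u)) = 0.
Proof.
move=> [[oU oW] sF FU _ _] Uu Fs i.
have dF v : U v -> differentiable F v by exact: smooth_differentiable.
pose w (t : R) : 'rV[R]_2 := t *: 'e_i + u.
have cw : continuous w.
  move=> t; have h : (fun t : R => t *: ('e_i : 'rV[R]_2)) @ t --> t *: ('e_i : 'rV[R]_2) by apply: cvgZr_tmp; exact: cvg_id.
  exact: (cvgD h (cvg_cst u)).
have w0 : w 0 = u by rewrite /w scale0r add0r.
have : \forall t \near (0 : R), U (w t).
  have Un : nbhs (w 0) U by rewrite w0; exact: (open_nbhs_nbhs (conj oU Uu)).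
  exact: (cw 0 _ Un).
move=> /nbhs_ballP[d /= d0 hd].
have Uw t : - d < t < d -> U (w t).
  by move=> td; apply: hd; rewrite /ball/= sub0r normrN ltr_norml.
have dj t j : - d < t < d -> is_derive t 1 (fun t => F (w t) 0 j) ('J F (w t) i j).
  move=> /Uw Ut; apply: (@line_derivative R _ (fun y => F y 0 j) ('e_i) u t).
  rewrite (jacobian_entry _ _ (dF _ Ut)).
  by apply/derivableP; have [h _] := smooth_coord sF j; exact: h.
pose N t := \sum_j F (w t) 0 j ^+ 2.
have dN t : - d < t < d -> is_derive t 1 N (\sum_j 2%:R * F (w t) 0 j ^+ 1 * 'J F (w t) i j).
  by move=> td; apply: isd_sum => j; exact: (isdX 2 (dj t j td)).
have Nle t : - d < t < d -> N t <= N 0.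
  move=> td; have SF v : U v -> S (F v).
    by move=> Uv; have : (F @` U) (F v) by [exists v]; rewrite FU => -[].
  have -> : N 0 = s ^+ 2 by rewrite /N w0 -Fs enorm_sqr /nsq sum3.
  have -> : N t = enorm (F (w t)) ^+ 2 by rewrite /N enorm_sqr /nsq sum3.
  case/andP : (sa) => s0 _; rewrite ler_pXn2r ?nnegrE ?sqrtr_ge0 ?(ltW s0)//.
  exact: (Smax (SF _ (Uw _ td))).
have d00 : - d < 0 < d by rewrite oppr_lt0 d0.
have h0 : is_derive (0 : R) 1 N 0.
  apply: (@derive1_at_max R N (- d) d 0).
  - by lra.
  - by move=> t; rewrite in_itv/= => td; have := dN t td => ?; apply: ex_derive.
  - by rewrite in_itv.
  - by move=> t; rewrite in_itv/= => td; exact: Nle.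
have e : \sum_j 2%:R * F u 0 j ^+ 1 * 'J F u i j = 0.
  have e1 := @derive_val _ _ _ _ _ _ _ (dN 0 d00).
  have e2 := @derive_val _ _ _ _ _ _ _ h0.
  by rewrite w0 in e1; exact: etrans (esym e1) e2.
have e' : 2 * edot (F u) (row i ('J F u)) = 0.
  apply: etrans e; rewrite /edot big_distrr/=; apply: eq_bigr => j _.
  by rewrite mxE expr1 mulrA.
by apply/eqP; move/eqP: e'; rewrite mulf_eq0 pnatr_eq0.
Qed.

Let enorm_gt0 (y : point) : enorm y = s -> 0 < enorm y < a. Proof. by move=> ->. Qed.

(** At maximal distance the tangent plane is orthogonal to [y], for [g] as for the flat metric. A
    Jacobian of rank 2 leaves a single normal line, so [N y] is a multiple of [y], and unit length
    makes the factor plus or minus [1 / s]. *)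
Lemma normal_radial N (y : point) : embedded_surface S -> outer_unit_normal g S N -> enorm y = s ->
  N y = s^-1 *: y.
Proof.
move=> eS oN ys; have Sy := sS ys; have ya := enorm_gt0 ys; case/andP : (sa) => s0 _.
have [n1 nT nout] := oN y Sy.
have [U [W [F [Wy lp]]]] := eS y Sy.
have [[oU oW] sF FU [G _ GF] rF] := lp.
have : (F @` U) y by rewrite FU.
move=> [u Uu Fu].
have orth i : edot y (row i ('J F u)) = 0.
  by rewrite -Fu; apply: jacobian_orthogonal lp Uu _ i; rewrite Fu.
have yJ : y *m ('J F u)^T = 0.
  by apply/rowP => i; have := orth i; rewrite /edot !mxE => e; rewrite -[RHS]e; apply: eq_bigr => j _; rewrite !mxE.
have NJ : N y *m ('J F u)^T = 0.
  apply/rowP => i; rewrite [RHS]mxE.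
  have : inner (g y) (N y) (row i ('J F u)) = 0.
    by apply: nT; exists U, W, F, u, 'e_i; split => //; rewrite rowE.
  rewrite (innerE _ _ ya) orth mulr0 addr0 => /eqP; rewrite mulf_eq0 (negbTE (lt0r_neq0 (al0 ya))).
  by move=> /eqP e; rewrite -[RHS]e mxE /edot; apply: eq_bigr => j _; rewrite !mxE.
have yn0 : y != 0.
  by apply/eqP => y0; move: s0; rewrite -ys y0 enormE /nsq !mxE expr0n/= !addr0 sqrtr0 ltxx.
have rk : \rank (kermx ('J F u)^T) = 1%N.
  by rewrite mxrank_ker mxrank_tr; have := rF u Uu; rewrite /row_free => /eqP ->.
have yk : (y <= kermx ('J F u)^T)%MS by apply/sub_kermxP.
have Nk : (N y <= kermx ('J F u)^T)%MS by apply/sub_kermxP.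
have ky : (kermx ('J F u)^T <= y)%MS.
  by have [_ <-] := mxrank_leqif_sup yk; rewrite rk rank_rV yn0.
have /sub_rVP[c Nc] := submx_trans Nk ky.
have eyy : edot y y = s ^+ 2 by rewrite -ys enorm_sqr /edot sum3 /nsq !expr2.
have ny : nsq y = s ^+ 2 by rewrite -enorm_sqr ys.
have ez t X : edot X (t *: y) = t * edot X y.
  by rewrite /edot !sum3 !mxE; ring.
have ez2 t X : edot (t *: y) X = t * edot y X.
  by rewrite /edot !sum3 !mxE; ring.
have sn := lt0r_neq0 s0.
have c2 : (c * s) ^+ 2 = 1.
  rewrite -n1 Nc (innerE _ _ ya) !ez !ez2 eyy ny.
  by field.
have [c1|c1] : c * s = 1 \/ c * s = -1.
  have /eqP : (c * s - 1) * (c * s + 1) = 0 by rewrite -subr_sqr c2 expr1n subrr.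
  by rewrite mulf_eq0 => /orP[/eqP h|/eqP h]; [left|right]; lra.
  by rewrite Nc; congr (_ *: _); apply: (mulIf sn); rewrite c1 mulVf.
exfalso.
(* With the inward sign, small positive multiples of the normal enter the ball, contradicting that
   they lie on the unbounded side. *)
have : \forall t \near (0 : R)^'+, t < s by exact: nbhs_right_lt.
move=> ts; near (0 : R)^'+ => t.
have t0 : 0 < t by near: t; exact: nbhs_right_gt.
have hts : t < s by near: t.
have hu : unbounded_side S (y + t *: N y) by near: t.
move: hu; apply: inside_not_unbounded sS _.
have -> : y + t *: N y = (1 + t * c) *: y by rewrite Nc scalerA scalerDl scale1r.
have cE : c = - s^-1 by apply: (mulIf sn); rewrite c1 mulNr mulVf.
have f1 : 1 + t * c = (s - t) / s by rewrite cE; field.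
have f0 : 0 < 1 + t * c by rewrite f1 divr_gt0// subr_gt0.
rewrite -ltr_sqr ?nnegrE ?sqrtr_ge0 ?(ltW s0)// enorm_sqr.
have -> : nsq ((1 + t * c) *: y) = (1 + t * c) ^+ 2 * s ^+ 2 by rewrite -ny /nsq !mxE; ring.
rewrite -exprMn ltr_pXn2r ?nnegrE ?mulr_ge0 ?ltW// f1 divfK//.
by rewrite ltrBlDr ltrDl.
Unshelve. all: by end_near. Qed.

(** [H] is the common principal curvature of the sphere and [L s / al s] the eigenvalue of [k] on
    its tangent plane. The two trapping traces are twice their sum and twice their difference. *)
Lemma trapped_sphere (H : R) : embedded_surface S -> trapped g k S ->
  (forall m i, i != 0 -> christoffel g m i 0 (s *: 'e_0) = (H - s^-1) * (i == m)%:R) ->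
  L s / al s < - `|H|.
Proof.
move=> eS [N oN tr] GE; case/andP : (sa) => s0 _; have sn := lt0r_neq0 s0.
pose p : point := s *: 'e_0.
have ps : enorm p = s by rewrite enorm_scale_e0 gtr0_norm.
have pa := enorm_gt0 ps.
have p1 : p 0 1 = 0 /\ p 0 2%:R = 0 by rewrite !mxE/= mulr0.
have [U [W [F [Wp lp]]]] := eS p (sS ps).
have [[oU oW] sF FU [G cG GF] rF] := lp.
have : (F @` U) p by rewrite FU; split => //; exact: sS.
move=> [u Uu Fu].
have [tr1 tr2] := tr U W F lp u Uu.
have dF := smooth_differentiable oU sF Uu.
have orth i : edot p (row i ('J F u)) = 0.
  by rewrite -Fu; apply: jacobian_orthogonal lp Uu _ i; rewrite Fu.
have J0 i : 'J F u i 0 = 0.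
  have := orth i; rewrite /edot sum3 !mxE/= !mulr0 !mul0r !addr0 mulr1.
  by move=> /eqP; rewrite mulf_eq0 (negbTE sn) => /eqP.
have Jinj v : v *m 'J F u = 0 -> v = 0.
  by move=> vJ; apply/eqP; rewrite -(mulmx_free_eq0 v (rF u Uu)) vJ.
have sum2 (f : 'I_2 -> R) : \sum_i f i = f 0 + f 1.
  by rewrite !big_ord_recl big_ord0 addr0; congr (_ + f _); exact: val_inj.
(* Tangent vectors at [p] have no first component, so the rank of the Jacobian is carried by its
   last two columns. *)
have detJ : 'J F u 0 1 * 'J F u 1 2%:R - 'J F u 1 1 * 'J F u 0 2%:R != 0.
  move: J0 Jinj; move: ('J F u) => J J0 Jinj; apply/eqP => D0.
  have v1 (c : 'I_3) : c = 1 \/ c = 2%:R -> J 1 c = 0 /\ J 0 c = 0.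
    move=> cc; have /rowP h : (\row_(i < 2) (if i == 0 then J 1 c else - J 0 c)) = 0.
      apply: Jinj; apply/rowP; apply: forall3; rewrite mxE sum2 !mxE/= ?J0 ?mulr0 ?addr0//;
        by case: cc => ->; lra.
    by have := h 0; have := h 1; rewrite !mxE/= => h1 h2; split; lra.
  have [a1 b1] := v1 1 (or_introl erefl); have [a2 b2] := v1 2%:R (or_intror erefl).
  have /rowP/(_ 0) : ('e_0 : 'rV[R]_2) = 0.
    by apply: Jinj; rewrite -rowE; apply/rowP; apply: forall3; rewrite !mxE ?J0 ?b1 ?b2.
  by rewrite !mxE/= => /eqP; rewrite oner_eq0.
have sc j := smooth_coord sF j.
have part i j : partial i (fun y => F y 0 j) u = 'J F u i j by rewrite jacobian_entry.
have [|d d0 inj] := @local_injectivity R U (fun y => F y 0 1) (fun y => F y 0 2%:R) u oU Uu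
  (sc 1).1 (fun i => @smooth_partial_continuous R _ _ U F i 1 u oU sF Uu)
  (sc 2%:R).1 (fun i => @smooth_partial_continuous R _ _ U F i 2%:R u oU sF Uu).
  by rewrite !part.
have Gp : G p = u by rewrite -Fu GF.
(* Differentiating the normal requires its value on a neighbourhood, so the chart must be shown to
   stay on the sphere. The point [F v] is projected to the sphere along the first axis by [h]; the
   projection lies in [S] and in [W], hence is some [F w] with [w] close to [u] by continuity of
   [G]. Its last two coordinates agree with those of [F v], and local injectivity gives [v = w]. *)
have near_sphere : \forall v \near u, enorm (F v) = s.
  pose h (x : point) : point := Num.sqrt (s ^+ 2 - x 0 1 ^+ 2 - x 0 2%:R ^+ 2) *: 'e_0
    + x 0 1 *: 'e_1 + x 0 2%:R *: 'e_(2%:R).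
  have [hh0 hh1 hh2] : [/\ forall x, h x 0 0 = Num.sqrt (s ^+ 2 - x 0 1 ^+ 2 - x 0 2%:R ^+ 2),
      forall x, h x 0 1 = x 0 1 & forall x, h x 0 2%:R = x 0 2%:R].
    by split => x; rewrite !mxE/= !mulr0 !mulr1 ?addr0 ?add0r.
  have hp : h p = p.
    apply/rowP; apply: forall3; rewrite ?hh0 ?hh1 ?hh2//.
    by rewrite p1.1 p1.2 expr0n/= !subr0 sqrtr_sqr gtr0_norm// !mxE/= mulr1.
  have ch : {for p, continuous h}.
    have cq : continuous (fun x : point => Num.sqrt (s ^+ 2 - x 0 1 ^+ 2 - x 0 2%:R ^+ 2)).
      move=> x; apply: (@continuous_comp _ _ _ (fun x : point => s ^+ 2 - x 0 1 ^+ 2 - x 0 2%:R ^+ 2) Num.sqrt);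
        last exact: sqrt_continuous.
      have c2 (i : 'I_3) : continuous (fun x : point => x 0 i ^+ 2).
        move=> y; apply: (@continuous_comp _ _ _ (fun x : point => x 0 i) (fun z => z ^+ 2)).
          exact: continuous_coord.
        exact: exprn_continuous.
      exact: (cvgB (cvgB (cvg_cst _) (c2 1 x)) (c2 2%:R x)).
    have z0 : (fun x : point => Num.sqrt (s ^+ 2 - x 0 1 ^+ 2 - x 0 2%:R ^+ 2) *: ('e_0 : point)) @ p -->
        Num.sqrt (s ^+ 2 - p 0 1 ^+ 2 - p 0 2%:R ^+ 2) *: ('e_0 : point).
      by have c := cq p; exact: (@cvgZr_tmp _ _ _ (nbhs p) (nbhs_filter p) _ _ _ c).
    have zi (i : 'I_3) : (fun x : point => x 0 i *: ('e_i : point)) @ p --> p 0 i *: ('e_i : point).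
      by have c := @continuous_coord R 3 i p; exact: (@cvgZr_tmp _ _ _ (nbhs p) (nbhs_filter p) _ _ _ c).
    exact: (cvgD (cvgD z0 (zi 1)) (zi 2%:R)).
  have cF : {for u, continuous F} by exact: differentiable_continuous.
  have box : nbhs u [set w : 'rV[R]_2 | forall i, `|u 0 i - w 0 i| < d].
    have n1 (i : 'I_2) : nbhs u [set w : 'rV[R]_2 | `|u 0 i - w 0 i| < d].
      have /cvgrPdist_lt h0 := @continuous_coord R 2 i u.
      exact: (h0 d d0).
    apply: filterS2 (n1 0) (n1 1) => w w0 w1 [[|[|//]] hi].
      by rewrite (_ : Ordinal hi = 0)//; exact: val_inj.
    by rewrite (_ : Ordinal hi = 1)//; exact: val_inj.
  have Sp : (S `&` W) p by split => //; exact: sS.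
  have E1 : nbhs p [set y : point | (S `&` W) y -> forall i, `|u 0 i - G y 0 i| < d].
    have nG : nbhs (G p) [set w : 'rV[R]_2 | forall i, `|u 0 i - w 0 i| < d] by rewrite Gp.
    have h3 : @nbhs_subspace _ (S `&` W) p (G @^-1` [set w : 'rV[R]_2 | forall i, `|u 0 i - w 0 i| < d]) := cG p _ nG.
    by rewrite -(nbhs_subspace_in Sp) in h3.
  have E2 : \forall y \near p, W y by exact: (open_nbhs_nbhs (conj oW Wp)).
  have E3 : nbhs p [set x : point | 0 < s ^+ 2 - x 0 1 ^+ 2 - x 0 2%:R ^+ 2].
    have c2 (i : 'I_3) : continuous (fun x : point => x 0 i ^+ 2).
      move=> y; apply: (@continuous_comp _ _ _ (fun x : point => x 0 i) (fun z => z ^+ 2)).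
        exact: continuous_coord.
      exact: exprn_continuous.
    have cq : continuous (fun x : point => s ^+ 2 - x 0 1 ^+ 2 - x 0 2%:R ^+ 2).
      by move=> x; exact: (cvgB (cvgB (cvg_cst _) (c2 1 x)) (c2 2%:R x)).
    have c0 : 0 < s ^+ 2 - p 0 1 ^+ 2 - p 0 2%:R ^+ 2 by rewrite p1.1 p1.2 expr0n/= !subr0 exprn_gt0.
    exact: (cq p _ (lt_nbhsr c0)).
  have E12 : nbhs p [set x : point | W (h x) /\ ((S `&` W) (h x) -> forall i, `|u 0 i - G (h x) 0 i| < d)].
    have n : nbhs (h p) [set y : point | W y /\ ((S `&` W) y -> forall i, `|u 0 i - G y 0 i| < d)].
      by rewrite hp; apply: filterS2 E1 E2 => y.
    exact: (ch _ n).
  have E4 : nbhs u [set v : 'rV[R]_2 | 0 < s ^+ 2 - F v 0 1 ^+ 2 - F v 0 2%:R ^+ 2 /\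
     (W (h (F v)) /\ ((S `&` W) (h (F v)) -> forall i, `|u 0 i - G (h (F v)) 0 i| < d))].
    have n : nbhs (F u) [set x : point | 0 < s ^+ 2 - x 0 1 ^+ 2 - x 0 2%:R ^+ 2 /\
       (W (h x) /\ ((S `&` W) (h x) -> forall i, `|u 0 i - G (h x) 0 i| < d))].
      by rewrite Fu; apply: filterS2 E3 E12 => x.
    exact: (cF _ n).
  apply: filterS2 box E4 => v vb [v3 [Wv Gv]].
  have hs : enorm (h (F v)) = s.
    rewrite enormE /nsq hh0 hh1 hh2 sqr_sqrtr ?(ltW v3)//.
    rewrite (_ : _ + _ + _ = s ^+ 2); last by ring.
    by rewrite sqrtr_sqr gtr0_norm.
  have SW : (S `&` W) (h (F v)) by split => //; exact: sS.
  have : (F @` U) (h (F v)) by rewrite FU.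
  move=> [w Uw Fw].
  have wb i : `|u 0 i - w 0 i| < d by have := Gv SW i; rewrite -Fw GF.
  have -> : v = w by apply: inj => //; rewrite Fw ?hh1 ?hh2.
  by rewrite Fw.
have NF : \forall v \near u, s^-1 *: F v = (N \o F) v.
  by apply: filterS near_sphere => v vs /=; rewrite (normal_radial eS oN vs).
have dpart i : partial i (N \o F) u = s^-1 *: row i ('J F u).
  rewrite /partial -(near_eq_derive _ NF) jacobian_row// -deriveZ//.
  exact: diff_derivable.
have Ne : N (F u) = 'e_0.
  by rewrite Fu (normal_radial eS oN ps) /p scalerA mulVf// scale1r.
(* The flat derivative of the radial normal contributes [1 / s] and the Christoffel term
   [H - 1 / s]. *)
have cov i : cov_along g N F i u = H *: row i ('J F u).
  apply/rowP => m; rewrite /cov_along dpart Ne Fu.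
  move: J0; move: ('J F u) => J J0.
  rewrite [LHS]mxE [X in _ + X]mxE !mxE sum3 !sum3.
  have e01 : ('e_0 : point) 0 1 = 0 by rewrite mxE.
  have e02 : ('e_0 : point) 0 2%:R = 0 by rewrite mxE.
  have e00 : ('e_0 : point) 0 0 = 1 by rewrite mxE.
  rewrite e00 e01 e02 J0 (GE m 1 isT) (GE m 2%:R isT) !(mulr0, mulr1, mul0r) !(addr0, add0r).
  by move: m; apply: forall3; rewrite ?J0/=; ring.
pose P := pullback F g u.
have PE i j : P i j = al s * edot (row i ('J F u)) (row j ('J F u)).
  by rewrite /P pullbackE Fu (innerE _ _ pa) ps !orth !mulr0 addr0.
have kP : pullback F k u = (L s / al s) *: P.
  apply/matrixP => i j; rewrite pullbackE Fu (kinnerE pa (orth i) (orth j)) ps [RHS]mxE PE.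
  by rewrite mulrA divfK// lt0r_neq0// al0.
have hP : second_form g N F u = H *: P.
  apply/matrixP => i j; rewrite [LHS]mxE [RHS]mxE cov.
  have -> : P i j = inner (g (F u)) (row i ('J F u)) (row j ('J F u)) by rewrite /P pullbackE.
  by rewrite Fu !(innerE _ _ pa) /edot !sum3 !mxE; ring.
have Pu : P \in unitmx.
  rewrite -row_free_unit; apply: inj_row_free => v vP; apply: Jinj.
  set X := v *m 'J F u.
  have key (J : 'M[R]_(2, 3)) (T : 'M[R]_2) :
      (forall i j, T i j = al s * edot (row i J) (row j J)) -> (v *m T *m v^T) 0 0 = al s * nsq (v *m J).
    by move=> h; rewrite !mxE !sum2 !mxE !sum2 !h /edot !sum3 /nsq !mxE !sum2; ring.
  have := key _ _ PE; rewrite -/X.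
  rewrite vP mul0mx mxE => /esym/eqP; rewrite mulf_eq0 (negbTE (lt0r_neq0 (al0 sa)))/= => /eqP X0.
  apply/rowP => m; rewrite [RHS]mxE; apply/eqP; rewrite -normr_le0.
  by apply: le_trans (enorm_coord X m) _; rewrite enormE X0 sqrtr0.
have trP (c : R) : mtrace P (c *: P) = 2 * c.
  by rewrite /mtrace -scalemxAr mulVmx// mxtraceZ mxtrace1 mulrC.
rewrite -/P kP hP -scalerDl trP in tr1; rewrite -/P kP hP -scalerBl trP in tr2.
case: (leP 0 H) => H0; [rewrite ger0_norm//|rewrite ltr0_norm//]; lra.
Qed.

End SphericalSurface.

(** * Conclusion *)

Section Assembly.
Variable R : realType.
Local Notation point := 'rV[R]_3.
Local Notation leb := (leb3 R).

Lemma entry_derivative (h : point -> 'M[R]_3) (x : point) l i j : derivable h x 'e_l ->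
  is_derive x 'e_l (fun y => h y i j) (partial l h x i j).
Proof.
move=> dh; rewrite /partial (derive_mx dh) mxE; apply/derivableP.
by have /derivable_mxP := dh; apply.
Qed.

Lemma ray_derivative (f : point -> R) (s df : R) : is_derive (s *: 'e_0 : point) 'e_0 f df ->
  is_derive s 1 (fun t : R => f (t *: 'e_0)) df.
Proof.
move=> h; have -> : (fun t : R => f (t *: 'e_0)) = (fun t => f (t *: 'e_0 + 0)).
  by apply/funext => t; rewrite addr0.
by apply: (@line_derivative R _ f ('e_0) 0 s); rewrite addr0.
Qed.

Lemma smooth_entry (U : set point) (h : point -> 'M[R]_3) i j : smooth_on U h ->
  (forall x, U x -> {for x, continuous (fun y => h y i j)}) /\
  (forall x, U x -> {for x, continuous (fun y => partial 0 h y i j)}) /\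
  (forall x, U x -> is_derive x 'e_0 (fun y => h y i j) (partial 0 h x i j)) /\
  (forall x, U x -> is_derive x 'e_0 (fun y => partial 0 h y i j) (partial 0 (partial 0 h) x i j)).
Proof.
move=> sh; have [c0 /(_ 0)[d0 [c1 h1]]] := sh 2%N; have [d1 _] := h1 0.
split; last split; last split.
- move=> x Ux; apply: (@continuous_comp _ _ _ h (fun z : 'M[R]_3 => z i j)); [exact: c0|exact: coord_continuous].
- move=> x Ux; apply: (@continuous_comp _ _ _ (partial 0 h) (fun z : 'M[R]_3 => z i j)); [exact: c1|exact: coord_continuous].
- by move=> x Ux; apply: entry_derivative; exact: d0.
- by move=> x Ux; apply: entry_derivative; exact: d1.
Qed.

Lemma ray_continuity (a : R) (f : point -> R) : 0 < a -> {for (0 : point), continuous f} ->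
  forall e, 0 < e -> exists2 d, 0 < d & forall (l : 'I_3) s, `|s| < d -> `|f 0 - f (s *: 'e_l)| <= e.
Proof.
move=> a0 cf e e0; have /cvgrPdist_le/(_ e e0)/nbhs_box[d d0 hd] := cf.
exists d => // l s sd; apply: hd => i; rewrite !mxE sub0r normrN normrM.
apply: le_lt_trans sd; rewrite ler_piMr//.
by rewrite eqxx/=; case: (_ == _); rewrite ?normr1 ?normr0.
Qed.

(** With [r = t sqrt A] the quotient is [sqrt A + t A1 / (2 sqrt A)], and [r l / A] is
    [t l / sqrt A]: everything but [sqrt A] carries a factor [t]. *)
Lemma axis_limit_bounds (e t A A1 l B : R) : 0 < e -> 0 < t -> 0 < A -> 2 <= B ->
  `|A - 1| <= e / 2 -> `|A - 1| <= 2^-1 -> `|A1| <= B -> `|l| <= B -> t * B <= e / 4 ->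
  let r := Num.sqrt (t ^+ 2 * A) in
  [/\ `|(2 * t * A + t ^+ 2 * A1) / (2 * r) - 1| <= e, `|r * (l / A)| <= e & r <= e].
Proof.
move=> e0 t0 A0 B2 Ae A2 A1B lB tB r; have tn := lt0r_neq0 t0.
pose s := Num.sqrt A; have s0 : 0 < s by rewrite sqrtr_gt0.
have s2 : s ^+ 2 = A by rewrite sqr_sqrtr// ltW.
have sA : `|s - 1| <= `|A - 1|.
  rewrite -s2 (_ : s ^+ 2 - 1 = (s - 1) * (s + 1)); last by ring.
  by rewrite normrM ler_peMr// ger0_norm; lra.
have [sl su] : 2^-1 <= s /\ s <= 2.
  by have := le_trans sA A2; rewrite ler_norml => /andP[? ?]; split; lra.
have sn := lt0r_neq0 s0.
have rE : r = t * s by rewrite /r sqrtrM ?sqr_ge0// sqrtr_sqr gtr0_norm.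
have is2 : s^-1 <= 2 by rewrite -(invrK (2 : R)) lef_pV2 ?posrE.
have is0 : 0 <= s^-1 by rewrite invr_ge0 ltW.
have tn0 := ltW t0.
have ub (X : R) : `|X| <= B -> `|t * X / s| <= e / 2.
  move=> XB; rewrite !normrM (gtr0_norm t0) (ger0_norm is0).
  apply: (@le_trans _ _ (e / 4 * 2)); last by lra.
  apply: ler_pM => //; first by rewrite mulr_ge0.
  by apply: le_trans tB; rewrite ler_wpM2l.
split.
- have -> : (2 * t * A + t ^+ 2 * A1) / (2 * r) - 1 = (s - 1) + t * A1 / s / 2.
    by rewrite rE -s2; field; rewrite sn tn.
  apply: le_trans (ler_normD _ _) _.
  by rewrite [`|_ / 2|]normrM [`|2^-1|]ger0_norm//; have := ub _ A1B; have := le_trans sA Ae; lra.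
- have -> : r * (l / A) = t * l / s by rewrite rE -s2; field.
  by have := ub _ lB; lra.
- rewrite rE; apply: (@le_trans _ _ (t * B)); last by lra.
  by rewrite ler_wpM2l//; lra.
Qed.

(** The value at the centre is read off another axis: along ['e_1] the same entry of the metric is
    the radial one, identically 1, and continuity at the centre makes the limits along both axes
    agree. *)
Lemma axis_limits (a : R) (f f1 h : point -> R) : 0 < a -> {for (0 : point), continuous f} ->
  {for (0 : point), continuous f1} -> {for (0 : point), continuous h} ->
  (forall t, 0 < t < a -> 0 < f (t *: 'e_0)) -> (forall t, 0 < t < a -> f (t *: 'e_1) = 1) ->
  forall e, 0 < e -> exists2 d, 0 < d & forall t, 0 < t < a -> t < d ->
    let r := Num.sqrt (t ^+ 2 * f (t *: 'e_0)) in
    [/\ `|(2 * t * f (t *: 'e_0) + t ^+ 2 * f1 (t *: 'e_0)) / (2 * r) - 1| <= e,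
        `|r * (h (t *: 'e_0) / f (t *: 'e_0))| <= e & r <= e].
Proof.
move=> a0 cf cf1 ch f0 fe1 e e0.
have [e1 [e10 e1e e14]] : exists e1 : R, [/\ 0 < e1, e1 <= e / 4 & e1 <= 4^-1].
  exists (Num.min (e / 4) 4^-1); split; last 2 first.
  - by rewrite ge_min lexx.
  - by rewrite ge_min lexx orbT.
  by rewrite lt_min divr_gt0//= ?invr_gt0.
have [d1 d10 h1] := ray_continuity a0 cf e10.
have [d2 d20 h2] := ray_continuity a0 cf1 (ltr01 : 0 < 1 :> R).
have [d3 d30 h3] := ray_continuity a0 ch (ltr01 : 0 < 1 :> R).
have [B [B2 BE]] : exists B : R, 2 <= B /\ B = `|f1 0| + `|h 0| + 2.
  by exists (`|f1 0| + `|h 0| + 2); split => //; rewrite lerDr addr_ge0.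
pose d4 := e / (4 * B); have d40 : 0 < d4.
  by rewrite divr_gt0// mulr_gt0//; exact: lt_le_trans B2.
exists (Num.min (Num.min d1 d2) (Num.min d3 d4)); first by rewrite !lt_min d10 d20 d30.
move=> t ta; rewrite !lt_min => /andP[/andP[t1 t2] /andP[t3 t4]].
case/andP : (ta) => t0 _.
have tt : `|t| = t by rewrite gtr0_norm.
have a1 := h1 1 t; rewrite fe1// tt in a1; have {}a1 := a1 t1.
have a2 := h1 0 t; rewrite tt in a2; have {}a2 := a2 t1.
have b1 := h2 0 t; rewrite tt in b1; have {}b1 := b1 t2.
have c1 := h3 0 t; rewrite tt in c1; have {}c1 := c1 t3.
have Ab : `|f (t *: 'e_0) - 1| <= 2 * e1.
  move: a1 a2; rewrite !ler_norml; clear => /andP[? ?] /andP[? ?]; apply/andP; split; lra.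
apply: (@axis_limit_bounds e t _ _ _ B) => //.
- exact: f0.
- by apply: le_trans Ab _; clear -e1e; lra.
- by apply: le_trans Ab _; clear -e14; lra.
- have := ler_normB (f1 0) (f1 0 - f1 (t *: 'e_0)); rewrite subKr BE; move=> h4; have h5 := normr_ge0 (h 0); clear -h4 h5 b1; lra.
- have := ler_normB (h 0) (h 0 - h (t *: 'e_0)); rewrite subKr BE; move=> h4; have h5 := normr_ge0 (f1 0); clear -h4 h5 c1; lra.
have B0 : 0 < B by exact: lt_le_trans B2.
by have := ltW t4; rewrite /d4 invfM mulrA ler_pdivlMr.
Qed.

Lemma spherical_functionE (a : R) (f : point -> R) x : spherical_function (eball a) f ->
  enorm x < a -> f x = f (enorm x *: 'e_0).
Proof. by move=> sf xa; have [Q rQ xQ] := rotation_to_axis x; rewrite -xQ sf. Qed.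

(** Compactness gives a point of maximal norm, and rotations spread it over its whole sphere. The
    radius is positive, since a chart of a surface reduced to the origin would be constant with zero
    Jacobian. *)
Lemma surface_max (a : R) (S : set point) : S `<=` eball a -> S !=set0 -> compact S ->
  embedded_surface S -> spherical_set S ->
  exists s, [/\ 0 < s < a, forall y, S y -> enorm y <= s & forall y, enorm y = s -> S y].
Proof.
move=> Sa S0 cS eS sS.
have [|c Sc hc] := @EVT_max_rV R 3 (@enorm R 3) S S0 cS.
  exact: continuous_subspaceT (@continuous_enorm R).
have {}Sc : S c by move: Sc; rewrite inE.
have {}hc y : S y -> enorm y <= enorm c by move=> Sy; apply: hc; rewrite inE.
exists (enorm c); split => //; last first.
  move=> y yc; have [P rP cP] := rotation_to_axis c; have [Q rQ yQ] := rotation_to_axis y.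
  have [rQ' _] := rotation_inv rQ; have [QQ _] := rQ.
  have -> : y = c *m P *m Q^T by rewrite cP -yc -yQ -mulmxA QQ mulmx1.
  by apply: (sS _ rQ'); exact: sS.
rewrite (Sa _ Sc) andbT lt_neqAle sqrtr_ge0 andbT eq_sym; apply/eqP => c0.
have [U [W [F [Wc [[oU _] sF FU _ rF]]]]] := eS c Sc.
have : (F @` U) c by rewrite FU.
move=> [u Uu Fu].
have F0 v : U v -> F v = 0.
  move=> Uv; have : (F @` U) (F v) by exists v.
  rewrite FU => -[/hc]; rewrite c0 => n0 _.
  by apply/rowP => i; rewrite mxE; apply/eqP; rewrite -normr_le0; apply: le_trans n0; exact: enorm_coord.
have dF := smooth_differentiable oU sF Uu.
have J0 : 'J F u = 0.
  apply/matrixP => i j; rewrite jacobian_entry// mxE.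
  have h : \forall v \near u, (fun _ : 'rV[R]_2 => 0 : R) v = F v 0 j.
    by apply: filterS (open_nbhs_nbhs (conj oU Uu)) => v /F0 ->; rewrite mxE.
  exact: (@derive_val _ _ _ _ _ _ _ (near_eq_is_derive h (isd_cst 0 u ('e_i)))).
by have := rF u Uu; rewrite J0 /row_free mxrank0.
Qed.

(** The 13 counts scalar components: nine of [k], three of the gradient of [psi0], and [psi1]. The
    doubled [eps] leaves room for extensions that do not attain the infimum, and 16 comes from
    [radial_energy]. *)
Lemma total_energy (a eps : R) (k : point -> 'M[R]_3) (psi0 psi1 : point -> R) (Q : R -> R) :
  0 < a -> 0 < eps -> smooth_on (eball a) k -> smooth_on (eball a) psi0 -> smooth_on (eball a) psi1 ->
  (forall p, enorm p < a -> \sum_i \sum_j k p i j ^+ 2 + \sum_j partial j psi0 p ^+ 2 + psi1 p ^+ 2 = Q (enorm p)) ->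
  (Hs_norm_tensor_on (eball a) (1 / 2) k + Hs_norm_on (eball a) (3 / 2) psi0
     + Hs_norm_on (eball a) (1 / 2) psi1 <= eps%:E)%E ->
  exists E : R -> R, forall t, 0 < t < a ->
    is_derive t 1 E (t * Q t) /\ 0 <= E t <= 16 * (13 * (Kd R * (2 * eps) ^+ 2)).
Proof.
move=> a0 e0 sk s0 s1 HQ Hn.
have n0 := @Hs_norm_on_ge0 R (eball a).
have hk i j : (Hs_norm_on (eball a) (1 / 2) (fun x => k x i j) <= eps%:E)%E.
  apply: le_trans (Hs_norm_tensor_on_ge _ _ _ i j) _; apply: le_trans Hn.
  by rewrite -addeA; apply: leeDl; exact: adde_ge0.
have T0 : (0 <= Hs_norm_tensor_on (eball a) (1 / 2) k)%E.
  by apply: sume_ge0 => i _; apply: sume_ge0 => j _; exact: n0.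
have h0 : (Hs_norm_on (eball a) (3 / 2) psi0 <= eps%:E)%E.
  by apply: le_trans Hn; rewrite addeAC; apply: leeDr; exact: adde_ge0.
have h1 : (Hs_norm_on (eball a) (1 / 2) psi1 <= eps%:E)%E.
  by apply: le_trans Hn; apply: leeDr; exact: adde_ge0.
have e1 : 0 < 2 * eps by rewrite mulr_gt0.
have e2 : eps < 2 * eps by lra.
have [c00 c01] := s0 2%N.
have cp j p : enorm p < a -> {for p, continuous (partial j psi0)} by move=> pa; have [_ [c _]] := c01 j; exact: c.
pose I := ((('I_3 * 'I_3) + ('I_3 + unit))%type : finType).
pose f (i : I) : point -> R := match i with
  | inl ij => fun x => k x ij.1 ij.2 | inr (inl j) => partial j psi0 | inr (inr _) => psi1 end.
have sumE (F : I -> R) : \sum_i F i = \sum_i \sum_j F (inl (i, j)) + \sum_j F (inr (inl j)) + F (inr (inr tt)).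
  rewrite big_sumType/= big_sumType/= addrA; congr (_ + _ + _); last first.
    by rewrite (big_pred1 tt)// => -[].
  by rewrite pair_big; apply: eq_bigr => -[].
have cf i p : enorm p < a -> {for p, continuous (f i)}.
  case: i => [[i j]|[j|[]]] pa /=.
  - by have [c _] := smooth_entry i j sk; exact: c.
  - exact: cp.
  - by have [c _] := s1 0%N; exact: c.
have fC (b d : R) (n : nat) : 0 < b -> b < a -> 0 < d ->
   \sum_i \int[leb]_x (f i (vec3 x) * f i (vec3 x) * cutoff b d n (vec3 x)) <= 13 * (Kd R * (2 * eps) ^+ 2).
  move=> b0 ba d0.
  have -> : 13 * (Kd R * (2 * eps) ^+ 2) = \sum_(i : I) (Kd R * (2 * eps) ^+ 2).
    by rewrite sumE !sum3 /=; ring.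
  apply: ler_sum => i _; case: i => [[i j]|[j|[]]] /=.
  - have [h [A [B [hf hh hF hN]]]] := Hs_norm_on_extension (hk i j) e1 e2.
    exact: (@hardy_half R a b d n b0 ba d0 _ h A B _ (@cf (inl (i, j))) hf hh hF hN).
  - have [h [A [B [hf hh hF hN]]]] := Hs_norm_on_extension h0 e1 e2.
    have [dj [cj hj]] := c01 j; have [djj cjj] := hj j.
    have cj2 p : enorm p < a -> {for p, continuous (partial j (partial j psi0))} by move=> pa; exact: cjj.1.
    have dj1 p : enorm p < a -> is_derive p 'e_j psi0 (partial j psi0 p) by move=> pa; apply/derivableP; exact: dj.
    have dj2 p : enorm p < a -> is_derive p 'e_j (partial j psi0) (partial j (partial j psi0) p).
      by move=> pa; apply/derivableP; exact: djj.
    exact: (@hardy_three_half R a b d n b0 ba d0 psi0 (partial j psi0) (partial j (partial j psi0)) h A B _ j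
      c00 cj cj2 dj1 dj2 hf hh hF hN).
  - have [h [A [B [hf hh hF hN]]]] := Hs_norm_on_extension h1 e1 e2.
    exact: (@hardy_half R a b d n b0 ba d0 _ h A B _ (@cf (inr (inr tt))) hf hh hF hN).
have fQ p : enorm p < a -> \sum_i f i p * f i p = Q (enorm p).
  by move=> pa; rewrite sumE -HQ.
have [E hE] := radial_energy cf fQ fC.
exists E => t ta; have [h1' h2'] := hE t ta; split => //.
have te : enorm (t *: 'e_0 : point) = t by rewrite enorm_scale_e0 gtr0_norm//; case/andP : ta.
rewrite (_ : Q t = \sum_i f i (t *: 'e_0) ^+ 2)// -[in LHS]te -fQ; last by rewrite te; case/andP : ta.
by apply: eq_bigr => i _; rewrite expr2.
Qed.

End Assembly.

Theorem proposition1p4 (R : realType) :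
  exists2 eps0 : R, 0 < eps0 &
    forall (a : R) (g k : 'rV[R]_3 -> 'M[R]_3) (r krr ktt : R -> R)
        (psi0 psi1 : 'rV[R]_3 -> R),
      0 < a ->
      riemannian_metric (eball a) g ->
      symmetric_2tensor (eball a) k ->
      spherical_tensor (eball a) g ->
      spherical_tensor (eball a) k ->
      polar_form a g (fun=> 1) (fun rho => r rho ^+ 2) ->
      polar_form a k krr ktt ->
      smooth_on (eball a) psi0 ->
      smooth_on (eball a) psi1 ->
      spherical_function (eball a) psi0 ->
      spherical_function (eball a) psi1 ->
      constraint_equations (eball a) g k psi0 psi1 ->
      (Hs_norm_tensor_on (eball a) (1 / 2) k
         + Hs_norm_on (eball a) (3 / 2) psi0
         + Hs_norm_on (eball a) (1 / 2) psi1 <= eps0%:E)%E ->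
      ~ exists S : set 'rV[R]_3,
          [/\ S `<=` eball a, S !=set0, compact S & connected S] /\
          [/\ embedded_surface S, spherical_set S & trapped g k S].
Proof.
have Kd0 := Kd_gt0 R.
(* Chosen so that [Kd R / M] is at most 10^-6. The energy bound has numerical factor 16 * 13 * 4 =
   832, so it stays below the 1/1000 demanded by [bootstrap]. *)
pose M : R := 1000 * (1000 * (Kd R + 1)).
have M1 : 1 <= M by rewrite /M; lra.
have M0 : 0 < M by lra.
exists M^-1; first by rewrite invr_gt0.
move=> a g k rr krr ktt psi0 psi1 a0 [sg tg pg] [sk tk] spg spk polg _ s0 s1 sp0 sp1 ce Hn.
move=> [S [[Sa S0 cS _] [eS sS tr]]].
pose z (t : R) : 'rV[R]_3 := t *: 'e_0.
have enz t : enorm (z t) = `|t| by exact: enorm_scale_e0.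
have zin t : 0 < t < a -> eball a (z t).
  by move=> /andP[t0 ta]; rewrite /eball/= enz gtr0_norm.
(* The profile functions of the polar forms carry no regularity of their own; the radial profiles
   are therefore restrictions of smooth Cartesian entries to the first axis. *)
pose al t := g (z t) 1 1; pose al1 t := partial 0 g (z t) 1 1.
pose al2 t := partial 0 (partial 0 g) (z t) 1 1.
pose K t := k (z t) 0 0; pose K1 t := partial 0 k (z t) 0 0.
pose L t := k (z t) 1 1; pose L1 t := partial 0 k (z t) 1 1.
have [cg [cg1 [dg dg1]]] := smooth_entry 1 1 sg.
have [_ [_ [dk0 _]]] := smooth_entry 0 0 sk.
have [ck [_ [dk1 _]]] := smooth_entry 1 1 sk.
have dal t : 0 < t < a -> is_derive t 1 al (al1 t) by move=> /zin h; exact: (ray_derivative (dg _ h)).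
have dal1 t : 0 < t < a -> is_derive t 1 al1 (al2 t).
  by move=> /zin h; exact: (ray_derivative (dg1 _ h)).
have dK t : 0 < t < a -> is_derive t 1 K (K1 t).
  by move=> /zin h; exact: (ray_derivative (dk0 _ h)).
have dL t : 0 < t < a -> is_derive t 1 L (L1 t).
  by move=> /zin h; exact: (ray_derivative (dk1 _ h)).
have al0 t : 0 < t < a -> 0 < al t.
  move=> /zin h; have e1n : ('e_1 : 'rV[R]_3) != 0.
    by apply/eqP => /rowP/(_ 1); rewrite !mxE/= => /eqP; rewrite oner_eq0.
  have := pg _ h _ e1n; congr (0 < _).
  by rewrite /inner !mxE sum3 !mxE !sum3 !mxE/= /al; ring.
have gE x : 0 < enorm x < a -> forall i j, g x i j =
    al (enorm x) * (i == j)%:R + (1 - al (enorm x)) / nsq x * x 0 i * x 0 j.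
  by move=> xa i j; rewrite (spherical_form spg tg xa) (polar_axis polg xa).
have kE x : 0 < enorm x < a -> forall i j, k x i j =
    L (enorm x) * (i == j)%:R + (K (enorm x) - L (enorm x)) / nsq x * x 0 i * x 0 j.
  by move=> xa i j; rewrite (spherical_form spk tk xa).
pose phi t := psi0 (z t); pose phi1 t := partial 0 psi0 (z t).
have pE x : 0 < enorm x < a -> psi0 x = phi (enorm x).
  by move=> /andP[_ xa]; exact: spherical_functionE sp0 xa.
have dphi t : 0 < t < a -> is_derive t 1 phi (phi1 t).
  move=> /zin h; have [_ /(_ 0)[d _]] := s0 1%N.
  exact: (ray_derivative (derivableP (d _ h))).
pose q t := t ^+ 2 * al t; pose q1 t := 2 * t * al t + t ^+ 2 * al1 t.
pose q2 t := 2 * al t + 4 * t * al1 t + t ^+ 2 * al2 t.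
have q0 t : 0 < t < a -> 0 < q t.
  by move=> ta; rewrite mulr_gt0 ?al0//; case/andP : ta => t0 _; rewrite exprn_gt0.
have dq t : 0 < t < a -> is_derive t 1 q (q1 t).
  by move=> ta; apply: is_derive_eq (isdM (isdX 2 (isd_id t)) (dal t ta)) _; rewrite /q1; ring.
have dq1 t : 0 < t < a -> is_derive t 1 q1 (q2 t).
  move=> ta; apply: is_derive_eq (isdD (isdM (isdM (isd_cst 2 t (1 : R)) (isd_id t)) (dal t ta))
    (isdM (isdX 2 (isd_id t)) (dal1 t ta))) _.
  by rewrite /q2; ring.
pose r t := Num.sqrt (q t); pose v t := q1 t / (2 * r t); pose v1 t := (q2 t - 2 * v t ^+ 2) / (2 * r t).
pose lam t := L t / al t; pose lam1 t := (L1 t * al t - L t * al1 t) / al t ^+ 2.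
have r0 t : 0 < t < a -> 0 < r t by move=> ta; rewrite sqrtr_gt0 q0.
have r2 t : 0 < t < a -> r t ^+ 2 = q t by move=> ta; rewrite sqr_sqrtr// ltW// q0.
have dr t : 0 < t < a -> is_derive t 1 r (v t).
  move=> ta; apply: is_derive_eq (@isd_comp R R Num.sqrt q t 1 _ _ (isd_sqrt (q0 t ta)) (dq t ta)) _.
  by rewrite /v mulrC.
have two_r t : 0 < t < a -> 2 * r t != 0 by move=> ta; rewrite lt0r_neq0// mulr_gt0// r0.
have dv t : 0 < t < a -> is_derive t 1 v (v1 t).
  move=> ta; have h := @isdV R R (fun t => 2 * r t) t 1 _ (two_r t ta) (isdM (isd_cst 2 t (1 : R)) (dr t ta)).
  apply: is_derive_eq (isdM (dq1 t ta) h) _.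
  have rn := lt0r_neq0 (r0 t ta).
  rewrite /v1 (_ : q1 t = 2 * r t * v t); last by rewrite /v mulrC divfK// two_r.
  by move: (v t) (q2 t) (r t) rn => V Q2 RR rn; field.
have dlam t : 0 < t < a -> is_derive t 1 lam (lam1 t).
  move=> ta; have A0 := lt0r_neq0 (al0 t ta).
  apply: is_derive_eq (isdM (dL t ta) (isdV A0 (dal t ta))) _.
  by rewrite /lam1; field.
have geo t : 0 < t < a -> [/\
    (2 - 2 * q2 t + q1 t ^+ 2 / (2 * q t)) / q t + (K t + 2 * L t / al t) ^+ 2
      - (K t ^+ 2 + 2 * (L t / al t) ^+ 2) = phi1 t ^+ 2 + psi1 (z t) ^+ 2 &
    K1 t + q1 t / q t * (K t - L t / al t) - (K1 t + 2 * (L1 t * al t - L t * al1 t) / al t ^+ 2)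
      = psi1 (z t) * phi1 t].
  move=> ta; have [c1 /(_ 0) c2] := ce _ (zin t ta).
  have [G1 G2] := grad_norm2_radial al0 gE ta pE (dphi t ta).
  move: c1 c2; rewrite /z (scalar_curvature_radial al0 dal dal1 gE ta) (trace_radial al0 gE kE ta)
    (tensor_norm2_radial al0 gE kE ta) G1 (divergence_radial al0 dal dK dL gE kE ta)
    (partial_trace_radial al0 dal dK dL gE kE ta) G2.
  by split.
have v2 t : 0 < t < a -> v t ^+ 2 = q1 t ^+ 2 / (4 * q t).
  move=> ta; rewrite -r2// /v; have := lt0r_neq0 (r0 t ta) => ?; by field.
have ham t : 0 < t < a -> r t * v1 t = (1 - v t ^+ 2) / 2 +
    r t ^+ 2 * (K t * lam t + lam t ^+ 2 / 2 - (phi1 t ^+ 2 + psi1 (z t) ^+ 2) / 4).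
  move=> ta; have [<- _] := geo t ta; rewrite (r2 t ta).
  have qn := lt0r_neq0 (q0 t ta); have rn := lt0r_neq0 (r0 t ta).
  have -> : r t * v1 t = q2 t / 2 - v t ^+ 2 by rewrite /v1; field.
  rewrite (v2 t ta) -/(lam t) -[2 * L t / al t]mulrA -/(lam t).
  by move: (q t) (q1 t) (q2 t) (lam t) (K t) qn => Q Q1 Q2 l kk qn; field.
have mom t : 0 < t < a -> - 2 * lam1 t + 2 * (v t / r t) * (K t - lam t) = psi1 (z t) * phi1 t.
  move=> ta; have [_ <-] := geo t ta.
  have qn := lt0r_neq0 (q0 t ta); have rn := lt0r_neq0 (r0 t ta).
  have -> : 2 * (v t / r t) = q1 t / q t by rewrite /v -(r2 t ta); field.
  by rewrite -/(lam t) -[2 * _ / _]mulrA -/(lam1 t); ring.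
pose Q (t : R) := \sum_i \sum_j k (z t) i j ^+ 2 + \sum_j partial j psi0 (z t) ^+ 2 + psi1 (z t) ^+ 2.
have en0 p : ~~ (0 < @enorm R 3 p) -> p = z (enorm p).
  rewrite -leNgt => p0; have e : enorm p = 0 by apply/eqP; rewrite eq_le p0 sqrtr_ge0.
  rewrite e /z scale0r; apply/rowP => i; rewrite mxE; apply/eqP; rewrite -normr_le0.
  by apply: le_trans p0; exact: enorm_coord.
have parp p : 0 < enorm p < a -> forall j, partial j psi0 p = phi1 (enorm p) * (p 0 j / enorm p).
  move=> pa j; case/andP : (pa) => p0 _.
  apply: (partial_near _ (isd_radial j p0 (dphi _ pa))).
  by apply: filterS (near_annulus pa) => y ya; rewrite pE.
(* The flat norms of the fields are radial: the rank one parts contribute only through [nsq],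
   leaving [K^2 + 2 L^2 + phi1^2] at every point off the centre. *)
have HQ p : enorm p < a -> \sum_i \sum_j k p i j ^+ 2 + \sum_j partial j psi0 p ^+ 2 + psi1 p ^+ 2 = Q (enorm p).
  move=> pa; have [p0|p0] := boolP (0 < enorm p); last by rewrite /Q -(en0 p p0).
  have pp : 0 < enorm p < a by rewrite p0.
  have ez : enorm (z (enorm p)) = enorm p by rewrite enz gtr0_norm.
  have zz : 0 < enorm (z (enorm p)) < a by rewrite ez.
  have H x : 0 < enorm x < a -> \sum_i \sum_j k x i j ^+ 2 + \sum_j partial j psi0 x ^+ 2 =
      K (enorm x) ^+ 2 + 2 * L (enorm x) ^+ 2 + phi1 (enorm x) ^+ 2.
    move=> xa; case/andP : (xa) => x0 _; have xn := lt0r_neq0 x0.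
    have nx : nsq x != 0 by rewrite -enorm_sqr expf_neq0.
    rewrite !sum3 !(kE x xa) !(parp x xa)/=.
    have h : x 0 2%:R ^+ 2 = nsq x - x 0 0 ^+ 2 - x 0 1 ^+ 2 by rewrite /nsq; ring.
    set l := L _; set kk := K _; set ph := phi1 _.
    pose D := (kk - l) / nsq x.
    transitivity (3 * l ^+ 2 + 2 * l * (D * nsq x) + (D * nsq x) ^+ 2 + ph ^+ 2 * (nsq x / enorm x ^+ 2)).
      by rewrite -/D /nsq; field.
    by rewrite /D divfK// enorm_sqr divff//; ring.
  by rewrite (H p pp) /Q (H _ zz) ez (spherical_functionE sp1 pa).
have Mi0 : 0 < M^-1 by rewrite invr_gt0.
have [E hE] := total_energy a0 Mi0 sk s0 s1 HQ Hn.
pose delta := 16 * (13 * (Kd R * (2 * M^-1) ^+ 2)).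
have KM : Kd R * M^-1 <= 1000^-1 * 1000^-1.
  rewrite ler_pdivrMr// (_ : 1000^-1 * 1000^-1 * M = Kd R + 1); first by rewrite lerDl.
  have t0 : (1000 : R) != 0 by rewrite pnatr_eq0.
  by rewrite /M; move: (1000 : R) t0 (Kd R + 1) => c c0 X; field.
have delta0 : 0 <= delta.
  apply: mulr_ge0 => //; apply: mulr_ge0 => //; apply: mulr_ge0; first exact: ltW.
  exact: sqr_ge0.
have gen (c X : R) : 16 * 13 * 4 <= c -> 0 <= X -> X <= c^-1 * c^-1 -> 16 * 13 * 4 * X <= c^-1.
  move=> c8 X0 h; have c0 : 0 < c by apply: lt_le_trans c8; rewrite -!natrM ltr0n.
  apply: (@le_trans _ _ (c * X)); first exact: ler_wpM2r.
  by rewrite -ler_pdivlMl.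
have delta1 : delta <= 1000^-1.
  have -> : delta = 16 * 13 * 4 * (Kd R * M^-1 * M^-1).
    by rewrite /delta; move: (M^-1) (Kd R) => m kd; ring.
  apply: gen; first by rewrite -!natrM ler_nat.
    by apply: mulr_ge0; [apply: mulr_ge0|]; exact: ltW.
  apply: le_trans KM; apply: ler_piMr; first by apply: mulr_ge0; exact: ltW.
  by rewrite invf_le1.
have dE t : 0 < t < a -> is_derive t 1 E (t * (K t ^+ 2 + 2 * (r t ^+ 2 / t ^+ 2 * lam t) ^+ 2 + phi1 t ^+ 2 + psi1 (z t) ^+ 2)).
  move=> ta; have [h _] := hE t ta; apply: is_derive_eq h _; congr (_ * _).
  case/andP : (ta) => t0 _; have tn := lt0r_neq0 t0; have an := lt0r_neq0 (al0 t ta).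
  have zt : 0 < enorm (z t) < a by rewrite enz gtr0_norm.
  have ezt : enorm (z t) = t by rewrite enz gtr0_norm.
  have -> : r t ^+ 2 / t ^+ 2 * lam t = L t by rewrite r2// /q /lam; field; rewrite tn an.
  rewrite /Q; congr (_ + _); rewrite !sum3 !(kE _ zt) !(parp _ zt) ezt.
  have nz : nsq (z t) = t ^+ 2 by rewrite -enorm_sqr ezt.
  by rewrite nz !mxE/=; field.
have Eb t : 0 < t < a -> 0 <= E t <= delta by move=> ta; have [_ h] := hE t ta.
have lim0 e : 0 < e -> exists2 d, 0 < d & forall t, 0 < t < a -> t < d ->
    [/\ `|v t - 1| <= e, `|r t * lam t| <= e & r t <= e].
  have B0 : eball a 0 by rewrite /eball/= -(scale0r ('e_0 : 'rV[R]_3)) enorm_scale_e0 normr0.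
  apply: (axis_limits a0 (cg 0 B0) (cg1 0 B0) (ck 0 B0) al0) => t ta; case/andP : (ta) => t0 _.
  have n1 : enorm (t *: 'e_1 : 'rV[R]_3) = t.
    by rewrite enormE /nsq !mxE/= !mulr0 mulr1 expr0n/= addr0 add0r sqrtr_sqr gtr0_norm.
  by rewrite gE ?n1// -enorm_sqr n1 !mxE/=; have := lt0r_neq0 t0 => tn; field.
have [s [sa Smax sph]] := surface_max Sa S0 cS eS sS.
have kE' x : 0 < enorm x < a -> exists D, forall i j, k x i j = L (enorm x) * (i == j)%:R + D * x 0 i * x 0 j.
  by move=> xa; exists ((K (enorm x) - L (enorm x)) / nsq x) => i j; exact: kE.
case/andP : (sa) => sp0' _; have sn := lt0r_neq0 sp0'; have an := lt0r_neq0 (al0 s sa).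
(* The principal curvature is [1 / s + al1 / (2 al)], the logarithmic derivative [v / r] of the area
   radius. *)
have G m i : i != 0 -> christoffel g m i 0 (s *: 'e_0) = (s^-1 + al1 s / (2 * al s) - s^-1) * (i == m)%:R.
  move=> i0; have zs : 0 < enorm (s *: 'e_0 : 'rV[R]_3) < a by rewrite enz gtr0_norm.
  rewrite (christoffel_radial al0 dal gE zs) enz gtr0_norm// !mxE/= (negbTE i0) ?eqxx.
  have f0 : false%:R = 0 :> R by [].
  rewrite f0; move: (i == m)%:R => dd.
  by field; rewrite sn an.
have T := trapped_sphere al0 gE kE' sa Smax sph eS tr G.
have B := bootstrap delta0 delta1 r0 dr dv dlam dE Eb ham mom lim0 sa.
have rs := r0 s sa; have rn := lt0r_neq0 rs.
have Hv : s^-1 + al1 s / (2 * al s) = v s / r s.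
  have -> : v s / r s = q1 s / (2 * q s) by rewrite -(r2 s sa) /v; field.
  by rewrite /q1 /q; field; rewrite sn an.
rewrite Hv normrM normfV (gtr0_norm rs) -/(lam s) in T.
have T2 : r s * lam s < r s * - (`|v s| / r s) by rewrite ltr_pM2l.
have e : r s * - (`|v s| / r s) = - `|v s| by move: `|v s| => V; field.
rewrite e in T2; move: B; rewrite ltr_norml => /andP[B1 _].
have B2 : - `|v s| <= - v s by rewrite lerN2 ler_norm.
by have := lt_trans B1 (lt_le_trans T2 B2); rewrite ltxx.
Qed.
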